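(* Let $1/2<\sigma<1$ and let $q$ be a large prime. Then there exists $c_4(\sigma)>0$ such that, uniformly in the range $1\ll \tau\leq c_4(\sigma)(\log q)^{1-\sigma}/\log_2 q$, we have $$ \Phi^{\mathrm{char}}_{q}(\sigma,\tau)=\exp\left(-A_1(\sigma)\tau^{\frac{1}{1-\sigma}}(\log\tau)^{\frac{\sigma}{1-\sigma}}\left(1+O\left(\frac{1}{\sqrt{\log\tau}}+r(\log q,\tau)\right)\right)\right).$$ The same estimate also holds for the proportion of non-principal characters $\chi \pmod q$ such that $\arg L(\sigma,\chi)>\tau$.
   Context: $\Phi^{\mathrm{char}}_{q}(\sigma,\tau):=\frac{1}{\phi(q)}\#\{\chi \bmod q,\ \chi\neq \chi_0: \log|L(\sigma,\chi)|>\tau\}$, where $\chi_0$ is the principal character and $L(s,\chi)$ the Dirichlet $L$-function. $\arg L(\sigma,\chi)=\mathrm{Im}\log L(\sigma,\chi)$ with $\log L$ defined by continuous variation from $\mathrm{Re}(s)>1$. $I_0(u)=\sum_{n\ge0}(u/2)^{2n}/(n!)^2$, $G_1(\sigma)=\int_0^\infty\log I_0(u)\,u^{-1-1/\sigma}du$, $A_1(\sigma)=\left(\frac{\sigma^{2\sigma}}{(1-\sigma)^{2\sigma-1}G_1(\sigma)^{\sigma}}\right)^{\frac{1}{1-\sigma}}$. For $y,\tau\ge3$, $r(y,\tau):=\left(\frac{\tau}{y^{1-\sigma}(\log y)^{-1}}\right)^{(\sigma-\frac12)/(1-\sigma)}$; $\log_2=\log\log$. *)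

(* Defs.v *)
From HB Require Import structures.
From mathcomp Require Import all_boot all_order all_algebra.
From mathcomp Require Import all_classical all_reals all_analysis.
From mathcomp Require Import complex finmap.
Set Implicit Arguments. Unset Strict Implicit. Unset Printing Implicit Defensive.
Import Order.TTheory GRing.Theory Num.Theory.
Import numFieldNormedType.Exports.
Local Open Scope ring_scope.
Local Open Scope classical_set_scope.

Section Defs.
Variable R : realType.

Definition dirichlet_char (q : nat) (chi : nat -> R[i]) : Prop :=
  [/\ forall n, chi (n + q)%N = chi n,
      forall m n, chi (m * n)%N = chi m * chi n
    & forall n, (chi n != 0) = coprime n q].

Definition principal_char (q : nat) : nat -> R[i] :=
  fun n => (coprime n q)%:R.

(* L(s,chi) for real s > 0 and chi non-principal, defined as the (convergent)
   Dirichlet series sum_{n>=1} chi(n) n^{-s}; real and imaginary parts are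
   taken as limits of real partial sums. *)
Definition L_re (s : R) (chi : nat -> R[i]) : R :=
  limn (fun N => \sum_(1 <= n < N) complex.Re (chi n) * (n%:R) `^ (- s)).
Definition L_im (s : R) (chi : nat -> R[i]) : R :=
  limn (fun N => \sum_(1 <= n < N) complex.Im (chi n) * (n%:R) `^ (- s)).
Definition Lfun (s : R) (chi : nat -> R[i]) : R[i] :=
  Complex (L_re s chi) (L_im s chi).

Definition cabs (z : R[i]) : R := Num.sqrt (complex.Re z ^+ 2 + complex.Im z ^+ 2).

Definition cexp (z : R[i]) : R[i] :=
  Complex (expR (complex.Re z) * cos (complex.Im z))
          (expR (complex.Re z) * sin (complex.Im z)).

Definition logabsL_gt (sigma tau : R) (chi : nat -> R[i]) : Prop :=
  0 < cabs (Lfun sigma chi) /\ tau < ln (cabs (Lfun sigma chi)).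

(* arg L(sigma,chi) > tau, where arg L = Im log L and log L(s,chi) is defined
   by continuous variation along the real half-line [sigma, +oo) starting from
   Re s > 1 (where log L(s,chi) -> 0 as s -> +oo): g is a continuous logarithm
   of L(.,chi) on [sigma,+oo) normalised by g(s) -> 0 as s -> +oo. *)
Definition argL_gt (sigma tau : R) (chi : nat -> R[i]) : Prop :=
  exists g : R -> R[i],
    [/\ forall s, sigma <= s -> cexp (g s) = Lfun s chi,
        {within `[sigma, +oo[, continuous (fun s => complex.Re (g s))},
        {within `[sigma, +oo[, continuous (fun s => complex.Im (g s))},
        (fun s => complex.Re (g s)) x @[x --> +oo] --> 0
          /\ (fun s => complex.Im (g s)) x @[x --> +oo] --> 0
      & tau < complex.Im (g sigma)].

Definition char_proportion (q : nat) (P : (nat -> R[i]) -> Prop) : R :=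
  (#|` fset_set [set chi | dirichlet_char q chi /\ chi <> principal_char q
                            /\ P chi] |)%:R / (totient q)%:R.

Definition Phi_char (q : nat) (sigma tau : R) : R :=
  char_proportion q (logabsL_gt sigma tau).

Definition Phi_arg (q : nat) (sigma tau : R) : R :=
  char_proportion q (argL_gt sigma tau).

Definition I0 (u : R) : R :=
  limn (fun N => \sum_(0 <= n < N) (u / 2) ^+ (2 * n) / ((n`!)%:R ^+ 2)).

Definition G1 (sigma : R) : R :=
  Rintegral lebesgue_measure `]0, +oo[
    (fun u => ln (I0 u) * u `^ (- 1 - sigma^-1)).

Definition A1 (sigma : R) : R :=
  (sigma `^ (2 * sigma)
     / ((1 - sigma) `^ (2 * sigma - 1) * (G1 sigma) `^ sigma))
    `^ ((1 - sigma)^-1).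

Definition r_err (sigma y tau : R) : R :=
  (tau / (y `^ (1 - sigma) / ln y)) `^ ((sigma - 2^-1) / (1 - sigma)).

End Defs.

(* Main.v *)
(* log L(s, chi) is compared with a sum over primes. Outside a set of q^(1 - d) characters, the
   approximation of L by a Dirichlet polynomial and high moments of its prime blocks give
   log L(sigma, chi) = sum_(p <= log q) chi(p) p^-sigma + O(r tau + 1), uniformly enough on
   [sigma, +oo) to follow the argument. By orthogonality, the exponential moments of the short
   sum are those of the random model with chi(p) independent and uniform on the circle, up to
   constants: E exp(k Re S) is comparable to exp(M(k)), M(k) = sum_p log I_0(k p^-sigma). The
   prime number theorem with a rate (from the 3-4-1 inequality, a lower bound for zeta on the
   line Re s = 1 and Fejer smoothing) yields M(k) ~ G_1 k^(1/sigma) / log k. The upper bound is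
   Chernoff's; for the lower bound, the second differences of M are bounded, so tilting by the
   least integer k with M(k) - M(k-1) >= tau + 8 concentrates S just above tau. *)
Require Import Defs.
From HB Require Import structures.
From mathcomp Require Import finmap all_boot all_order all_algebra.
From mathcomp Require Import all_classical all_reals all_analysis.
From mathcomp Require Import complex measurable_realfun ring lra zify.
Set Implicit Arguments. Unset Strict Implicit. Unset Printing Implicit Defensive.
Import Order.TTheory GRing.Theory Num.Theory.
Import numFieldNormedType.Exports.
Local Open Scope ring_scope.
Local Notation Re := complex.Re.
Local Notation Im := complex.Im.
Local Notation "x %:c" := ((x%:C)%C) (at level 2, format "x %:c").

(** Zeros are excluded, not counted. Off an exceptional set, L(s, chi) exp(-P(s)), with P a
    truncated series for log L, stays within 1/2 of 1 on all of [sigma, +oo). This excludes zeros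
    there, gives log |L| up to O(1) and leaves the argument no room to wind, so both claims come
    from one distribution, that of Re (om S) with om = 1 or -i. The tool is a weighted mean square
    over the half-line, which has a closed form for Dirichlet polynomials and controls their
    supremum. The term 1/sqrt(log tau) is the rate of the prime number theorem obtained here; r(log
    q, tau) arises twice, from cutting the random model at log q and from moments of order
    tau^(1/(1-sigma)) (log tau)^(sigma/(1-sigma)) of the next block of primes. The cut at y = log q
    is a length at which orthogonality works: exponential moments are expanded to a degree M with
    y^M <= q, and M must exceed the size of the exponent. *)

Lemma cabs_ge0 (R : realType) (z : R[i]) : 0 <= cabs z.
Proof. exact: sqrtr_ge0. Qed.
Lemma ln_natr_ge0 (R : realType) (n : nat) : 0 <= ln (n%:R : R).
Proof. by case: n => [|n]; [rewrite ln0|rewrite ln_ge0 // ler1n]. Qed.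
Lemma ler_of_eq (R : numDomainType) (x y : R) : x = y -> x <= y.
Proof. by move->. Qed.

Ltac sign :=
 first [ assumption | lazymatch goal with
 | |- is_true (in_mem _ _) => first [rewrite posrE | rewrite nnegrE]; sign
 | |- is_true (_ ==> (_ != 0)) => apply/implyP => _; sign
 | |- is_true (_ != 0) => apply: lt0r_neq0; sign
 | |- _ == 0 = false => apply: gt_eqF; sign
 | |- is_true (_ && _) => apply/andP; split; sign
 | |- is_true (0 <= ?x) => lazymatch x with
  | _ * _ => apply: mulr_ge0; sign
  | _ + _ => apply: addr_ge0; sign
  | _ ^-1 => rewrite invr_ge0; sign
  | _ ^+ _ => first [apply: exprn_ge0; sign | exact: sqr_ge0]
  | \sum_(_ <- _ | _) _ => apply: sumr_ge0 => ? _; sign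
  | expR _ => exact: expR_ge0
  | powR _ _ => exact: powR_ge0
  | `|_| => exact: normr_ge0
  | Num.sqrt _ => exact: sqrtr_ge0
  | cabs _ => exact: cabs_ge0
  | ln _%:R => exact: ln_natr_ge0
  | _%:R => exact: ler0n
  | 1 => exact: ler01
  | _ => first [apply: ltW; assumption | apply: le_trans ler01 _; assumption | by [] | progress unfold x; sign]
  end
 | |- is_true (0 < ?x) => lazymatch x with
  | _ * _ => apply: mulr_gt0; sign
  | _ + _ => first [apply: addr_gt0; sign | apply: ltr_wpDl; sign | apply: ltr_wpDr; sign]
  | _ ^-1 => rewrite invr_gt0; sign
  | _ ^+ _ => apply: exprn_gt0; sign
  | expR _ => exact: expR_gt0
  | powR _ _ => apply: powR_gt0; sign
  | Num.sqrt _ => rewrite sqrtr_gt0; sign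
  | ln _ => first [apply: ln_gt0; assumption | apply: lt_le_trans ltr01 _; assumption]
  | _%:R => first [rewrite ltr0n; by [] | by [] | rewrite ltr0n; apply: prime_gt0; assumption | apply: lt_le_trans ltr01 _; assumption]
  | _ => first [apply: lt_le_trans ltr01 _; assumption | by [] | progress unfold x; sign]
  end
 | |- _ => by []
 end ].
(* [/1/] in a rewrite chain calls [ssrdone1]. *)
Ltac ssrdone1 := sign.
Tactic Notation "via" uconstr(y) := refine (@le_trans _ _ y _ _ _ _).
Tactic Notation "step" open_constr(h) := apply: (le_trans h).

(** * Modulus, parts and exponential of complex numbers *)

Section ComplexModulus.
Variable R : realType.
Implicit Types (z w : R[i]) (x y : R).

Lemma cabs_normc z : cabs z = ComplexField.Normc.normc z.
Proof. by case: z. Qed.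
Lemma cabsM z w : cabs (z * w) = cabs z * cabs w.
Proof. by rewrite !cabs_normc ComplexField.Normc.normcM. Qed.
Lemma ler_cabsD z w : cabs (z + w) <= cabs z + cabs w.
Proof. by rewrite !cabs_normc le_normcD. Qed.
Lemma cabs0 : cabs (0 : R[i]) = 0.
Proof. by rewrite cabs_normc ComplexField.Normc.normc0. Qed.
Lemma cabs1 : cabs (1 : R[i]) = 1.
Proof. by rewrite cabs_normc ComplexField.Normc.normc1. Qed.
Lemma cabsN z : cabs (- z) = cabs z.
Proof. by rewrite !cabs_normc normcN. Qed.
Lemma cabsV z : cabs z^-1 = (cabs z)^-1.
Proof. by rewrite !cabs_normc ComplexField.Normc.normcV. Qed.
Lemma cabsX z n : cabs (z ^+ n) = cabs z ^+ n.
Proof. by elim: n => [|n ih]; rewrite ?cabs1 // !exprS cabsM ih. Qed.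
Lemma cabs_real x : cabs x%:c = `|x|.
Proof. by rewrite /cabs expr0n addr0 sqrtr_sqr. Qed.
Lemma cabs_eq0 z : (cabs z == 0) = (z == 0).
Proof.
apply/eqP/eqP => [|->]; last exact: cabs0.
by rewrite cabs_normc => /ComplexField.Normc.eq0_normc.
Qed.

Lemma cabs_gt0 z : (0 < cabs z) = (z != 0).
Proof. by rewrite lt_neqAle cabs_ge0 andbT eq_sym cabs_eq0. Qed.
Lemma ler_cabsB z w : cabs (z - w) <= cabs z + cabs w.
Proof. by rewrite -(cabsN w) ler_cabsD. Qed.
Lemma cabs_distC z w : cabs (z - w) = cabs (w - z).
Proof. by rewrite -cabsN opprB. Qed.
Lemma lerB_cabs z w : cabs z - cabs w <= cabs (z - w).
Proof. by rewrite lerBlDr -{1}(subrK w z) ler_cabsD. Qed.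
Lemma sqr_cabs z : cabs z ^+ 2 = Re z ^+ 2 + Im z ^+ 2.
Proof. by rewrite sqr_sqrtr // addr_ge0 // sqr_ge0. Qed.
Lemma ler_Re_cabs z : `|Re z| <= cabs z.
Proof.
by rewrite -(@ler_pXn2r _ 2) /1/ sqr_cabs real_normK ?num_real/1/ lerDl sqr_ge0.
Qed.

Lemma ler_Im_cabs z : `|Im z| <= cabs z.
Proof.
by rewrite -(@ler_pXn2r _ 2) /1/ sqr_cabs real_normK ?num_real/1/ lerDr sqr_ge0.
Qed.

Lemma ReD z w : Re (z + w) = Re z + Re w.
Proof. by case: z; case: w. Qed.
Lemma ImD z w : Im (z + w) = Im z + Im w.
Proof. by case: z; case: w. Qed.
Lemma ReN z : Re (- z) = - Re z.
Proof. by case: z. Qed.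
Lemma ImN z : Im (- z) = - Im z.
Proof. by case: z. Qed.
Lemma ReM z w : Re (z * w) =
 Re z * Re w - Im z * Im w.
Proof. by case: z; case: w. Qed.
Lemma ImM z w : Im (z * w) =
 Re z * Im w + Im z * Re w.
Proof. by case: z; case: w. Qed.
Lemma Re_real x : Re x%:c = x. Proof. by []. Qed.
Lemma Re_conjc z : Re (conjc z) = Re z.
Proof. by case: z. Qed.
Lemma Im_conjc z : Im (conjc z) = - Im z.
Proof. by case: z. Qed.
Lemma Re_sum I (r : seq I) (P : pred I) (F : I -> R[i]) :
 Re (\sum_(i <- r | P i) F i) = \sum_(i <- r | P i) Re (F i).
Proof. by apply: (big_morph _ ReD). Qed.
Lemma Im_sum I (r : seq I) (P : pred I) (F : I -> R[i]) :
 Im (\sum_(i <- r | P i) F i) = \sum_(i <- r | P i) Im (F i).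
Proof. by apply: (big_morph _ ImD). Qed.
Lemma Re_realM x z : Re (x%:c * z) = x * Re z.
Proof. by rewrite ReM mul0r subr0. Qed.
Lemma Im_realM x z : Im (x%:c * z) = x * Im z.
Proof. by rewrite ImM mul0r addr0. Qed.
Lemma complex_eqP z w :
 Re z = Re w -> Im z = Im w -> z = w.
Proof. by case: z; case: w => /= ? ? ? ? -> ->. Qed.
Lemma ler_cabs_sum I (r : seq I) (P : pred I) (F : I -> R[i]) :
 cabs (\sum_(i <- r | P i) F i) <= \sum_(i <- r | P i) cabs (F i).
Proof.
elim/big_ind2: _ => [|x1 x2 y1 y2 h1 h2|//]; first by rewrite cabs0.
by apply: le_trans (ler_cabsD _ _) _; apply: lerD.
Qed.

Lemma cabs_conjc z : cabs (conjc z) = cabs z.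
Proof. by rewrite /cabs Re_conjc Im_conjc sqrrN. Qed.
Lemma mulc_conjc z : z * conjc z = (cabs z ^+ 2)%:c.
Proof. by rewrite sqr_cabs; apply: complex_eqP; rewrite ?ReM ?ImM ?Re_conjc ?Im_conjc /=; ring. Qed.
Lemma ler_cabs_ReIm z : cabs z <= `|Re z| + `|Im z|.
Proof.
rewrite -(@ler_pXn2r _ 2) /1/ sqr_cabs.
rewrite sqrrD !real_normK ?num_real //.
by rewrite addrAC lerDl mulrn_wge0 // mulr_ge0.
Qed.

Lemma realc_sum I (r : seq I) (P : pred I) (F : I -> R) :
 (\sum_(i <- r | P i) F i)%:c = \sum_(i <- r | P i) (F i)%:c.
Proof. exact: raddf_sum. Qed.
Lemma realcM x y : (x * y)%:c = x%:c * y%:c :> R[i].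
Proof. exact: rmorphM. Qed.
Lemma realcD x y : (x + y)%:c = x%:c + y%:c :> R[i].
Proof. exact: rmorphD. Qed.
Lemma realcN x : (- x)%:c = - x%:c :> R[i].
Proof. exact: rmorphN. Qed.

(* Rotating [w] onto the positive real axis. *)
Lemma cabs_rotate w : exists u, cabs u <= 1 /\ Re (u * w) = cabs w.
Proof.
have [->|w0] := eqVneq w 0; first by exists 0; rewrite cabs0 mul0r ler01.
exists (((cabs w)^-1%:C)%C * conjc w); split.
 rewrite cabsM cabs_real cabs_conjc ger0_norm /1/.
 by rewrite mulVf // cabs_eq0.
rewrite -mulrA Re_realM mulrC (mulrC (conjc w)) mulc_conjc /= expr2.
by rewrite mulfK // cabs_eq0.
Qed.

Lemma cexpD z w : cexp (z + w) = cexp z * cexp w.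
Proof.
by apply: complex_eqP; rewrite /cexp /= ReD ImD expRD ?cosD ?sinD; ring.
Qed.
Lemma cexp0 : cexp (0 : R[i]) = 1.
Proof. by apply: complex_eqP; rewrite /cexp ?cos0 ?sin0 expR0 ?mulr1 ?mulr0. Qed.
Lemma cexp_real x : cexp x%:c = (expR x)%:c.
Proof. by apply: complex_eqP; rewrite /cexp ?cos0 ?sin0 ?mulr1 ?mulr0. Qed.
Lemma cabs_cexp z : cabs (cexp z) = expR (Re z).
Proof.
rewrite /cabs /cexp !exprMn -mulrDr cos2Dsin2 mulr1 sqrtr_sqr.
by rewrite ger0_norm // expR_ge0.
Qed.
Lemma cexp_sum I (r : seq I) (P : pred I) (F : I -> R[i]) :
 cexp (\sum_(i <- r | P i) F i) = \prod_(i <- r | P i) cexp (F i).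
Proof. exact: (big_morph _ cexpD cexp0). Qed.
End ComplexModulus.

Ltac triD := lazymatch goal with
 |- is_true (cabs _ <= _) => apply: le_trans (ler_cabsD _ _) _ | _ => apply: le_trans (ler_normD _ _) _ end.
Ltac triB := lazymatch goal with
 |- is_true (cabs _ <= _) => apply: le_trans (ler_cabsB _ _) _ | _ => apply: le_trans (ler_normB _ _) _ end.
Ltac triS := lazymatch goal with
 |- is_true (cabs _ <= _) => apply: le_trans (ler_cabs_sum _ _ _) _ | _ => apply: le_trans (ler_norm_sum _ _ _) _ end.

(** * Complex-valued functions of a real variable *)

Section RealVariable.
Variable R : realType.
Implicit Types (f : R -> R[i]) (g : R -> R) (x y : R).

Lemma derive_ge0_le g g' (a b : R) : a <= b ->
 (forall x, a <= x <= b -> is_derive x 1 g (g' x)) ->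
 (forall x, a <= x <= b -> 0 <= g' x) -> g a <= g b.
Proof.
move=> ab dg g0.
have [||c cab e] := @MVT_segment R g g' a b ab.
- move=> x; rewrite in_itv /= => /andP[h1 h2]; apply: dg.
 by rewrite !ltW.
- apply: derivable_within_continuous => x; rewrite in_itv /= => h.
 by have [] := dg x h.
by rewrite -subr_ge0 e mulr_ge0 ?subr_ge0 // g0.
Qed.

(** Every path in the proof is a piece of the real line, so a derivative is a pair of real ones. *)
Definition cderiv f x (l : R[i]) : Prop :=
 is_derive x 1 (fun t => Re (f t)) (Re l) /\
 is_derive x 1 (fun t => Im (f t)) (Im l).

Lemma is_deriveEq g x (a b : R) : a = b -> is_derive x 1 g a -> is_derive x 1 g b.
Proof. by move->. Qed.
Lemma cderiv_cst (c : R[i]) x : cderiv (fun=> c) x 0.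
Proof. by split; apply: is_derive_cst. Qed.
Lemma cderivD f1 f2 x l1 l2 : cderiv f1 x l1 -> cderiv f2 x l2 ->
 cderiv (fun t => f1 t + f2 t) x (l1 + l2).
Proof.
move=> [a1 b1] [a2 b2]; split; rewrite ?ReD ?ImD.
- have -> : (fun t => Re (f1 t + f2 t)) = (fun t => Re (f1 t)) + (fun t => Re (f2 t)) by apply/funext => t; rewrite ReD.
 exact: is_deriveD.
- have -> : (fun t => Im (f1 t + f2 t)) = (fun t => Im (f1 t)) + (fun t => Im (f2 t)) by apply/funext => t; rewrite ImD.
 exact: is_deriveD.
Qed.

Lemma cderivM f1 f2 x l1 l2 : cderiv f1 x l1 -> cderiv f2 x l2 ->
 cderiv (fun t => f1 t * f2 t) x (l1 * f2 x + f1 x * l2).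
Proof.
move=> [a1 b1] [a2 b2]; split.
- have -> : (fun t => Re (f1 t * f2 t)) =
  (fun t => Re (f1 t)) * (fun t => Re (f2 t)) - (fun t => Im (f1 t)) * (fun t => Im (f2 t)).
  by apply/funext => t; rewrite ReM.
 apply: is_deriveEq (is_deriveB (is_deriveM a1 a2) (is_deriveM b1 b2)).
 by rewrite ReD !ReM /GRing.scale /=; ring.
- have -> : (fun t => Im (f1 t * f2 t)) =
  (fun t => Re (f1 t)) * (fun t => Im (f2 t)) + (fun t => Im (f1 t)) * (fun t => Re (f2 t)).
  by apply/funext => t; rewrite ImM.
 apply: is_deriveEq (is_deriveD (is_deriveM a1 b2) (is_deriveM b1 a2)).
 by rewrite ImD !ImM /GRing.scale /=; ring.
Qed.

Lemma cderivZ f x l (c : R[i]) : cderiv f x l -> cderiv (fun t => c * f t) x (c * l).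
Proof.
move=> h; have := cderivM (cderiv_cst c x) h; by rewrite mul0r add0r.
Qed.

Lemma cderiv_sum (I : Type) (r : seq I) (P : pred I) (F : I -> R -> R[i]) (F' : I -> R[i]) x :
 (forall i, P i -> cderiv (F i) x (F' i)) ->
 cderiv (fun t => \sum_(i <- r | P i) F i t) x (\sum_(i <- r | P i) F' i).
Proof.
move=> h; elim: r => [|i r ih].
 rewrite big_nil; have -> : (fun t => \sum_(i <- [::] | P i) F i t) = (fun=> 0).
  by apply/funext => t; rewrite big_nil.
 exact: cderiv_cst.
rewrite big_cons; case: ifPn => Pi.
 have -> : (fun t => \sum_(j <- i :: r | P j) F j t) = (fun t => F i t + \sum_(j <- r | P j) F j t) by apply/funext => t; rewrite big_cons Pi.
 exact: cderivD (h _ Pi) ih.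
have -> // : (fun t => \sum_(j <- i :: r | P j) F j t) = (fun t => \sum_(j <- r | P j) F j t).
by apply/funext => t; rewrite big_cons (negbTE Pi).
Qed.

Lemma cderiv_real g x l : is_derive x 1 g l -> cderiv (fun t => (g t)%:c) x (l%:c).
Proof. by move=> h; split => //=; apply: is_derive_cst. Qed.
Lemma cderiv_cexp f x l : cderiv f x l -> cderiv (fun t => cexp (f t)) x (l * cexp (f x)).
Proof.
move=> [hr hi].
have he := @is_derive1_comp _ expR _ _ _ _ (is_derive_expR _) hr.
have hc := @is_derive1_comp _ cos _ _ _ _ (is_derive_cos _) hi.
have hs := @is_derive1_comp _ sin _ _ _ _ (is_derive_sin _) hi.
split.
- apply: is_deriveEq (is_deriveM he hc).
 by rewrite /cexp ReM /GRing.scale /=; ring.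
- apply: is_deriveEq (is_deriveM he hs).
 by rewrite /cexp ImM /GRing.scale /=; ring.
Qed.

(** The mean value theorem fails for complex values; rotating f b - f a onto the positive axis
    leaves a real function, g - Re (u f), that is nondecreasing. In this form g stands for the
    integral of a majorant of |f'|. *)
Lemma cabs_le_of_derive f f' g g' (a b : R) : a <= b ->
 (forall x, a <= x <= b -> cderiv f x (f' x)) ->
 (forall x, a <= x <= b -> is_derive x 1 g (g' x)) ->
 (forall x, a <= x <= b -> cabs (f' x) <= g' x) ->
 cabs (f b - f a) <= g b - g a.
Proof.
move=> ab df dg le.
have [u [u1 e]] := cabs_rotate (f b - f a); rewrite -e.
have H : forall x, a <= x <= b ->
 is_derive x 1 (g - (fun t => Re (u * f t))) (g' x - Re (u * f' x)).
 by move=> x hx; apply: is_deriveB; [exact: dg | have [] := cderivZ u (df x hx)].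
have := @derive_ge0_le _ _ a b ab H.
rewrite /= => h; have {}h : g a - Re (u * f a) <= g b - Re (u * f b).
 apply: h => x hx; rewrite subr_ge0.
 apply: le_trans (le x hx); apply: le_trans (ler_norm _) _.
 apply: le_trans (ler_Re_cabs _) _.
 by rewrite cabsM ler_piMl // cabs_ge0.
by rewrite mulrBr ReD ReN; lra.
Qed.

End RealVariable.

(** * Divisor sums and finite convolution *)

Section DirichletConvolution.
Variable S : comNzRingType.
Implicit Types (f g : nat -> S).

Definition dconv f g (n : nat) : S :=
 \sum_(d < n.+1 | (0 < d)%N && (d %| n)%N) f d * g (n %/ d)%N.

(** A range for d that does not depend on n is what allows the double sums below to be exchanged. *)
Lemma sum_divisors_bound (f : nat -> nat -> S) (n M : nat) : (0 < n)%N -> (n < M)%N ->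
 \sum_(d < n.+1 | (0 < d)%N && (d %| n)%N) f d (n %/ d)%N =
 \sum_(d < M | (0 < d)%N && (d %| n)%N) f d (n %/ d)%N.
Proof.
move=> n0 nM.
rewrite -(big_mkord (fun d => (0 < d)%N && (d %| n)%N) (fun d => f d (n %/ d)%N)).
rewrite -[RHS](big_mkord (fun d => (0 < d)%N && (d %| n)%N) (fun d => f d (n %/ d)%N)).
rewrite [RHS](big_cat_nat (n := n.+1)) //= [X in _ + X]big1_seq ?addr0 // => d.
rewrite mem_index_iota => /andP[/andP[_ dn] /andP[h _]].
by have := dvdn_leq n0 dn; lia.
Qed.

Lemma sum_multiples (F : nat -> nat -> S) (d M : nat) : (0 < d)%N ->
 \sum_(n < M | (0 < n)%N && (d %| n)%N) F d (n %/ d)%N =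
 \sum_(e < M | (0 < e)%N && (d * e < M)%N) F d e.
Proof.
move=> d0.
have -> : \sum_(e < M | (0 < e)%N && (d * e < M)%N) F d e =
 \sum_(e < M | (0 < e)%N && (d * e < M)%N) \sum_(n < M | n == (d * e)%N :> nat) F d e.
 apply: eq_bigr => e /andP[e0 h].
 by rewrite (big_pred1 (Ordinal h)) // => n; rewrite -val_eqE.
rewrite (exchange_big_dep (fun n : 'I_M => (0 < n)%N && (d %| n)%N)) /=; last first.
 by move=> e n /andP[e0 h] /eqP ->; rewrite muln_gt0 d0 e0 dvdn_mulr.
apply: eq_bigr => n /andP[n0 dn].
have nd : (n %/ d < M)%N by apply: leq_ltn_trans (leq_div _ _) (ltn_ord n).
rewrite (big_pred1 (Ordinal nd)) // => e; rewrite /= -val_eqE /=.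
apply/idP/idP => [/andP[_ /eqP ->]|/eqP ->]; first by rewrite mulKn.
by rewrite muln_divA // mulKn // divn_gt0 dvdn_leq // ltn_ord eqxx.
Qed.

Lemma sum_divisors (F : nat -> nat -> S) (M : nat) :
 \sum_(n < M | (0 < n)%N) \sum_(d < n.+1 | (0 < d)%N && (d %| n)%N) F d (n %/ d)%N =
 \sum_(d < M | (0 < d)%N) \sum_(e < M | (0 < e)%N && (d * e < M)%N) F d e.
Proof.
rewrite (eq_bigr (fun n : 'I_M => \sum_(d < M | (0 < d)%N && (d %| n)%N) F d (n %/ d)%N)).
 rewrite (exchange_big_dep (fun d : 'I_M => (0 < d)%N)) /=; last by move=> ? ? _ /andP[].
 apply: eq_bigr => d d0; rewrite -sum_multiples //; apply: eq_bigl => n.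
 by rewrite d0.
by move=> n n0; apply: sum_divisors_bound.
Qed.
End DirichletConvolution.

(** * The von Mangoldt function *)

Section VonMangoldt.
Variable R : realType.

(** The list of prime divisors is a singleton exactly for the powers p^k with k >= 1. *)
Definition vM (n : nat) : R := if primes n is [:: p] then ln (p%:R) else 0.

Lemma vM_prime_power (p k : nat) : prime p -> (0 < k)%N -> vM (p ^ k)%N = ln (p%:R).
Proof. by move=> pp k0; rewrite /vM primesX // primes_prime. Qed.
Lemma vM_prime (p : nat) : prime p -> vM p = ln (p%:R).
Proof. by move=> pp; rewrite -(vM_prime_power pp (ltn0Sn 0)) expn1. Qed.
Lemma vM_neq0 n : vM n != 0 -> exists p k, [/\ prime p, (0 < k)%N & n = (p ^ k)%N].
Proof.
rewrite /vM; case E: (primes n) => [|p [|p' s]]; rewrite ?eqxx // => _.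
have pn : p \in primes n by rewrite E mem_head.
have [pp n0 dv] : [/\ prime p, (0 < n)%N & (p %| n)%N] by move: pn; rewrite mem_primes => /and3P[].
have : p.-nat n.
 apply/pnatP => // r pr rn; have : r \in primes n by rewrite mem_primes pr n0 rn.
 by rewrite E inE.
move=> /p_natP [k e]; exists p, k; split => //.
by case: k e => // e; move: dv; rewrite e dvdn1 => /eqP p1; rewrite p1 in pp.
Qed.

Lemma vM_ge0 n : 0 <= vM n.
Proof.
have [->//|/vM_neq0 [p [k [pp k0 ->]]]] := eqVneq (vM n) 0.
by rewrite vM_prime_power // ln_ge0 // ler1n prime_gt0.
Qed.

(** Strong induction on n = m p with p the least prime factor. Among the divisors of n that do not
    divide m, only p^(v+1), v the exponent of p in m, is a prime power, and it adds log p. *)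
Lemma sum_vM n : (0 < n)%N -> \sum_(d < n.+1 | (0 < d)%N && (d %| n)%N) vM d = ln (n%:R).
Proof.
elim/ltn_ind: n => n IH n0.
have [n1|n1] := leqP n 1.
 have -> : n = 1%N by apply/eqP; rewrite eqn_leq n1.
 by rewrite (bigD1 (@Ordinal 2 1 isT)) //= big1 ?addr0 ?ln1 // => -[[|[|m]] i].
move: (pdiv_prime n1) (pdiv_dvd n); move: (pdiv n) => p pp /dvdnP[m e].
have m0 : (0 < m)%N by case: (m) e n0 => // ->.
have mn : (m < n)%N by rewrite e ltn_Pmulr // prime_gt1.
have := IH _ mn m0.
rewrite (@sum_divisors_bound _ (fun d _ => vM d) m n.+1 m0 (ltnW mn)) => IHm.
have pan : (p ^ (logn p m).+1 %| n)%N by rewrite e expnSr dvdn_mul // pfactor_dvdnn.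
have pln : (p ^ (logn p m).+1 < n.+1)%N by rewrite ltnS dvdn_leq.
rewrite (bigID (fun d : 'I_n.+1 => (d %| m)%N)) /=.
rewrite [X in X + _](eq_bigl (fun d : 'I_n.+1 => (0 < d)%N && (d %| m)%N)); last first.
 move=> d; rewrite -andbA; congr (_ && _).
 by apply: andb_idl => h; have := dvdn_mulr p h; rewrite -e.
rewrite IHm (bigD1 (Ordinal pln)) /=; last first.
 by rewrite pan expn_gt0 prime_gt0 //= pfactor_dvdn // ltnn.
rewrite vM_prime_power // big1 ?addr0; last first.
 move=> d /andP[/andP[/andP[d0 dn] dm] ne].
 apply/eqP; apply/negPn/negP => /vM_neq0 [r [k [pr k0 dk]]].
 move/negP: ne; apply; apply/eqP/val_inj => /=.
 rewrite dk in dn dm *.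
 have rp : r = p.
  apply/eqP; apply/negPn/negP => ne; move/negP: dm; apply.
  rewrite -(@Gauss_dvdl _ _ p) -?e // coprimeXl //.
  by rewrite prime_coprime // dvdn_prime2.
 rewrite rp in dn dm *; congr (_ ^ _)%N.
 have lpn : logn p n = (logn p m).+1 by rewrite e (lognM p m0 (prime_gt0 pp)) -{3}(expn1 p) pfactorK // addn1.
 by move: dn dm; rewrite !pfactor_dvdn // lpn; lia.
by rewrite e natrM lnM /1/ ltr0n prime_gt0.
Qed.

Lemma vM_le_ln n : vM n <= ln n%:R.
Proof.
have [->|n0] := posnP n; first by rewrite /vM ln0.
rewrite -sum_vM // (bigD1 (@Ordinal n.+1 n (ltnSn n))) /=; last by rewrite n0 dvdnn.
by rewrite lerDl sumr_ge0 // => d _; apply: vM_ge0.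
Qed.

Lemma vM1 : vM 1 = 0. Proof. by []. Qed.
End VonMangoldt.

(** * Convergence of complex series and the product of two Dirichlet series *)

Section Series.
Variable R : realType.
Implicit Types (f g : nat -> R[i]).

Definition cser f (l : R[i]) : Prop :=
 forall e : R, 0 < e -> exists N0 : nat, forall N, (N0 <= N)%N ->
  cabs (\sum_(n < N) f n - l) < e.

Lemma cabs_lt_eps0 (z : R[i]) : (forall e : R, 0 < e -> cabs z < e) -> z = 0.
Proof.
move=> h; apply/eqP; rewrite -cabs_eq0; apply/negPn/negP => n0.
by have := h _ (_ : 0 < cabs z); rewrite ltxx lt_neqAle cabs_ge0 andbT eq_sym n0 => /(_ isT).
Qed.

Lemma cser_uniq f l1 l2 : cser f l1 -> cser f l2 -> l1 = l2.
Proof.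
move=> h1 h2; apply/eqP; rewrite -subr_eq0; apply/eqP/cabs_lt_eps0 => e e0.
have e2 : 0 < e / 2 by lra.
have [N1 H1] := h1 _ e2; have [N2 H2] := h2 _ e2.
have := H1 _ (leq_maxl N1 N2); have := H2 _ (leq_maxr N1 N2).
set s := \sum_(_ < _) _ => a b.
have -> : l1 - l2 = (s - l2) - (s - l1) by ring.
apply: le_lt_trans (ler_cabsB _ _) _; lra.
Qed.

Lemma cserD f g l m : cser f l -> cser g m -> cser (fun n => f n + g n) (l + m).
Proof.
move=> h1 h2 e e0.
have e2 : 0 < e / 2 by lra.
have [N1 H1] := h1 _ e2; have [N2 H2] := h2 _ e2.
exists (maxn N1 N2) => N; rewrite geq_max => /andP[a b].
have := H1 _ a; have := H2 _ b => h h'.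
rewrite big_split /=.
set s := \sum_(_ < _) _ in h' *; set t := \sum_(_ < _) _ in h *.
have -> : s + t - (l + m) = (s - l) + (t - m) by ring.
apply: le_lt_trans (ler_cabsD _ _) _; lra.
Qed.

Lemma cserZ f l c : cser f l -> cser (fun n => c * f n) (c * l).
Proof.
move=> h e e0.
have c1 : 0 < cabs c + 1 by sign.
have [N1 H1] := h _ (divr_gt0 e0 c1).
exists N1 => N /H1; rewrite -mulr_sumr -mulrBr cabsM.
rewrite ltr_pdivlMr // => hh; apply: le_lt_trans hh.
by rewrite mulrC ler_wpM2l /1/ lerDl.
Qed.

Lemma cser_cabs_le f l (B : R) (N0 : nat) : cser f l ->
 (forall N, (N0 <= N)%N -> cabs (\sum_(n < N) f n) <= B) -> cabs l <= B.
Proof.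
move=> h hB; apply/ler_addgt0Pr => e e0.
have [N1 H1] := h _ e0.
have := H1 _ (leq_maxl N1 N0); have := hB _ (leq_maxr N1 N0).
set s := \sum_(_ < _) _ => a b.
have -> : l = s - (s - l) by ring.
triB; lra.
Qed.

Definition abs_summable f : Prop := exists B : R, forall N, \sum_(n < N) cabs (f n) <= B.

Lemma abs_summable_real (a : nat -> R) (B : R) :
 (forall N, \sum_(n < N) `|a n| <= B) -> exists l : R,
  forall e : R, 0 < e -> exists N0 : nat, forall N, (N0 <= N)%N -> `|\sum_(n < N) a n - l| < e.
Proof.
move=> hB.
have cv : cvgn (series a).
 apply: normed_cvg; apply: nondecreasing_is_cvgn.
  by apply: nondecreasing_series => n _ _; apply: normr_ge0.
 exists B => _ [n _ <-] /=; rewrite /series /= big_mkord; exact: hB.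
exists (limn (series a)) => e e0.
have /cvgrPdist_lt /(_ e e0) [N0 _ h] := cv.
by exists N0 => N hN; have := h N hN; rewrite /series /= big_mkord distrC.
Qed.

Lemma abs_summable_cser f : abs_summable f -> exists l, cser f l.
Proof.
move=> [B hB].
have [|l1 h1] := @abs_summable_real (fun n => Re (f n)) B.
 move=> N; apply: le_trans (hB N); apply: ler_sum => i _; exact: ler_Re_cabs.
have [|l2 h2] := @abs_summable_real (fun n => Im (f n)) B.
 move=> N; apply: le_trans (hB N); apply: ler_sum => i _; exact: ler_Im_cabs.
exists (Complex l1 l2) => e e0.
have e2 : 0 < e / 2 by lra.
have [N1 H1] := h1 _ e2; have [N2 H2] := h2 _ e2.
exists (maxn N1 N2) => N; rewrite geq_max => /andP[a b].
apply: le_lt_trans (ler_cabs_ReIm _) _.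
rewrite ReD ImD ReN ImN Re_sum Im_sum /=.
have := H1 _ a; have := H2 _ b; lra.
Qed.

(* The difference of the two sides is supported on pairs (d,e) outside the square [0,N)^2. *)
Lemma cser_dconv f g l m : f 0%N = 0 -> g 0%N = 0 -> abs_summable f -> abs_summable g ->
 cser f l -> cser g m -> cser (fun n => if n == 0%N then 0 else dconv f g n) (l * m).
Proof.
move=> f0 g0 sf sg hl hm e e0.
pose fa n := (cabs (f n))%:c; pose ga n := (cabs (g n))%:c.
have absE h n : cabs (cabs (h n))%:c = cabs (h n) by rewrite cabs_real ger0_norm /1/.
have [|la hla] := @abs_summable_cser fa.
 by case: sf => B hB; exists B => N; under eq_bigr do rewrite absE.
have [|ma hma] := @abs_summable_cser ga.
 by case: sg => B hB; exists B => N; under eq_bigr do rewrite absE.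
have [Bf hBf] := sf; have [Bg hBg] := sg.
have Bf0 : 0 <= Bf by have := hBf 0%N; rewrite big_ord0.
have Bg0 : 0 <= Bg by have := hBg 0%N; rewrite big_ord0.
have cl : cabs l <= Bf.
 apply: (cser_cabs_le (N0 := 0) hl) => N _.
 by triS.
have prodbound (a b c d : R[i]) (e' : R) : cabs (a - c) < e' -> cabs (b - d) < e' ->
  cabs b <= Bg -> cabs c <= Bf -> cabs (a * b - c * d) <= e' * (Bf + Bg).
 move=> h1 h2 h3 h4.
 have -> : a * b - c * d = (a - c) * b + c * (b - d) by ring.
 triD; rewrite !cabsM mulrDr addrC.
 by apply: lerD; [rewrite mulrC|]; apply: ler_pM; rewrite /1/ ltW.
(* Three products of partial sums are compared with their limits below, each within e1 (Bf + Bg) <=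
   e/4. *)
set e1 := e / (4 * (Bf + Bg + 1)).
have e10 : 0 < e1 by sign.
have [N1 H1] := hl _ e10; have [N2 H2] := hm _ e10.
have [N3 H3] := hla _ e10; have [N4 H4] := hma _ e10.
set N := (maxn (maxn N1 N2) (maxn N3 N4)).+1.
have [n1 n2 n3 n4] : [/\ (N1 <= N)%N, (N2 <= N)%N, (N3 <= N)%N & (N4 <= N)%N] by rewrite /N; split; lia.
(* Every pair of the square [0, N)^2 then satisfies d k < M. *)
exists (N * N)%N => M hM.
have NM : (N <= M)%N by apply: leq_trans hM; rewrite leq_pmull.
have n3M := leq_trans n3 NM; have n4M := leq_trans n4 NM.
have e1B : e1 * (Bf + Bg) <= e / 4.
 rewrite /e1 -mulrA; apply: ler_wpM2l; first lra.
 by rewrite ler_pdivrMl; clear -Bf0 Bg0; lra.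
have -> : \sum_(n < M) (if n == 0%N :> nat then 0 else dconv f g n) =
 \sum_(d < M) \sum_(k < M) (if (d * k < M)%N then f d * g k else 0).
 rewrite (eq_bigr (fun n : 'I_M => if (0 < n)%N then dconv f g n else 0)); last first.
  by move=> [[|n] hn].
 rewrite -big_mkcond (sum_divisors (fun d k => f d * g k)) big_mkcond /=.
 apply: eq_bigr => d _; case: posnP => [->|d0].
  by rewrite big1 // => k _; rewrite f0 mul0r; case: ifP.
 rewrite big_mkcond; apply: eq_bigr => k _; case: posnP => [->|k0] //=.
 by rewrite g0 mulr0; case: ifP.
pose sq (d k : nat) := (d < N)%N && (k < N)%N.
have sumsq (a b : nat -> R[i]) : (\sum_(d < N) a d) * (\sum_(k < N) b k) =
  \sum_(d < M) \sum_(k < M) (if sq d k then a d * b k else 0).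
 rewrite (big_ord_widen _ a NM) (big_ord_widen _ b NM) big_distrlr big_mkcond /=.
 apply: eq_bigr => d _; rewrite /sq; case: ifP => dN /=; last by rewrite big1.
 by rewrite big_mkcond.
(* The leftover pairs are dominated by the same pairs for |f| and |g|, and there the sum is a
   difference of two products with the common limit la ma. *)
have key : cabs (\sum_(d < M) \sum_(k < M) (if (d * k < M)%N then f d * g k else 0) -
  (\sum_(d < N) f d) * (\sum_(k < N) g k)) <=
  cabs ((\sum_(d < M) fa d) * (\sum_(k < M) ga k) - (\sum_(d < N) fa d) * (\sum_(k < N) ga k)).
 rewrite sumsq -sumrB.
 have -> : (\sum_(d < M) fa d) * (\sum_(k < M) ga k) - (\sum_(d < N) fa d) * (\sum_(k < N) ga k) =
   (\sum_(d < M) \sum_(k < M) (if sq d k then 0 else cabs (f d) * cabs (g k)))%:c.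
  rewrite sumsq big_distrlr /= -sumrB realc_sum; apply: eq_bigr => d _.
  rewrite -sumrB realc_sum; apply: eq_bigr => k _; rewrite /fa /ga; case: ifP => _.
   by rewrite subrr.
  by rewrite subr0 realcM.
 rewrite cabs_real ger0_norm; last first.
  by apply: sumr_ge0 => d _; apply: sumr_ge0 => k _; case: ifP => // _; rewrite mulr_ge0 ?cabs_ge0.
 triS; apply: ler_sum => d _.
 rewrite -sumrB; triS; apply: ler_sum => k _.
 case: ifP => h1; rewrite /sq; case: ifP => h2; rewrite ?subrr ?cabs0 ?subr0 ?cabsM //.
 - by move/andP: h2 => [a b]; move: h1; rewrite (leq_trans _ hM) // ltn_mul.
 - by sign.
have kb1 : cabs (\sum_(k < N) g k) <= Bg by triS.
have gabd n : cabs (\sum_(k < n) ga k) <= Bg by triS; under eq_bigr do rewrite absE.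
have lab : cabs la <= Bf.
 apply: (cser_cabs_le (N0 := 0) hla) => n _.
 by triS; under eq_bigr do rewrite absE.
have b1 := prodbound _ _ _ _ _ (H1 _ n1) (H2 _ n2) kb1 cl.
have b2 := prodbound _ _ _ _ _ (H3 _ n3M) (H4 _ n4M) (gabd M) lab.
have b3 := prodbound _ _ _ _ _ (H3 _ n3) (H4 _ n4) (gabd N) lab.
move: key b1 b2 b3; set X := \sum_(d < M) \sum_(k < M) _.
set A := (\sum_(d < M) fa d) * _; set B := (\sum_(d < N) fa d) * _; set D := (\sum_(d < N) f d) * _.
move=> key b1 b2 b3.
have -> : X - l * m = (X - D) + (D - l * m) by ring.
apply: le_lt_trans (ler_cabsD _ _) _.
have : cabs (A - B) <= cabs (A - la * ma) + cabs (B - la * ma).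
 have -> : A - B = (A - la * ma) - (B - la * ma) by ring.
 exact: ler_cabsB.
clear -e0 e1B key b1 b2 b3; lra.
Qed.
End Series.

(** * Taylor remainders of exp(-w) in the right half-plane *)

Section ExpRemainders.
Variable R : realType.
Implicit Types (w : R[i]) (t : R).

Lemma is_derive_monomial (c : R) (n : nat) t :
 is_derive t 1 (fun x : R => c * x ^+ n.+1) (c * n.+1%:R * t ^+ n).
Proof.
have h : is_derive t (1 : R) (fun x : R => x ^+ n.+1) (n.+1%:R * t ^+ n).
 have -> : (fun x : R => x ^+ n.+1) = (id : R -> R) ^+ n.+1 by apply/funext => x; rewrite exprfctE.
 have := @is_deriveX R R^o id n.+1 t 1 1 (is_derive_id _ _).
 by apply: is_deriveEq; rewrite /GRing.scale /= mulr1.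
have := is_deriveZ c h; rewrite /GRing.scale /= mulrA; exact.
Qed.

Lemma cderiv_expline w t :
 cderiv (fun x : R => cexp (- (x%:c * w))) t (- w * cexp (- (t%:c * w))).
Proof.
apply: (@cderiv_cexp _ (fun x : R => - (x%:c * w))).
have -> : (fun x : R => - (x%:c * w)) = (fun x : R => (- w) * x%:c) by apply/funext => x; rewrite mulNr mulrC.
have := @cderiv_real R (fun x : R => x) t 1 (is_derive_id _ _).
by move=> /(cderivZ (- w)); rewrite mulr1.
Qed.

Lemma cabs_expline w t : 0 <= Re w -> 0 <= t -> cabs (cexp (- (t%:c * w))) <= 1.
Proof.
by move=> w0 t0; rewrite cabs_cexp ReN Re_realM -expR0 ler_expR oppr_le0 mulr_ge0.
Qed.

Lemma cderivEq (f : R -> R[i]) t (a b : R[i]) : a = b -> cderiv f t a -> cderiv f t b.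
Proof. by move->. Qed.
Lemma cderiv_line w t : cderiv (fun x : R => x%:c * w) t w.
Proof.
have := @cderiv_real R (fun x : R => x) t 1 (is_derive_id _ _).
move=> h; have := cderivM h (cderiv_cst w t).
by apply: cderivEq; rewrite mulr0 addr0 mul1r.
Qed.

(** The remainders [expN_rem1], [expN_rem3] and [expN_rem4] are integrals of t^n w^(n+1) exp(-t w)
    over [0, 1], where |exp(-t w)| <= 1. They are the errors met when (log x)^k x^(-1-z) is
    integrated from n to n + 1, with w = z log(1 + 1/n). *)
Lemma expline_rem w n (F : R -> R[i]) : 0 <= Re w ->
 (forall t, cderiv F t (t%:c ^+ n * w ^+ n.+1 * cexp (- (t%:c * w)))) ->
 cabs (F 1 - F 0) <= cabs w ^+ n.+1 / n.+1%:R.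
Proof.
move=> w0 dF; have := @cabs_le_of_derive R F _ (fun x => cabs w ^+ n.+1 / n.+1%:R * x ^+ n.+1) _ 0 1 ler01
 (fun x _ => dF x) (fun x _ => is_derive_monomial _ n x).
rewrite expr1n expr0n mulr0 mulr1 subr0; apply=> x /andP[x0 _]; rewrite divfK ?pnatr_eq0 //.
by rewrite cabsM (cabsM _ (w ^+ _)) !cabsX cabs_real ger0_norm // (mulrC (x ^+ n)) ler_piMr ?cabs_expline /1/.
Qed.

Lemma expN_rem1 w : 0 <= Re w -> cabs (1 - cexp (- w)) <= cabs w.
Proof.
move=> w0; have := @expline_rem w 0 (fun x => -1 * cexp (- (x%:c * w))) w0.
rewrite expr1 divr1 (_ : _ - _ = 1 - cexp (- w)); last by rewrite mul1r mul0r oppr0 cexp0; ring.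
apply=> t.
by apply: cderivEq (cderivZ (-1) (cderiv_expline w t)); ring.
Qed.

Lemma expN_rem2 w : 0 <= Re w -> cabs (cexp (- w) - 1 + w) <= cabs w ^+ 2 / 2.
Proof.
move=> w0.
have := @cabs_le_of_derive R (fun x : R => cexp (- (x%:c * w)) + x%:c * w)
 (fun x => - w * cexp (- (x%:c * w)) + w) (fun x => cabs w ^+ 2 / 2 * x ^+ 2)
 (fun x => cabs w ^+ 2 / 2 * 2%:R * x ^+ 1) 0 1 ler01.
rewrite expr1n expr0n mul0r mul1r oppr0 cexp0 mulr0 mulr1 subr0 addr0 addrAC; apply.
- by move=> x _; apply: cderivD; [apply: cderiv_expline|apply: cderiv_line].
- by move=> x _; apply: (is_derive_monomial _ 1 x).
- move=> x /andP[x0 _]; rewrite expr1 divfK //.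
 have -> : - w * cexp (- (x%:c * w)) + w = w * (1 - cexp (- (x%:c * w))) by ring.
 rewrite cabsM expr2 -mulrA ler_wpM2l /1/.
 have := @expN_rem1 (x%:c * w); rewrite Re_realM mulr_ge0 // => /(_ isT).
 by rewrite cabsM cabs_real ger0_norm // (mulrC x).
Qed.

Lemma expN_rem3 w : 0 <= Re w ->
 cabs (1 - cexp (- w) - w * cexp (- w)) <= cabs w ^+ 2 / 2.
Proof.
move=> w0; pose e (x : R) := cexp (- (x%:c * w)); pose l (x : R) := x%:c * w.
have := @expline_rem w 1 (fun x => -1 * e x + -1 * (l x * e x)) w0.
rewrite (_ : _ - _ = 1 - cexp (- w) - w * cexp (- w)); last by rewrite /e /l mul1r mul0r oppr0 cexp0; ring.
apply=> t; have h1 := cderiv_expline w t.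
by apply: cderivEq (cderivD (cderivZ (-1) h1) (cderivZ (-1) (cderivM (cderiv_line w t) h1))); ring.
Qed.

Lemma expN_rem4 w : 0 <= Re w ->
 cabs (2 - 2 * cexp (- w) - 2 * w * cexp (- w) - w ^+ 2 * cexp (- w)) <= cabs w ^+ 3 / 3.
Proof.
move=> w0; pose e (x : R) := cexp (- (x%:c * w)); pose l (x : R) := x%:c * w.
have := @expline_rem w 2 (fun x => (-2 * e x + -2 * (l x * e x)) + -1 * (l x * (l x * e x))) w0.
rewrite (_ : _ - _ = 2 - 2 * cexp (- w) - 2 * w * cexp (- w) - w ^+ 2 * cexp (- w)); last first.
 by rewrite /e /l mul1r mul0r oppr0 cexp0; ring.
apply=> t; have h1 := cderiv_expline w t; have h2 := cderiv_line w t; have h3 := cderivM h2 h1.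
by apply: cderivEq (cderivD (cderivD (cderivZ (-2) h1) (cderivZ (-2) h3)) (cderivZ (-1) (cderivM h2 h3))); ring.
Qed.
End ExpRemainders.

(** * Sums of powers and logarithms by comparison with integrals *)

Section PowerSums.
Variable R : realType.

(** Integral comparison in difference form, by the mean value theorem; [sum_powRN_tail] telescopes
    it. *)
Lemma powR_decr (a x : R) : 0 < a -> 0 < x ->
 a * (x + 1) `^ (- a - 1) <= x `^ (- a) - (x + 1) `^ (- a).
Proof.
move=> a0 x0.
have [|||c] := @MVT_segment R (fun t => t `^ (- a)) (fun t => - a * t `^ (- a - 1)) x (x + 1).
- by rewrite lerDl.
- by move=> t; rewrite in_itv => /andP[xt _]; apply: is_derive1_powR; apply: lt_trans xt.
- apply: derivable_within_continuous => t; rewrite in_itv /= => /andP[xt _].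
 by have [] := is_derive1_powR (- a) (lt_le_trans x0 xt).
rewrite in_itv /= => /andP[xc cx] e.
have -> : x `^ (- a) - (x + 1) `^ (- a) = a * c `^ (- a - 1) by rewrite -opprB e addrAC subrr add0r mulr1 mulNr opprK.
rewrite ler_pM2l // -opprD !powRN lef_pV2 ?posrE ?powR_gt0; try (clear -x0 xc; lra).
by rewrite ge0_ler_powR ?nnegrE; lra.
Qed.

Lemma sum_powRN_tail (a : R) (M N : nat) : 0 < a -> (0 < M)%N ->
 \sum_(M <= n < N) (n.+1%:R : R) `^ (- a - 1) <= M%:R `^ (- a) / a.
Proof.
move=> a0 M0; have [NM|MN] := leqP N M.
 by rewrite big_geq /1/ divr_ge0 ltW.
via ((M%:R `^ (- a) - N%:R `^ (- a)) / a); last first.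
 by rewrite ler_pM2r /1/ gerBl powR_ge0.
rewrite ler_pdivlMr // mulr_suml.
rewrite [leRHS](_ : _ = \sum_(M <= k < N) (k%:R `^ (- a) - k.+1%:R `^ (- a))); last first.
 rewrite -[LHS]opprB -(telescope_sumr (fun n : nat => n%:R `^ (- a)) (ltnW MN)) -sumrN.
 by apply: eq_bigr => n _; rewrite opprB.
rewrite !big_seq; apply: ler_sum => n; rewrite mem_index_iota => /andP[hn _].
by rewrite mulrC -natr1 powR_decr // ltr0n (leq_trans M0).
Qed.

Lemma lnS_ge (n : nat) : (0 < n)%N -> (n.+1%:R : R)^-1 <= ln ((n.+1%:R : R) / n%:R).
Proof.
move=> n0; have n0' : 0 < (n%:R : R) by sign.
have -> : (n.+1%:R : R) / n%:R = (n%:R / n.+1%:R)^-1 by rewrite invf_div.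
rewrite lnV /1/ lerNr.
have e2 : (n%:R / n.+1%:R : R) = 1 + (- n.+1%:R^-1) by rewrite -natr1; field; rewrite natr1 pnatr_eq0.
by rewrite e2; apply: le_ln1Dx; rewrite ltrN2 invf_lt1 // ltr1n ltnS.
Qed.

Lemma lnS_bounds (n : nat) : (0 < n)%N ->
 [/\ 0 <= ln ((n.+1%:R : R) / n%:R), ln ((n.+1%:R : R) / n%:R) <= n%:R^-1 &
   `|n%:R^-1 - ln ((n.+1%:R : R) / n%:R)| <= n%:R^-1 ^+ 2].
Proof.
move=> n0; have n0' : 0 < (n%:R : R) by sign.
have e1 : (n.+1%:R : R) / n%:R = 1 + n%:R^-1 by rewrite -natr1 mulrDl divff /1/ mul1r.
have iv : 0 < (n%:R : R)^-1 by sign.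
have h1 : ln ((n.+1%:R : R) / n%:R) <= n%:R^-1 by rewrite e1; apply: le_ln1Dx; lra.
have h0 : 0 <= ln ((n.+1%:R : R) / n%:R) by rewrite e1 ln_ge0 // lerDl ltW.
have h2 := lnS_ge n0.
split => //; rewrite ger0_norm ?subr_ge0 //.
via (n%:R^-1 - n.+1%:R^-1); first by rewrite lerD2l lerN2.
have -> : (n%:R^-1 - n.+1%:R^-1 : R) = n%:R^-1 * n.+1%:R^-1 by rewrite -natr1; field; rewrite natr1 !pnatr_eq0; lia.
by rewrite expr2 ler_pM2l /1/ lef_pV2 /1/ ler_nat.
Qed.

(** A fourth root, because the square of the left side must still be absorbed by x^(1/2), which
    leaves a convergent sum of n^(-3/2). *)
Lemma ln_le_root4 (x : R) : 1 <= x -> (1 + ln x) <= 4 * x `^ (4^-1).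
Proof.
move=> x1; have x0 : 0 < x by lra.
have -> : ln x = 4 * ln (x `^ (4^-1)) by rewrite ln_powR mulrA divff ?mul1r.
have : ln (x `^ (4^-1)) <= x `^ (4^-1) - 1.
 have := @le_ln1Dx R (x `^ 4^-1 - 1); rewrite addrCA subrr addr0; apply.
 by have := powR_gt0 (4^-1) x0; lra.
lra.
Qed.

(* Uniform in M, since 1 + ln n <= (1 + ln M) (1 + ln (n/M)). *)
Lemma sum_log_tail (k M N : nat) : (k <= 2)%N -> (0 < M)%N ->
 \sum_(M <= n < N) (1 + ln (n%:R : R)) ^+ k / n%:R ^+ 2 <= 48 * (1 + ln M%:R) ^+ k / M%:R.
Proof.
move=> k2 M0; have M0' : 0 < (M%:R : R) by sign.
have lM : 0 <= ln (M%:R : R) by sign.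
have term n : (M <= n)%N -> (1 + ln (n%:R : R)) ^+ k / n%:R ^+ 2 <=
  16 * (1 + ln M%:R) ^+ k * M%:R `^ (- 2^-1) * n%:R `^ (- 2^-1 - 1).
 move=> Mn; have n0 : 0 < (n%:R : R) by rewrite ltr0n (leq_trans M0).
 have r1 : 1 <= (n%:R / M%:R : R) by rewrite ler_pdivlMr // mul1r ler_nat.
 have lr : 0 <= ln (n%:R / M%:R : R) by rewrite ln_ge0.
 have step1 : (1 + ln (n%:R : R)) <= (1 + ln M%:R) * (1 + ln (n%:R / M%:R)).
  have -> : ln (n%:R : R) = ln M%:R + ln (n%:R / M%:R) by rewrite -lnM /1/ mulrC divfK /1/ gt_eqF.
  nra.
 have step2 : (1 + ln (n%:R / M%:R : R)) ^+ k <= 16 * (n%:R / M%:R) `^ (2^-1).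
  have b1 := ln_le_root4 r1.
  have b2 : (1 + ln (n%:R / M%:R : R)) ^+ k <= (4 * (n%:R / M%:R) `^ (4^-1)) ^+ 2.
   have c1 : 1 <= 4 * (n%:R / M%:R : R) `^ (4^-1) by lra.
   apply: le_trans (_ : _ <= (4 * (n%:R / M%:R : R) `^ (4^-1)) ^+ k) _.
    by apply: lerXn2r => //; rewrite nnegrE; clear -lr b1; lra.
   by apply: ler_weXn2l.
  apply: le_trans b2 _; rewrite exprMn -(powR_mulrn 2 (powR_ge0 _ _)) -powRrM.
  rewrite (_ : 4^-1 * 2%:R = 2^-1 :> R); last by lra.
  rewrite (_ : 4 ^+ 2 = 16 :> R); clear; lra.
 have pn (a : R) : n%:R `^ a != 0 by sign.
 have -> : n%:R `^ (- 2^-1 - 1) = n%:R `^ (2^-1) / (n%:R ^+ 2) :> R.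
  rewrite -powR_mulrn /1/ -powRN -powRD; last by apply/implyP => _; rewrite gt_eqF.
  by congr (_ `^ _); lra.
 rewrite !mulrA ler_pM2r /1/.
 via (((1 + ln M%:R) * (1 + ln (n%:R / M%:R))) ^+ k).
  by apply: lerXn2r => /1/; rewrite nnegrE.
 rewrite exprMn (mulrC 16) -!mulrA ler_wpM2l /1/.
 apply: le_trans step2 _; rewrite powRM /1/.
 by rewrite -(powR_inv1 (ltW M0')) -powRrM mulN1r (mulrC (n%:R `^ _)).
have [NM|MN] := leqP N M.
 by rewrite big_geq // !mulr_ge0 ?invr_ge0 ?exprn_ge0 ?addr_ge0.
rewrite big_ltn //.
(* 48 = 16 + 32: the term n = M, and 16 times the factor 2 from the tail of n^(-3/2). *)
have first : (1 + ln (M%:R : R)) ^+ k / M%:R ^+ 2 <= 16 * (1 + ln M%:R) ^+ k / M%:R.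
 have M1 : 1 <= (M%:R : R) by rewrite ler1n.
 rewrite expr2 invfM mulrA ler_pM2r /1/ mulrC.
 rewrite ler_wpM2r /1/ (le_trans (y := 1)) ?invf_le1; clear -M1; lra.
have rest : \sum_(M.+1 <= n < N) (1 + ln (n%:R : R)) ^+ k / n%:R ^+ 2 <=
  32 * (1 + ln M%:R) ^+ k / M%:R.
 via (\sum_(M.+1 <= n < N) 16 * (1 + ln M%:R) ^+ k * M%:R `^ (- 2^-1) * n%:R `^ (- 2^-1 - 1)).
  rewrite !big_seq; apply: ler_sum => n; rewrite mem_index_iota => /andP[hn _].
  by apply: term; apply: ltnW.
 rewrite -mulr_sumr big_add1.
 apply: le_trans (ler_wpM2l _ (sum_powRN_tail N.-1 _ M0)) _.
 - by sign.
 - by sign.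
 rewrite invrK -!mulrA [X in _ * X](_ : _ = (1 + ln M%:R) ^+ k * (2 / M%:R)); first by lra.
 congr (_ * _); rewrite mulrA -powRD; last by apply/implyP => _; rewrite gt_eqF.
 by rewrite mulrC (_ : - 2^-1 - 2^-1 = -1 :> R) ?powR_inv1; clear -M0'; lra.
lra.
Qed.
End PowerSums.

(** Both identities are stated over an arbitrary field, where [field] meets only atoms, and are
    instantiated at complex exponentials. *)
Lemma telescope_alg1 (F : fieldType) (e E L v w z : F) : z != 0 ->
 L * v * e - (e * (L / z + z^-1 ^+ 2) - e * E * ((L + w / z) / z + z^-1 ^+ 2)) =
 e * (L * (v - (1 - E) / z) - (1 - E - w * E) / z ^+ 2).
Proof. by move=> z0; field. Qed.
Lemma telescope_alg2 (F : fieldType) (e E L v w z : F) : z != 0 ->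
 L ^+ 2 * v * e - (e * (L ^+ 2 / z + 2 * L / z ^+ 2 + 2 / z ^+ 3) -
   e * E * ((L + w / z) ^+ 2 / z + 2 * (L + w / z) / z ^+ 2 + 2 / z ^+ 3)) =
 e * (L ^+ 2 * (v - (1 - E) / z) - 2 * L * ((1 - E - w * E) / z ^+ 2)
   - (2 - 2 * E - 2 * w * E - w ^+ 2 * E) / z ^+ 3).
Proof. by move=> z0; field. Qed.

(** * Dirichlet series of zeta(1 + z) and its first two derivatives *)

Section ZetaSeries.
Variable R : realType.
Implicit Types (z : R[i]) (n k : nat).

(* [ez z n] is n^{-z}; the k-th term below is (log n)^k n^{-1-z}, with value 0 at n = 0. *)
Definition ez z n : R[i] := cexp (- ((ln (n%:R : R))%:c * z)).
Definition zterm k z n : R[i] := (ln (n%:R : R) ^+ k / n%:R)%:c * ez z n.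

Lemma cabs_ez z n : 0 <= Re z -> cabs (ez z n) <= 1.
Proof.
move=> z0; rewrite cabs_cexp ReN Re_realM expR_le1 oppr_le0 mulr_ge0 //.
exact: ln_natr_ge0.
Qed.

Lemma ez_mul z m n : (0 < m)%N -> (0 < n)%N -> ez z (m * n) = ez z m * ez z n.
Proof.
move=> m0 n0; rewrite /ez -cexpD natrM lnM /1/.
by rewrite realcD mulrDl opprD.
Qed.

Lemma ez1 z : ez z 1 = 1.
Proof. by rewrite /ez ln1 mul0r oppr0 cexp0. Qed.
Lemma zterm0 k z : zterm k z 0 = 0.
Proof. by rewrite /zterm invr0 mulr0 mul0r. Qed.
Lemma ezS z n : (0 < n)%N ->
 ez z n.+1 = ez z n * cexp (- ((ln (n.+1%:R / n%:R : R))%:c * z)).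
Proof.
move=> n0; rewrite /ez -cexpD; congr cexp.
rewrite lnM /1/ lnV /1/.
by rewrite realcD realcN; ring.
Qed.

(** The integral of (log x)^k x^(-1-z) over [n, +oo) in closed form, for k = 0, 1, 2. *)
Definition ztail k z n : R[i] :=
 let L := (ln (n%:R : R))%:c in
 ez z n * (if k is 0 then z^-1 else if k is 1 then L / z + z^-1 ^+ 2
      else L ^+ 2 / z + 2 * L / z ^+ 2 + 2 / z ^+ 3).

(** First-order Euler-Maclaurin: each term is compared with the integral over [n, n + 1]. The bound
    depends on z only through |z|, so it survives when Re z tends to 0. *)
Lemma zterm_telescope k z n : (k <= 2)%N -> 0 <= Re z -> z != 0 -> (0 < n)%N ->
 cabs (zterm k z n - (ztail k z n - ztail k z n.+1)) <=
 (1 + cabs z) * ((1 + ln (n%:R : R)) ^+ k / n%:R ^+ 2).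
Proof.
move=> k2 rz z0 n0.
have [l0 l1 l2] := lnS_bounds R n0; set l := ln _ in l0 l1 l2.
have L0 : 0 <= ln (n%:R : R) by sign.
have ni : 0 < (n%:R : R)^-1 by sign.
have lS : ln n.+1%:R = ln n%:R + l by rewrite /l -lnM /1/ mulrC divfK /1/ pnatr_eq0 -lt0n.
set w := (l%:c * z).
have rw : 0 <= Re w by rewrite Re_realM mulr_ge0.
have cw : cabs w = l * cabs z by rewrite cabsM cabs_real ger0_norm.
have cz : 0 < cabs z by rewrite cabs_gt0.
set E := cexp (- w).
have lz : l%:c = w / z by rewrite /w mulfK.
have ez1' : ez z n.+1 = ez z n * E by rewrite ezS.
have l22 : l ^+ 2 <= n%:R^-1 ^+ 2 by apply: lerXn2r; rewrite /1/ ltW.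
have l33 : l ^+ 3 <= n%:R^-1 ^+ 2.
 rewrite exprS; via (1 * l ^+ 2); last by rewrite mul1r.
 apply: ler_wpM2r; rewrite /1/; apply: le_trans l1 _.
 by rewrite invf_le1 /1/ ler1n.
(* Apart from the factor n^-z, the error is a combination of these three quantities with
   coefficients in L = log n; each is an exponential remainder in w divided by a power of z. *)
have A1 : cabs ((n%:R^-1)%:c - (1 - E) / z) <= (1 + cabs z) * n%:R^-1 ^+ 2.
 have -> : (n%:R^-1)%:c - (1 - E) / z = ((n%:R^-1 - l))%:c + (E - 1 + w) / z by rewrite realcD realcN lz; ring.
 triD; rewrite cabs_real cabsM cabsV.
 have := expN_rem2 rw; rewrite cw => h.
 have : cabs (E - 1 + w) / cabs z <= cabs z * n%:R^-1 ^+ 2.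
  rewrite ler_pdivrMr //; apply: le_trans h _.
  have : (l * cabs z) ^+ 2 <= n%:R^-1 ^+ 2 * cabs z ^+ 2.
   by rewrite exprMn ler_wpM2r // exprn_ge0 // ltW.
  have := exprn_ge0 2 (ltW ni); have := exprn_ge0 2 (ltW cz); clear; nra.
 clear -l2; lra.
have A2 : cabs ((1 - E - w * E) / z ^+ 2) <= n%:R^-1 ^+ 2 / 2.
 rewrite cabsM cabsV cabsX ler_pdivrMr /1/.
 step (expN_rem3 rw); rewrite cw exprMn.
 have := exprn_ge0 2 (ltW cz); clear -l22; nra.
have A3 : cabs ((2 - 2 * E - 2 * w * E - w ^+ 2 * E) / z ^+ 3) <= n%:R^-1 ^+ 2 / 3.
 rewrite cabsM cabsV cabsX ler_pdivrMr /1/.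
 step (expN_rem4 rw); rewrite cw exprMn.
 have := exprn_ge0 3 (ltW cz); clear -l33; nra.
have eb := cabs_ez n rz.
have q0 := exprn_ge0 2 (ltW ni).
have c0 := cabs_ge0 z.
rewrite -exprVn.
case: k k2 => [|[|[|//]]] _; rewrite /zterm /ztail ez1' ?lS.
- have -> : (ln n%:R ^+ 0 / n%:R)%:c * ez z n - (ez z n / z - ez z n * E / z) =
  ez z n * ((n%:R^-1)%:c - (1 - E) / z) by rewrite expr0 mul1r; ring.
 rewrite cabsM expr0 mul1r; apply: le_trans A1.
 by rewrite ler_piMl /1/.
- set L := (ln _)%:c.
 have -> : (ln n%:R ^+ 1 / n%:R)%:c * ez z n - (ez z n * (L / z + z^-1 ^+ 2) -
   ez z n * E * ((ln n%:R + l)%:c / z + z^-1 ^+ 2)) =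
  ez z n * (L * ((n%:R^-1)%:c - (1 - E) / z) - (1 - E - w * E) / z ^+ 2).
  by rewrite expr1 realcM realcD lz -/L; apply: telescope_alg1.
 rewrite cabsM; via (1 * (ln n%:R * ((1 + cabs z) * n%:R^-1 ^+ 2) + n%:R^-1 ^+ 2 / 2)).
  apply: ler_pM; rewrite /1/; triB.
  apply: lerD => //; rewrite cabsM cabs_real ger0_norm //.
  by apply: ler_wpM2l.
 rewrite expr1; clear -c0; nra.
- set L := (ln _)%:c.
 have -> : (ln n%:R ^+ 2 / n%:R)%:c * ez z n -
   (ez z n * (L ^+ 2 / z + 2 * L / z ^+ 2 + 2 / z ^+ 3) -
   ez z n * E * ((ln n%:R + l)%:c ^+ 2 / z + 2 * (ln n%:R + l)%:c / z ^+ 2 + 2 / z ^+ 3)) =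
  ez z n * (L ^+ 2 * ((n%:R^-1)%:c - (1 - E) / z) - 2 * L * ((1 - E - w * E) / z ^+ 2)
   - (2 - 2 * E - 2 * w * E - w ^+ 2 * E) / z ^+ 3).
  by rewrite realcM rmorphXn realcD lz -/L; apply: telescope_alg2.
 rewrite cabsM; via (1 * (ln n%:R ^+ 2 * ((1 + cabs z) * n%:R^-1 ^+ 2) +
  2 * ln n%:R * (n%:R^-1 ^+ 2 / 2) + n%:R^-1 ^+ 2 / 3)).
  apply: ler_pM; rewrite /1/; triB.
  apply: lerD => //; triB.
  apply: lerD; first by rewrite cabsM cabsX cabs_real ger0_norm // ler_wpM2l // exprn_ge0.
  rewrite cabsM [cabs (2 * L)]cabsM cabs_real ger0_norm //.
  rewrite (_ : cabs 2 = 2); last by rewrite -[2]/((2%:R)) -(rmorph_nat (real_complex R)) cabs_real ger0_norm.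
  by rewrite ler_wpM2l // mulr_ge0.
 set x := ln _ in L0 *; set y := _ ^+ 2 in q0 *; set c := cabs z in c0 *.
 have : 0 <= x * y by sign.
 have : 0 <= x * y * c by sign.
 have : 0 <= y * c by sign.
 rewrite mul1r; set e := x ^+ 2 * _.
 have -> : (1 + c) * ((1 + x) ^+ 2 * y) = e + (2 * (x * y) + 2 * (x * y * c) + y + y * c) by rewrite /e; ring.
 have -> : 2 * x * (y / 2) = x * y by field.
 clear -q0; lra.
Qed.

Lemma sum_ztail k z (M N : nat) : (M <= N)%N ->
 \sum_(M <= n < N) (ztail k z n - ztail k z n.+1) = ztail k z M - ztail k z N.
Proof.
move=> MN; rewrite -[RHS]opprB -(telescope_sumr _ MN) -sumrN.
by apply: eq_bigr => n _; rewrite opprB.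
Qed.

Lemma sum_zterm_ztail k z (M N : nat) : (k <= 2)%N -> 0 <= Re z -> z != 0 ->
 (0 < M)%N -> (M <= N)%N ->
 cabs (\sum_(M <= n < N) zterm k z n - (ztail k z M - ztail k z N)) <=
 (1 + cabs z) * (48 * (1 + ln (M%:R : R)) ^+ k / M%:R).
Proof.
move=> k2 rz z0 M0 MN; rewrite -sum_ztail // -sumrB.
triS.
via (\sum_(M <= n < N) (1 + cabs z) * ((1 + ln n%:R) ^+ k / n%:R ^+ 2)).
 rewrite !big_seq; apply: ler_sum => n; rewrite mem_index_iota => /andP[hn _].
 by apply: zterm_telescope => //; apply: leq_trans hn.
rewrite -mulr_sumr ler_wpM2l /1/.
exact: sum_log_tail.
Qed.

Lemma cabs_zterm k z n : cabs (zterm k z n) =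
 ln (n%:R : R) ^+ k / n%:R * expR (- (ln n%:R * Re z)).
Proof.
rewrite cabsM cabs_real cabs_cexp ReN Re_realM ger0_norm //.
by case: n => [|n]; rewrite ?invr0 ?mulr0 // divr_ge0 // exprn_ge0 // ln_ge0 // ler1n.
Qed.

(** In absolute value z becomes its real part a. There the terms are nonnegative, and the telescoped
    sum is bounded since the tail at its upper end is nonnegative. *)
Lemma zterm_summable k z : (k <= 2)%N -> 0 < Re z -> abs_summable (zterm k z).
Proof.
move=> k2 rz; set a := Re z in rz.
have az : a%:c != 0 by apply/eqP => -[] /eqP; rewrite gt_eqF.
have ra : 0 <= Re (a%:c) by sign.
set B := (1 + cabs (a%:c)) * (48 * (1 + ln (1%:R : R)) ^+ k / 1%:R) + cabs (ztail k a%:c 1).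
have Tpos n : zterm k a%:c n = (cabs (zterm k z n))%:c.
 rewrite cabs_zterm -/a /zterm /ez; rewrite [RHS]realcM; congr (_ * _).
 by rewrite -realcM -realcN cexp_real.
have tl n : (0 < n)%N -> 0 <= Re (ztail k a%:c n).
 move=> n0; have L0 : 0 <= ln (n%:R : R) by sign.
 have e : ez a%:c n = (expR (- (ln n%:R * a)))%:c by rewrite /ez -realcM -realcN cexp_real.
 have i1 : (a%:c)^-1 = (a^-1%:C)%C by rewrite rmorphV // unitfE gt_eqF.
 rewrite /ztail e Re_realM mulr_ge0 /1/.
 have two : (2 : R[i]) = 2%:c by rewrite rmorph_nat.
 case: k k2 {B Tpos} => [|[|[|//]]] _.
 - by rewrite i1 invr_ge0 ltW.
 - by rewrite i1 -realcM -rmorphXn -realcD addr_ge0 /1/ ltW.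
 - rewrite two -!exprVn i1 -!rmorphXn -!realcM -!realcD /=.
  by sign.
exists B => N; case: N => [|N].
 by rewrite big_ord0 addr_ge0 /1/ mulr_ge0 ln1 addr0 expr1n; lra.
rewrite -(big_mkord xpredT (fun n => cabs (zterm k z n))) big_ltn // zterm0 cabs0 add0r.
have := @sum_zterm_ztail k _ 1 N.+1 k2 ra az isT isT.
rewrite (eq_bigr (fun n => (cabs (zterm k z n))%:c)); last by move=> n _.
rewrite -realc_sum => h.
have := le_trans (ler_norm _) (le_trans (ler_Re_cabs _) h).
rewrite ReD ReN Re_real ReD ReN.
have := tl N.+1 isT; have := le_trans (ler_norm _) (ler_Re_cabs (ztail k a%:c 1)).
rewrite /B; lra.
Qed.
End ZetaSeries.

(** * Upper bounds for zeta and its derivatives to the right of Re s = 1 *)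

Section ZetaBounds.
Variable R : realType.
Implicit Types (z : R[i]) (n k : nat).

Lemma exists_nat_gt (x : R) : exists n : nat, x < n%:R.
Proof.
by exists (Num.bound `|x|); apply: le_lt_trans (ler_norm _) (archi_boundP (normr_ge0 x)).
Qed.

Lemma ln_unbounded (K : R) : exists N0 : nat, (0 < N0)%N /\
 forall N, (N0 <= N)%N -> K <= ln (N%:R : R).
Proof.
have [n hn] := exists_nat_gt (expR K).
exists n; have n0 : (0 < n)%N by rewrite -(ltr_nat R) (lt_trans (expR_gt0 K)).
split => /1/ N nN; rewrite -(expRK K) ler_ln ?posrE ?ltr0n ?(leq_trans n0) /1/.
by apply: ltW; apply: lt_le_trans hn _; rewrite ler_nat.
Qed.

(** The fourth power of c (1 + x) <= exp(x a/4) has powers of 1 + x to spare; with x = log N, N^-a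
    (log N)^2 therefore tends to 0. *)
Lemma exp_decay (a x : R) : 0 < a -> 0 <= x ->
 expR (- (x * a)) * (1 + x) ^+ 2 <= (Num.min 1 (a / 4)) ^- 4 / (1 + x).
Proof.
move=> a0 x0; set c := Num.min _ _.
have c0 : 0 < c by rewrite lt_min ltr01; lra.
have c1 : c <= 1 by rewrite ge_min lexx.
have c2 : c <= a / 4 by rewrite ge_min lexx orbT.
have h1 : c * (1 + x) <= expR (x * a / 4).
 apply: le_trans (expR_ge1Dx _); nra.
have h2 : (c * (1 + x)) ^+ 4 <= expR (x * a).
 have -> : expR (x * a) = expR (x * a / 4) ^+ 4 by rewrite -expRM_natl; congr expR; field.
 by apply: lerXn2r; rewrite /1/ nnegrE mulr_ge0; lra.
rewrite expRN ler_pdivlMr /1/ -mulrA -exprSr mulrC ler_pdivrMr /1/.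
rewrite mulrC ler_pdivlMr /1/; apply: le_trans h2.
rewrite exprMn mulrC ler_wpM2l /1/.
by rewrite ler_weXn2l //; lra.
Qed.

Lemma cabs_natr n : cabs (n%:R : R[i]) = n%:R.
Proof. by rewrite -(rmorph_nat (real_complex R)) cabs_real ger0_norm. Qed.
Lemma cabs_ztail k z n : (k <= 2)%N -> (0 < n)%N -> z != 0 -> cabs (ztail k z n) <=
 cabs (ez z n) * ((1 + ln (n%:R : R)) ^+ k * ((cabs z)^-1 + 2 * (cabs z)^-1 ^+ 2 + 2 * (cabs z)^-1 ^+ 3)).
Proof.
move=> k2 n0 z0; rewrite cabsM ler_wpM2l /1/.
have L0 := ln_natr_ge0 R n; set L := ln _ in L0 *.
have c0 : 0 <= (cabs z)^-1 by sign.
have cL : cabs (L%:c) = L by rewrite cabs_real ger0_norm.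
have q0 := exprn_ge0 2 c0; have t0 := exprn_ge0 3 c0.
case: k k2 => [|[|[|//]]] _.
- by rewrite expr0 mul1r cabsV; lra.
- triD; rewrite cabsM cabsX cabsV cL expr1.
 have := mulr_ge0 L0 q0; have := mulr_ge0 L0 t0; nra.
- triD; apply: le_trans (lerD (ler_cabsD _ _) (lexx _)) _.
 rewrite !(cabsM _ (_ ^-1)) !cabsV [cabs (2 * _)]cabsM cabsX cL.
 rewrite !(cabsX z) (cabs_natr 2) -!exprVn.
 have h1 := mulr_ge0 L0 q0; have h2 := mulr_ge0 L0 t0; have h3 := mulr_ge0 L0 c0.
 have h4 := mulr_ge0 L0 h1; have h5 := mulr_ge0 L0 h2.
 set p := (cabs z)^-1 in c0 q0 t0 h1 h2 h3 h4 h5 *.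
 have -> : (1 + L) ^+ 2 * (p + 2 * p ^+ 2 + 2 * p ^+ 3) =
  (L ^+ 2 * p + 2 * L * p ^+ 2 + 2 * p ^+ 3) + (p + 2 * p ^+ 2 + 2 * (L * p) +
  2 * (L * p ^+ 2) + 4 * (L * p ^+ 3) + 2 * (L * (L * p ^+ 2)) + 2 * (L * (L * p ^+ 3))) by ring.
 by rewrite lerDl; lra.
Qed.

Lemma ztail_small k z (e : R) : (k <= 2)%N -> 0 < Re z -> 0 < e ->
 exists N0 : nat, forall N, (N0 <= N)%N -> cabs (ztail k z N) < e.
Proof.
move=> k2 rz e0.
have z0 : z != 0 by apply/eqP => h; rewrite h ltxx in rz.
set P := (cabs z)^-1 + 2 * (cabs z)^-1 ^+ 2 + 2 * (cabs z)^-1 ^+ 3.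
have P0 : 0 <= P by sign.
set D := (Num.min 1 (Re z / 4)) ^- 4.
have [N0 [N00 h]] := ln_unbounded (D * P / e).
exists N0 => N /[dup] hN /h hh.
have Np : (0 < N)%N by apply: leq_trans hN.
have L0 := ln_natr_ge0 R N.
apply: le_lt_trans (cabs_ztail k2 Np z0) _; rewrite -/P mulrA.
have h1 : cabs (ez z N) * (1 + ln N%:R) ^+ k <= D / (1 + ln N%:R).
 apply: le_trans (exp_decay rz L0); rewrite cabs_cexp ReN Re_realM.
 rewrite ler_wpM2l /1/ ler_weXn2l /1/; lra.
apply: le_lt_trans (ler_wpM2r P0 h1) _.
rewrite mulrAC ltr_pdivrMr; last by lra.
move: hh; rewrite ler_pdivrMr; nra.
Qed.

(** Z is (-1)^k times the k-th derivative of zeta at 1 + z. The error is uniform as Re z tends to 0;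
    this does the work of analytic continuation up to the line Re s = 1. *)
Lemma zeta_exists k z : (k <= 2)%N -> 0 < Re z ->
 exists Z, cser (zterm k z) Z /\ forall M, (0 < M)%N ->
  cabs (Z - (\sum_(n < M) zterm k z n + ztail k z M)) <=
  (1 + cabs z) * (48 * (1 + ln (M%:R : R)) ^+ k / M%:R).
Proof.
move=> k2 rz.
have z0 : z != 0 by apply/eqP => h; rewrite h ltxx in rz.
have [Z hZ] := abs_summable_cser (zterm_summable k2 rz).
exists Z; split => // M M0; apply/ler_addgt0Pr => e e0.
have e2 : 0 < e / 2 by lra.
have [N1 h1] := ztail_small k2 rz e2; have [N2 h2] := hZ _ e2.
set N := maxn (maxn N1 N2) M.
have [n1 n2 n3] : [/\ (N1 <= N)%N, (N2 <= N)%N & (M <= N)%N] by rewrite /N; split; lia.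
have eN : \sum_(n < N) zterm k z n = \sum_(n < M) zterm k z n + \sum_(M <= n < N) zterm k z n.
 by rewrite -!(big_mkord xpredT (zterm k z)) (big_cat_nat (n := M)).
have := @sum_zterm_ztail R k z M N k2 (ltW rz) z0 M0 n3.
have := h1 _ n1; have := h2 _ n2; rewrite eN.
set A := \sum_(n < M) _; set S := \sum_(M <= n < N) _ => b1 b2 b3.
have -> : Z - (A + ztail k z M) = (S - (ztail k z M - ztail k z N)) - (A + S - Z) - ztail k z N by ring.
triB; apply: le_trans (lerD (ler_cabsB _ _) (lexx _)) _; lra.
Qed.

Lemma harmonic_le (M : nat) : (0 < M)%N -> \sum_(n < M) (n%:R : R)^-1 <= 1 + ln M%:R.
Proof.
case: M => // M _; rewrite big_ord_recl invr0 add0r.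
suff h : forall K : nat, \sum_(i < K.+1) (i.+1%:R : R)^-1 <= 1 + ln (K.+1%:R).
 case: M => [|M]; first by rewrite big_ord0 ln1 addr0.
 step (h M); rewrite lerD2l ler_ln /1/ ler_nat; lia.
elim=> [|K IK]; first by rewrite big_ord_recl big_ord0 addr0 invr1 ln1 addr0.
rewrite big_ord_recr /=; have := lnS_ge R (ltn0Sn K).
have -> : ln (K.+2%:R / K.+1%:R : R) = ln K.+2%:R - ln K.+1%:R by rewrite ln_div /1/.
by set x := (K.+2%:R)^-1; set y := ln K.+2%:R; set w := ln K.+1%:R in IK * => h; move: (\sum_(i < _) _) IK => v IK; lra.
Qed.

Definition Xlog z : R := 1 + ln (2 + cabs z).

Lemma Xlog_ge1 z : 1 <= Xlog z.
Proof. by rewrite lerDl ln_ge0; have := cabs_ge0 z; lra. Qed.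
Lemma sum_zterm_le k z (M : nat) : 0 <= Re z -> (0 < M)%N ->
 cabs (\sum_(n < M) zterm k z n) <= (1 + ln (M%:R : R)) ^+ k.+1.
Proof.
move=> rz M0; triS.
have lM := ln_natr_ge0 R M.
via (\sum_(n < M) (1 + ln M%:R) ^+ k * (n%:R)^-1).
 apply: ler_sum => n _; rewrite cabs_zterm -[leRHS]mulr1.
 have ln0 := ln_natr_ge0 R n.
 apply: ler_pM; rewrite /1/; last first.
  by rewrite expR_le1 oppr_le0 mulr_ge0.
 rewrite ler_wpM2r //; apply: lerXn2r; rewrite ?nnegrE //; first by lra.
 case: n {ln0} => -[|n] hn /=; first by rewrite ln0; lra.
 via (ln M%:R); last by lra.
 by rewrite ler_ln /1/ ler_nat ltnW.
rewrite -mulr_sumr exprSr ler_wpM2l ?harmonic_le /1/; lra.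
Qed.

Lemma nat_near z : exists M : nat, [/\ (0 < M)%N, 1 + cabs z <= M%:R & M%:R <= 2 + cabs z].
Proof.
have c0 := cabs_ge0 z.
exists (Num.trunc (cabs z)).+2; have /andP[h1 h2] := truncn_itv c0; split => //.
 by rewrite -natr1; move: h2; lra.
by rewrite -!natr1; move: h1; lra.
Qed.

(** Cutting the series at M between 1 + |z| and 2 + |z| makes the truncation error O((1 + log M)^k),
    below the bound (1 + log M)^(k+1) for the partial sum. *)
Lemma zeta_far (rho : R) : 0 < rho -> exists C : R, 0 < C /\
 forall k z Z, (k <= 2)%N -> 0 < Re z -> rho <= cabs z -> cser (zterm k z) Z ->
 cabs Z <= C * Xlog z ^+ k.+1.
Proof.
move=> r0; set P := rho^-1 + 2 * rho^-1 ^+ 2 + 2 * rho^-1 ^+ 3.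
have P0 : 0 <= P by sign.
exists (49 + P); split; first by lra.
move=> k z Z k2 rz hz hZ.
have [Z' [hZ' hM]] := zeta_exists k2 rz; rewrite (cser_uniq hZ hZ') {Z hZ}.
have [M [M0 M1 M2]] := nat_near z; have := hM M M0.
have c0 := cabs_ge0 z; have lM := ln_natr_ge0 R M.
have z0 : z != 0 by apply/eqP => h; rewrite h ltxx in rz.
have LX : 1 + ln M%:R <= Xlog z by rewrite lerD2l ler_ln /1/; lra.
have X1 := Xlog_ge1 z.
have b1 : (1 + cabs z) * (48 * (1 + ln M%:R) ^+ k / M%:R) <= 48 * Xlog z ^+ k.+1.
 via (48 * (1 + ln M%:R) ^+ k).
  rewrite mulrA ler_pdivrMr /1/ mulrC ler_wpM2l /1/ mulr_ge0 exprn_ge0; lra.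
 rewrite ler_wpM2l // (@le_trans _ _ (Xlog z ^+ k)) //.
  by apply: lerXn2r; rewrite ?nnegrE; clear -lM LX; lra.
 by rewrite ler_weXn2l.
have b2 : cabs (\sum_(n < M) zterm k z n) <= Xlog z ^+ k.+1.
 step (sum_zterm_le k (ltW rz) M0).
 by apply: lerXn2r; rewrite ?nnegrE; clear -lM LX; lra.
have b3 : cabs (ztail k z M) <= P * Xlog z ^+ k.+1.
 step (cabs_ztail k2 M0 z0).
 have ci : (cabs z)^-1 <= rho^-1 by rewrite lef_pV2 ?posrE; clear -r0 hz; lra.
 have ci0 : 0 <= (cabs z)^-1 by sign.
 have PP : (cabs z)^-1 + 2 * (cabs z)^-1 ^+ 2 + 2 * (cabs z)^-1 ^+ 3 <= P.
  have : (cabs z)^-1 ^+ 2 <= rho^-1 ^+ 2 by apply: lerXn2r; rewrite ?nnegrE; clear -ci ci0; lra.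
  have : (cabs z)^-1 ^+ 3 <= rho^-1 ^+ 3 by apply: lerXn2r; rewrite ?nnegrE; clear -ci ci0; lra.
  rewrite /P; clear -ci; lra.
 have PP0 : 0 <= (cabs z)^-1 + 2 * (cabs z)^-1 ^+ 2 + 2 * (cabs z)^-1 ^+ 3 by sign.
 via (1 * (Xlog z ^+ k.+1 * P)); last by rewrite mul1r mulrC.
 apply: ler_pM; rewrite ?cabs_ge0 ?mulr_ge0 ?exprn_ge0 ?(cabs_ez _ (ltW rz)) //; first by (clear -lM; lra).
 apply: ler_pM; rewrite ?exprn_ge0 //; first by (clear -lM; lra).
 rewrite (@le_trans _ _ (Xlog z ^+ k)) //; last by rewrite ler_weXn2l.
 by apply: lerXn2r; rewrite ?nnegrE; clear -lM LX; lra.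
set A := \sum_(n < M) _ in b2 *; move=> b4.
have -> : Z' = (Z' - (A + ztail k z M)) + A + ztail k z M by ring.
triD; apply: le_trans (lerD (ler_cabsD _ _) (lexx _)) _; lra.
Qed.

(** Take M = 1: the partial sum is empty, the tail integral is exactly the polar part k!/z^(k+1),
    and the error is 48 (1 + |z|) <= 96. *)
Lemma zeta_near k z Z : (k <= 2)%N -> 0 < Re z -> cabs z <= 1 -> cser (zterm k z) Z ->
 cabs (Z - k`!%:R / z ^+ k.+1) <= 96.
Proof.
move=> k2 rz z1 hZ.
have [Z' [hZ' hM]] := zeta_exists k2 rz; rewrite (cser_uniq hZ hZ') {Z hZ}.
have e0 : \sum_(n < 1) zterm k z n = 0 by rewrite big_ord_recl big_ord0 addr0 zterm0.
have := hM 1%N isT; rewrite e0 add0r ln1 addr0 expr1n mulr1 divr1.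
have -> : ztail k z 1 = k`!%:R / z ^+ k.+1.
 rewrite /ztail ez1 mul1r ln1; case: k k2 {hZ' hM e0} => [|[|[|//]]] _.
 - by rewrite fact0 mul1r expr1.
 - by rewrite (_ : 1`! = 1%N) // mul0r add0r mul1r exprVn.
 - by rewrite expr0n mulr0 !mul0r !add0r.
move=> h; step h; lra.
Qed.
End ZetaBounds.

(** * Euler product and the 3-4-1 inequality *)

Section Euler.
Variable R : realType.
Implicit Types (z : R[i]) (n k N : nat).

Definition rough N n : bool :=
 (0 < n)%N && ~~ has (fun p => prime p && (p %| n)%N) (iota 0 N).

(** The reciprocal of the finite Euler product of zeta(1 + z): taking reciprocals keeps every factor
    free of inverses. *)
Definition eulerN N z : R[i] := \prod_(p < N | prime p) (1 - zterm 0 z p).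

Lemma zterm0_mul z m n : zterm 0 z (m * n) = zterm 0 z m * zterm 0 z n.
Proof.
have [->|m0] := posnP m; first by rewrite mul0n zterm0 mul0r.
have [->|n0] := posnP n; first by rewrite muln0 zterm0 mulr0.
by rewrite /zterm ez_mul // !expr0 !mul1r natrM invfM realcM; ring.
Qed.

Lemma roughS N n : rough N.+1 n = rough N n && ~~ (prime N && (N %| n)%N).
Proof.
have e : iota 0 N.+1 = rcons (iota 0 N) N by rewrite -[N.+1]addn1 iotaD cats1.
by rewrite /rough e has_rcons negb_or andbA andbAC -andbA andbCA andbA.
Qed.

Lemma rough_mulr N p m : prime p -> (N <= p)%N -> rough N (p * m) = rough N m.
Proof.
move=> pp Np; rewrite /rough muln_gt0 prime_gt0 //=; congr (_ && ~~ _).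
apply: eq_in_has => r; rewrite mem_iota add0n => /andP[_ rN].
case pr : (prime r) => //=; rewrite Euclid_dvdM // (dvdn_prime2 pr pp).
by rewrite (_ : (r == p) = false) //; apply/negbTE; rewrite neq_ltn (leq_trans rN Np).
Qed.

Lemma cser_dilate (f : nat -> R[i]) l (p : nat) : (0 < p)%N -> cser f l ->
 cser (fun n => if (p %| n)%N then f (n %/ p)%N else 0) l.
Proof.
move=> p0 h e e0; have [N0 H] := h _ e0; exists (N0 * p)%N => N hN.
(* (N + p - 1) div p is the ceiling of N/p, the number of multiples of p below N. *)
have -> : \sum_(n < N) (if (p %| n)%N then f (n %/ p)%N else 0) =
  \sum_(m < (N + p.-1) %/ p) f m.
 rewrite -big_mkcond /= -(big_mkord (fun n => (p %| n)%N) (fun n => f (n %/ p)%N)).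
 rewrite -(big_mkord xpredT f).
 elim: N {hN} => [|N IH].
  by rewrite big_geq // add0n divn_small ?big_geq // prednK.
 rewrite big_mkcond big_nat_recr //= -big_mkcond IH.
 case: ifP => [/dvdnP[m ->]|nd].
  rewrite mulnK // (_ : (m * p + p.-1) %/ p = m)%N; last first.
   by rewrite divnMDl // divn_small ?addn0 // prednK.
  rewrite (_ : ((m * p).+1 + p.-1) %/ p = m.+1)%N; last first.
   by rewrite addSnnS prednK // divnMDl // divnn p0 addn1.
  by rewrite big_nat_recr.
 rewrite addr0; congr (\sum_(0 <= m < _) _).
 have -> : (N.+1 + p.-1 = N + p)%N by lia.
 have -> : ((N + p) %/ p = (N %/ p).+1)%N by rewrite divnDr // divnn p0 addn1.
 rewrite {1}(divn_eq N p) -addnA divnMDl // -[in RHS]addn1; congr (_ + _)%N.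
 have -> : (N %% p + p.-1 = p + (N %% p).-1)%N by lia.
 by rewrite divnDl // divnn p0 divn_small ; lia.
apply: H; rewrite leq_divRL; lia.
Qed.

Lemma cser_ext (f g : nat -> R[i]) l : f =1 g -> cser f l -> cser g l.
Proof. by move=> /funext ->. Qed.
(** The sieve of Eratosthenes: multiplying by 1 - p^(-1-z) removes the multiples of p from what has
    survived the smaller primes. *)
Lemma cser_rough z Z N : cser (zterm 0 z) Z ->
 cser (fun n => if rough N n then zterm 0 z n else 0) (Z * eulerN N z).
Proof.
move=> hZ; elim: N => [|N IH].
 rewrite /eulerN big_ord0 mulr1; apply: cser_ext hZ => n.
 by rewrite /rough andbT; case: posnP => [->|//]; rewrite zterm0.
rewrite /eulerN big_mkcond big_ord_recr -big_mkcond /= -/(eulerN N z).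
case pN : (prime N); last first.
 by rewrite mulr1; apply: cser_ext IH => n; rewrite roughS pN andbT.
have N0 := prime_gt0 pN.
rewrite mulrA mulrBr mulr1 (mulrC _ (zterm 0 z N)) -mulNr.
apply: cser_ext (cserD IH (cserZ (- zterm 0 z N) (cser_dilate N0 IH))) => n.
rewrite roughS pN /=; case: (boolP (N %| n)%N) => [/dvdnP[m ->]|nd]; last first.
 by rewrite mulr0 addr0 andbT.
rewrite mulnK // mulnC rough_mulr //= andbF.
by case: ifP => _; rewrite ?mulr0 ?addr0 // zterm0_mul mulNr subrr.
Qed.

Lemma rough_ge N n : rough N n -> (1 < n)%N -> (N <= n)%N.
Proof.
move=> /andP[n0 /hasPn h] n1; rewrite leqNgt; apply/negP => nN.
have pd : pdiv n \in iota 0 N by rewrite mem_iota add0n; apply: leq_ltn_trans nN; apply: dvdn_leq => //; exact: pdiv_dvd.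
by have := h _ pd; rewrite pdiv_prime // pdiv_dvd.
Qed.

Lemma summable_tail (f : nat -> R[i]) : abs_summable f -> forall e : R, 0 < e ->
 exists N0 : nat, forall N M, (N0 <= N)%N -> \sum_(N <= n < M) cabs (f n) < e.
Proof.
move=> [B hB] e e0.
have [|l hl] := @abs_summable_real R (fun n => cabs (f n)) B.
 by move=> N; rewrite (eq_bigr (fun n : 'I_N => cabs (f n))) ?hB // => i _; rewrite ger0_norm ?cabs_ge0.
have e2 : 0 < e / 2 by lra.
have [N0 H] := hl _ e2; exists N0 => N M hN.
have [MN|NM] := leqP M N; first by rewrite big_geq.
have := H _ hN; have := H _ (leq_trans hN (ltnW NM)).
rewrite -!(big_mkord xpredT (fun n => cabs (f n))) [X in `|X - _|](big_cat_nat (n := N)) //=; last exact: ltnW.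
rewrite !ltr_norml; lra.
Qed.

Lemma euler_limit z Z (e : R) : 0 < Re z -> cser (zterm 0 z) Z -> 0 < e ->
 exists N0 : nat, forall N, (N0 <= N)%N -> cabs (Z * eulerN N z - 1) < e.
Proof.
move=> rz hZ e0; have e2 : 0 < e / 2 by lra.
have [N0 H] := summable_tail (zterm_summable (isT : (0 <= 2)%N) rz) e2.
exists (maxn N0 2) => N; rewrite geq_max => /andP[N0N N2].
suff : cabs (Z * eulerN N z - 1) <= e / 2 by lra.
have [M1 HM] := cser_rough N hZ e2.
apply/ler_addgt0Pr => d d0.
have [M2 HM2] := cser_rough N hZ d0.
set M := maxn (maxn M1 M2) N.
have [m2 m3] : (M2 <= M)%N /\ (N <= M)%N by rewrite /M; split; lia.
have := HM2 _ m2; set S := \sum_(n < M) _ => hS.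
have S1 : cabs (S - 1) <= e / 2.
 rewrite /S -(big_mkord xpredT (fun n => if rough N n then zterm 0 z n else 0)).
 rewrite (big_cat_nat (n := N)) //= (big_cat_nat (n := 2)) //=.
 rewrite big_ltn // big_ltn // big_geq // zterm0.
 have -> : rough N 1 = true by rewrite /rough; apply/hasPn => p _; rewrite dvdn1; case: eqP => [->|_]; rewrite ?andbF.
 have -> : zterm 0 z 1 = 1 by rewrite /zterm ez1 expr0 divr1 mulr1.
 rewrite [X in _ + X + _]big1_seq ?addr0; last first.
  move=> n; rewrite mem_index_iota => /andP[_ /andP[h1 h2]]; case: ifP => // h.
  by have := rough_ge h h1; rewrite leqNgt h2.
 have -> : rough N 0 = false by [].
 rewrite add0r addrAC subrr add0r; triS.
 apply: le_trans (ltW (H N M N0N)); apply: ler_sum => n _; case: ifP => // _.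
 by rewrite cabs0 cabs_ge0.
have -> : Z * eulerN N z - 1 = (S - 1) - (S - Z * eulerN N z) by ring.
triB; lra.
Qed.

Lemma eulerN_factor (a u r : R) (p : nat) : r = (p%:R)^-1 * expR (- (ln p%:R * a)) ->
 cabs (1 - zterm 0 (Complex a u) p) ^+ 2 <= expR (r ^+ 2 - 2 * r * cos (ln p%:R * u)).
Proof.
move=> er; apply: le_trans (expR_ge1Dx _); rewrite sqr_cabs.
set t := ln p%:R * u.
have eE : ez (Complex a u) p = Complex (expR (- (ln p%:R * a)) * cos t) (- (expR (- (ln p%:R * a)) * sin t)).
 rewrite /ez (_ : - ((ln p%:R)%:c * Complex a u) = Complex (- (ln p%:R * a)) (- t)).
  by rewrite /cexp cosN sinN mulrN.
 by apply: complex_eqP; rewrite ?ReN ?ImN ?Re_realM ?Im_realM.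
have -> : Re (1 - zterm 0 (Complex a u) p) = 1 - r * cos t by rewrite ReD ReN /zterm Re_realM eE expr0 mul1r er mulrA.
have -> : Im (1 - zterm 0 (Complex a u) p) = r * sin t by rewrite ImD ImN /zterm Im_realM eE /= expr0 mul1r er; ring.
have := cos2Dsin2 t => e.
have -> : (1 - r * cos t) ^+ 2 + (r * sin t) ^+ 2 =
 1 - 2 * r * cos t + r ^+ 2 * (cos t ^+ 2 + sin t ^+ 2) by ring.
by rewrite e; lra.
Qed.

(** The exponents 3, 4, 1 are doubled so that only squared moduli occur. With c = cos t, the
    exponent contains -2 r (3 + 4 c + cos 2t) = -4 r (1 + c)^2 <= 0, and the remaining 8 r^2 sums to
    at most 8 times 48. *)
Lemma eulerN_341 (a u : R) N : 0 <= a ->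
 cabs (eulerN N (Complex a 0)) ^+ 6 * cabs (eulerN N (Complex a u)) ^+ 8 *
 cabs (eulerN N (Complex a (2 * u))) ^+ 2 <= expR 384.
Proof.
move=> a0.
have cp z : cabs (eulerN N z) = \prod_(p < N | prime p) cabs (1 - zterm 0 z p).
 exact: (big_morph (@cabs R) (@cabsM R) (cabs1 R)).
rewrite !cp -!prodrXl -!big_split /=.
via (\prod_(p < N | prime p) expR (8 * (p%:R^-1 ^+ 2))).
 apply: ler_prod => p pp; rewrite !mulr_ge0 ?cabs_ge0 //=.
 set r := (p%:R)^-1 * expR (- (ln p%:R * a)).
 have h0 := eulerN_factor 0 (erefl r); have h1 := eulerN_factor u (erefl r).
 have h2 := eulerN_factor (2 * u) (erefl r); move: h0 h1 h2.
 have -> : ln p%:R * (2 * u) = ln p%:R * u + ln p%:R * u by ring.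
 rewrite mulr0 cos0 mulr1 cosD.
 set c := cos _; set s := sin _.
 have cs : s ^+ 2 = 1 - c ^+ 2 by rewrite /s sin2cos2.
 set A := cabs _; set B := cabs (1 - zterm 0 (Complex a u) p); set D := cabs _ => hA hB hD.
 have A0 : 0 <= A ^+ 2 by sign.
 have B0 : 0 <= B ^+ 2 by sign.
 have r0 : 0 <= r by sign.
 have r1 : r <= p%:R^-1 by rewrite ler_piMr /1/ expR_le1 oppr_le0 mulr_ge0 /1/ ln_natr_ge0.
 have eA : A ^+ 6 = (A ^+ 2) ^+ 3 by rewrite -exprM.
 have eB : B ^+ 8 = (B ^+ 2) ^+ 4 by rewrite -exprM.
 rewrite eA eB.
 via (expR (r ^+ 2 - 2 * r) ^+ 3 * expR (r ^+ 2 - 2 * r * c) ^+ 4 *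
   expR (r ^+ 2 - 2 * r * (c * c - s * s))).
  apply: ler_pM => /1/; rewrite /1/.
  by apply: ler_pM; rewrite /1/; apply: lerXn2r; rewrite ?nnegrE.
 rewrite -!expRM_natl -!expRD ler_expR.
 have : r ^+ 2 <= p%:R^-1 ^+ 2 by apply: lerXn2r; rewrite ?nnegrE.
 rewrite -(expr2 s) cs => h.
 have -> : 3 * (r ^+ 2 - 2 * r) + 4 * (r ^+ 2 - 2 * r * c) + (r ^+ 2 - 2 * r * (c * c - (1 - c ^+ 2)))
   = 8 * r ^+ 2 - 4 * r * (1 + c) ^+ 2 by ring.
 have : 0 <= 4 * r * (1 + c) ^+ 2 by apply: mulr_ge0; [exact: mulr_ge0|exact: sqr_ge0].
 lra.
rewrite -(@expR_sum _ _ _ (fun p : 'I_N => prime p)) ler_expR -mulr_sumr.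
have : \sum_(p < N | prime p) (p%:R : R)^-1 ^+ 2 <= 48; last by lra.
case: N {cp} => [|N]; first by rewrite big_ord0.
rewrite big_mkcond /= -(big_mkord xpredT (fun p => if prime p then p%:R^-1 ^+ 2 else 0)).
rewrite big_ltn //= add0r.
have := @sum_log_tail R 0 1 N.+1 isT isT; rewrite expr0 mulr1 divr1; apply: le_trans.
apply: ler_sum => p _; by rewrite expr0 mul1r exprVn; case: ifP.
Qed.

Lemma zeta_341 (a u : R) Z0 Z1 Z2 : 0 < a ->
 cser (zterm 0 (Complex a 0)) Z0 -> cser (zterm 0 (Complex a u)) Z1 ->
 cser (zterm 0 (Complex a (2 * u))) Z2 ->
 expR (-384) / 2 <= cabs Z0 ^+ 6 * cabs Z1 ^+ 8 * cabs Z2 ^+ 2.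
Proof.
move=> a0 h0 h1 h2.
(* The moduli enter with total exponent 16, each at least 31/32, and (31/32)^16 >= 1/2. *)
have e0 : 0 < (32^-1 : R) by sign.
have [N0 H0] := euler_limit (a0 : 0 < Re (Complex a 0)) h0 e0.
have [N1 H1] := euler_limit (a0 : 0 < Re (Complex a u)) h1 e0.
have [N2 H2] := euler_limit (a0 : 0 < Re (Complex a (2 * u))) h2 e0.
set N := maxn (maxn N0 N1) N2.
have [n0 n1 n2] : [/\ (N0 <= N)%N, (N1 <= N)%N & (N2 <= N)%N] by rewrite /N; split; lia.
have lb (w : R[i]) : cabs (w - 1) < 32^-1 -> 31 / 32 <= cabs w.
 move=> h; have := lerB_cabs 1 (1 - w).
 by rewrite cabs1 opprB addrCA subrr addr0 cabs_distC; lra.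
have := lb _ (H0 _ n0); have := lb _ (H1 _ n1); have := lb _ (H2 _ n2); rewrite !cabsM.
have := eulerN_341 u N (ltW a0).
set E0 := cabs (eulerN N (Complex a 0)); set E1 := cabs (eulerN N (Complex a u)).
set E2 := cabs (eulerN N (Complex a (2 * u))) => hE b2 b1 b0.
set P := cabs Z0 ^+ 6 * cabs Z1 ^+ 8 * cabs Z2 ^+ 2.
have P0 : 0 <= P by sign.
have half : 2^-1 <= (31 / 32 : R) ^+ 16.
 have q3 : 3 / 4 <= (((31 / 32 : R) ^+ 2) ^+ 2) ^+ 2 by clear; nra.
 rewrite (_ : 16 = 2 * 2 * 2 * 2)%N // !exprM; move: q3; set x := _ ^+ 2 ^+ 2 ^+ 2 => q3; clear -q3; nra.
have : (31 / 32) ^+ 16 <= P * expR 384.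
 apply: le_trans (ler_wpM2l P0 hE).
 have -> : P * (E0 ^+ 6 * E1 ^+ 8 * E2 ^+ 2) =
  (cabs Z0 * E0) ^+ 6 * (cabs Z1 * E1) ^+ 8 * (cabs Z2 * E2) ^+ 2 by rewrite /P; ring.
 rewrite (_ : 16 = 6 + 8 + 2)%N // !exprD.
 apply: ler_pM; rewrite ?mulr_ge0 ?exprn_ge0 //; last by apply: lerXn2r; rewrite ?nnegrE //; lra.
 by apply: ler_pM; rewrite /1/; apply: lerXn2r; rewrite /1/; lra.
move=> h; rewrite expRN mulrC ler_pdivrMr /1/; lra.
Qed.
End Euler.

(** * Lower bounds for zeta near the line Re s = 1 *)

Section ZetaLower.
Variable R : realType.
Implicit Types (z : R[i]) (u : R).

(** With y = x^(1/m), 1 + log x = 1 + m log y <= m y. *)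
Lemma polylog_le (m : nat) (x : R) : (0 < m)%N -> 1 <= x -> (1 + ln x) ^+ m <= m%:R ^+ m * x.
Proof.
move=> m0 x1; have x0 : 0 < x by lra.
have m0' : 0 < (m%:R : R) by sign.
have m1 : 1 <= (m%:R : R) by rewrite ler1n.
set y := x `^ (m%:R^-1); have y0 : 0 < y by sign.
have ly : ln y <= y - 1 by have := @le_ln1Dx R (y - 1); rewrite addrCA subrr addr0; apply; lra.
have lx : ln x = m%:R * ln y by rewrite ln_powR mulrA divff ?mul1r // gt_eqF.
have ym : y ^+ m = x by rewrite -powR_mulrn /1/ -powRrM mulVf ?powRr1 /1/ ltW.
have h : 1 + ln x <= m%:R * y by rewrite lx; nra.
rewrite -{2}ym -exprMn; apply: lerXn2r; rewrite ?nnegrE //.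
 by have := ln_ge0 x1; lra.
by sign.
Qed.

Definition Yl u : R := 1 + ln (3 + `|u|).

Lemma Yl_ge1 u : 1 <= Yl u.
Proof. by rewrite lerDl ln_ge0; have := normr_ge0 u; lra. Qed.
Lemma cabs_Complex_le (a u : R) : 0 <= a -> cabs (Complex a u) <= a + `|u|.
Proof. by move=> a0; have := ler_cabs_ReIm (Complex a u); rewrite ger0_norm. Qed.
Lemma Xlog_Yl (a u : R) : 0 <= a <= 1 -> Xlog (Complex a u) <= Yl u.
Proof.
move=> /andP[a0 a1]; have := cabs_Complex_le u a0; have := cabs_ge0 (Complex a u) => h1 h2.
by rewrite lerD2l ler_ln /1/; have := normr_ge0 u; lra.
Qed.

Lemma Yl2 u : Yl (2 * u) <= 2 * Yl u.
Proof.
have h := normr_ge0 u.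
have h3 : 0 <= ln (3 + `|u|) by rewrite ln_ge0; lra.
have : ln (3 + `|2 * u|) <= ln (2 * (3 + `|u|)).
 by rewrite ler_ln /1/ normrM ger0_norm; lra.
rewrite lnM /1/.
have l2 : ln (2 : R) <= 1 by have := @le_ln1Dx R 1; rewrite (_ : 1 + 1 = 2 :> R) //; apply; lra.
rewrite /Yl; lra.
Qed.

Lemma zeta_farY (rho : R) : 0 < rho -> exists C : R, 0 < C /\
 forall k a u Z, (k <= 2)%N -> 0 < a <= 1 -> rho <= cabs (Complex a u) ->
 cser (zterm k (Complex a u)) Z -> cabs Z <= C * Yl u ^+ k.+1.
Proof.
move=> r0; have [C [C0 h]] := zeta_far r0; exists C; split => //.
move=> k a u Z k2 /andP[a0 a1] hr hZ.
apply: le_trans (h k _ _ k2 _ hr hZ) _ => //.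
rewrite ler_pM2l /1/; apply: lerXn2r; rewrite ?nnegrE ?Xlog_Yl /1/.
 by have := Xlog_ge1 (Complex a u); lra.
by have := Yl_ge1 u; lra.
Qed.

(* The 3-4-1 inequality alone gives a lower bound that degenerates as a -> 0. *)
Lemma zeta_lower_pre (rho : R) : 0 < rho <= 1 -> exists c : R, 0 < c <= 1 /\
 forall a u Z, 0 < a <= 1 -> rho <= cabs (Complex a u) ->
 cser (zterm 0 (Complex a u)) Z -> c * a ^+ 6 <= cabs Z ^+ 8 * Yl u ^+ 2.
Proof.
move=> /andP[r0 r1]; have [C [C0 h]] := zeta_farY r0.
(* 97 = 1 + 96: the pole 1/a and the bounded part of zeta(1 + a), where a <= 1. *)
have [K [K0 K97]] : exists K : R, 0 < K /\ 97 <= K by exists 97.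
have [X [X0 hX]] : exists X : R, 0 < X /\ X = expR (-384) / 2.
 exists (expR (-384) / 2); split; last exact: erefl.
 by apply: divr_gt0; [exact: expR_gt0|exact: ltr0Sn].
set c := X / (K ^+ 6 * (2 * C) ^+ 2).
have D0 : 0 < K ^+ 6 * (2 * C) ^+ 2 by sign.
have c0 : 0 < c by sign.
exists (Num.min 1 c); split; first by rewrite lt_min ltr01 c0 ge_min lexx.
move=> a u Z /andP[a0 a1] hr hZ.
have a01 : 0 < a <= 1 by rewrite a0.
have [Z0 [hZ0 _]] := @zeta_exists R 0 (Complex a 0) isT a0.
have [Z2 [hZ2 _]] := @zeta_exists R 0 (Complex a (2 * u)) isT a0.
have := zeta_341 a0 hZ0 hZ hZ2; rewrite -hX.
have b0 : cabs Z0 <= K / a.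
 via (97 / a); last by rewrite ler_pM2r // invr_gt0.
 have ca : cabs (Complex a 0) = a by rewrite (cabs_real a) ger0_norm // ltW.
 have := @zeta_near R 0 (Complex a 0) Z0 isT a0; rewrite ca fact0 expr1 => /(_ a1 hZ0) hh.
 have : cabs (1 / Complex a 0) = a^-1 by rewrite mul1r cabsV ca.
 have := lerB_cabs Z0 (1 / Complex a 0).
 have : 96 <= 96 / a by rewrite ler_pdivlMr; clear -a01; lra.
 clear -hh; lra.
have b2 : cabs Z2 <= 2 * C * Yl u.
 apply: le_trans (h 0%N a (2 * u) Z2 isT a01 _ hZ2) _.
  apply: le_trans hr _; rewrite /cabs /= ler_wsqrtr // lerD2l exprMn.
  by have := sqr_ge0 u; clear; lra.
 by rewrite expr1; have := ler_wpM2l (ltW C0) (Yl2 u); clear; lra.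
have Y1 := Yl_ge1 u.
move=> key.
via (c * a ^+ 6).
 by rewrite ler_wpM2r /1/ ge_min lexx orbT.
have stp : X <= (K / a) ^+ 6 * cabs Z ^+ 8 * (2 * C * Yl u) ^+ 2.
 apply: le_trans key _; apply: ler_pM; rewrite /1/.
  rewrite ler_wpM2r ?exprn_ge0 ?cabs_ge0 //; apply: lerXn2r; rewrite ?nnegrE ?cabs_ge0 //.
  by sign.
 apply: lerXn2r; rewrite /1/ !mulr_ge0; lra.
rewrite /c [leLHS](_ : _ = (a ^+ 6 * X) / (K ^+ 6 * (2 * C) ^+ 2)); last by ring.
rewrite ler_pdivrMr //.
step (ler_wpM2l (exprn_ge0 6 (ltW a0)) stp).
by apply: ler_of_eq; field; rewrite gt_eqF.
Qed.

Lemma cabs_ez_dist (a b u : R) (n : nat) : 0 <= a -> a <= b ->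
 cabs (ez (Complex a u) n - ez (Complex b u) n) <= (b - a) * ln n%:R.
Proof.
move=> a0 ab; have L0 := ln_natr_ge0 R n.
have -> : ez (Complex b u) n = ez (Complex a u) n * cexp (- ((ln n%:R * (b - a))%:c)).
 rewrite /ez -cexpD; congr cexp; apply: complex_eqP;
 by rewrite !(ReD, ImD, ReN, ImN, Re_realM, Im_realM) /=; ring.
rewrite -[X in cabs (X - _)]mulr1 -mulrBr cabsM.
via (1 * cabs (1 - cexp (- ((ln n%:R * (b - a))%:c)))).
 by rewrite ler_wpM2r /1/ cabs_ez.
rewrite mul1r; apply: le_trans (expN_rem1 _) _.
 by rewrite mulr_ge0 // subr_ge0.
by rewrite cabs_real ger0_norm mulrC // mulr_ge0 // subr_ge0.
Qed.

(** Horizontal variation of zeta at height u, both values being truncated at the same M. M stays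
    free: the first term grows with log M, the last decays like 1/M. *)
Lemma zeta_dist (rho : R) (M : nat) (a b u : R) Za Zb : 0 < rho -> rho <= `|u| -> 0 < a -> a <= b ->
 b <= 1 -> (0 < M)%N -> cser (zterm 0 (Complex a u)) Za -> cser (zterm 0 (Complex b u)) Zb ->
 cabs (Za - Zb) <= (b - a) * ((1 + ln M%:R) ^+ 2 + (1 + ln M%:R) / rho + rho^-1 ^+ 2)
   + 96 * (2 + `|u|) / M%:R.
Proof.
move=> r0 ru a0 ab b1 M0 hA hB.
have b0 : 0 < b by lra.
have [Z' [hZ' hMa]] := @zeta_exists R 0 (Complex a u) isT a0.
rewrite (cser_uniq hA hZ') {Za hA}; have {}hMa := hMa _ M0.
have [Z'' [hZ'' hMb]] := @zeta_exists R 0 (Complex b u) isT b0.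
rewrite (cser_uniq hB hZ'') {Zb hB}; have {}hMb := hMb _ M0.
have lM := ln_natr_ge0 R M.
have ba : 0 <= b - a by lra.
have u0 := normr_ge0 u.
have cr x : rho <= cabs (Complex x u) by apply: le_trans ru (ler_Im_cabs (Complex x u)).
have ci x : cabs (Complex x u)^-1 <= rho^-1 by rewrite cabsV lef_pV2 ?posrE; have := cr x; clear -r0; lra.
have nz x : Complex x u != 0 by rewrite -cabs_gt0; have := cr x; clear -r0; lra.
have tail x : 0 < x -> x <= 1 -> (1 + cabs (Complex x u)) * (48 * (1 + ln M%:R) ^+ 0 / M%:R) <=
  48 * (2 + `|u|) / M%:R.
 move=> x0 x1; rewrite expr0 mulr1 mulrA ler_pM2r /1/ mulrC ler_wpM2l /1/.
 by have := cabs_Complex_le u (ltW x0); clear -x1; lra.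
have ta := tail a a0 (le_trans ab b1); have tb := tail b b0 b1.
have d1 : cabs (\sum_(n < M) zterm 0 (Complex a u) n - \sum_(n < M) zterm 0 (Complex b u) n) <=
  (b - a) * (1 + ln M%:R) ^+ 2.
 rewrite -sumrB; triS.
 via (\sum_(n < M) (b - a) * (1 + ln M%:R) * (n%:R)^-1).
  apply: ler_sum => n _; rewrite /zterm -mulrBr cabsM cabs_real expr0 mul1r.
  rewrite ger0_norm /1/ mulrC ler_wpM2r /1/.
  step (cabs_ez_dist u n (ltW a0) ab); rewrite ler_wpM2l //.
  case: n => -[|n] hn /=; first by rewrite ln0; clear -lM; lra.
  via (ln M%:R); last by (clear; lra).
  by rewrite ler_ln /1/ ler_nat ltnW.
 rewrite -mulr_sumr expr2 mulrA ler_wpM2l ?harmonic_le // mulr_ge0; clear -lM ba; lra.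
have d2 : cabs (ztail 0 (Complex a u) M - ztail 0 (Complex b u) M) <=
  (b - a) * ((1 + ln M%:R) / rho + rho^-1 ^+ 2).
 rewrite /ztail; set ea := ez _ M; set eb := ez _ M.
 have -> : ea / Complex a u - eb / Complex b u =
  (ea - eb) * (Complex a u)^-1 + eb * ((Complex b u - Complex a u) * ((Complex a u)^-1 * (Complex b u)^-1)).
  by field; rewrite !nz.
 triD; rewrite mulrDr; apply: lerD.
  rewrite cabsM mulrA; apply: ler_pM; rewrite /1/.
  by step (cabs_ez_dist u M (ltW a0) ab); rewrite ler_wpM2l; clear -ba; lra.
 rewrite cabsM; via (1 * ((b - a) * rho^-1 ^+ 2)); last by rewrite mul1r.
 have eb1 : cabs eb <= 1 by apply: cabs_ez; exact: ltW.
 apply: ler_pM; rewrite /1/; rewrite cabsM.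
 have -> : Complex b u - Complex a u = (b - a)%:c by apply: complex_eqP; rewrite !(ReD, ImD, ReN, ImN) ?subrr.
 rewrite cabs_real ger0_norm // ler_wpM2l // cabsM expr2.
 by apply: ler_pM; rewrite ?cabs_ge0.
move: hMa hMb d1 d2; set Sa := \sum_(n < M) _; set Sb := \sum_(n < M) _.
set Ta := ztail _ _ _; set Tb := ztail _ _ _ => hMa hMb d1 d2.
have -> : Z' - Z'' = (Z' - (Sa + Ta)) - (Z'' - (Sb + Tb)) + (Sa - Sb) + (Ta - Tb) by ring.
triD; apply: le_trans (lerD (ler_cabsD _ _) (lexx _)) _.
apply: le_trans (lerD (lerD (ler_cabsB _ _) (lexx _)) (lexx _)) _.
rewrite -addrA mulrDr in d2 *.
have -> : 96 * (2 + `|u|) / M%:R = 48 * (2 + `|u|) / M%:R + 48 * (2 + `|u|) / M%:R by ring.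
rewrite !mulrDr in d2 *; lra.
Qed.
End ZetaLower.
Section ZetaLower2.
Variable R : realType.
Implicit Types (u : R).

Lemma ler_pX2 (x y : R) (n : nat) : (0 < n)%N -> 0 <= x -> 0 <= y -> x ^+ n <= y ^+ n -> x <= y.
Proof. by move=> n0 x0 y0; rewrite ler_pXn2r. Qed.
Lemma ln_scale (m v : R) (j : nat) : 0 < m -> 0 < v ->
 ln (2 * (m ^- j * v ^+ 2)) = ln 2 + j%:R * ln m^-1 + 2 * ln v.
Proof.
move=> m0 v0; have mp : 0 < m ^- j by sign.
rewrite lnM /1/ lnM /1/ !lnV /1/.
by rewrite (lnXn j m0) (lnXn 2 v0) -(mulr_natl (ln m) j) -(mulr_natl (ln v) 2); ring.
Qed.

(* With l = m^4, M ~ m^-16 (3+|u|)^2 and b = m^16 / Y^9, the value at abscissa 1 + b controls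
  all smaller abscissae. *)
Lemma zeta_lower (rho : R) : 0 < rho <= 1 -> exists c : R, 0 < c /\
 forall a u Z, 0 < a <= 1 -> rho <= cabs (Complex a u) ->
 cser (zterm 0 (Complex a u)) Z -> c / Yl u ^+ 7 <= cabs Z.
Proof.
move=> /andP[r0 r1]; set r := rho / 2.
have r01 : 0 < r <= 1 by rewrite /r; apply/andP; split; lra.
have [rp _] := andP r01.
have [c1 [/andP[c10 c11] h]] := zeta_lower_pre r01.
set D := 19 ^+ 2 + 19 / r + r^-1 ^+ 2.
have ri : 0 < r^-1 by sign.
have D1 : 1 <= D by rewrite /D; have := exprn_ge0 2 (ltW ri); lra.
have [K7 [K70 pl7]] : exists K7 : R, 1 <= K7 /\ forall x : R, 1 <= x -> 96 * (1 + ln x) ^+ 7 <= K7 * x.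
 exists (96 * 7%:R ^+ 7); split.
  by apply: mulr_ege1; [rewrite ler1n|apply: exprn_ege1; rewrite ler1n].
 by move=> x x1; rewrite -mulrA; apply: ler_wpM2l; [exact: ler0n|apply: polylog_le].
set m := Num.min (Num.min 1 r) (Num.min (c1 / (4 * D)) (c1 / (4 * K7))).
have m0 : 0 < m by rewrite !lt_min ltr01 rp !divr_gt0; clear -c10 D1 K70; lra.
have [m1 mr mD mK] : [/\ m <= 1, m <= r, m <= c1 / (4 * D) & m <= c1 / (4 * K7)] by split; rewrite /m !ge_min lexx ?orbT.
have mpow n : (0 < n)%N -> m ^+ n <= m by move=> n0; rewrite -[leRHS]expr1 ler_wiXn2l // ltW.
have mD' : 4 * D * m <= c1 by rewrite mulrC -ler_pdivlMr; clear -D1 mD; lra.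
have mK' : 4 * K7 * m <= c1 by rewrite mulrC -ler_pdivlMr; clear -K70 mK; lra.
clear mD mK; clearbody m.
exists (c1 * m ^+ 12 / 2); split; first by sign.
move=> a u Z /andP[a0 a1] hr hZ.
have Y1 := Yl_ge1 u; have Yp : 0 < Yl u by lra.
have u0 := normr_ge0 u.
have {}h a' := h a' u; set Y := Yl u in Y1 Yp h *.
have u3 : 0 < 3 + `|u| by clear -u0; lra.
have ly : ln (3 + `|u|) = Y - 1 by rewrite /Y /Yl; clear; lra.
have pl : 96 * Y ^+ 7 <= K7 * (3 + `|u|) by apply: pl7; clear -u0; lra.
clearbody Y.
set b := m ^+ 16 / Y ^+ 9.
have Y9 : 1 <= Y ^+ 9 by rewrite exprn_ege1.
have b0 : 0 < b by sign.
have br : b <= r.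
 rewrite /b ler_pdivrMr /1/; step (mpow 16%N isT).
 by step mr; rewrite ler_peMr // ltW.
have b1 : b <= 1 by step br; case/andP: r01.
(* from the pre-bound at an abscissa at least b *)
have large x Z' : b <= x -> x <= 1 -> r <= cabs (Complex x u) -> cser (zterm 0 (Complex x u)) Z' ->
  c1 * m ^+ 12 / Y ^+ 7 <= cabs Z'.
 move=> bx x1 hx hZ'; have x01 : 0 < x <= 1 by rewrite x1 (lt_le_trans b0).
 have hh := h x Z' x01 hx hZ'.
 apply: (@ler_pX2 _ _ 8) => //; rewrite ?cabs_ge0 //.
  by sign.
 have : c1 * b ^+ 6 <= cabs Z' ^+ 8 * Y ^+ 2.
  apply: le_trans hh; rewrite ler_pM2l /1/; apply: lerXn2r; rewrite ?nnegrE /1/.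
  by case/andP: x01 => xx _; exact: ltW.
 have -> : c1 * b ^+ 6 = c1 * (m ^+ 12) ^+ 8 / (Y ^+ 7) ^+ 8 * Y ^+ 2.
  rewrite /b; field; rewrite gt_eqF //.
 rewrite ler_pM2r /1/; apply: le_trans.
 rewrite expr_div_n (exprMn 8 c1) ler_pM2r /1/.
 rewrite ler_pM2r /1/.
 by rewrite -[leRHS]expr1 ler_wiXn2l // ltW.
have half : c1 * m ^+ 12 / 2 / Y ^+ 7 <= c1 * m ^+ 12 / Y ^+ 7.
 rewrite ler_pM2r /1/ ler_pdivrMr /1/.
 have h0 : 0 < c1 * m ^+ 12 by sign.
 by clear -h0; lra.
have [ba|ab] := leP b a.
 apply: le_trans half (large a Z ba a1 _ hZ); rewrite /r in hr *; clear -hr r0; lra.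
(* Here a < b <= rho/2, so the distance rho from the pole must come from u. *)
have ur : r <= `|u|.
 have := cabs_Complex_le u (ltW a0); rewrite /r in br *; clear -hr br ab; lra.
have [Zb [hZb _]] := @zeta_exists R 0 (Complex b u) isT b0.
have hb := large b Zb (lexx b) b1 (le_trans ur (ler_Im_cabs (Complex b u))) hZb.
set x := m ^- 16 * (3 + `|u|) ^+ 2.
have mi : 1 <= m ^- 16 by rewrite -invr1 lef_pV2 /1/ exprn_ile1 /1/ ltW.
have x1 : 1 <= x by rewrite -[leLHS]mulr1; apply: ler_pM => //; apply: exprn_ege1; clear -u0; lra.
have x0 := le_trans ler01 x1.
set M := (Num.trunc x).+1.
have /andP[M1 M2] := truncn_itv x0.
have Mx : M%:R <= 2 * x by rewrite /M -natr1; clear -M1 x1; lra.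
have xM : x <= M%:R by rewrite ltW.
have d := @zeta_dist R r M a b u Z Zb rp ur a0 (ltW ab) b1 isT hZ hZb.
have lM : 1 + ln M%:R <= 19 / m * Y.
 have : ln M%:R <= ln (2 * x) by rewrite ler_ln /1/; clear -x1; lra.
 rewrite /x (ln_scale 16 m0 u3).
 have l2 : ln (2 : R) <= 1 by have := @le_ln1Dx R 1; rewrite (_ : 1 + 1 = 2 :> R) //; apply; clear; lra.
 have im : 1 <= m^-1 by rewrite -invr1 lef_pV2 /1/.
 have lm : ln m^-1 <= m^-1 - 1 by have := @le_ln1Dx R (m^-1 - 1); rewrite addrCA subrr addr0; apply; clear -im; lra.
 rewrite ly => hl; have : 1 + ln M%:R <= 16 * m^-1 + 2 * Y by clear -hl l2 lm Y1; lra.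
 by clear -im Y1; nra.
have lM0 : 0 <= ln (M%:R : R) by sign.
have e1 : (b - a) * ((1 + ln M%:R) ^+ 2 + (1 + ln M%:R) / r + r^-1 ^+ 2) <= c1 * m ^+ 12 / Y ^+ 7 / 4.
 have mY : 1 <= m^-1 * Y by rewrite -[leLHS]mulr1; apply: ler_pM => //; rewrite -invr1 lef_pV2 ?posrE.
 have q1 : (1 + ln M%:R) ^+ 2 <= 19 ^+ 2 * (m^-1 * Y) ^+ 2 by rewrite -exprMn mulrA lerXn2r /1/.
 have q2 : (1 + ln M%:R) / r <= 19 / r * (m^-1 * Y) ^+ 2.
  via (19 / m * Y / r); first by rewrite ler_pM2r.
  have -> : 19 / m * Y / r = 19 / r * (m^-1 * Y) by ring.
  by rewrite ler_pM2l /1/ -[leLHS]expr1 ler_weXn2l.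
 have q3 : r^-1 ^+ 2 <= r^-1 ^+ 2 * (m^-1 * Y) ^+ 2 by rewrite ler_peMr /1/ exprn_ege1.
 have q : (1 + ln M%:R) ^+ 2 + (1 + ln M%:R) / r + r^-1 ^+ 2 <= D * (m^-1 * Y) ^+ 2 by rewrite /D !(mulrDl _ _ (_ ^+ 2)); apply: lerD q3; apply: lerD.
 via (b * (D * (m^-1 * Y) ^+ 2)).
  by apply: ler_pM _ _ _ q; [rewrite subr_ge0 ltW|sign|rewrite lerBlDr lerDl ltW].
 have -> : b * (D * (m^-1 * Y) ^+ 2) = (4 * D * m ^+ 2) * (m ^+ 12 / Y ^+ 7 / 4) by rewrite /b; field; rewrite !gt_eqF.
 have -> : c1 * m ^+ 12 / Y ^+ 7 / 4 = c1 * (m ^+ 12 / Y ^+ 7 / 4) by ring.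
 rewrite ler_wpM2r /1/.
 apply: le_trans mD'; rewrite ler_wpM2l ?mpow /1/.
have e2 : 96 * (2 + `|u|) / M%:R <= c1 * m ^+ 12 / Y ^+ 7 / 4.
 via (96 * (3 + `|u|) / x).
  by apply: ler_pM; [sign|sign|rewrite ler_wpM2l // lerD2r ler_nat|rewrite lef_pV2 /1/].
 have -> : 96 * (3 + `|u|) / x = 96 * m ^+ 16 / (3 + `|u|) by rewrite /x; field; rewrite !gt_eqF.
 rewrite ler_pdivrMr //.
 have -> : c1 * m ^+ 12 / Y ^+ 7 / 4 * (3 + `|u|) = m ^+ 12 * (c1 / 4 * (3 + `|u|)) / Y ^+ 7 by ring.
 rewrite ler_pdivlMr /1/.
 have -> : 96 * m ^+ 16 * Y ^+ 7 = m ^+ 12 * (m ^+ 4 * (96 * Y ^+ 7)) by ring.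
 rewrite ler_wpM2l /1/.
 via (m * (K7 * (3 + `|u|))).
  by apply: ler_pM; rewrite ?mpow; sign.
 have : 4 * K7 * m * (3 + `|u|) <= c1 * (3 + `|u|) by rewrite ler_pM2r.
 by clear; lra.
have := lerB_cabs Zb Z; rewrite cabs_distC in d.
have -> : c1 * m ^+ 12 / 2 / Y ^+ 7 = c1 * m ^+ 12 / Y ^+ 7 / 2 by ring.
by clear -d hb e1 e2; lra.
Qed.
End ZetaLower2.

(** * The logarithmic derivative of zeta and its derivative *)

Section LogDerivative.
Variable R : realType.
Implicit Types (z : R[i]) (n k : nat) (u : R).

Definition lterm k z n : R[i] := (vM R n * ln (n%:R : R) ^+ k / n%:R)%:c * ez z n.

Lemma cabs_lterm k z n : cabs (lterm k z n) <= cabs (zterm k.+1 z n).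
Proof.
rewrite !cabsM !cabs_real ler_wpM2r /1/ !normrM.
rewrite ler_wpM2r // exprS normrM ler_wpM2r //.
by rewrite !ger0_norm ?vM_ge0 ?vM_le_ln /1/.
Qed.

Lemma lterm_summable k z : (k <= 1)%N -> 0 < Re z -> abs_summable (lterm k z).
Proof.
move=> k1 rz; have [|B hB] := @zterm_summable R k.+1 z _ rz; first by lia.
by exists B => N; apply: le_trans (hB N); apply: ler_sum => n _; apply: cabs_lterm.
Qed.

Lemma lterm0 k z : lterm k z 0 = 0.
Proof. by rewrite /lterm invr0 mulr0 mul0r. Qed.
Lemma dconv_lterm k j z n : (0 < n)%N ->
 dconv (lterm k z) (zterm j z) n = (n%:R^-1)%:c * ez z n *
  \sum_(d < n.+1 | (0 < d)%N && (d %| n)%N) (vM R d * ln (d%:R : R) ^+ k * ln ((n %/ d)%:R : R) ^+ j)%:c.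
Proof.
move=> n0; rewrite /dconv mulr_sumr; apply: eq_bigr => -[d hd] /= /andP[d0 /dvdnP[m e]].
have m0 : (0 < m)%N by case: (m) e n0 => // ->.
have -> : (n %/ d = m)%N by rewrite e mulnK.
have -> : (n%:R : R)^-1 = m%:R^-1 * d%:R^-1 by rewrite e natrM invfM.
have -> : ez z n = ez z m * ez z d by rewrite e ez_mul.
by rewrite /lterm /zterm !realcM; ring.
Qed.

Lemma ln_divn (n d : nat) : (0 < n)%N -> (0 < d)%N -> (d %| n)%N ->
 ln (d%:R : R) + ln ((n %/ d)%:R : R) = ln n%:R.
Proof.
move=> n0 d0 dn; rewrite -lnM ?posrE ?ltr0n //; last by rewrite divn_gt0 dvdn_leq.
by rewrite -natrM mulnC divnK.
Qed.

Lemma zeta_log_derivative z Z0 Z1 L0 : 0 < Re z ->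
 cser (zterm 0 z) Z0 -> cser (zterm 1 z) Z1 -> cser (lterm 0 z) L0 -> Z1 = L0 * Z0.
Proof.
move=> rz h0 h1 hL; apply: cser_uniq h1 _.
have := cser_dconv (lterm0 0 z) (zterm0 0 z) (lterm_summable (isT : (0 <= 1)%N) rz)
 (zterm_summable (isT : (0 <= 2)%N) rz) hL h0.
apply: cser_ext => n; case: eqP => [->|/eqP n0]; first by rewrite zterm0.
rewrite -lt0n in n0; rewrite dconv_lterm // -realc_sum.
rewrite (eq_bigr (fun d : 'I_n.+1 => vM R d)); last by move=> d _; rewrite !expr0 !mulr1.
by rewrite sum_vM // /zterm expr1 realcM; ring.
Qed.

(** Among arithmetic functions: the convolution of Lambda log with 1, plus that of Lambda with log,
    is log n times the divisor sum of Lambda, that is (log n)^2. *)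
Lemma zeta_log_derivative2 z Z0 Z1 Z2 L0 L1 : 0 < Re z ->
 cser (zterm 0 z) Z0 -> cser (zterm 1 z) Z1 -> cser (zterm 2 z) Z2 ->
 cser (lterm 0 z) L0 -> cser (lterm 1 z) L1 -> Z2 = L1 * Z0 + L0 * Z1.
Proof.
move=> rz h0 h1 h2 hL0 hL1; apply: cser_uniq h2 _.
have A := cser_dconv (lterm0 1 z) (zterm0 0 z) (lterm_summable (isT : (1 <= 1)%N) rz)
 (zterm_summable (isT : (0 <= 2)%N) rz) hL1 h0.
have B := cser_dconv (lterm0 0 z) (zterm0 1 z) (lterm_summable (isT : (0 <= 1)%N) rz)
 (zterm_summable (isT : (1 <= 2)%N) rz) hL0 h1.
apply: cser_ext (cserD A B) => n; case: eqP => [->|/eqP n0]; first by rewrite zterm0 addr0.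
rewrite -lt0n in n0; rewrite !dconv_lterm // -!realc_sum -mulrDr -realcD -big_split /=.
rewrite (eq_bigr (fun d : 'I_n.+1 => ln n%:R * vM R d)); last first.
 move=> d /andP[d0 dn]; rewrite !expr0 !expr1 !mulr1 -mulrDr ln_divn // mulrC //.
by rewrite -mulr_sumr sum_vM // /zterm expr2 !realcM; ring.
Qed.

(** B0, B1, B2 are the bounded parts near z = 0. Both L1 and Z1 have the polar part 1/z^2, so their
    difference is a quotient without negative powers of z. *)
Lemma near_pole_alg (F : fieldType) (z B0 B1 B2 Z0 Z1 Z2 L0 L1 : F) :
 z != 0 -> 1 + z * B0 != 0 -> Z0 = 1 / z ^+ 1 + B0 -> Z1 = 1 / z ^+ 2 + B1 -> Z2 = 2 / z ^+ 3 + B2 ->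
 Z1 = L0 * Z0 -> Z2 = L1 * Z0 + L0 * Z1 ->
 L1 - Z1 = (z * B2 + z ^+ 2 * B0 * B2 - 2 * B1 - z ^+ 2 * B1 ^+ 2 - B0 ^+ 2 - B1 - 2 * z * B0 * B1
   - z ^+ 2 * B0 ^+ 2 * B1) / (1 + z * B0) ^+ 2.
Proof.
move=> z0 d0 e0 e1 e2 r1 r2.
have Zn : Z0 = (1 + z * B0) / z by rewrite e0 expr1; field.
have Z0n : Z0 != 0 by rewrite Zn mulf_neq0 // invr_eq0.
have L0e : L0 = Z1 / Z0 by rewrite r1 mulfK.
have L1e : L1 = (Z2 - L0 * Z1) / Z0 by rewrite r2 addrK mulfK.
rewrite L1e L0e Zn e1 e2; field.
by rewrite z0 d0.
Qed.

(* Uniform in the abscissa: this is where the pole at s = 1 cancels. *)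
Lemma mangoldt_series_bound : exists C : R, 0 < C /\ forall (a u : R), 0 < a <= 1 ->
 exists D, cser (fun n => ((vM R n - 1) * ln (n%:R : R) / n%:R)%:c * ez (Complex a u) n) D /\
  cabs D <= C * Num.sqrt (3 + `|u|).
Proof.
(* Then |z B0| <= 96/200 < 1/2 within rho, and 1 + z B0 stays away from 0. *)
set rho : R := 200^-1.
have r01 : 0 < rho <= 1 by apply/andP; split; rewrite /rho; lra.
have [r0 r1] := andP r01.
have [C1 [C10 hfar]] := zeta_farY r0.
have [c [c0 hlow]] := zeta_lower r01.
(* With Y = 1 + log(3 + |u|), the bounds for 1/Z0, Z1 and L0 are O(Y^7), O(Y^2) and O(Y^9), so L0
   Z1/Z0 is O(Y^18). A square root of |u| is affordable because the kernel below has weights like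
   1/(1 + u^2). *)
have [K [K0 hK]] : exists K : R, 0 < K /\ forall x : R, 1 <= x -> (1 + ln x) ^+ 18 <= K * Num.sqrt x.
 exists (36%:R ^+ 18); split; first by sign.
 move=> x x1; have x0 : 0 <= x by lra.
 have l0 := ln_ge0 x1.
 apply: (@ler_pX2 _ _ _ 2) => /1/; rewrite /1/.
 by rewrite (exprMn 2 (36%:R ^+ 18)) sqr_sqrtr // -!exprM; apply: (@polylog_le R 36).
have [K1 [K10 hK1]] : exists K1 : R, 0 < K1 /\ 8 * (96 ^+ 3 + 5 * 96 ^+ 2 + 4 * 96) <= K1.
 exists (8 * (96 ^+ 3 + 5 * 96 ^+ 2 + 4 * 96)); split; last exact: lexx.
 apply: mulr_gt0; first exact: ltr0Sn.
 apply: addr_gt0; last by sign.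
 apply: addr_gt0; first by sign.
 by apply: mulr_gt0; [exact: ltr0Sn|apply: exprn_gt0; exact: ltr0Sn].
set C2 := C1 / c + C1 ^+ 2 / c ^+ 2 + C1.
have C20 : 0 < C2 by sign.
exists (K1 + C2 * K); split; first by sign.
move=> a u a01; have [a0 a1] := andP a01.
set z := Complex a u.
have z0 : z != 0 by apply/eqP => -[] e _; rewrite e ltxx in a0.
have [Z0 [h0 _]] := @zeta_exists R 0 z isT a0.
have [Z1 [h1 _]] := @zeta_exists R 1 z isT a0.
have [Z2 [h2 _]] := @zeta_exists R 2 z isT a0.
have [L0 hL0] := abs_summable_cser (lterm_summable (isT : (0 <= 1)%N) (a0 : 0 < Re z)).
have [L1 hL1] := abs_summable_cser (lterm_summable (isT : (1 <= 1)%N) (a0 : 0 < Re z)).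
have r1' := zeta_log_derivative (a0 : 0 < Re z) h0 h1 hL0.
have r2' := zeta_log_derivative2 (a0 : 0 < Re z) h0 h1 h2 hL0 hL1.
exists (L1 - Z1); split.
 rewrite -[L1 - Z1]/(L1 + - Z1) -[- Z1]mulN1r; apply: cser_ext (cserD hL1 (cserZ (-1) h1)) => n.
 by rewrite /lterm /zterm expr1 -mulrA !mulrBl mul1r realcD realcN; ring.
have u0 := normr_ge0 u.
have s1 : 1 <= Num.sqrt (3 + `|u|) by rewrite -[leLHS]sqrtr1 ler_wsqrtr; clear -a1 u0; lra.
have [near|far'] := leP (cabs z) rho.
 have z1 : cabs z <= 1 by clear -r1 near; lra.
 have n0 := zeta_near (isT : (0 <= 2)%N) (a0 : 0 < Re z) z1 h0.
 have n1 := zeta_near (isT : (1 <= 2)%N) (a0 : 0 < Re z) z1 h1.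
 have n2 := zeta_near (isT : (2 <= 2)%N) (a0 : 0 < Re z) z1 h2.
 rewrite fact0 in n0; rewrite (_ : 1`! = 1%N) in n1; rewrite (_ : 2`! = 2%N) // in n2.
 set B0 := Z0 - _ in n0; set B1 := Z1 - _ in n1; set B2 := Z2 - _ in n2.
 have zB : cabs (z * B0) <= 2^-1.
  rewrite cabsM; via (rho * 96); last by rewrite /rho; clear; lra.
  by apply: ler_pM; rewrite ?cabs_ge0.
 have dl : 2^-1 <= cabs (1 + z * B0).
  have := lerB_cabs 1 (- (z * B0)); rewrite cabs1 cabsN opprK; clear -zB; lra.
 have d0 : 1 + z * B0 != 0 by rewrite -cabs_gt0; clear -dl; lra.
 have e0 : Z0 = 1 / z ^+ 1 + B0 by rewrite /B0 addrCA subrr addr0.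
 have e1 : Z1 = 1 / z ^+ 2 + B1 by rewrite /B1 addrCA subrr addr0.
 have e2 : Z2 = 2 / z ^+ 3 + B2 by rewrite /B2 addrCA subrr addr0.
 rewrite (near_pole_alg z0 d0 e0 e1 e2 r1' r2') cabsM cabsV cabsX.
 via K1; last first.
  rewrite -[leLHS]mulr1; apply: ler_pM => //; first exact: ltW.
  by rewrite lerDl mulr_ge0 // ltW.
 rewrite ler_pdivrMr ?exprn_gt0 //; last by (clear -dl; lra).
 have dl2 : 4^-1 <= cabs (1 + z * B0) ^+ 2 by rewrite (_ : 4^-1 = 2^-1 ^+ 2 :> R); [apply: lerXn2r; rewrite ?nnegrE ?cabs_ge0|(clear; lra)].
 have [w [w96 w0]] : exists w : R, w = 96 /\ 0 <= w by exists 96.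
 rewrite -w96 in n0 n1 n2 hK1.
 set b0 := cabs B0 in n0; set b1 := cabs B1 in n1; set b2 := cabs B2 in n2.
 have [p0 p1 p2] : [/\ 0 <= b0, 0 <= b1 & 0 <= b2] by split; apply: cabs_ge0.
 have pz := cabs_ge0 z.
 have zz n : cabs z ^+ n <= 1 by rewrite exprn_ile1.
 have t1 : cabs (z * B2) <= w by rewrite cabsM -[leRHS]mul1r; apply: ler_pM; rewrite ?cabs_ge0.
 have t2 : cabs (z ^+ 2 * B0 * B2) <= w * w.
  rewrite cabsM (cabsM _ B0) cabsX; apply: ler_pM; rewrite /1/.
  by rewrite -[leRHS]mul1r; apply: ler_pM; rewrite ?exprn_ge0.
 have t3 : cabs (2 * B1) <= 2 * w by rewrite cabsM (cabs_natr R 2); apply: ler_pM; rewrite ?cabs_ge0.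
 have t4 : cabs (z ^+ 2 * B1 ^+ 2) <= w ^+ 2.
  rewrite cabsM -[leRHS]mul1r; apply: ler_pM; rewrite ?cabsX /1/.
  by apply: lerXn2r.
 have t5 : cabs (B0 ^+ 2) <= w ^+ 2 by rewrite cabsX; apply: lerXn2r.
 have t6 : cabs (2 * z * B0 * B1) <= 2 * w * w.
  rewrite !cabsM (cabs_natr R 2); apply: ler_pM; rewrite /1/.
  apply: ler_pM; rewrite /1/; clear -z1; lra.
 have t7 : cabs (z ^+ 2 * B0 ^+ 2 * B1) <= w ^+ 2 * w.
  rewrite cabsM; apply: ler_pM; rewrite /1/.
  rewrite cabsM -[leRHS]mul1r; apply: ler_pM; rewrite ?cabsX /1/.
  by apply: lerXn2r.
 have T : cabs (z * B2 + z ^+ 2 * B0 * B2 - 2 * B1 - z ^+ 2 * B1 ^+ 2 - B0 ^+ 2 - B1 - 2 * z * B0 * B1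
   - z ^+ 2 * B0 ^+ 2 * B1) <= w ^+ 3 + 5 * w ^+ 2 + 4 * w.
  do 6 (triB; rewrite -lerBrDr).
  by triD; rewrite -/b1; clear -t1 t2 t3 t4 t5 t6 t7 n1; lra.
 apply: le_trans T _; rewrite -ler_pdivrMr; last by (clear -dl2; lra).
 rewrite ler_pdivrMr; last by (clear -dl2; lra).
 clear -K10 dl2 hK1; nra.
have hr := ltW far'.
have f0 := hfar 0%N a u Z0 isT a01 hr h0; have f1 := hfar 1%N a u Z1 isT a01 hr h1.
have f2 := hfar 2%N a u Z2 isT a01 hr h2; have lw := hlow a u Z0 a01 hr h0.
have Y1 := Yl_ge1 u; set Y := Yl u in f0 f1 f2 lw Y1.
have Yp : 0 < Y by clear -Y1; lra.
have Z0p : 0 < cabs Z0 by apply: lt_le_trans lw; rewrite divr_gt0 ?exprn_gt0.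
have Z0n : Z0 != 0 by rewrite -cabs_gt0.
have iZ : (cabs Z0)^-1 <= Y ^+ 7 / c by rewrite -[leRHS]invf_div lef_pV2 /1/.
have L0e : L0 = Z1 / Z0 by rewrite r1' mulfK.
have L1e : L1 = (Z2 - L0 * Z1) / Z0 by rewrite r2' addrK mulfK.
have iZ0 : 0 <= (cabs Z0)^-1 by sign.
have g0 : cabs L0 <= C1 / c * Y ^+ 9.
 rewrite L0e cabsM cabsV; via (C1 * Y ^+ 2 * (Y ^+ 7 / c)).
  by apply: ler_pM; rewrite ?cabs_ge0.
 by apply: ler_of_eq; ring.
have g1 : cabs L1 <= (C1 / c + C1 ^+ 2 / c ^+ 2) * Y ^+ 18.
 rewrite L1e cabsM cabsV; via ((C1 * Y ^+ 11 + C1 / c * Y ^+ 9 * (C1 * Y ^+ 2)) * (Y ^+ 7 / c)).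
  apply: ler_pM; rewrite /1/; triB; apply: lerD.
   by step f2; rewrite ler_pM2l // ler_weXn2l.
  by rewrite cabsM; apply: ler_pM; rewrite ?cabs_ge0.
 by apply: ler_of_eq; field; rewrite gt_eqF.
have g2 : cabs (L1 - Z1) <= C2 * Y ^+ 18.
 triB; rewrite /C2 mulrDl; apply: lerD => //.
 by step f1; rewrite ler_pM2l // ler_weXn2l.
apply: le_trans g2 _; have := hK (3 + `|u|); rewrite -/(Yl u) -/Y => hK'.
have {}hK' : Y ^+ 18 <= K * Num.sqrt (3 + `|u|) by apply: hK'; lra.
via (C2 * (K * Num.sqrt (3 + `|u|))).
 by rewrite ler_pM2l.
by rewrite [leRHS]mulrDl mulrA lerDr mulr_ge0 /1/.
Qed.
End LogDerivative.

(** * The Fejer kernel and cosine sums approximating exp(-|t|) *)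

Section FourierKernel.
Variable R : realType.
Implicit Types (t x T : R).

Definition chR t : R := (expR t + expR (- t)) / 2.
Definition shR t : R := (expR t - expR (- t)) / 2.

Lemma is_derive_chR_lin (c t : R) :
 is_derive t 1 (fun x => chR (c - x)) (- shR (c - t)) /\
 is_derive t 1 (fun x => shR (c - x)) (- chR (c - t)).
Proof.
have d1 : is_derive t (1 : R) (fun x : R => c - x) (-1).
 have := is_deriveB (is_derive_cst c t (1 : R)) (is_derive_id t (1 : R)).
 by rewrite sub0r.
have d2 : is_derive t (1 : R) (fun x : R => - (c - x)) 1 by have := is_deriveN d1; rewrite opprK.
have e1 := @is_derive1_comp _ expR _ _ _ _ (is_derive_expR _) d1.
have e2 := @is_derive1_comp _ expR _ _ _ _ (is_derive_expR _) d2.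
split.
- have -> : (fun x => chR (c - x)) = 2^-1 *: ((expR \o (fun x : R => c - x)) + (expR \o (fun x : R => - (c - x)))).
  by apply/funext => x; rewrite /chR mulrC.
 apply: is_deriveEq (is_deriveZ _ (is_deriveD e1 e2)).
 by rewrite /GRing.scale /= /shR; ring.
- have -> : (fun x => shR (c - x)) = 2^-1 *: ((expR \o (fun x : R => c - x)) - (expR \o (fun x : R => - (c - x)))).
  by apply/funext => x; rewrite /shR mulrC.
 apply: is_deriveEq (is_deriveZ _ (is_deriveB e1 e2)).
 by rewrite /GRing.scale /= /chR; ring.
Qed.

Lemma is_derive_cosl (a b t : R) : is_derive t 1 (fun x => cos (a * x + b)) (- a * sin (a * t + b)).
Proof.
have d1 : is_derive t (1 : R) (fun x : R => a * x + b) a.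
 have := is_deriveD (is_deriveZ a (is_derive_id t (1 : R))) (is_derive_cst b t (1 : R)).
 by apply: is_deriveEq; rewrite /GRing.scale /= mulr1 addr0.
apply: is_deriveEq (@is_derive1_comp _ cos _ _ _ _ (is_derive_cos _) d1).
by rewrite mulrC mulrN mulNr.
Qed.

Lemma is_derive_sinl (a b t : R) : is_derive t 1 (fun x => sin (a * x + b)) (a * cos (a * t + b)).
Proof.
have d1 : is_derive t (1 : R) (fun x : R => a * x + b) a.
 have := is_deriveD (is_deriveZ a (is_derive_id t (1 : R))) (is_derive_cst b t (1 : R)).
 by apply: is_deriveEq; rewrite /GRing.scale /= mulr1 addr0.
apply: is_deriveEq (@is_derive1_comp _ sin _ _ _ _ (is_derive_sin _) d1).
by rewrite mulrC.
Qed.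

(* A primitive of [ch (c - x) * cos (w x + b)]. *)
Lemma is_derive_chcos (c w b t : R) :
 is_derive t 1 (fun x => (1 + w ^+ 2)^-1 * (- shR (c - x) * cos (w * x + b) + w * chR (c - x) * sin (w * x + b)))
  (chR (c - t) * cos (w * t + b)).
Proof.
have [dc ds] := is_derive_chR_lin c t.
have dcos := is_derive_cosl w b t; have dsin := is_derive_sinl w b t.
have := is_deriveZ (1 + w ^+ 2)^-1 (is_deriveD (is_deriveM (is_deriveN ds) dcos)
  (is_deriveM (is_deriveZ w dc) dsin)).
apply: is_deriveEq; rewrite !fctE /GRing.scale /=.
rewrite (_ : w *: chR (c - t) = w * chR (c - t)) //.
have : 1 + w ^+ 2 != 0 by sign.
by move=> h; field.
Qed.

Lemma is_derive_cosprim (w b t : R) : w != 0 ->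
 is_derive t 1 (fun x => w^-1 * sin (w * x + b)) (cos (w * t + b)).
Proof.
move=> w0; apply: is_deriveEq (is_deriveZ w^-1 (is_derive_sinl w b t)).
by rewrite /GRing.scale /= mulrA mulVf ?mul1r.
Qed.

(** An integral over [0, T] is carried by an explicit primitive; the integrands are sums of cosines,
    possibly times ch. *)
Definition int0 (T : R) (f : R -> R) (v : R) : Prop :=
 exists F : R -> R, (forall t, is_derive t 1 F (f t)) /\ v = F T - F 0.

Lemma int0D T f g v w : int0 T f v -> int0 T g w -> int0 T (fun t => f t + g t) (v + w).
Proof.
move=> [F [dF ->]] [G [dG ->]]; exists (F + G); split; last by rewrite !fctE; ring.
by move=> t; apply: is_deriveD.
Qed.

Lemma int0Z T f v c : int0 T f v -> int0 T (fun t => c * f t) (c * v).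
Proof.
move=> [F [dF ->]]; exists (c *: F); split; last by rewrite !fctE /GRing.scale /=; ring.
by move=> t; apply: is_deriveZ.
Qed.

Lemma int0_sum T (n : nat) (f : nat -> R -> R) (v : nat -> R) :
 (forall d, (d < n)%N -> int0 T (f d) (v d)) ->
 int0 T (fun t => \sum_(d < n) f d t) (\sum_(d < n) v d).
Proof.
elim: n => [|n IH] h.
 rewrite big_ord0; exists (fun=> 0); split; last by rewrite subrr.
 move=> t; rewrite big_ord0; exact: is_derive_cst.
rewrite big_ord_recr /=; have -> : (fun t => \sum_(d < n.+1) f d t) = (fun t => \sum_(d < n) f d t + f n t).
 by apply/funext => t; rewrite big_ord_recr.
by apply: int0D; [apply: IH => d hd; apply: h; apply: leq_trans hd _|apply: h].
Qed.

Lemma int0_cst T c : int0 T (fun=> c) (c * T).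
Proof.
exists (fun t => c * t); split; last by rewrite mulr0 subr0.
move=> t; have := is_deriveZ c (is_derive_id t (1 : R)).
by rewrite /GRing.scale /= mulr1.
Qed.

Lemma int0_ge0 T f v : 0 <= T -> int0 T f v -> (forall t, 0 <= t <= T -> 0 <= f t) -> 0 <= v.
Proof.
move=> T0 [F [dF ->]] f0; rewrite subr_ge0.
by apply: (derive_ge0_le T0 (fun x _ => dF x)).
Qed.

Lemma int0_eq T f g v w : f =1 g -> v = w -> int0 T f v -> int0 T g w.
Proof. by move=> /funext -> ->. Qed.
Lemma cosD2pin (x : R) (n : nat) : cos (x + 2 * pi * n%:R) = cos x.
Proof.
elim: n => [|n IH]; first by rewrite mulr0 addr0.
have -> : x + 2 * pi * n.+1%:R = (x + 2 * pi * n%:R) + pi *+ 2 by rewrite -natr1 mulr2n; ring.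
by rewrite cosD2pi.
Qed.

Lemma sinD2pin (x : R) (n : nat) : sin (x + 2 * pi * n%:R) = sin x.
Proof.
elim: n => [|n IH]; first by rewrite mulr0 addr0.
have -> : x + 2 * pi * n.+1%:R = (x + 2 * pi * n%:R) + pi *+ 2 by rewrite -natr1 mulr2n; ring.
by rewrite sinD2pi.
Qed.

Lemma int0_cos T w b (n : nat) : w != 0 -> w * T = 2 * pi * n%:R ->
 int0 T (fun t => cos (w * t + b)) 0.
Proof.
move=> w0 e; exists (fun x => w^-1 * sin (w * x + b)); split.
 by move=> t; apply: is_derive_cosprim.
by rewrite mulr0 add0r e (addrC _ b) sinD2pin subrr.
Qed.

Lemma int0_cosN T w b (n : nat) : w != 0 -> w * T = - (2 * pi * n%:R) ->
 int0 T (fun t => cos (w * t + b)) 0.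
Proof.
move=> w0 e; apply: (@int0_eq _ (fun t => cos ((- w) * t + - b)) _ 0 0) => //.
 by move=> t; rewrite -cosN opprD mulNr !opprK.
by apply: (@int0_cos _ _ _ n); rewrite ?oppr_eq0 // mulNr e opprK.
Qed.

Lemma int0_chcos T w b (n : nat) : w * T = 2 * pi * n%:R ->
 int0 T (fun t => chR (T / 2 - t) * cos (w * t + b)) (2 * shR (T / 2) / (1 + w ^+ 2) * cos b).
Proof.
move=> e; eexists; split; first by move=> t; apply: is_derive_chcos.
rewrite /= mulr0 add0r subr0 e addrC -[in RHS](addrC b) cosD2pin sinD2pin.
have -> : T / 2 - T = - (T / 2) by field.
have -> : shR (- (T / 2)) = - shR (T / 2) by rewrite /shR opprK; ring.
have -> : chR (- (T / 2)) = chR (T / 2) by rewrite /chR opprK; ring.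
by ring.
Qed.

(** J times the Fejer kernel as the squared modulus of the sum of exp(i j x): this form shows that
    the kernel is nonnegative. *)
Lemma fejer_square (x : R) (J : nat) :
 (\sum_(j < J) cos (j%:R * x)) ^+ 2 + (\sum_(j < J) sin (j%:R * x)) ^+ 2 =
 \sum_(d < J) (if d == 0%N :> nat then J%:R else 2 * (J%:R - d%:R)) * cos (d%:R * x).
Proof.
have aux : forall K : nat, \sum_(d < K) (if d == 0%N :> nat then K%:R else 2 * (K%:R - d%:R)) * cos (d%:R * x) =
  - K%:R + 2 * \sum_(d < K) (K%:R - d%:R) * cos (d%:R * x).
 case=> [|K]; first by rewrite !big_ord0; ring.
 rewrite !big_ord_recl /= mul0r cos0 mulr1 subr0 mulr1 mulrDr addrA; congr (_ + _); first by ring.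
 by rewrite mulr_sumr; apply: eq_bigr => i _; rewrite mulrA.
rewrite aux; elim: J => [|J IH]; first by rewrite !big_ord0; ring.
rewrite !big_ord_recr /=.
set C := \sum_(j < J) cos _ in IH *; set S := \sum_(j < J) sin _ in IH *.
have -> : \sum_(d < J) (J.+1%:R - d%:R) * cos (d%:R * x) =
  \sum_(d < J) (J%:R - d%:R) * cos (d%:R * x) + C.
 by rewrite -big_split /=; apply: eq_bigr => i _; rewrite -natr1; ring.
have -> : (C + cos (J%:R * x)) ^+ 2 + (S + sin (J%:R * x)) ^+ 2 =
 (C ^+ 2 + S ^+ 2) + (cos (J%:R * x) ^+ 2 + sin (J%:R * x) ^+ 2) +
 2 * (C * cos (J%:R * x) + S * sin (J%:R * x)) by ring.
rewrite IH cos2Dsin2.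
have -> : C * cos (J%:R * x) + S * sin (J%:R * x) = \sum_(d < J) cos (d.+1%:R * x).
 rewrite !mulr_suml -big_split (reindex_inj rev_ord_inj) /=; apply: eq_bigr => i _.
 rewrite -cosB -cosN; congr cos; have := ltn_ord i => hi.
 have -> : (J%:R : R) = (J - i.+1)%:R + i.+1%:R by rewrite -natrD subnK.
 by ring.
have eC : C + cos (J%:R * x) = 1 + \sum_(d < J) cos (d.+1%:R * x).
 have -> : C + cos (J%:R * x) = \sum_(j < J.+1) cos (j%:R * x) by rewrite big_ord_recr.
 by rewrite big_ord_recl mul0r cos0.
have -> : \sum_(d < J) cos (d.+1%:R * x) = C + cos (J%:R * x) - 1 by rewrite eC; ring.
by rewrite -natr1; ring.
Qed.

(** sin y >= y - y^3/6, and y^2 <= 4. *)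
Lemma sin_lower (y : R) : 0 <= y <= 2 -> y / 3 <= sin y.
Proof.
move=> /andP[y0 y2].
have f1 x : 0 <= x -> sin x <= x.
 move=> x0; have := @derive_ge0_le R (id - sin) (fun t => 1 - cos t) 0 x x0.
 rewrite !fctE sin0 subr0 subr_ge0; apply.
 by move=> t _; rewrite subr_ge0 cos_le1.
have f2 x : 0 <= x -> 1 - x ^+ 2 / 2 <= cos x.
 move=> x0.
 have := @derive_ge0_le R (cos + (fun t => 2^-1 * t ^+ 2)) (fun t => - sin t + 2^-1 * 2%:R * t ^+ 1) 0 x x0.
 rewrite !fctE cos0 expr0n mulr0 addr0 => h.
 have : 1 <= cos x + 2^-1 * x ^+ 2; last by lra.
 apply: h => t /andP[t0 _]; first exact: (is_deriveD (is_derive_cos t) (is_derive_monomial 2^-1 1 t)).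
 by rewrite mulVf // mul1r expr1; have := f1 _ t0; lra.
have := @derive_ge0_le R (sin + (fun t => - 1 * t ^+ 1) + (fun t => 6^-1 * t ^+ 3))
  (fun t => (cos t + - 1 * 1%:R * t ^+ 0) + 6^-1 * 3%:R * t ^+ 2) 0 y y0.
rewrite !fctE sin0 !expr0n !mulr0 !addr0 => h.
have : 0 <= sin y + -1 * y ^+ 1 + 6^-1 * y ^+ 3.
 apply: h => t /andP[t0 _].
  exact: (is_deriveD (is_deriveD (is_derive_sin t) (is_derive_monomial (-1) 0 t)) (is_derive_monomial 6^-1 2 t)).
 by have := f2 _ t0; rewrite expr0; lra.
rewrite expr1 exprS.
have : y * y ^+ 2 <= y * 4 by apply: ler_wpM2l => //; nra.
lra.
Qed.

Lemma powR_decr_step (a x h : R) : 0 < a -> 0 < x -> 0 < h ->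
 a * h * (x + h) `^ (- a - 1) <= x `^ (- a) - (x + h) `^ (- a).
Proof.
move=> a0 x0 h0.
have [|||c] := @MVT_segment R (fun t => t `^ (- a)) (fun t => - a * t `^ (- a - 1)) x (x + h).
- by rewrite lerDl ltW.
- by move=> t; rewrite in_itv => /andP[xt _]; apply: is_derive1_powR; apply: lt_trans xt.
- apply: derivable_within_continuous => t; rewrite in_itv /= => /andP[xt _].
 by have [] := is_derive1_powR (- a) (lt_le_trans x0 xt).
rewrite in_itv /= => /andP[xc cx] e.
have -> : x `^ (- a) - (x + h) `^ (- a) = a * h * c `^ (- a - 1) by rewrite -opprB e addrAC subrr add0r; ring.
rewrite ler_pM2l /1/ -opprD !powRN lef_pV2 ?posrE ?powR_gt0; try (clear -x0 xc cx; lra).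
by rewrite ge0_ler_powR ?nnegrE; clear -a0 x0 xc cx; lra.
Qed.

(** A Riemann sum of step h for the convergent integral of sqrt(3 + v)/(1 + v^2): the bound survives
    when the period 2 pi/h grows. *)
Lemma kernel_weight_sum (h : R) (J : nat) : 0 < h <= 1 ->
 \sum_(d < J) h * Num.sqrt (3 + d%:R * h) / (1 + (d%:R * h) ^+ 2) <= 24.
Proof.
move=> /andP[h0 h1].
have st (v : R) : 0 <= v -> Num.sqrt (3 + v) / (1 + v ^+ 2) <= 4 * (1 + v) `^ (- 2^-1 - 1).
 move=> v0; have p : 0 < 1 + v by lra.
 have s1 : Num.sqrt (3 + v) <= 2 * Num.sqrt (1 + v).
  rewrite -(@ler_pXn2r _ 2) /1/ exprMn !sqr_sqrtr; lra.
 have s2 : (1 + v ^+ 2)^-1 <= 2 * (1 + v) `^ (- 2).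
  rewrite powRN powR_mulrn /1/ -[leRHS]invf_div.
  by rewrite lef_pV2 /1/; have := sqr_ge0 (1 - v); nra.
 have i0 : 0 <= (1 + v ^+ 2)^-1 by sign.
 via (2 * Num.sqrt (1 + v) * (2 * (1 + v) `^ (- 2))).
  by apply: ler_pM; rewrite ?sqrtr_ge0.
 rewrite -powR12_sqrt /1/.
 have -> : 2 * (1 + v) `^ 2^-1 * (2 * (1 + v) `^ (-2)) = 4 * ((1 + v) `^ 2^-1 * (1 + v) `^ (-2)) by ring.
 rewrite -powRD; last by apply/implyP => _; rewrite gt_eqF.
 by rewrite (_ : 2^-1 - 2 = - 2^-1 - 1 :> R); lra.
have half : 0 < (2^-1 : R) by sign.
have tele : forall K : nat, \sum_(d < K) h * (1 + d.+1%:R * h) `^ (- 2^-1 - 1) <= 2 * (1 - (1 + K%:R * h) `^ (- 2^-1)).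
 elim=> [|K IH]; first by rewrite big_ord0 mul0r addr0 powR1 subrr mulr0.
 rewrite big_ord_recr /=.
 have x0 : 0 < 1 + K%:R * h by sign.
 have := powR_decr_step half x0 h0.
 have -> : 1 + K%:R * h + h = 1 + K.+1%:R * h by rewrite -natr1; ring.
 lra.
case: J => [|J]; first by rewrite big_ord0.
rewrite big_ord_recl /= mul0r.
have t0 : h * Num.sqrt (3 + 0) / (1 + 0 ^+ 2) <= 4.
 have e1 : (1 + 0 : R) `^ (- 2^-1 - 1) = 1 by rewrite addr0 powR1.
 have := st 0 (lexx 0); rewrite e1 mulr1 -mulrA => hh.
 have := ler_pM (ltW h0) _ h1 hh; rewrite mul1r; apply.
 by sign.
have rest : \sum_(i < J) h * Num.sqrt (3 + (bump 0 i)%:R * h) / (1 + ((bump 0 i)%:R * h) ^+ 2) <=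
  4 * (2 * (1 - (1 + J%:R * h) `^ (- 2^-1))).
 apply: le_trans (ler_wpM2l _ (tele J)) => //; rewrite mulr_sumr; apply: ler_sum => i _.
 have -> : bump 0 i = i.+1 by [].
 rewrite -mulrA [leRHS]mulrCA ler_wpM2l /1/; apply: st.
 by sign.
have := powR_ge0 (1 + J%:R * h) (- 2^-1); lra.
Qed.

Lemma chR_lip (c t x T : R) : 0 <= T -> `|c| <= T -> 0 <= t <= T -> 0 <= x <= T ->
 `|chR (c - t) - chR (c - x)| <= expR (2 * T) * `|t - x|.
Proof.
move=> T0 cT ht hx.
wlog xt : t x ht hx / x <= t.
 move=> H; have [tx|/ltW xt] := leP t x; last exact: H.
 by rewrite distrC (distrC t); apply: H.
have [||d] := @MVT_segment R (fun s => chR (c - s)) (fun s => - shR (c - s)) x t xt.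
- by move=> s _; have [] := is_derive_chR_lin c s.
- apply: derivable_within_continuous => s _; by have [[]] := is_derive_chR_lin c s.
rewrite in_itv /= => /andP[xd dt] ->.
rewrite normrM ler_wpM2r /1/ normrN /shR normrM (ger0_norm (_ : 0 <= 2^-1)) /1/.
have b : `|c - d| <= 2 * T.
 triB; rewrite (ger0_norm (_ : 0 <= d)); last by lra.
 lra.
rewrite ler_pdivrMr //; triB.
rewrite !ger0_norm /1/.
have : expR (c - d) <= expR (2 * T) by rewrite ler_expR; move: b; rewrite ler_norml; lra.
have : expR (- (c - d)) <= expR (2 * T) by rewrite ler_expR; move: b; rewrite ler_norml; lra.
lra.
Qed.

Lemma oneBcos_lower (y : R) : 0 <= y <= pi -> y ^+ 2 / 18 <= 1 - cos y.
Proof.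
move=> /andP[y0 yp].
have : y / 2 / 3 <= sin (y / 2).
 apply: sin_lower; have /andP[_ p2] := pihalf_02 R; apply/andP; split; lra.
move=> h; have -> : cos y = 1 - 2 * sin (y / 2) ^+ 2.
 rewrite {1}(_ : y = y / 2 + y / 2) ?cosD; last by field.
 by have := cos2Dsin2 (y / 2) => e; rewrite -!expr2; lra.
have : (y / 2 / 3) ^+ 2 <= sin (y / 2) ^+ 2 by apply: lerXn2r => //; rewrite nnegrE; lra.
have -> : (y / 2 / 3) ^+ 2 = y ^+ 2 / 36 by field.
lra.
Qed.

(* Fejer's theorem for the T-periodic extension of ch(T/2 - x). *)
Lemma fejer_ch (T e : R) : 0 < T -> 0 < e -> exists J0 : nat, forall J, (J0 <= J)%N ->
 forall x, 0 <= x <= T -> let h := 2 * pi / T in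
 `|chR (T / 2 - x) - \sum_(d < J) (if d == 0%N :> nat then 1 else 2 * (1 - d%:R / J%:R)) *
   (2 * shR (T / 2) / T / (1 + (d%:R * h) ^+ 2)) * cos (d%:R * h * x)| <= e.
Proof.
move=> T0 e0.
have pi0 := pi_gt0 R.
set L := expR (2 * T); have L0 : 0 < L by sign.
set h := 2 * pi / T; have h0 : 0 < h by sign.
(* C turns AM-GM, L s <= e/2 + (L s)^2/(2 e), into a bound by 1 - cos(h s) >= (h s)^2/18. *)
set C := 18 * (L / h) ^+ 2 / (4 * (e / 2)).
have C0 : 0 < C.
 rewrite /C; apply: divr_gt0; first by sign.
 by sign.
have [J1 hJ1] := exists_nat_gt (C / (e / 2)).
exists (maxn J1 2) => J; rewrite geq_max => /andP[JJ J2] x /andP[x0 xT] /=.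
have Jp : 0 < (J%:R : R) by rewrite ltr0n (leq_trans _ J2).
have CJ : C / J%:R <= e / 2.
 rewrite ler_pdivrMr // mulrC -ler_pdivrMr; last by lra.
 by apply: ltW; apply: lt_le_trans hJ1 _; rewrite ler_nat.
pose G t := chR (T / 2 - t).
pose a (d : nat) : R := if d == 0%N :> nat then 1 else 2 * (1 - d%:R / J%:R).
pose K t := \sum_(d < J) a d * cos (d%:R * h * t + - (d%:R * h * x)).
have K0 t : 0 <= K t.
 have := fejer_square (h * t - h * x) J => E.
 have -> : K t = J%:R^-1 * ((\sum_(j < J) cos (j%:R * (h * t - h * x))) ^+ 2 +
   (\sum_(j < J) sin (j%:R * (h * t - h * x))) ^+ 2).
  rewrite E mulr_sumr; apply: eq_bigr => d _; rewrite [RHS]mulrA.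
  have -> : d%:R * h * t + - (d%:R * h * x) = d%:R * (h * t - h * x) by ring.
  congr (_ * _).
  by rewrite /a; case: eqP => _; field; rewrite gt_eqF.
 by sign.
(* the chord distance on the circle controls G *)
have key t : 0 <= t <= T -> `|G t - G x| <= e / 2 + C * (1 - cos (h * t + - (h * x))).
 move=> /andP[t0 tT].
 have [s [s0 sT hs cs]] : exists s, [/\ 0 <= s, s <= T / 2, `|G t - G x| <= L * s &
   cos (h * t + - (h * x)) = cos (h * s)].
  have lip y z' : 0 <= y <= T -> 0 <= z' <= T -> `|G y - G z'| <= L * `|y - z'|.
   by move=> hy hz; apply: chR_lip => //; rewrite ?ger0_norm; clear -t0 tT; lra.
  have hT : h * T = 2 * pi * 1%:R by rewrite /h mulr1; field; rewrite gt_eqF.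
  have [small|big] := leP `|t - x| (T / 2).
   exists `|t - x|; split => //; first by apply: lip; rewrite ?t0 ?x0.
   have [tx|xt] := leP x t.
    by rewrite ger0_norm ?subr_ge0 // mulrBr.
   by rewrite ltr0_norm ?subr_lt0 // opprB -cosN; congr cos; ring.
  have GT : G T = G 0.
   rewrite /G /chR subr0 (_ : T / 2 - T = - (T / 2)); last by field.
   by rewrite opprK addrC.
  exists (T - `|t - x|); split.
  - by rewrite subr_ge0 ler_norml; clear -x0 xT t0 tT; lra.
  - by clear -big; lra.
  - have [tx|xt] := leP x t.
    have -> : G t - G x = (G t - G T) + (G 0 - G x) by rewrite GT; ring.
    triD.
    have := lip t T; have := lip 0 x; rewrite t0 x0 tT xT !lexx (ltW T0) /=.
    move=> /(_ isT isT) h1 /(_ isT isT) h2; move: h1 h2.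
    rewrite sub0r normrN (ger0_norm x0) (ler0_norm (_ : t - T <= 0)) ?subr_le0 //.
    rewrite (ger0_norm (_ : 0 <= t - x)) ?subr_ge0 // !mulrBr opprB mulrBr; clear; lra.
   have -> : G t - G x = (G t - G 0) + (G T - G x) by rewrite GT; ring.
   triD.
   have := lip t 0; have := lip T x; rewrite t0 x0 tT xT !lexx (ltW T0) /=.
   move=> /(_ isT isT) h1 /(_ isT isT) h2; move: h1 h2.
   rewrite subr0 (ger0_norm t0) (ger0_norm (_ : 0 <= T - x)) ?subr_ge0 //.
   rewrite (ler0_norm (_ : t - x <= 0)) ?subr_le0 ?(ltW xt) // opprB !mulrBr; clear; lra.
  - have [tx|xt] := leP x t.
    rewrite (ger0_norm (_ : 0 <= t - x)) ?subr_ge0 //.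
    rewrite -cosN -(cosD2pin _ 1) -hT; congr cos; ring.
   rewrite (ler0_norm (_ : t - x <= 0)) ?subr_le0 ?(ltW xt) //.
   by rewrite -(cosD2pin _ 1) -hT; congr cos; ring.
 rewrite cs; apply: le_trans hs _.
 have hsp : 0 <= h * s <= pi.
  rewrite mulr_ge0 ?(ltW h0) //=; have -> : pi = h * (T / 2) by rewrite /h; field; rewrite gt_eqF.
  by rewrite ler_pM2l.
 have := oneBcos_lower hsp => hc.
 have hb : C * ((h * s) ^+ 2 / 18) <= C * (1 - cos (h * s)) by rewrite ler_pM2l.
 apply: le_trans (lerD (lexx _) hb).
 have -> : C * ((h * s) ^+ 2 / 18) = (L * s) ^+ 2 / (4 * (e / 2)) by rewrite /C; field; rewrite !gt_eqF.
 have e2 : 0 < e / 2 by clear -e0; lra.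
 rewrite -subr_ge0.
 have -> : e / 2 + (L * s) ^+ 2 / (4 * (e / 2)) - L * s = (e / 2 - L * s / 2) ^+ 2 / (e / 2) by field; rewrite gt_eqF.
 by sign.
have wT (d : nat) : d%:R * h * T = 2 * pi * d%:R by rewrite /h; field; rewrite gt_eqF.
have hn0 (d : nat) : (0 < d)%N -> d%:R * h != 0 by move=> d0; rewrite mulf_neq0 ?pnatr_eq0 -?lt0n // gt_eqF.
set S := \sum_(d < J) _.
have IG : int0 T (fun t => G t * K t) (T * S).
 apply: int0_eq (int0_sum (n := J) (f := fun d t => a d * (G t * cos (d%:R * h * t + - (d%:R * h * x))))
   (v := fun d => a d * (2 * shR (T / 2) / (1 + (d%:R * h) ^+ 2) * cos (- (d%:R * h * x)))) _).
 - by move=> t; rewrite /K mulr_sumr; apply: eq_bigr => d _; ring.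
 - rewrite /S mulr_sumr; apply: eq_bigr => d _; rewrite cosN -/(a d).
  have : 1 + (d%:R * h) ^+ 2 != 0 by sign.
  by move=> n1; field; rewrite n1 gt_eqF.
 - by move=> d _; apply: int0Z; apply: int0_chcos.
have IK : int0 T K T.
 apply: int0_eq (int0_sum (n := J) (f := fun d t => a d * cos (d%:R * h * t + - (d%:R * h * x)))
   (v := fun d => if d == 0%N then T else 0) _).
 - by move=> t.
 - rewrite (bigD1 (Ordinal (leq_trans (isT : (0 < 2)%N) J2))) //= big1 ?addr0 // => d hd.
  by case: eqP => // e1; move/eqP: hd; case; apply: val_inj.
 - move=> d _; case: eqP => [->|/eqP d0].
   apply: int0_eq (int0_cst T 1) => [t|]; last by rewrite mul1r.
   by rewrite /a eqxx !mul0r oppr0 addr0 cos0 mulr1.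
  rewrite -[X in int0 _ _ X](mulr0 (a d)); apply: int0Z; apply: (@int0_cos _ _ _ d) => //.
  by apply: hn0; rewrite lt0n.
(* Compared with [IK], the kernel's mean of 1 - cos is exactly 1/J, which tends to 0. *)
have IKc : int0 T (fun t => cos (h * t + - (h * x)) * K t) (T * (1 - J%:R^-1)).
 apply: int0_eq (int0_sum (n := J) (f := fun d t => a d / 2 * (cos ((d%:R + 1) * h * t + - ((d%:R + 1) * h * x)) +
   cos ((d%:R - 1) * h * t + - ((d%:R - 1) * h * x))))
   (v := fun d => if d == 1%N then T * (1 - J%:R^-1) else 0) _).
 - move=> t; rewrite /K mulr_sumr; apply: eq_bigr => d _.
  set A := h * t + - (h * x); set B := d%:R * h * t + - (d%:R * h * x).
  have -> : (d%:R + 1) * h * t + - ((d%:R + 1) * h * x) = B + A by rewrite /A /B; ring.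
  have -> : (d%:R - 1) * h * t + - ((d%:R - 1) * h * x) = B - A by rewrite /A /B; ring.
  by rewrite (cosD B A) (cosB B A); move: (cos A) (cos B) (sin A) (sin B) => *; field.
 - rewrite (bigD1 (Ordinal J2)) //= big1 ?addr0 // => d hd.
  by case: eqP => // e1; move/eqP: hd; case; apply: val_inj.
 - move=> d _.
  have I1 : int0 T (fun t => cos ((d%:R + 1) * h * t + - ((d%:R + 1) * h * x))) 0.
   rewrite natr1; apply: (@int0_cos _ _ _ d.+1) => //; exact: hn0.
  have I2 : d != 1%N -> int0 T (fun t => cos ((d%:R - 1) * h * t + - ((d%:R - 1) * h * x))) 0.
   case: (d) => [|[//|d'] _].
    move=> _; apply: (@int0_cosN _ _ _ 1); last by rewrite sub0r mulN1r mulNr /h mulr1; field; rewrite gt_eqF.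
    by rewrite sub0r mulN1r oppr_eq0 gt_eqF.
   rewrite -natr1 addrK; apply: (@int0_cos _ _ _ d'.+1) => //; exact: hn0.
  case: eqP => [d1|/eqP d1].
   have -> : T * (1 - J%:R^-1) = a d / 2 * (0 + T) by rewrite d1 /a /= add0r; field; rewrite gt_eqF.
   apply: int0Z; apply: int0D => //; rewrite d1 subrr.
   apply: int0_eq (int0_cst T 1) => [t|]; last by rewrite mul1r.
   by rewrite !mul0r oppr0 addr0 cos0.
  rewrite -[X in int0 _ _ X](mulr0 (a d / 2)); apply: int0Z.
  by rewrite -[X in int0 _ _ X](addr0 0); apply: int0D => //; apply: I2.
have main (sg : R) : `|sg| <= 1 -> sg * (T * S - G x * T) <= (e / 2) * T + C * (T - T * (1 - J%:R^-1)).
 move=> hsg; rewrite -subr_ge0.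
 have I := int0D (int0D (int0Z (e / 2) IK) (int0Z C (int0D IK (int0Z (-1) IKc))))
   (int0Z (- sg) (int0D IG (int0Z (- G x) IK))).
 have := int0_ge0 (ltW T0) I.
 have -> : e / 2 * T + C * (T + -1 * (T * (1 - J%:R^-1))) + - sg * (T * S + - G x * T) =
   e / 2 * T + C * (T - T * (1 - J%:R^-1)) - sg * (T * S - G x * T) by ring.
 apply=> t ht.
 have -> : e / 2 * K t + C * (K t + -1 * (cos (h * t + - (h * x)) * K t)) + - sg * (G t * K t + - G x * K t) =
  (e / 2 + C * (1 - cos (h * t + - (h * x))) - sg * (G t - G x)) * K t by ring.
 rewrite mulr_ge0 // subr_ge0; apply: le_trans (key t ht); apply: le_trans (ler_norm _) _.
 by rewrite normrM ler_piMl.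
have bound : (e / 2) * T + C * (T - T * (1 - J%:R^-1)) <= e * T.
 have -> : C * (T - T * (1 - J%:R^-1)) = C / J%:R * T by ring.
 have := ler_wpM2r (ltW T0) CJ; clear; lra.
have p1 := main 1; have p2 := main (-1); rewrite normr1 in p1; rewrite normrN1 in p2.
have {}p1 := p1 (lexx _); have {}p2 := p2 (lexx _).
rewrite -/(G x) ler_norml; apply/andP; split; rewrite -(ler_pM2r T0); clear -bound p1 p2; lra.
Qed.

(** On |t| <= A the function exp(-|t|) is close to ch(c - |t|)/sh c, whose periodic extension has
    positive Fourier coefficients. Its Fejer means have nonnegative weights, and their total against
    sqrt(3 + |u|) is bounded independently of A and d; on this uniformity the smoothing argument
    rests. *)
Lemma kernel_approx : exists C0 : R, 0 < C0 /\ forall A d : R, 0 < A -> 0 < d ->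
 exists (J : nat) (w u : nat -> R), [/\ forall i, (i < J)%N -> 0 <= w i,
  \sum_(i < J) w i * Num.sqrt (3 + `|u i|) <= C0 &
  forall t, `|t| <= A -> `|expR (- `|t|) - \sum_(i < J) w i * cos (u i * t)| <= d].
Proof.
exists 24; split; first exact: ltr0Sn.
(* The term |log(4/d)| makes exp(A - c) <= d/4, and c >= 4 makes the frequency step h = pi/c at most
   1. *)
move=> A d A0 d0; set c := 4 + A + `|ln (4 / d)|; set T := 2 * c.
have nl := normr_ge0 (ln (4 / d)).
have c4 : 4 <= c by rewrite /c; lra.
have T0 : 0 < T by rewrite /T; lra.
have cT : T / 2 = c by rewrite /T; field.
have pi0 := pi_gt0 R; have /andP[_ pi4] := pihalf_02 R.
have pi2 : 2 <= pi :> R by apply: pi_ge2.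
have sh1 : 2^-1 <= shR c.
 have := expR_ge1Dx c; have : expR (- c) <= 1 by rewrite expR_le1; lra.
 by rewrite /shR; lra.
have sh0 : 0 < shR c by lra.
have e0 : 0 < d / 2 * shR c by sign.
have [J0 H] := fejer_ch T0 e0; rewrite cT in H.
set J := J0.+1; have {}H := H J (leqnSn _).
set h := 2 * pi / T; have h0 : 0 < h by sign.
have h1 : h <= 1 by rewrite ler_pdivrMr // mul1r /T; clear -c4 pi4; lra.
pose a (i : nat) : R := if i == 0%N then 1 else 2 * (1 - i%:R / J%:R).
have a02 i : (i < J)%N -> 0 <= a i <= 2.
 move=> iJ; rewrite /a; case: eqP => _; first by rewrite ler01 ler1n.
 have : 0 <= i%:R / J%:R :> R by sign.
 have : i%:R / J%:R <= 1 :> R by rewrite ler_pdivrMr // mul1r ler_nat ltnW.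
 move=> q1 q2; apply/andP; split; lra.
pose w i := a i * (2 / T / (1 + (i%:R * h) ^+ 2)).
have den i : 0 < 1 + (i%:R * h) ^+ 2 by sign.
exists J, w, (fun i => i%:R * h); split.
- by move=> i iJ; rewrite /w; have /andP[q _] := a02 i iJ; rewrite mulr_ge0 // !divr_ge0 // ltW.
- apply: le_trans (kernel_weight_sum J (_ : 0 < h <= 1)); last by rewrite h0.
 apply: ler_sum => i _; rewrite (ger0_norm (_ : 0 <= i%:R * h)); last by sign.
 rewrite mulrAC; have /andP[q1 q2] := a02 i (ltn_ord i).
 rewrite /w mulrAC -mulrA; set s := Num.sqrt _.
 have s0 : 0 <= s / (1 + (i%:R * h) ^+ 2) by sign.
 rewrite [leLHS](_ : _ = a i * (2 / T) * (s / (1 + (i%:R * h) ^+ 2))); last by ring.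
 rewrite [leRHS](_ : _ = h * (s / (1 + (i%:R * h) ^+ 2))); last by ring.
 rewrite ler_wpM2r //; have -> : 2 / T = h / pi by rewrite /h mulrAC mulfK // gt_eqF.
 rewrite mulrA ler_pdivrMr // mulrC ler_pM2l; clear -pi2 h0 q2; lra.
- move=> t tA; set x := `|t|; have x0 : 0 <= x by sign.
 have xT : x <= T by rewrite /x /T /c; clear -A0 nl tA; lra.
 have hx : 0 <= x <= T by rewrite x0.
 have {H} := H x hx; rewrite /= -/h => H.
 have -> : \sum_(i < J) w i * cos (i%:R * h * t) = (\sum_(i < J) (if i == 0%N :> nat then 1 else 2 * (1 - i%:R / J%:R)) *
    (2 * shR c / T / (1 + (i%:R * h) ^+ 2)) * cos (i%:R * h * x)) / shR c.
  rewrite mulr_suml; apply: eq_bigr => i _; rewrite -/(a i) /w.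
  have -> : cos (i%:R * h * t) = cos (i%:R * h * x).
   rewrite /x; case: (leP 0 t) => ht; first by rewrite ger0_norm.
   by rewrite ltr0_norm // mulrN cosN.
  by field; rewrite !gt_eqF.
 set S := \sum_(i < J) _ in H *.
 have h2 : `|chR (c - x) / shR c - S / shR c| <= d / 2 by rewrite -mulrBl normrM normfV (ger0_norm (ltW sh0)) ler_pdivrMr.
 have h3 : `|expR (- x) - chR (c - x) / shR c| <= d / 2.
  have -> : expR (- x) - chR (c - x) / shR c = - ((expR (x - c) + expR (- x - c)) / 2 / shR c).
   have num : expR (- x) * shR c - chR (c - x) = - ((expR (x - c) + expR (- x - c)) / 2).
    by rewrite /chR /shR opprB !expRD !expRN; field; rewrite !gt_eqF ?expR_gt0.
   by rewrite -{1}(mulfK (lt0r_neq0 sh0) (expR (- x))) -mulrBl num mulNr.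
  rewrite normrN ger0_norm; last first.
   apply: divr_ge0; last exact: ltW.
   by sign.
  have b1 : expR (x - c) <= d / 4.
   have -> : d / 4 = expR (- ln (4 / d)) by rewrite expRN lnK /1/ invf_div.
   rewrite ler_expR /c; have := ler_norm (ln (4 / d)); rewrite /x; clear -tA; lra.
  have b2 : expR (- x - c) <= d / 4 by apply: le_trans b1; rewrite ler_expR; lra.
  rewrite ler_pdivrMr //; have : d / 2 * 2^-1 <= d / 2 * shR c by rewrite ler_pM2l; clear -d0 sh1; lra.
  clear -b1 b2; lra.
 have -> : expR (- x) - S / shR c = (expR (- x) - chR (c - x) / shR c) + (chR (c - x) / shR c - S / shR c) by ring.
 triD; clear -h2 h3; lra.
Qed.
End FourierKernel.

(** * Smoothed sums of Lambda - 1 and Chebyshev's bounds *)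

Section Chebyshev.
Variable R : realType.
Implicit Types (m n N : nat).

(* n^{-1} e^{-|log n - log m|} *)
Definition Ek m n : R := n%:R^-1 * expR (- `|ln (n%:R : R) - ln m%:R|).

Lemma EkE m n : (0 < m)%N -> (0 < n)%N ->
 Ek m n = if (n <= m)%N then m%:R^-1 else m%:R / n%:R ^+ 2.
Proof.
move=> m0 n0; rewrite /Ek.
have [mp np] : 0 < (m%:R : R) /\ 0 < (n%:R : R) by rewrite !ltr0n.
case: leqP => h.
 have : ln (n%:R : R) <= ln m%:R by rewrite ler_ln /1/ ler_nat.
 rewrite -subr_le0 => hh; rewrite ler0_norm /1/ opprK expRD lnK /1/ expRN lnK /1/.
 by rewrite mulrA mulVf ?mul1r // gt_eqF.
have : ln (m%:R : R) <= ln n%:R by rewrite ler_ln /1/ ler_nat ltnW.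
rewrite -subr_ge0 => hh; rewrite ger0_norm /1/ opprB expRD lnK /1/ expRN lnK /1/.
by rewrite expr2 invfM mulrCA.
Qed.

Lemma Ek0 m : Ek m 0 = 0.
Proof. by rewrite /Ek invr0 mul0r. Qed.
Lemma Ek_ge0 m n : 0 <= Ek m n.
Proof. by rewrite mulr_ge0. Qed.
Lemma Ek_le m n : (0 < m)%N -> (0 < n)%N -> Ek m n <= m%:R / n%:R ^+ 2.
Proof.
move=> m0 n0; rewrite EkE //; case: leqP => // h.
have [mp np] : 0 < (m%:R : R) /\ 0 < (n%:R : R) by rewrite !ltr0n.
rewrite ler_pdivlMr /1/ mulrC ler_pdivrMr /1/ -expr2.
by apply: lerXn2r; rewrite ?nnegrE ?ler_nat.
Qed.

Definition cn n : R := vM R n - 1.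

Lemma cn_abs n : `|cn n| <= 1 + ln n%:R.
Proof.
rewrite /cn; triB; rewrite normr1 ger0_norm ?vM_ge0 //.
by rewrite addrC lerD2l vM_le_ln.
Qed.

Lemma Re_twist (a u v : R) n :
 Re (cexp (Complex 0 (u * v)) * ez (Complex a u) n) =
 expR (- (ln n%:R * a)) * cos (u * (ln n%:R - v)).
Proof.
rewrite /ez -cexpD.
have -> : Complex 0 (u * v) + - ((ln n%:R)%:c * Complex a u) =
  Complex (- (ln n%:R * a)) (- (u * (ln n%:R - v))).
 by apply: complex_eqP; rewrite /=; ring.
by rewrite /cexp cosN.
Qed.

Definition an (a : R) n : R := cn n * ln n%:R / n%:R * expR (- (ln n%:R * a)).

Lemma an_sum_cos : exists C : R, 0 < C /\ forall a u v : R, 0 < a <= 1 ->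
 exists s : R, `|s| <= C * Num.sqrt (3 + `|u|) /\ forall e : R, 0 < e -> exists N0 : nat,
  forall N, (N0 <= N)%N -> `|\sum_(n < N) an a n * cos (u * (ln n%:R - v)) - s| < e.
Proof.
have [C [C0 h]] := mangoldt_series_bound R; exists C; split => // a u v a01.
have [D [hD bD]] := h a u a01.
set r := cexp (Complex 0 (u * v)).
have r1 : cabs r = 1 by rewrite cabs_cexp expR0.
exists (Re (r * D)); split.
 by apply: le_trans (ler_Re_cabs _) _; rewrite cabsM r1 mul1r.
move=> e e0; have [N0 H] := cserZ r hD e0; exists N0 => N /H.
apply: le_lt_trans; apply: le_trans (ler_Re_cabs _); rewrite ReD ReN Re_sum.
rewrite [X in _ <= `|X - _|](eq_bigr (fun n : 'I_N => an a n * cos (u * (ln n%:R - v)))) //.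
by move=> n _; rewrite mulrCA Re_realM Re_twist /an /cn; ring.
Qed.

Lemma an_abs_tail (a : R) : 0 < a <= 1 -> exists N0 : nat, forall N M, (N0 <= N)%N ->
 \sum_(N <= n < M) `|an a n| <= 1.
Proof.
move=> /andP[a0 a1].
have s1 := summable_tail (@zterm_summable R 1 (Complex a 0) isT a0) (_ : 0 < 2^-1).
have s2 := summable_tail (@zterm_summable R 2 (Complex a 0) isT a0) (_ : 0 < 2^-1).
have hh : 0 < 2^-1 :> R by sign.
have [N1 H1] := s1 hh; have [N2 H2] := s2 hh.
exists (maxn N1 N2) => N M; rewrite geq_max => /andP[n1 n2].
have := ltW (H1 N M n1); have := ltW (H2 N M n2) => q2 q1.
have : \sum_(N <= n < M) `|an a n| <= \sum_(N <= n < M) cabs (zterm 1 (Complex a 0) n) +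
 \sum_(N <= n < M) cabs (zterm 2 (Complex a 0) n).
 rewrite -big_split; apply: ler_sum => n _; rewrite !cabs_zterm /=.
 have l0 := ln_natr_ge0 R n.
 rewrite /an !normrM (ger0_norm l0) (ger0_norm (expR_ge0 _)) (ger0_norm (_ : 0 <= n%:R^-1)) /1/.
 rewrite -mulrDl ler_wpM2r /1/ -mulrDl ler_wpM2r /1/ expr1 expr2.
 by step (ler_wpM2r l0 (cn_abs n)); rewrite mulrDl mul1r.
lra.
Qed.

Lemma an_Ek_bound : exists C : R, 0 < C /\ forall (a : R) m, 0 < a <= 1 -> (0 < m)%N ->
 exists N0 : nat, forall N, (N0 <= N)%N ->
 `|\sum_(n < N) cn n * ln n%:R * Ek m n * expR (- (ln n%:R * a))| <= C.
Proof.
have [C1 [C10 hC]] := an_sum_cos; have [C0 [C00 hK]] := kernel_approx R.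
exists (1 + C0 * (C1 + 2)); split; first by sign.
move=> a m a01 m0; have [N0 hN0] := an_abs_tail a01; exists N0 => N hN.
set v := ln (m%:R : R).
have eqE n : cn n * ln n%:R * Ek m n * expR (- (ln n%:R * a)) = an a n * expR (- `|ln n%:R - v|) by rewrite /an /Ek; ring.
rewrite (eq_bigr (fun n : 'I_N => an a n * expR (- `|ln n%:R - v|))); last by move=> n _; exact: eqE.
set B := \sum_(n < N) `|an a n|.
have B0 : 0 <= B by sign.
set A := 1 + ln (N%:R : R) + `|v|.
have A0 : 0 < A by sign.
(* The kernel is approximated within 1/(1 + B), B the sum of |an a n|, so this error contributes at
   most 1. *)
have d0 : 0 < (1 + B)^-1 by sign.
have [J [w [u [w0 wC wK]]]] := hK A _ A0 d0.
have sw : \sum_(i < J) w i <= C0.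
 apply: le_trans wC; apply: ler_sum => i _; rewrite ler_peMr ?w0 //.
 by rewrite -[leLHS]sqrtr1 ler_wsqrtr; have := normr_ge0 (u i); clear; lra.
have part (i : nat) : `|\sum_(n < N) an a n * cos (u i * (ln n%:R - v))| <= C1 * Num.sqrt (3 + `|u i|) + 2.
 have [s [sb hs]] := hC a (u i) v a01; have [N1 hN1] := hs 1 ltr01.
 have := hN1 (maxn N1 N) (leq_maxl _ _); set M := maxn N1 N.
 have NM : (N <= M)%N by apply: leq_maxr.
 have := hN0 N M hN; rewrite -!(big_mkord xpredT (fun n => an a n * cos (u i * (ln n%:R - v)))).
 rewrite [X in `|X - s|](big_cat_nat (n := N)) //=.
 set P := \sum_(0 <= n < N) _; set Q := \sum_(N <= n < M) _ * _ => ht hh.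
 have hQ : `|Q| <= 1.
  triS; apply: le_trans ht; apply: ler_sum => n _.
  by rewrite normrM ler_piMr // cos_max.
 have -> : P = (P + Q - s) + s - Q by ring.
 triB; apply: le_trans (lerD (ler_normD _ _) (lexx _)) _; clear -sb hh hQ; lra.
have -> : \sum_(n < N) an a n * expR (- `|ln n%:R - v|) =
 \sum_(n < N) an a n * (expR (- `|ln n%:R - v|) - \sum_(i < J) w i * cos (u i * (ln n%:R - v))) +
 \sum_(i < J) w i * \sum_(n < N) an a n * cos (u i * (ln n%:R - v)).
 rewrite [X in _ + X](eq_bigr (fun i : 'I_J => \sum_(n < N) an a n * (w i * cos (u i * (ln n%:R - v))))); last first.
  by move=> i _; rewrite mulr_sumr; apply: eq_bigr => n _; rewrite mulrCA.
 rewrite exchange_big -big_split /=; apply: eq_bigr => n _.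
 by rewrite -mulr_sumr -mulrDr subrK.
triD; apply: lerD.
 triS.
 via (\sum_(n < N) `|an a n| * (1 + B)^-1).
  apply: ler_sum => -[[|n] hn] _ /=.
   by rewrite /an invr0 !(mulr0, mul0r) normr0 mul0r.
  rewrite normrM ler_wpM2l // wK // /A.
  have l1 : ln (n.+1%:R : R) <= ln N%:R by rewrite ler_ln ?posrE ?ltr0n ?(leq_trans _ hn) // ler_nat ltnW.
  have l0 := ln_natr_ge0 R n.+1.
  by triB; rewrite ger0_norm; clear -l1 l0; lra.
 by rewrite -mulr_suml -/B ler_pdivrMr; clear -B0; lra.
triS.
via (\sum_(i < J) (C1 * (w i * Num.sqrt (3 + `|u i|)) + 2 * w i)).
 apply: ler_sum => i _; rewrite normrM (ger0_norm (w0 i (ltn_ord i))).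
 step (ler_wpM2l (w0 i (ltn_ord i)) (part i)).
 by apply: ler_of_eq; ring.
rewrite big_split /= -!mulr_sumr.
have := ler_wpM2l (ltW C10) wC; clear -sw; lra.
Qed.

Lemma sum_cn_tail m N M : (0 < m)%N -> (0 < N)%N ->
 \sum_(N <= n < M) `|cn n * ln n%:R * Ek m n| <= 48 * m%:R * (1 + ln N%:R) ^+ 2 / N%:R.
Proof.
move=> m0 N0.
via (\sum_(N <= n < M) m%:R * ((1 + ln n%:R) ^+ 2 / n%:R ^+ 2)).
 rewrite !big_seq; apply: ler_sum => n; rewrite mem_index_iota => /andP[hn _].
 have n0 : (0 < n)%N by apply: leq_trans hn.
 have l0 := ln_natr_ge0 R n.
 have := Ek_le m0 n0; have := Ek_ge0 m n; move: (Ek m n) => E E0 Ele.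
 rewrite !normrM (ger0_norm l0) (ger0_norm E0) [leRHS]mulrCA.
 apply: ler_pM => //; first by sign.
 via ((1 + ln n%:R) * (1 + ln n%:R)); last by rewrite expr2.
 by apply: ler_pM => //; [apply: cn_abs|lra].
rewrite -mulr_sumr; apply: le_trans (ler_wpM2l (ler0n _ _) (sum_log_tail R M (leqnn 2) N0)) _.
by apply: ler_of_eq; ring.
Qed.

(** Let a tend to 0 with N fixed. The terms beyond N are bounded directly, as [Ek m n] <= m/n^2. *)
Lemma cn_ln_Ek_bound : exists C : R, 0 < C /\ forall m N, (0 < m)%N -> (0 < N)%N ->
 `|\sum_(n < N) cn n * ln n%:R * Ek m n| <= C + 48 * m%:R * (1 + ln N%:R) ^+ 2 / N%:R.
Proof.
have [C [C0 h]] := an_Ek_bound; exists C; split => // m N m0 N0.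
set K := \sum_(n < N) `|cn n * ln n%:R * Ek m n| * ln n%:R.
have K0 : 0 <= K by sign.
apply/ler_addgt0Pr => e e0.
set a := Num.min 1 (e / (1 + K)).
have a0 : 0 < a by rewrite lt_min ltr01 divr_gt0; clear -K0 e0; lra.
have a1 : a <= 1 by rewrite ge_min lexx.
have aK : a * K <= e.
 via (e / (1 + K) * K); first by rewrite ler_wpM2r // ge_min lexx orbT.
 rewrite mulrAC ler_pdivrMr; nra.
have [|N1 H] := h a m _ m0; first by rewrite a0.
have := H (maxn N1 N) (leq_maxl _ _); set M := maxn N1 N.
have NM : (N <= M)%N by apply: leq_maxr.
rewrite -(big_mkord xpredT (fun n => cn n * ln n%:R * Ek m n * expR (- (ln n%:R * a)))).
rewrite (big_cat_nat (n := N)) //= big_mkord.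
set P := \sum_(n < N) _ * _; set Q := \sum_(N <= n < M) _ * _ => hPQ.
have hQ : `|Q| <= 48 * m%:R * (1 + ln N%:R) ^+ 2 / N%:R.
 apply: le_trans (sum_cn_tail M m0 N0); triS.
 apply: ler_sum => n _; rewrite normrM ler_piMr /1/ ger0_norm /1/ expR_le1 oppr_le0.
 by sign.
set S := \sum_(n < N) _.
have hS : `|S - P| <= a * K.
 rewrite -sumrB; triS; rewrite /K mulr_sumr; apply: ler_sum => n _.
 rewrite [X in `|X|](_ : _ = cn n * ln n%:R * Ek m n * (1 - expR (- (ln n%:R * a)))); last by ring.
 move: (cn n * ln n%:R * Ek m n) => E; rewrite normrM mulrCA ler_wpM2l //.
 have := expR_ge1Dx (- (ln n%:R * a)) => q.
 rewrite ger0_norm; last by rewrite subr_ge0 expR_le1 oppr_le0 mulr_ge0 /1/ ltW.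
 clear -q; lra.
have -> : S = (S - P) + (P + Q) - Q by ring.
triB; apply: le_trans (lerD (ler_normD _ _) (lexx _)) _; clear -aK hPQ hQ hS; lra.
Qed.

Lemma ln_Ek_sum m N : (0 < m)%N -> \sum_(n < N) ln n%:R * Ek m n <= 49 * (1 + ln m%:R).
Proof.
move=> m0; have mp : 0 < (m%:R : R) by sign.
have l0 := ln_natr_ge0 R m.
have nn n : 0 <= ln n%:R * Ek m n by rewrite mulr_ge0 ?Ek_ge0 /1/.
rewrite -(big_mkord xpredT (fun n => ln n%:R * Ek m n)).
via (\sum_(0 <= n < maxn N m.+1) ln n%:R * Ek m n).
 by rewrite [leRHS](big_cat_nat (n := N)) ?leq_maxl //= lerDl sumr_ge0.
rewrite (big_cat_nat (n := m.+1)) ?leq_maxr //= [leRHS](_ : _ = (1 + ln m%:R) + 48 * (1 + ln m%:R)); last by ring.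
apply: lerD.
 rewrite big_nat_recl // Ek0 mulr0 add0r.
 via (\sum_(0 <= i < m) (ln m%:R / m%:R)).
  apply: ler_sum_nat => i /andP[_ im]; rewrite EkE /1/ im ler_wpM2r /1/.
  by rewrite ler_ln /1/ ler_nat.
 rewrite big_const_nat subn0 iter_addr_0 -[_ *+ m]mulr_natr divfK; lra.
via (\sum_(m.+1 <= i < maxn N m.+1) m%:R * ((1 + ln i%:R) ^+ 1 / i%:R ^+ 2)).
 apply: ler_sum_nat => i /andP[mi _].
 have i0 : (0 < i)%N by apply: leq_trans mi.
 rewrite expr1 [leRHS]mulrCA; apply: ler_pM; rewrite ?Ek_ge0 ?Ek_le /1/; lra.
rewrite -mulr_sumr.
apply: le_trans (ler_wpM2l (ltW mp) (sum_log_tail R _ (isT : (1 <= 2)%N) (isT : (0 < m.+1)%N))) _.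
rewrite expr1.
have m1 : (m.+1%:R : R) = m%:R + 1 by rewrite -natr1.
have ls : ln (m.+1%:R : R) <= ln m%:R + m%:R^-1 by have [_ + _] := lnS_bounds R m0; rewrite ln_div /1/; lra.
rewrite mulrCA -mulrA ler_wpM2l // mulrCA mulrA ler_pdivrMr ?m1; last by lra.
have mv : m%:R * m%:R^-1 = 1 :> R by rewrite divff // gt_eqF.
have := ler_wpM2l (ltW mp) ls; rewrite m1; nra.
Qed.

Definition bn n : R := vM R n + 1.

Lemma bn_ge0 n : 0 <= bn n.
Proof. by rewrite /bn; have := vM_ge0 R n; lra. Qed.
Lemma cn_bn n : `|cn n| <= bn n.
Proof. by triB; rewrite normr1 ger0_norm ?vM_ge0. Qed.
Lemma log_sqr_decay (K e : R) : 0 < e -> exists N0 : nat, forall N, (N0 <= N)%N ->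
  K * (1 + ln N%:R) ^+ 2 / N%:R <= e.
Proof.
move=> e0; have K0 := normr_ge0 K.
have [N0 [N00 h]] := ln_unbounded (27 * `|K| / e); exists N0 => N hN.
have N1 : 1 <= (N%:R : R) by rewrite ler1n (leq_trans _ hN).
have l0 : 0 <= ln (N%:R : R) by sign.
have := polylog_le (isT : (0 < 3)%N) N1; have := h N hN.
rewrite ler_pdivrMr // => hl hp.
rewrite ler_pdivrMr; last by lra.
via (`|K| * (1 + ln N%:R) ^+ 2); first by rewrite ler_wpM2r ?ler_norm /1/.
move: (ln N%:R) l0 hl hp => l l0 hl hp.
rewrite -(ler_pM2l (_ : 0 < 1 + l)); last by lra.
rewrite [leLHS](_ : _ = `|K| * (1 + l) ^+ 3); last by ring.
step (ler_wpM2l K0 hp).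
rewrite [leLHS](_ : _ = 27 * `|K| * N%:R); last by ring.
rewrite mulrA ler_wpM2r; clear -e0 K0 hl hp; nra.
Qed.

Lemma vM_ln_Ek : exists C : R, 0 < C /\ forall m N, (0 < m)%N ->
 \sum_(n < N) vM R n * ln n%:R * Ek m n <= C * (1 + ln m%:R).
Proof.
have [C [C0 h]] := cn_ln_Ek_bound; exists (C + 50); split; first by lra.
move=> m N m0; have lm := ln_natr_ge0 R m.
have [N0 hN0] := log_sqr_decay (48 * m%:R) ltr01.
set M := maxn N (maxn N0 1).
have M1 : (0 < M)%N by rewrite !leq_max !orbT.
have MN0 : (N0 <= M)%N by rewrite !leq_max leqnn orbT.
have := h m M m0 M1; have := hN0 M MN0; have := ln_Ek_sum M m0.
have -> : \sum_(n < M) cn n * ln n%:R * Ek m n =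
 \sum_(n < M) vM R n * ln n%:R * Ek m n - \sum_(n < M) ln n%:R * Ek m n.
 by rewrite -sumrB; apply: eq_bigr => n _; rewrite /cn; ring.
move=> h1 h2; rewrite ler_norml => /andP[_ h3].
have h4 : \sum_(n < N) vM R n * ln n%:R * Ek m n <= \sum_(n < M) vM R n * ln n%:R * Ek m n.
 rewrite -!(big_mkord xpredT (fun n => vM R n * ln n%:R * Ek m n)).
 rewrite [leRHS](big_cat_nat (n := N)) ?leq_maxl //= lerDl sumr_ge0 // => n _.
 by rewrite !mulr_ge0 ?vM_ge0 /1/.
have : C <= C * (1 + ln m%:R) by rewrite ler_peMr; clear -C0 lm; lra.
lra.
Qed.

(** Positivity of Lambda: beyond k the kernel is k/n^2 and log n >= (1 + log k)/3, so the logarithm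
    can be divided out of [vM_ln_Ek]. *)
Lemma sum_bn_tail : exists C : R, 0 < C /\ forall k N, (0 < k)%N ->
 \sum_(k.+1 <= n < N) bn n / n%:R ^+ 2 <= C / k%:R.
Proof.
have [C [C0 h]] := vM_ln_Ek; exists (3 * C + 48); split; first by lra.
move=> k N k0; have kp : 0 < (k%:R : R) by sign.
have lk := ln_natr_ge0 R k.
under eq_bigr => n _ do rewrite /bn mulrDl.
rewrite big_split /= mulrDl; apply: lerD.
 rewrite ler_pdivlMr // -(ler_pM2r (_ : 0 < 1 + ln k%:R)); last by lra.
 have := h k (maxn k.+1 N) k0; rewrite -(big_mkord xpredT (fun n => vM R n * ln n%:R * Ek k n)).
 rewrite (big_cat_nat (n := k.+1)) ?leq_maxl //=.
 have t0 n : 0 <= vM R n * ln n%:R * Ek k n by rewrite !mulr_ge0 ?vM_ge0 /1/.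
 have : 0 <= \sum_(0 <= n < k.+1) vM R n * ln n%:R * Ek k n by apply: sumr_ge0.
 set P := \sum_(0 <= n < k.+1) _; set Q := \sum_(k.+1 <= n < maxn k.+1 N) _ => P0 hPQ.
 suff : \sum_(k.+1 <= n < N) vM R n / n%:R ^+ 2 * k%:R * (1 + ln k%:R) <= 3 * Q.
  by rewrite -mulr_suml -mulr_suml; lra.
 have [Nk|Nk] := leqP N k.+1.
  rewrite big_geq // mulr_ge0 //; apply: sumr_ge0 => n _; exact: t0.
 have -> : Q = \sum_(k.+1 <= n < N) vM R n * ln n%:R * Ek k n by rewrite /Q (maxn_idPr _) // ltnW.
 rewrite mulr_sumr; apply: ler_sum_nat => n /andP[kn _].
 have n0 : (0 < n)%N by apply: leq_trans kn.
 rewrite EkE // leqNgt kn /= [leRHS](_ : _ = vM R n / n%:R ^+ 2 * k%:R * (3 * ln n%:R)); last by ring.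
 apply: ler_wpM2l; first by rewrite !mulr_ge0 ?vM_ge0.
 have l1 : ln (k%:R : R) <= ln n%:R by rewrite ler_ln /1/ ler_nat ltnW.
 have l2 : ln (2 : R) <= ln n%:R by rewrite ler_ln /1/ ler_nat (leq_trans _ kn).
 have l3 : 2^-1 <= ln (2 : R) by have := @lnS_ge R 1 isT; rewrite divr1.
 lra.
have := sum_log_tail R N (isT : (0 <= 2)%N) (isT : (0 < k.+1)%N); rewrite expr0 mulr1.
move=> /le_trans; apply; rewrite ler_wpM2l /1/ lef_pV2 /1/ ler_nat /1/.
Qed.

Definition psib m : R := \sum_(1 <= n < m.+1) bn n.

(** Chebyshev's bound by halving: on (m/2, m] the weight 1/n^2 of the tail bound is at least
    1/m^2. *)
Lemma psib_le : exists C : R, 0 < C /\ forall m, psib m <= C * m%:R.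
Proof.
have [C [C0 h]] := sum_bn_tail; exists (6 * C + 1); split; first by lra.
elim/ltn_ind => m IH.
have [m1|m1] := leqP m 1.
 case: m m1 {IH} => [|[|]] // _; first by rewrite /psib big_geq // mulr0.
 rewrite /psib big_nat1 /bn mulr1.
 by have := vM_le_ln R 1; rewrite ln1; lra.
set k := (m %/ 2)%N.
have k0 : (0 < k)%N by rewrite divn_gt0.
have km : (k < m)%N by rewrite ltn_Pdiv // ltnW.
have k3 : (m <= 3 * k)%N by rewrite /k; lia.
have k2 : (2 * k <= m)%N by rewrite /k; lia.
have mp : 0 < (m%:R : R) by rewrite ltr0n ltnW.
have kp : 0 < (k%:R : R) by sign.
rewrite /psib (big_cat_nat (n := k.+1)) //=; last by rewrite ltnS ltnW.
have := IH k km; rewrite /psib.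
have : \sum_(k.+1 <= i < m.+1) bn i <= m%:R ^+ 2 * (C / k%:R).
 apply: le_trans (ler_wpM2l (sqr_ge0 _) (h k m.+1 k0)); rewrite mulr_sumr.
 apply: ler_sum_nat => n /andP[kn nm].
 have np : 0 < (n%:R : R) by rewrite ltr0n (leq_trans _ kn).
 rewrite mulrCA ler_peMr ?bn_ge0 /1/ ler_pdivlMr /1/ mul1r.
 by apply: lerXn2r; rewrite ?nnegrE ?ler_nat.
set P := \sum_(_ <= _ < k.+1) _; set Q := \sum_(_ <= _ < m.+1) _ => hQ hP.
have : m%:R ^+ 2 * (C / k%:R) <= 3 * C * m%:R.
 rewrite mulrA ler_pdivrMr //.
 have : (m%:R : R) <= 3 * k%:R by rewrite -natrM ler_nat.
 move=> hh; have := ler_wpM2l (mulr_ge0 (ltW C0) (ltW mp)) hh; lra.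
have : 2 * (k%:R : R) <= m%:R by rewrite -natrM ler_nat.
move=> q1 q2; have := ler_wpM2l (ltW C0) q1; lra.
Qed.

Lemma abs_T_split m N (w : nat -> R) : (0 < m)%N -> (m < N)%N ->
 `|\sum_(n < N) cn n * w n * Ek m n| <=
 (\sum_(1 <= n < m.+1) bn n * `|w n|) / m%:R + m%:R * \sum_(m.+1 <= n < N) `|w n| * (bn n / n%:R ^+ 2).
Proof.
move=> m0 mN; triS.
rewrite -(big_mkord xpredT (fun n => `|cn n * w n * Ek m n|)).
rewrite (big_cat_nat (n := m.+1)) //= big_ltn // Ek0 mulr0 normr0 add0r.
have aux n : `|cn n * w n * Ek m n| <= bn n * `|w n| * Ek m n.
 have := Ek_ge0 m n; move: (Ek m n) => E E0.
 by rewrite !normrM (ger0_norm E0) -!mulrA ler_wpM2r ?cn_bn // mulr_ge0.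
apply: lerD.
 rewrite mulr_suml; apply: ler_sum_nat => n /andP[n1 nm].
 by step (aux n); rewrite EkE // -ltnS nm.
rewrite mulr_sumr; apply: ler_sum_nat => n /andP[n1 nm].
have n0 : (0 < n)%N by apply: leq_trans n1.
step (aux n); rewrite EkE // leqNgt n1 /=.
by apply: ler_of_eq; ring.
Qed.

Lemma ln_diff_sum m n : (0 < m)%N -> (m <= n)%N ->
 ln n%:R - ln m%:R <= \sum_(m <= k < n) (k%:R : R)^-1.
Proof.
move=> m0; elim: n => [|n IH]; first by rewrite leqNgt m0.
rewrite leq_eqVlt => /predU1P[<-|]; first by rewrite big_geq // subrr.
rewrite ltnS => mn; have n0 : (0 < n)%N by apply: leq_trans mn.
rewrite big_nat_recr //=; have := IH mn.
have [_ + _] := lnS_bounds R n0; rewrite ln_div /1/; lra.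
Qed.

(** Only orders of magnitude enter. The factor |log n - log m| is bounded by a sum of 1/k between m
    and n, and after exchanging sums Chebyshev's bounds apply for each k. *)
Lemma T_ln_bound : exists C : R, 0 < C /\ forall m N, (0 < m)%N -> (m < N)%N ->
 `|\sum_(n < N) cn n * (ln n%:R - ln m%:R) * Ek m n| <= C /\ `|\sum_(n < N) cn n * Ek m n| <= C.
Proof.
have [C1 [C10 h1]] := sum_bn_tail; have [C2 [C20 h2]] := psib_le.
exists (C2 + 48 * C1); split; first by lra.
move=> m N m0 mN; have mp : 0 < (m%:R : R) by sign.
split; last first.
 have := abs_T_split (fun=> 1) m0 mN; rewrite normr1.
 under eq_bigr => n _ do rewrite mulr1.
 move=> /le_trans; apply; apply: lerD.
  rewrite ler_pdivrMr //; under eq_bigr => n _ do rewrite mulr1.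
  exact: h2.
 under eq_bigr => n _ do rewrite mul1r.
 by step (ler_wpM2l (ltW mp) (h1 m N m0)); rewrite mulrCA divff; lra.
step (abs_T_split (fun n => ln n%:R - ln m%:R) m0 mN); apply: lerD.
 rewrite ler_pdivrMr //.
 via (\sum_(1 <= n < m.+1) \sum_(1 <= k < m | (n <= k)%N) bn n / k%:R).
  apply: ler_sum_nat => n /andP[n1 nm].
  rewrite -mulr_sumr ler_wpM2l ?bn_ge0 // distrC ger0_norm; last first.
   by rewrite subr_ge0 ler_ln /1/ ler_nat.
  by step (ln_diff_sum n1 nm); rewrite (big_nat_widenl _ _ _ _ _ n1).
 rewrite (exchange_big_dep_nat xpredT) //=.
 via (\sum_(1 <= k < m) C2); last first.
  by rewrite big_const_nat iter_addr_0 -[leLHS]mulr_natr ler_wpM2l /1/ ler_nat leq_subr.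
 apply: ler_sum_nat => k /andP[k1 km].
 have kp : 0 < (k%:R : R) by sign.
 rewrite -mulr_suml ler_pdivrMr //; apply: le_trans (h2 k).
 have km1 : (k.+1 <= m.+1)%N by rewrite ltnS ltnW.
 by rewrite /psib [leRHS](big_nat_widen _ _ _ _ _ km1).
via (m%:R * (C1 * (48 / m%:R))); last first.
 rewrite [leLHS](_ : _ = m%:R / m%:R * (48 * C1)); last by ring.
 by rewrite divff /1/ mul1r.
rewrite ler_wpM2l /1/.
via (\sum_(m.+1 <= n < N) \sum_(m <= k < N | (k < n)%N) k%:R^-1 * (bn n / n%:R ^+ 2)).
 apply: ler_sum_nat => n /andP[n1 nN].
 rewrite -mulr_suml ler_wpM2r ?divr_ge0 ?bn_ge0 /1/ ger0_norm; last first.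
  by rewrite subr_ge0 ler_ln ?posrE ?ltr0n ?(leq_trans _ n1) // ler_nat ltnW.
 by step (ln_diff_sum m0 (ltnW n1)); rewrite (big_nat_widen _ _ _ _ _ (ltnW nN)).
rewrite (exchange_big_dep_nat xpredT) //=.
have := sum_log_tail R N (isT : (0 <= 2)%N) m0; rewrite expr0 mulr1.
move=> /(ler_wpM2l (ltW C10)); apply: le_trans; rewrite mulr_sumr.
apply: ler_sum_nat => k /andP[k1 km].
have k0 : (0 < k)%N by apply: leq_trans k1.
rewrite -mulr_sumr expr0 [leRHS](_ : _ = k%:R^-1 * (C1 / k%:R)); last by rewrite expr2 invfM; ring.
rewrite ler_wpM2l /1/; apply: le_trans (h1 k N k0).
have km1 : (m.+1 <= k.+1)%N by rewrite ltnS.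
by rewrite [leRHS](big_nat_widenl _ _ _ _ _ km1).
Qed.

Definition Tn N m : R := \sum_(n < N) cn n * Ek m n.

(** Since log m = log n - (log n - log m), two bounded sums give a saving of log m for the
    unweighted one. [N0] depends on the range of m because the truncation error is of order m (log
    N)^2/N. *)
Lemma Tn_bound : exists C : R, 0 < C /\ forall M, exists N0 : nat, forall N m, (N0 <= N)%N ->
 (0 < m <= M)%N -> `|Tn N m| * (1 + ln m%:R) <= C.
Proof.
have [C1 [C10 h1]] := cn_ln_Ek_bound; have [C2 [C20 h2]] := T_ln_bound.
exists (C1 + 1 + 2 * C2); split; first by lra.
move=> M; have [N0 h3] := log_sqr_decay (48 * M%:R) (@ltr01 R).
exists (maxn N0 M.+1) => N m; rewrite geq_max => /andP[N0N MN] /andP[m0 mM].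
have mN : (m < N)%N by apply: leq_ltn_trans MN.
have N0' : (0 < N)%N by apply: leq_ltn_trans mN.
have lm := ln_natr_ge0 R m.
have [b1 b2] := h2 m N m0 mN; have b3 := h1 m N m0 N0'.
have b4 := h3 N N0N.
have b5 : 48 * m%:R * (1 + ln N%:R) ^+ 2 / N%:R <= 1 :> R.
 apply: le_trans b4; by rewrite !ler_wpM2r /1/ ler_pM2l /1/ ler_nat.
have e : Tn N m * (1 + ln m%:R) = Tn N m + \sum_(n < N) cn n * ln n%:R * Ek m n -
  \sum_(n < N) cn n * (ln n%:R - ln m%:R) * Ek m n.
 by rewrite /Tn mulr_suml -big_split /= -sumrB; apply: eq_bigr => n _; ring.
have -> : `|Tn N m| * (1 + ln m%:R) = `|Tn N m * (1 + ln m%:R)| by rewrite normrM (@ger0_norm _ (1 + _)); clear -lm; lra.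
rewrite e.
triB; apply: le_trans (lerD (ler_normD _ _) (lexx _)) _; rewrite /Tn; lra.
Qed.
End Chebyshev.

(** * Prime number theorem with relative error 1/sqrt(log m) *)

Section PrimeNumberTheorem.
Variable R : realType.
Implicit Types (m n N h : nat).

Definition An m : R := \sum_(1 <= n < m.+1) cn R n.
Definition Qn N m : R := \sum_(m.+1 <= n < N) cn R n / n%:R ^+ 2.

(** T mixes psi(m) - m with the tail sum Q; the Tauberian step below bounds Q alone. *)
Lemma Tn_split N m : (0 < m)%N -> (m < N)%N ->
 m%:R * Tn R N m = An m + m%:R ^+ 2 * Qn N m.
Proof.
move=> m0 mN; have mp : 0 < (m%:R : R) by sign.
rewrite /Tn -(big_mkord xpredT (fun n => cn R n * Ek R m n)) (big_cat_nat (n := m.+1)) //=.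
rewrite big_ltn // Ek0 mulr0 add0r mulrDr; congr (_ + _); rewrite ?/An ?/Qn !mulr_sumr !big_nat.
 apply: eq_bigr => n /andP[n1 nm]; rewrite EkE /1/ -ltnS nm mulrCA divff ?mulr1 /1/.
apply: eq_bigr => n /andP[n1 nm].
by rewrite EkE ?(leq_trans _ n1) // leqNgt n1 /=; ring.
Qed.

Lemma cn_geN1 n : -1 <= cn R n.
Proof. by rewrite /cn; have := vM_ge0 R n; lra. Qed.
(** Differencing m T over [m, m + h] cancels [An] up to the terms in between, whose weights are
    nonnegative. The one-sided bound Lambda - 1 >= -1 then gives an upper bound for Q at m + h and a
    lower bound for Q at m. *)
Lemma Tn_diff N m h : (0 < m)%N -> (m + h < N)%N ->
 let m' := (m + h)%N in
 let D : R := m'%:R ^+ 2 - m%:R ^+ 2 in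
 D * Qn N m' <= m'%:R * Tn R N m' - m%:R * Tn R N m + h%:R * (D / m%:R ^+ 2) /\
 m'%:R * Tn R N m' - m%:R * Tn R N m - h%:R * (D / m%:R ^+ 2) <= D * Qn N m.
Proof.
move=> m0 mN m' D; have mp : 0 < (m%:R : R) by sign.
have m'N : (m' < N)%N by [].
have mm' : (m <= m')%N by rewrite leq_addr.
have m'0 : (0 < m')%N by apply: leq_trans mm'.
have mN' : (m < N)%N by apply: leq_ltn_trans m'N.
rewrite !Tn_split //.
have -> : An m' = An m + \sum_(m.+1 <= n < m'.+1) cn R n by rewrite /An (big_cat_nat (n := m.+1)).
have eQ : Qn N m = \sum_(m.+1 <= n < m'.+1) cn R n / n%:R ^+ 2 + Qn N m' by rewrite /Qn (big_cat_nat (n := m'.+1)).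
have wt n : (m < n <= m')%N -> 0 <= 1 - m%:R ^+ 2 / n%:R ^+ 2 :> R /\
  1 - m%:R ^+ 2 / n%:R ^+ 2 <= D / (m%:R ^+ 2 : R) /\
  0 <= m'%:R ^+ 2 / n%:R ^+ 2 - 1 :> R /\ m'%:R ^+ 2 / n%:R ^+ 2 - 1 <= D / (m%:R ^+ 2 : R).
 move=> /andP[mn nm']; have np : 0 < (n%:R : R) by rewrite ltr0n (leq_trans _ mn).
 have a1 : (m%:R ^+ 2 : R) <= n%:R ^+ 2 by rewrite lerXn2r ?ler_nat /1/ ltnW.
 have a2 : (n%:R ^+ 2 : R) <= m'%:R ^+ 2 by rewrite lerXn2r ?ler_nat /1/.
 have p1 : 0 < (m%:R ^+ 2 : R) by sign.
 have p2 : 0 < (n%:R ^+ 2 : R) by sign.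
 rewrite /D; move: (m%:R ^+ 2 : R) (n%:R ^+ 2 : R) (m'%:R ^+ 2 : R) p1 p2 a1 a2 => x y z x0 y0 xy yz.
 have yv : y / y = 1 by rewrite divff /1/.
 have e1 : 1 - x / y = (y - x) / y by rewrite mulrBl yv.
 have e2 : z / y - 1 = (z - y) / y by rewrite mulrBl yv.
 have iy : y^-1 <= x^-1 by rewrite lef_pV2.
 have iy0 : 0 <= y^-1 by sign.
 have aux w : 0 <= w -> w <= z - x -> 0 <= w / y /\ w / y <= (z - x) / x by move=> w0 wz; rewrite mulr_ge0 //= ler_pM.
 rewrite e1 e2; have [] := aux (y - x) _ _; [(clear -xy yz; lra)|(clear -xy yz; lra)|move=> u1 u2]; have [] := aux (z - y) _ _; [(clear -xy yz; lra)|(clear -xy yz; lra)|by []].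
have hs (w : nat -> R) : (forall n, (m < n <= m')%N -> 0 <= w n /\ w n <= D / m%:R ^+ 2) ->
  - (h%:R * (D / m%:R ^+ 2)) <= \sum_(m.+1 <= n < m'.+1) cn R n * w n.
 move=> hw; have -> : h%:R * (D / m%:R ^+ 2) = \sum_(m.+1 <= n < m'.+1) D / m%:R ^+ 2.
  by rewrite big_const_nat iter_addr_0 -[RHS]mulr_natl /m' subSS addKn.
 rewrite -sumrN; apply: ler_sum_nat => n /andP[mn nm'].
 have [w0 w1] := hw n (introT andP (conj mn nm')); have := cn_geN1 n.
 move: (cn R n) (w n) w0 w1 => c w' w0 w1 c1; nra.
have h1 := hs (fun n => 1 - m%:R ^+ 2 / n%:R ^+ 2) (fun n H => conj (wt n H).1 (wt n H).2.1).
have h2 := hs (fun n => m'%:R ^+ 2 / n%:R ^+ 2 - 1) (fun n H => (wt n H).2.2).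
have s1 : \sum_(m.+1 <= n < m'.+1) cn R n * (1 - m%:R ^+ 2 / n%:R ^+ 2) =
  \sum_(m.+1 <= n < m'.+1) cn R n - m%:R ^+ 2 * \sum_(m.+1 <= n < m'.+1) cn R n / n%:R ^+ 2.
 by rewrite mulr_sumr -sumrB; apply: eq_bigr => n _; ring.
have s2 : \sum_(m.+1 <= n < m'.+1) cn R n * (m'%:R ^+ 2 / n%:R ^+ 2 - 1) =
  m'%:R ^+ 2 * \sum_(m.+1 <= n < m'.+1) cn R n / n%:R ^+ 2 - \sum_(m.+1 <= n < m'.+1) cn R n.
 by rewrite mulr_sumr -sumrB; apply: eq_bigr => n _; ring.
rewrite s1 in h1; rewrite s2 in h2; rewrite eQ.
move: h1 h2; rewrite /D; clear.
move: (h%:R * _) (\sum_(_ <= _ < _) cn R _) (\sum_(_ <= _ < _) _ / _) (Qn N m') (An m) => H S1 S2 Q A h1 h2.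
by split; lra.
Qed.

(** The real arithmetic of [Qn_bound]: T, T' and T'' are the smoothed sums at m, m + h and m - h. *)
Lemma Qn_arith (C1 C2 m h s T T' T'' Q : R) : 0 < C1 -> 0 < C2 -> 0 < m -> 0 < s -> 1 <= h ->
 h <= m / (2 * s) -> m <= 4 * s * h -> 2 * h <= m ->
 - (2 * C1 / s ^+ 2) <= T -> T <= 2 * C1 / s ^+ 2 ->
 - (2 * C1 / s ^+ 2) <= T' -> T' <= 2 * C1 / s ^+ 2 ->
 - (2 * C1 / s ^+ 2) <= T'' -> T'' <= 2 * C1 / s ^+ 2 ->
 (m ^+ 2 - (m - h) ^+ 2) * Q <= m * T - (m - h) * T'' + h * ((m ^+ 2 - (m - h) ^+ 2) / (m - h) ^+ 2) ->
 (m + h) * T' - m * T - h * (((m + h) ^+ 2 - m ^+ 2) / m ^+ 2) <= ((m + h) ^+ 2 - m ^+ 2) * Q ->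
 - ((12 * C1 + 2 + 2 * C2) / (m * s)) <= Q <= (12 * C1 + 2 + 2 * C2) / (m * s).
Proof.
move=> C10 C20 mp s0 hp hb1 hb2 hm2; set B := 2 * C1 / s ^+ 2 => a1 b1 a2 b2 a3 b3 hu hl.
have B0 : 0 <= B by sign.
have h0 : 0 < h by lra.
have Bb : B / h <= 8 * C1 / (m * s).
 rewrite ler_pdivrMr /1/ ler_pdivrMr /1/.
 rewrite [leRHS](_ : _ = 8 * C1 * h * s / m); last by field; rewrite !gt_eqF.
 by rewrite ler_pdivlMr //; clear -C10 hb2; nra.
have Hb : h / m ^+ 2 <= 2^-1 / (m * s).
 rewrite ler_pdivrMr /1/ [leRHS](_ : _ = m / (2 * s)) /1/.
 by field; rewrite !gt_eqF.
apply/andP; split.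
 have key : - (B / h) - h / m ^+ 2 <= Q.
  have Dp : 0 < (m + h) ^+ 2 - m ^+ 2 by clear -mp h0; nra.
  rewrite -(ler_pM2l Dp); apply: le_trans hl.
  have -> : ((m + h) ^+ 2 - m ^+ 2) * (- (B / h) - h / m ^+ 2) =
   - ((2 * m + h) * B) - h * (((m + h) ^+ 2 - m ^+ 2) / m ^+ 2).
   by move: B {a1 b1 a2 b2 a3 b3 B0 Bb} => B; field; rewrite !gt_eqF.
  by rewrite lerD2r; clear -a1 b1 a2 b2 mp h0; nra.
 apply: le_trans key; rewrite lerNl opprD !opprK.
 step (lerD Bb Hb); rewrite -mulrDl ler_wpM2r /1/.
 by clear -C10 C20; lra.
have m1p : m / 2 <= m - h by clear -hm2; lra.
have m10 : 0 < m - h by clear -hm2 mp h0; lra.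
move: (m - h) m1p m10 (subKr m h) hu => m1 m1p m10 eh hu.
have key : Q <= B / h + h / m1 ^+ 2.
 have Dp : 0 < m ^+ 2 - m1 ^+ 2 by clear -mp h0 m10 eh; nra.
 rewrite -(ler_pM2l Dp); apply: le_trans hu _.
 have -> : (m ^+ 2 - m1 ^+ 2) * (B / h + h / m1 ^+ 2) =
   (m + m1) * B + h * ((m ^+ 2 - m1 ^+ 2) / m1 ^+ 2).
  rewrite -eh in h0 *.
  by move: B {a1 b1 a2 b2 a3 b3 B0 Bb} => B; field; rewrite !gt_eqF.
 by rewrite lerD2r; clear -a3 b3 a1 b1 mp m10; nra.
apply: le_trans key _.
have Hb' : h / m1 ^+ 2 <= 4 * (h / m ^+ 2).
 rewrite [leRHS](_ : _ = h * ((m / 2) ^+ 2)^-1); last by field; rewrite gt_eqF.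
 rewrite ler_wpM2l /1/ lef_pV2 /1/.
 by rewrite lerXn2r /1/.
via (8 * C1 / (m * s) + 4 * (2^-1 / (m * s))); first by clear -Bb Hb Hb'; lra.
by rewrite mulrA -mulrDl ler_wpM2r /1/; clear -C10 C20; lra.
Qed.

(** With T = O(1/s^2), s = sqrt(1 + log m), differencing costs T m/h and the one-sided bound h/m,
    relative to 1/m. The choice h = m/(2 s) balances both at 1/s; this is the origin of the square
    root in the final error. *)
Lemma Qn_bound : exists C : R, 0 < C /\ forall m, (0 < m)%N -> exists N0 : nat, forall N, (N0 <= N)%N ->
 `|Qn N m| <= C / (m%:R * Num.sqrt (1 + ln m%:R)).
Proof.
have [C1 [C10 hT]] := Tn_bound R; have [C2 [C20 hQ]] := sum_bn_tail R.
exists (12 * C1 + 2 + 2 * C2); split; first by lra.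
move=> m m0; have mp : 0 < (m%:R : R) by sign.
have l0 := ln_natr_ge0 R m; set L := 1 + ln (m%:R : R).
have L1 : 1 <= L by rewrite /L; lra.
set s := Num.sqrt L.
have s1 : 1 <= s by rewrite -[leLHS]sqrtr1 ler_wsqrtr.
have s0 : 0 < s by lra.
have ss : s ^+ 2 = L by rewrite sqr_sqrtr; lra.
have Lm : L <= m%:R by have := expR_ge1Dx (ln (m%:R : R)); rewrite lnK.
have [m4|m4] := ltnP m 4.
 exists 0 => N _; via (C2 / m%:R).
  apply: le_trans (hQ m N m0); triS; apply: ler_sum => n _.
  by rewrite normrM (ger0_norm (_ : 0 <= n%:R ^- 2)) /1/ ler_wpM2r ?cn_bn.
 have s2 : s <= 2.
  rewrite -(@ler_pXn2r _ 2) /1/ ss; apply: le_trans Lm _.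
  by rewrite -natrX ler_nat ltnW.
 rewrite invfM (mulrC m%:R^-1) mulrA ler_wpM2r /1/ ler_pdivlMr /1/.
 nra.
have m4' : 4 <= (m%:R : R) by rewrite ler_nat.
set x := m%:R / (2 * s).
have x1 : 1 <= x.
 rewrite ler_pdivlMr ?mul1r; last by lra.
 rewrite -(@ler_pXn2r _ 2) /1/.
 rewrite exprMn ss; move: m%:R m4' Lm => M M4 LM; nra.
set h := Num.truncn x.
have x0 : 0 <= x by lra.
have /andP[hx xh] := truncn_itv x0; rewrite -/h in hx xh.
have h1 : (0 < h)%N by rewrite truncn_gt0.
have hp : 1 <= (h%:R : R) by rewrite ler1n.
have hb : h%:R <= m%:R / (2 * s) /\ m%:R <= 4 * s * h%:R :> R.
 split => //; move: xh; rewrite -natr1 /x ltr_pdivrMr; last by lra.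
 clear -m4' hp; nra.
have [hb1 hb2] := hb.
have hm2 : 2 * h%:R <= m%:R :> R.
 move: hb1; rewrite ler_pdivlMr; last by lra.
 clear -L1 s1 Lm; nra.
have hm : (h <= m)%N by rewrite -(ler_nat R); clear -hp hm2; lra.
have [N0 hN0] := hT (m + h)%N.
exists (maxn N0 (m + h).+1) => N; rewrite geq_max => /andP[N0N mhN].
have mhN' : (m - h + h < N)%N by rewrite subnK // (leq_ltn_trans (leq_addr h m)).
have mh0 : (0 < m - h)%N by rewrite subn_gt0 -(ltr_nat R); clear -hp hm2; lra.
have [hu _] := Tn_diff mh0 mhN'; have [_ hl] := Tn_diff m0 mhN.
move: hu; rewrite subnK // natrB // => hu; rewrite natrD in hl.
have Tb j : (0 < j <= m + h)%N -> m%:R / 2 <= (j%:R : R) -> `|Tn R N j| <= 2 * C1 / L.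
 move=> hj mj; have := hN0 N j N0N hj; have jp : 0 < (j%:R : R) by (clear -mp mj; lra).
 have lj : L / 2 <= 1 + ln j%:R.
  have : ln (m%:R / 2) <= ln (j%:R : R) by rewrite ler_ln /1/; lra.
  rewrite ln_div /1/ /L.
  have : ln (4 : R) <= ln m%:R by rewrite ler_ln /1/; lra.
  have -> : ln (4 : R) = 2 * ln 2 by rewrite [4](_ : _ = 2 ^+ 2 :> R) ?lnXn //; ring.
  clear; lra.
 move=> ht; rewrite ler_pdivlMr; last by (clear -L1; lra).
 have := normr_ge0 (Tn R N j); clear -lj ht; nra.
have T1 := Tb m; have T2 := Tb (m + h)%N; have T3 := Tb (m - h)%N.
rewrite natrD in T2; rewrite natrB // in T3.
have {}T1 : `|Tn R N m| <= 2 * C1 / L by apply: T1; [rewrite m0 leq_addr|(clear -mp; lra)].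
have {}T2 : `|Tn R N (m + h)| <= 2 * C1 / L by apply: T2; [rewrite leqnn addn_gt0 m0|(clear -hp hm2; lra)].
have {}T3 : `|Tn R N (m - h)| <= 2 * C1 / L by apply: T3; [rewrite mh0 (leq_trans (leq_subr _ _)) // leq_addr|(clear -hm2; lra)].
move: T1 T2 T3; rewrite !ler_norml => /andP[a1 b1] /andP[a2 b2] /andP[a3 b3].
have Bs : 2 * C1 / L = 2 * C1 / s ^+ 2 by rewrite ss.
rewrite Bs in a1 b1 a2 b2 a3 b3; clear -C10 C20 mp s0 hp hb1 hb2 hm2 a1 b1 a2 b2 a3 b3 hu hl.
exact: (Qn_arith C10 C20 mp s0 hp hb1 hb2 hm2 a1 b1 a2 b2 a3 b3 hu hl).
Qed.

Lemma psi_bound : exists C : R, 0 < C /\ forall m, (0 < m)%N ->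
 `|An m| <= C * m%:R / Num.sqrt (1 + ln m%:R).
Proof.
have [C1 [C10 h1]] := Tn_bound R; have [C2 [C20 h2]] := Qn_bound.
exists (C1 + C2); split; first by lra.
move=> m m0; have mp : 0 < (m%:R : R) by sign.
have l0 := ln_natr_ge0 R m.
have [N1 H1] := h1 m; have [N2 H2] := h2 m m0.
set N := maxn (maxn N1 N2) m.+1.
have q1 : (N1 <= N)%N by rewrite !leq_max leqnn.
have q2 : (N2 <= N)%N by rewrite !leq_max leqnn orbT.
have q3 : (m < N)%N by rewrite leq_maxr.
have := H1 N m q1; rewrite m0 leqnn => /(_ isT) hT; have hQ := H2 N q2.
have := Tn_split m0 q3 => e.
have -> : An m = m%:R * Tn R N m - m%:R ^+ 2 * Qn N m by rewrite e addrK.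
set L := 1 + ln m%:R in hT hQ *.
have L1 : 1 <= L by rewrite /L; clear -l0; lra.
set s := Num.sqrt L in hQ *.
have s1 : 1 <= s by rewrite -[leLHS]sqrtr1 ler_wsqrtr.
have s0 : 0 < s by clear -s1; lra.
have ss : s ^+ 2 = L by rewrite sqr_sqrtr; clear -L1; lra.
rewrite mulrDl mulrDl; triB; apply: lerD.
 rewrite normrM (ger0_norm (ltW mp)) ler_pdivlMr /1/ [leRHS]mulrC -mulrA ler_wpM2l /1/.
 apply: le_trans hT; rewrite ler_wpM2l // -ss; nra.
rewrite normrM (ger0_norm (sqr_ge0 _)); apply: le_trans (ler_wpM2l (sqr_ge0 _) hQ) _.
by apply: ler_of_eq; field; rewrite !gt_eqF.
Qed.
End PrimeNumberTheorem.

(** * From psi to sums over primes *)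

Section PrimeSums.
Variable R : realType.
Implicit Types (m n N : nat) (a phi F : nat -> R).

Lemma abel_sum a F N : (0 < N)%N ->
 \sum_(1 <= n < N.+1) a n * F n =
 (\sum_(1 <= n < N.+1) a n) * F N +
 \sum_(1 <= n < N) (\sum_(1 <= i < n.+1) a i) * (F n - F n.+1).
Proof.
case: N => // N _; elim: N => [|N IH]; first by rewrite !big_nat1 big_geq // addr0.
rewrite big_nat_recr //= IH [in RHS]big_nat_recr //= [X in _ = _ + X]big_nat_recr //=; ring.
Qed.

(** The majorant of the partial sums is itself a partial sum, so that summation by parts can be
    undone on the right. *)
Lemma abel_le a phi F N :
 (forall m, (0 < m <= N)%N -> `|\sum_(1 <= n < m.+1) a n| <= \sum_(1 <= n < m.+1) phi n) ->
 (forall n, (0 < n < N)%N -> F n.+1 <= F n) -> 0 <= F N ->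
 `|\sum_(1 <= n < N.+1) a n * F n| <= \sum_(1 <= n < N.+1) phi n * F n.
Proof.
have [->|N0] := posnP N; first by rewrite !big_geq // normr0.
move=> h dF F0; rewrite !abel_sum //; triD; apply: lerD.
 by rewrite normrM (ger0_norm F0) ler_wpM2r // h // N0 leqnn.
triS; apply: ler_sum_nat => n /andP[n1 nN].
have d0 : 0 <= F n - F n.+1 by rewrite subr_ge0 dF // n1.
by rewrite normrM (ger0_norm d0) ler_wpM2r // h // n1 ltnW.
Qed.

(** Proper prime powers p^k <= m have p <= sqrt m and k <= log_2 m; each pair is charged log m. *)
Lemma sum_vM_nonprime m : (0 < m)%N ->
 \sum_(1 <= n < m.+1 | ~~ prime n) vM R n <= 4 * Num.sqrt m%:R * (1 + ln m%:R) ^+ 2.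
Proof.
move=> m0; have mp : 0 < (m%:R : R) by sign.
have m1 : 1 <= (m%:R : R) by rewrite ler1n.
have l0 := ln_natr_ge0 R m.
set r := Num.truncn (Num.sqrt m%:R : R); set J := trunc_log 2 m.
have s1 : 1 <= Num.sqrt m%:R :> R by rewrite -[leLHS]sqrtr1 ler_wsqrtr.
have s0 : 0 <= Num.sqrt m%:R :> R by lra.
have rs : (r%:R : R) <= Num.sqrt m%:R by have /andP[] := truncn_itv s0.
have Jl : (J%:R : R) <= 2 * ln m%:R.
 have : ln ((2 ^ J)%:R : R) <= ln m%:R by rewrite ler_ln /1/ ler_nat trunc_logP.
 rewrite natrX lnXn // -[_ *+ J]mulr_natr.
 have l2 : 2^-1 <= ln (2 : R) by have := @lnS_ge R 1 isT; rewrite divr1.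
 have := ler_wpM2r (ler0n R J) l2; lra.
via (\sum_(1 <= n < m.+1) \sum_(p < r.+1) \sum_(j < J.+1) ((p ^ j == n)%N)%:R * ln m%:R).
 rewrite big_mkcond; apply: ler_sum_nat => n /andP[n1 nm].
 have tn (p : 'I_r.+1) (j : 'I_J.+1) : 0 <= ((p ^ j == n)%N)%:R * ln (m%:R : R) by sign.
 have S0 : 0 <= \sum_(p < r.+1) \sum_(j < J.+1) ((p ^ j == n)%N)%:R * ln (m%:R : R) by sign.
 case: ifP => // np; have [->//|/vM_neq0 [p [k [pp k0 nk]]]] := eqVneq (vM R n) 0.
 have k2 : (1 < k)%N.
  case: k k0 nk => // -[|//] _ nk; by move: np; rewrite nk expn1 pp.
 have pr : (p < r.+1)%N.
  rewrite ltnS truncn_ge_nat /1/ -(@ler_pXn2r _ 2) /1/ sqr_sqrtr /1/.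
  by rewrite -natrX ler_nat (leq_trans _ (_ : n <= m)%N) // nk leq_exp2l // prime_gt1.
 have kJ : (k < J.+1)%N.
  rewrite ltnS trunc_log_max // (leq_trans _ (_ : n <= m)%N) // nk leq_exp2r //.
  exact: prime_gt1.
 rewrite (bigD1 (Ordinal pr)) //= (bigD1 (Ordinal kJ)) //= -nk eqxx mul1r -addrA.
 via (ln m%:R).
  by step (vM_le_ln R n); rewrite ler_ln /1/ ler_nat.
 rewrite lerDl; apply: addr_ge0; apply: sumr_ge0 => i _; first by sign.
 by sign.
rewrite exchange_big /=.
via (\sum_(p < r.+1) \sum_(j < J.+1) ln m%:R).
 apply: ler_sum => p _; rewrite exchange_big /=; apply: ler_sum => j _.
 rewrite -mulr_suml ler_piMl // -natr_sum -[leRHS]/(1%:R) ler_nat.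
 rewrite -big_mkcond sum1_count.
 rewrite (@eq_count _ _ (pred1 (p ^ j)%N)); last by move=> n; rewrite eq_sym.
 by rewrite count_uniq_mem ?iota_uniq // leq_b1.
rewrite !sumr_const !card_ord -mulrnA -[leLHS]mulr_natr natrM -!natr1.
have a1 : r%:R + 1 <= 2 * Num.sqrt m%:R :> R by lra.
have a2 : J%:R + 1 <= 2 * (1 + ln m%:R) :> R by lra.
have [r0 J0] : 0 <= r%:R + 1 :> R /\ 0 <= J%:R + 1 :> R by sign.
move: (ln m%:R : R) (Num.sqrt m%:R : R) (r%:R + 1 : R) (J%:R + 1 : R) l0 s1 s0 a1 a2 r0 J0.
clear => l s r J l0 s1 s0 a1 a2 r0 J0.
via ((1 + l) * ((2 * (1 + l)) * (2 * s))); last first.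
 by apply: ler_of_eq; ring.
by apply: ler_pM => //; [rewrite mulr_ge0|lra|apply: ler_pM].
Qed.

Lemma sqrt_ln_ge1 m : 1 <= Num.sqrt (1 + ln (m%:R : R)).
Proof. by rewrite -[leLHS]sqrtr1 ler_wsqrtr; have := ln_natr_ge0 R m; lra. Qed.
Lemma polylog_root : exists K : R, 0 < K /\ forall m, (0 < m)%N ->
 4 * Num.sqrt m%:R * (1 + ln (m%:R : R)) ^+ 2 <= K * m%:R / Num.sqrt (1 + ln m%:R).
Proof.
have [K [K0 KE]] : exists K : R, 0 < K /\ K ^+ 2 = 6 ^+ 6 by exists (6 ^+ 3); rewrite exprn_gt0 // -exprM.
exists (4 * K); split; first by sign.
move=> m m0; have m1 : 1 <= (m%:R : R) by rewrite ler1n.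
have l0 := ln_natr_ge0 R m; have s1 := sqrt_ln_ge1 m.
have L0 : 0 <= 1 + ln (m%:R : R) by lra.
have h : (1 + ln m%:R) ^+ 3 <= K * Num.sqrt m%:R.
 rewrite -(@ler_pXn2r _ 2) /1/.
 rewrite (exprMn 2 K) sqr_sqrtr /1/ -exprM KE.
 exact: (polylog_le (isT : (0 < 6)%N) m1).
rewrite ler_pdivlMr; last by lra.
have sL : Num.sqrt (1 + ln (m%:R : R)) <= 1 + ln m%:R.
 rewrite -[leRHS]ger0_norm // -sqrtr_sqr.
 by rewrite ler_wsqrtr; nra.
have mm : m%:R = Num.sqrt m%:R * Num.sqrt m%:R :> R by rewrite -expr2 sqr_sqrtr.
have q0 := sqrtr_ge0 (m%:R : R).
via (4 * Num.sqrt m%:R * (1 + ln m%:R) ^+ 3).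
 rewrite [leRHS](_ : _ = 4 * Num.sqrt m%:R * (1 + ln m%:R) ^+ 2 * (1 + ln m%:R)); last by ring.
 by apply: ler_wpM2l => //; rewrite !mulr_ge0 // exprn_ge0.
rewrite [in leRHS]mm; step (ler_wpM2l (mulr_ge0 (ler0n _ 4) q0) h).
by apply: ler_of_eq; ring.
Qed.

Definition thn n : R := (prime n)%:R * ln n%:R - 1.

(** The right side, which is at least C m/sqrt(1 + log m), is spread over n to fit [abel_le]. *)
Lemma theta_bound : exists C : R, 0 < C /\ forall m, (0 < m)%N ->
 `|\sum_(1 <= n < m.+1) thn n| <= \sum_(1 <= n < m.+1) C / Num.sqrt (1 + ln n%:R).
Proof.
have [C [C0 h]] := psi_bound R; have [K [K0 hK]] := polylog_root.
exists (C + K); split; first by lra.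
move=> m m0; have := h m m0 => hA.
via ((C + K) * m%:R / Num.sqrt (1 + ln m%:R)); last first.
 have -> : (C + K) * m%:R / Num.sqrt (1 + ln m%:R) =
  \sum_(1 <= n < m.+1) (C + K) / Num.sqrt (1 + ln m%:R).
  by rewrite big_const_nat iter_addr_0 subn1 -[RHS]mulr_natr; ring.
 apply: ler_sum_nat => n /andP[n1 nm].
 have p1 := sqrt_ln_ge1 n; have p2 := sqrt_ln_ge1 m.
 rewrite ler_wpM2l ?lef_pV2 /1/.
 rewrite ler_wsqrtr /1/ lerD2l ler_ln /1/ ler_nat /1/.
have -> : \sum_(1 <= n < m.+1) thn n = An R m - \sum_(1 <= n < m.+1 | ~~ prime n) vM R n.
 rewrite [X in _ - X]big_mkcond -sumrB; apply: eq_bigr => n _.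
 rewrite /thn /cn; case: (boolP (prime n)) => [pn|_] /=; last by ring.
 by rewrite mul1r vM_prime // subr0.
triB; rewrite mulrDl mulrDl; apply: lerD => //.
rewrite ger0_norm; last by apply: sumr_ge0 => n _; exact: vM_ge0.
exact: le_trans (sum_vM_nonprime m0) (hK m m0).
Qed.

Lemma theta_upper : exists C : R, 0 < C /\ forall m,
 \sum_(1 <= n < m.+1) (prime n)%:R * ln n%:R <= C * m%:R.
Proof.
have [C [C0 h]] := psib_le R; exists C; split => // m.
apply: le_trans (h m); apply: ler_sum => n _; rewrite /bn.
have := vM_ge0 R n; case: (boolP (prime n)) => [/(vM_prime R) ->|_]; rewrite ?mul1r ?mul0r; lra.
Qed.
End PrimeSums.

(** * Prime sums of functions concentrated at a scale e^L *)

Section ScaledPrimeSums.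
Variable R : realType.
Implicit Types (m n N : nat).

Lemma powR_expR (x a : R) : 0 < x -> x `^ a = expR (a * ln x).
Proof. by move=> x0; rewrite /powR gt_eqF. Qed.
Lemma powR_incr (b x : R) : 0 < b < 1 -> 0 < x ->
 (1 - b) * (x + 1) `^ (- b) <= (x + 1) `^ (1 - b) - x `^ (1 - b).
Proof.
move=> /andP[b0 b1] x0.
have [|||c] := @MVT_segment R (fun t => t `^ (1 - b)) (fun t => (1 - b) * t `^ (1 - b - 1)) x (x + 1).
- by rewrite lerDl.
- by move=> t; rewrite in_itv => /andP[xt _]; apply: is_derive1_powR; apply: lt_trans xt.
- apply: derivable_within_continuous => t; rewrite in_itv /= => /andP[xt _].
 by have [] := is_derive1_powR (1 - b) (lt_le_trans x0 xt).
rewrite in_itv /= => /andP[xc cx] ->.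
rewrite (_ : x + 1 - x = 1) ?mulr1 ?ler_pM2l; [|lra|ring].
have -> : 1 - b - 1 = - b by ring.
rewrite !powRN lef_pV2 ?posrE ?powR_gt0; try lra.
by rewrite ge0_ler_powR ?nnegrE; lra.
Qed.

Lemma sum_powRN_head (b : R) (M : nat) : 0 < b < 1 ->
 \sum_(1 <= n < M.+1) (n%:R : R) `^ (- b) <= M%:R `^ (1 - b) / (1 - b).
Proof.
move=> bb; have /andP[b0 b1] := bb; have c0 : 0 < 1 - b by lra.
case: M => [|M]; first by rewrite big_geq /1/ divr_ge0 ?(ltW c0).
rewrite ler_pdivlMr //; elim: M => [|M IH].
 by rewrite big_nat1 !powR1 mul1r; lra.
rewrite big_nat_recr //= mulrDl.
have M0 : 0 < (M.+1%:R : R) by sign.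
have := powR_incr bb M0; rewrite natr1; lra.
Qed.

Lemma weight_bound (e C L l : R) : 0 < e <= 2 -> 0 <= C -> 1 <= L -> 0 <= l ->
 C / (Num.max l (ln 2) * Num.sqrt (1 + l)) + `|(Num.max l (ln 2))^-1 - L^-1| <=
 (C + 1) * 16 / e ^+ 2 / (L * Num.sqrt L) * (expR (e * (L - l)) + expR (e * (l - L))).
Proof.
move=> /andP[e0 e2] C0 L1 l0; set m := Num.max _ _; set t := `|L - l|.
have l2 : 2^-1 <= ln (2 : R) by have := @lnS_ge R 1 isT; rewrite divr1.
have l2' : ln (2 : R) <= 1 by have := @expR_ge1Dx R (ln 2); rewrite lnK /1/; lra.
have t0 : 0 <= t by sign.
have mlam : (1 + l) / 4 <= m by rewrite /m le_max; apply/orP; case: (lerP l 1) => h; [right|left]; lra.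
have ml : m <= 1 + l by rewrite /m ge_max; apply/andP; split; clear -l0 l2'; lra.
have m0 : 0 < m by lra.
have ml1 : l <= m by rewrite /m le_max lexx.
have Lt : L <= (1 + l) * (1 + t).
 have : L - l <= t by apply: ler_norm.
 clear -l0 t0; nra.
have mL : `|L - m| <= 1 + t.
 have -> : L - m = (L - l) + (l - m) by ring.
 triD; rewrite -/t addrC lerD2r ler_norml; lra.
set sL := Num.sqrt L; set sl := Num.sqrt (1 + l).
have sL1 : 1 <= sL by rewrite -[leLHS]sqrtr1 ler_wsqrtr.
have sl1 : 1 <= sl by rewrite -[leLHS]sqrtr1 ler_wsqrtr; clear -l0; lra.
have sLL : sL ^+ 2 = L by rewrite sqr_sqrtr; clear -L1; lra.
have sll : sl ^+ 2 = 1 + l by rewrite sqr_sqrtr; clear -mlam ml; lra.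
have st : sL <= sl * (1 + t).
 rewrite -(@ler_pXn2r _ 2) /1/; try (clear; lra).
 rewrite exprMn sLL sll; step Lt; rewrite ler_wpM2l; clear -l0 t0; nra.
have E1 : (1 + t) ^+ 2 <= 4 / e ^+ 2 * expR (e * t).
 have : e / 2 * (1 + t) <= expR (e / 2 * t).
  by apply: le_trans (expR_ge1Dx _); clear -e2; nra.
 move=> h; rewrite mulrAC ler_pdivlMr /1/ mulrC.
 have -> : expR (e * t) = expR (e / 2 * t) ^+ 2 by rewrite -expRM_natl; congr expR; field.
 have h0 : 0 <= e / 2 * (1 + t) by sign.
 have : (e / 2 * (1 + t)) ^+ 2 <= expR (e / 2 * t) ^+ 2 by rewrite lerXn2r /1/.
 move: (expR _) => E; clear; nra.
have E2 : expR (e * t) <= expR (e * (L - l)) + expR (e * (l - L)).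
 rewrite /t; have [h|h] := lerP 0 (L - l).
  by rewrite ger0_norm // lerDl expR_ge0.
 by rewrite ltr0_norm // opprB lerDr expR_ge0.
have Lp : 0 < L by clear -L1; lra.
have LsL : 0 < L * sL by sign.
have B1 : (m * sl)^-1 <= 4 * (1 + t) ^+ 2 / (L * sL).
 rewrite -[leLHS]mul1r ler_pdivrMr /1/ mulrAC ler_pdivlMr /1/ mul1r.
 have : L * sL <= (1 + l) * (1 + t) * (sl * (1 + t)) by apply: ler_pM; clear -Lt sL1 st Lp; lra.
 move=> /le_trans; apply.
 rewrite [leRHS](_ : _ = (4 * m) * (1 + t) * (sl * (1 + t))); last by ring.
 by rewrite !ler_wpM2r ?mulr_ge0 //; clear -t0 mlam sl1; lra.
have B2 : `|m^-1 - L^-1| <= 4 * (1 + t) ^+ 2 / (L * sL).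
 have -> : m^-1 - L^-1 = (L - m) / (m * L) by field; rewrite !gt_eqF.
 rewrite normrM [X in _ * X]ger0_norm; last by sign.
 rewrite ler_pdivrMr /1/ mulrAC ler_pdivlMr /1/.
 have sLL' : sL <= L by rewrite -sLL expr2 ler_peMr; clear -sL1; lra.
 have : `|L - m| * (L * sL) <= (1 + t) * (L * ((1 + l) * (1 + t))).
  apply: ler_pM => //; first by sign.
  by rewrite ler_wpM2l; clear -Lt sL1 sLL'; lra.
 move=> /le_trans; apply.
 rewrite [leRHS](_ : _ = (1 + t) * (L * ((4 * m) * (1 + t)))); last by ring.
 apply: ler_wpM2l; first by (clear -t0; lra).
 by rewrite ler_wpM2l ?(ltW Lp) // ler_wpM2r //; clear -t0 mlam; lra.
via ((C + 1) * (4 * (1 + t) ^+ 2 / (L * sL))).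
 by rewrite mulrDl mul1r lerD // ler_wpM2l.
have -> : (C + 1) * 16 / e ^+ 2 / (L * sL) * (expR (e * (L - l)) + expR (e * (l - L))) =
  (C + 1) * (4 * (4 / e ^+ 2 * (expR (e * (L - l)) + expR (e * (l - L)))) / (L * sL)) by ring.
apply: ler_wpM2l; first by (clear -C0; lra).
rewrite ler_wpM2r /1/ ler_wpM2l /1/.
step E1; rewrite ler_wpM2l /1/ divr_ge0.
Qed.

(** e is so small that the sum of n^(-σ-e) below e^L is governed by its upper end and that of
    n^(-2σ+e) beyond e^L converges. *)
Lemma weight_sum (σ e : R) : 2^-1 < σ < 1 -> 0 < e -> σ + e < 1 -> e < 2 * σ - 1 ->
 exists C : R, 0 < C /\ forall L N (f : nat -> R), 0 <= L ->
 (forall n, (0 < n)%N -> 0 <= f n) ->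
 (forall n, (0 < n)%N -> f n <= expR (σ * L) * n%:R `^ (- σ)) ->
 (forall n, (0 < n)%N -> f n <= expR (2 * σ * L) * n%:R `^ (- (2 * σ))) ->
 \sum_(1 <= n < N.+1) f n * (expR (e * (L - ln n%:R)) + expR (e * (ln n%:R - L))) <= C * expR L.
Proof.
move=> /andP[s1 s2] e0 e1 e2.
set a := 2 * σ - 1 - e; have a0 : 0 < a by rewrite /a; lra.
set b := σ + e; have b01 : 0 < b < 1 by rewrite /b; lra.
have b1 : 0 < 1 - b by rewrite /b; lra.
exists (2 / (1 - b) + 2 * (2 `^ a / a)); split.
 by sign.
move=> L N f L0 f0 f1 f2; set X := expR L.
have X0 : 0 < X by sign.
have X1 : 1 <= X by rewrite -expR0 ler_expR.
have lX : ln X = L by apply: expRK.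
set M := Num.truncn X.
have /andP[MX XM] := truncn_itv (ltW X0); rewrite -/M in MX XM.
have M0 : (0 < M)%N by rewrite truncn_gt0.
set w := fun n : nat => expR (e * (L - ln n%:R)) + expR (e * (ln n%:R - L)) : R.
have w0 n : 0 <= w n by rewrite addr_ge0.
have t0 n : (0 < n)%N -> 0 <= f n * w n by move=> n0; rewrite mulr_ge0 ?f0.
via (\sum_(1 <= n < maxn N.+1 M.+1) f n * w n).
 rewrite [leRHS](big_cat_nat (n := N.+1)) ?leq_maxl //= lerDl big_nat sumr_ge0 // => n /andP[nN _].
 by rewrite t0 // (leq_trans _ nN).
rewrite (big_cat_nat (n := M.+1)) ?leq_maxr //= mulrDl; apply: lerD.
 via (2 * X `^ b * \sum_(1 <= n < M.+1) n%:R `^ (- b)).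
  rewrite mulr_sumr; apply: ler_sum_nat => n /andP[n0 nM].
  have np : 0 < (n%:R : R) by sign.
  have ln_ : ln n%:R <= L by rewrite -lX ler_ln /1/ (le_trans _ MX) /1/ ler_nat.
  have : w n <= 2 * expR (e * (L - ln n%:R)).
   by rewrite mulr_natl mulr2n lerD2l ler_expR ler_wpM2l; clear -e0 ln_; lra.
  move=> /(ler_pM (f0 n n0) (w0 n) (f1 n n0)) /le_trans; apply.
  rewrite !powR_expR // lX [leLHS](_ : _ = 2 * (expR (σ * L) * expR (- σ * ln n%:R) * expR (e * (L - ln n%:R)))); last by ring.
  rewrite -[leRHS]mulrA ler_wpM2l // -!expRD ler_expR /b; clear; lra.
 apply: le_trans (ler_wpM2l _ (sum_powRN_head M b01)) _; first by sign.
 via (2 * X `^ b * (X `^ (1 - b) / (1 - b))).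
  rewrite ler_wpM2l /1/ ler_wpM2r ?invr_ge0 ?(ltW b1) /1/.
  by rewrite ge0_ler_powR ?nnegrE ?(ltW b1) ?(ltW X0).
 rewrite [leLHS](_ : _ = 2 / (1 - b) * (X `^ b * X `^ (1 - b))); last by ring.
 rewrite -powRD (_ : b + (1 - b) = 1) ?powRr1 /1/; ring.
have X2 : X / 2 <= M%:R by move: XM; rewrite -natr1; have : 1 <= (M%:R : R) by [rewrite ler1n]; lra.
via (2 * X `^ (2 * σ - e) * \sum_(M <= n < maxn N M) n.+1%:R `^ (- a - 1)).
 rewrite maxnSS big_add1 /= mulr_sumr; apply: ler_sum_nat => n /andP[nM nN].
 have ln_ : L <= ln n.+1%:R by rewrite -lX ler_ln /1/ (le_trans (ltW XM)) /1/ ler_nat.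
 have : w n.+1 <= 2 * expR (e * (ln n.+1%:R - L)).
  by rewrite mulr_natl mulr2n lerD2r ler_expR ler_wpM2l; clear -e0 ln_; lra.
 move=> /(ler_pM (f0 n.+1 isT) (w0 n.+1) (f2 n.+1 isT)) /le_trans; apply.
 rewrite !powR_expR // lX [leLHS](_ : _ = 2 * (expR (2 * σ * L) * expR (- (2 * σ) * ln n.+1%:R) * expR (e * (ln n.+1%:R - L)))); last by ring.
 rewrite -[leRHS]mulrA ler_wpM2l // -!expRD ler_expR /a; clear; lra.
apply: le_trans (ler_wpM2l _ (sum_powRN_tail _ a0 M0)) _; first by sign.
via (2 * X `^ (2 * σ - e) * ((X / 2) `^ (- a) / a)).
 rewrite ler_wpM2l /1/ ler_wpM2r /1/.
 rewrite !powRN lef_pV2 /1/.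
 by rewrite ge0_ler_powR /1/.
rewrite !powR_expR ?ln_div /1/ lX.
rewrite [leLHS](_ : _ = 2 / a * (expR ((2 * σ - e) * L) * expR (- a * (L - ln 2)))); last by ring.
rewrite [leRHS](_ : _ = 2 / a * (expR (a * ln 2) * expR L)); last by rewrite /X; ring.
by rewrite ler_wpM2l /1/ -!expRD ler_expR /a; clear; lra.
Qed.

(** f decreases and is at most (X/n)^σ and (X/n)^(2σ) with X = e^L, so n near X dominates, where
    primes have density 1/L. The main application is f(n) = log I_0(k n^-σ) with k = X^σ. *)
Lemma prime_sum_scaled (σ : R) : 2^-1 < σ < 1 ->
 exists C : R, 0 < C /\ forall L N (f : nat -> R), 1 <= L ->
 (forall n, (0 < n)%N -> 0 <= f n) -> (forall n, (0 < n)%N -> f n.+1 <= f n) ->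
 (forall n, (0 < n)%N -> f n <= expR (σ * L) * n%:R `^ (- σ)) ->
 (forall n, (0 < n)%N -> f n <= expR (2 * σ * L) * n%:R `^ (- (2 * σ))) ->
 `|\sum_(1 <= n < N.+1) (prime n)%:R * f n - L^-1 * \sum_(1 <= n < N.+1) f n| <=
 C * expR L / (L * Num.sqrt L).
Proof.
move=> s12; have /andP[s1 s2] := s12.
set e := Num.min (1 - σ) (2 * σ - 1) / 2.
have [e0 e1 e2] : [/\ 0 < e, σ + e < 1 & e < 2 * σ - 1].
 rewrite /e; split.
 - by rewrite divr_gt0 // lt_min; lra.
 - have : Num.min (1 - σ) (2 * σ - 1) <= 1 - σ by rewrite ge_min lexx.
  lra.
 - have : Num.min (1 - σ) (2 * σ - 1) <= 2 * σ - 1 by rewrite ge_min lexx orbT.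
  lra.
have [C1 [C10 h1]] := theta_bound R; have [C2 [C20 h2]] := weight_sum s12 e0 e1 e2.
exists ((C1 + 1) * 16 / e ^+ 2 * C2); split.
 by sign.
move=> L N f L1 f0 fd f1 f2.
set l := fun n : nat => Num.max (ln (n%:R : R)) (ln 2).
have l2 : 2^-1 <= ln (2 : R) by have := @lnS_ge R 1 isT; rewrite divr1.
have lp n : 0 < l n by rewrite /l lt_max; apply/orP; right; clear -l2; lra.
set F := fun n => f n / l n.
have e_diff : \sum_(1 <= n < N.+1) (prime n)%:R * f n - L^-1 * \sum_(1 <= n < N.+1) f n =
  \sum_(1 <= n < N.+1) thn R n * F n + \sum_(1 <= n < N.+1) f n * ((l n)^-1 - L^-1).
 rewrite mulr_sumr -sumrB -big_split /=; apply: eq_bigr => n _; rewrite /thn /F.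
 have -> : (prime n)%:R * f n = (prime n)%:R * ln n%:R * (f n / l n).
  case: (boolP (prime n)) => pn; last by rewrite !mul0r.
  have -> : l n = ln n%:R by rewrite /l max_l /1/ ler_ln /1/ ler_nat prime_gt1.
  have : 0 < ln (n%:R : R) by rewrite ln_gt0 // ltr1n prime_gt1.
  by move=> l0; rewrite !mul1r mulrCA divff /1/ mulr1.
 ring.
rewrite e_diff; triD.
have A : `|\sum_(1 <= n < N.+1) thn R n * F n| <= \sum_(1 <= n < N.+1) C1 / Num.sqrt (1 + ln n%:R) * F n.
 have [->|N0] := posnP N; first by rewrite !big_geq // normr0.
 apply: abel_le.
 - by move=> m /andP[m0 _]; apply: h1.
 - move=> n /andP[n0 _]; rewrite /F ler_pM ?f0 ?fd ?invr_ge0 ?(ltW (lp _)) /1/ lef_pV2 /1/.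
  rewrite /l ge_max; apply/andP; split; rewrite le_max ?lexx ?orbT //.
  by rewrite ler_ln /1/ ler_nat leqnSn.
 - by rewrite /F divr_ge0 ?f0 ?(ltW (lp _)).
apply: le_trans (lerD A (ler_norm_sum _ _ _)) _; rewrite -big_split /=.
via (\sum_(1 <= n < N.+1) (C1 + 1) * 16 / e ^+ 2 / (L * Num.sqrt L) *
  (f n * (expR (e * (L - ln n%:R)) + expR (e * (ln n%:R - L))))).
 apply: ler_sum_nat => n /andP[n0 _].
 rewrite normrM (ger0_norm (f0 n n0)) /F.
 rewrite [leLHS](_ : _ = f n * (C1 / (l n * Num.sqrt (1 + ln n%:R)) + `|(l n)^-1 - L^-1|)); last first.
  by rewrite invfM; ring.
 rewrite [leRHS](_ : _ = f n * ((C1 + 1) * 16 / e ^+ 2 / (L * Num.sqrt L) * (expR (e * (L - ln n%:R)) + expR (e * (ln n%:R - L))))); last by ring.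
 apply: ler_wpM2l; first exact: f0.
 apply: weight_bound => /1/; rewrite /1/.
 by rewrite e0; clear -e1 e2; lra.
rewrite -mulr_sumr; apply: le_trans (ler_wpM2l _ (h2 L N f _ f0 f1 f2)) _; last 2 first.
- clear -L1; lra.
- by apply: ler_of_eq; ring.
by sign.
Qed.

Lemma prime_powR_tail (a : R) : 1 < a -> exists C : R, 0 < C /\ forall M N, (1 < M)%N ->
 \sum_(M <= n < N) (prime n)%:R * (n%:R : R) `^ (- a) <= C * M%:R `^ (1 - a) / ln M%:R.
Proof.
move=> a1; have [C [C0 h]] := theta_upper R.
have a0 : 0 < a - 1 by lra.
set K := 1 + (a - 1)^-1.
have K0 : 0 < K by sign.
exists (C * K); split; first by sign.
move=> M N M1; have Mp : 0 < (M%:R : R) by rewrite ltr0n ltnW.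
have M0 : (0 < M)%N by rewrite ltnW.
have lM : 0 < ln (M%:R : R) by rewrite ln_gt0 // ltr1n.
rewrite ler_pdivlMr //.
have [NM|MN] := leqP N M.
 by rewrite big_geq /1/ mul0r !mulr_ge0 ?(ltW C0) ?(ltW K0).
case: N MN => // N; rewrite ltnS => MN.
(* Frozen at M^-a below M, F is monotone from n = 1 on, as Abel summation requires. *)
set F := fun n => (Num.max (n%:R : R) M%:R) `^ (- a).
have A : `|\sum_(1 <= n < N.+1) ((prime n)%:R * ln n%:R) * F n| <= \sum_(1 <= n < N.+1) C * F n.
 apply: abel_le.
 - move=> m _; rewrite ger0_norm; last by sign.
  step (h m); rewrite big_const_nat iter_addr_0 subn1 -[leRHS]mulr_natr /=.
  by rewrite lexx.
 - move=> n _; rewrite /F !powRN lef_pV2 ?posrE ?powR_gt0 ?lt_max ?Mp ?orbT //.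
  apply: ge0_ler_powR; rewrite ?nnegrE; [lra|by sign|by sign|].
  by rewrite ge_max; apply/andP; split; rewrite le_max ?lexx ?orbT // ler_nat leqnSn.
 - by rewrite powR_ge0.
have {A} := le_trans (ler_norm _) A.
rewrite -mulr_sumr (big_cat_nat (n := M)) //=; last by rewrite ltnW.
set P := \sum_(1 <= n < M) _ * _.
have P0 : 0 <= P by apply: sumr_ge0 => n _; rewrite !mulr_ge0 ?ln_natr_ge0 ?powR_ge0.
set Q := \sum_(M <= n < N.+1) _ * _ => A.
have B : (\sum_(M <= n < N.+1) (prime n)%:R * n%:R `^ (- a)) * ln M%:R <= Q.
 rewrite mulr_suml /Q; apply: ler_sum_nat => n /andP[Mn nN].
 rewrite /F max_l ?ler_nat /1/ mulrAC ler_wpM2r /1/ ler_wpM2l /1/ ler_ln ?posrE ?ltr0n ?ler_nat /1/.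
 exact: leq_trans Mn.
have D : \sum_(1 <= i < N.+1) F i <= K * M%:R `^ (1 - a).
 rewrite (big_cat_nat (n := M.+1)) //= mulrDl mul1r; apply: lerD.
  via (\sum_(1 <= n < M.+1) M%:R `^ (- a)).
   apply: ler_sum_nat => n /andP[_ nM]; by rewrite /F max_r // ler_nat.
  rewrite big_const_nat iter_addr_0 subn1 -[leLHS]mulr_natr /=.
  rewrite -{2}(powRr1 (ltW Mp)) -powRD /1/.
  by rewrite (_ : - a + 1 = 1 - a) //; ring.
 rewrite big_add1 /= mulrC.
 have := sum_powRN_tail N a0 M0; rewrite (_ : - (a - 1) = 1 - a); last by ring.
 apply: le_trans; apply: ler_sum_nat => n /andP[Mn nN].
 rewrite /F max_l ?ler_nat 1?leqW //.
 by rewrite (_ : 1 - a - 1 = - a) //; ring.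
have := ler_wpM2l (ltW C0) D; clear -P0 A B; lra.
Qed.
End ScaledPrimeSums.

(** * Averages over equally spaced points of the circle *)

Section RootsOfUnity.
Variable R : realType.
Implicit Types (N a d m : nat).

Lemma conjc_inv1 (z : R[i]) : cabs z = 1 -> z * conjc z = 1.
Proof. by move=> h; rewrite mulc_conjc h expr1n. Qed.
Lemma conjcM (z w : R[i]) : conjc (z * w) = conjc z * conjc w.
Proof. exact: rmorphM. Qed.
Lemma conjcX (z : R[i]) n : conjc (z ^+ n) = conjc z ^+ n.
Proof. exact: rmorphXn. Qed.
Lemma conjc_sum I (r : seq I) (P : pred I) (F : I -> R[i]) :
 conjc (\sum_(i <- r | P i) F i) = \sum_(i <- r | P i) conjc (F i).
Proof. exact: rmorph_sum. Qed.

Definition rou N a : R[i] := cexp (Complex 0 (2 * pi * a%:R / N%:R)).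

Lemma rouD N a b : rou N (a + b) = rou N a * rou N b.
Proof.
by rewrite /rou -cexpD; congr cexp; apply: complex_eqP; rewrite /= ?addr0 // natrD; ring.
Qed.

Lemma rou0 N : rou N 0 = 1.
Proof. by rewrite /rou mulr0 mul0r; exact: cexp0. Qed.
Lemma rou_mul N a d : rou N (a * d) = rou N a ^+ d.
Proof. by elim: d => [|d IH]; rewrite ?muln0 ?rou0 // mulnS rouD IH exprS. Qed.
Lemma cabs_rou N a : cabs (rou N a) = 1.
Proof. by rewrite /rou cabs_cexp expR0. Qed.
Lemma rouNN N : (0 < N)%N -> rou N N = 1.
Proof.
move=> N0; rewrite /rou mulfK ?pnatr_eq0 -?lt0n // /cexp /= expR0 !mul1r.
by rewrite mulr_natl cos2pi sin2pi.
Qed.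

Lemma rou_neq1 N d : (0 < d < N)%N -> rou N d != 1.
Proof.
move=> /andP[d0 dN]; apply/eqP => h.
have N0 : 0 < (N%:R : R) by rewrite ltr0n (leq_ltn_trans _ dN).
have := congr1 (@Re R) h; rewrite /rou /cexp /= expR0 mul1r.
set x := (pi * d%:R / N%:R : R).
have -> : 2 * pi * d%:R / N%:R = x *+ 2 :> R by rewrite /x -mulr_natl; ring.
rewrite cos_mulr2n => e.
have : 0 < sin x.
 apply: sin_gt0_pi; have p0 := pi_gt0 R; rewrite /x divr_gt0 ?mulr_gt0 ?ltr0n ?(leq_ltn_trans _ dN) //=.
 by rewrite ltr_pdivrMr // ltr_pM2l // ltr_nat.
have : sin x ^+ 2 = 0.
 have := cos2Dsin2 x; move: e; rewrite -mulr_natl.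
 by move: (cos x ^+ 2) (sin x ^+ 2) => u v; lra.
by move/eqP; rewrite sqrf_eq0 => /eqP ->; rewrite ltxx.
Qed.

Lemma rou_modn N d : (0 < N)%N -> rou N (d %% N) = rou N d.
Proof.
by move=> N0; rewrite {2}(divn_eq d N) rouD mulnC rou_mul rouNN // expr1n mul1r.
Qed.

Lemma sum_rou N d : (0 < N)%N -> \sum_(a < N) rou N (a * d) = (N * (N %| d))%:R.
Proof.
move=> N0; have e (a : 'I_N) : rou N (a * d) = rou N d ^+ a by rewrite mulnC rou_mul.
under eq_bigr => a _ do rewrite e.
have [h|h] := boolP (N %| d)%N.
 have -> : rou N d = 1 by rewrite -rou_modn // (eqP h) rou0.
 by under eq_bigr => a _ do rewrite expr1n; rewrite sumr_const card_ord muln1.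
rewrite muln0; have r1 : rou N d - 1 != 0.
 rewrite subr_eq0 -rou_modn // rou_neq1 // ltn_mod N0 andbT lt0n; exact: h.
apply: (mulfI r1); rewrite mulr0 -subrX1.
by rewrite -rou_mul mulnC rou_mul rouNN // expr1n subrr.
Qed.

Definition circ N (th : R) a : R[i] := rou N a * cexp (Complex 0 (- th)).

Lemma cabs_circ N th a : cabs (circ N th a) = 1.
Proof. by rewrite cabsM cabs_rou mul1r cabs_cexp expR0. Qed.
Lemma sum_circ N th i j : (i + j < N)%N ->
 \sum_(a < N) circ N th a ^+ i * conjc (circ N th a) ^+ j = (N * (i == j))%:R.
Proof.
move=> ijN; have N0 : (0 < N)%N by apply: leq_ltn_trans ijN.
wlog ij : i j ijN / (j <= i)%N.
 move=> H; have [ij|ij] := leqP j i; first exact: H.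
 have := H j i; rewrite addnC => /(_ ijN (ltnW ij)) h.
 rewrite eq_sym -(conjc_nat R) -h conjc_sum; apply: eq_bigr => a _.
 by move: (circ N th a) => z; rewrite conjcM !conjcX conjcK mulrC.
have -> : \sum_(a < N) circ N th a ^+ i * conjc (circ N th a) ^+ j =
 \sum_(a < N) rou N (a * (i - j)) * cexp (Complex 0 (- th)) ^+ (i - j).
 apply: eq_bigr => a _; rewrite -{1}(subnK ij) exprD -mulrA -exprMn conjc_inv1 ?cabs_circ //.
 by rewrite expr1n mulr1 exprMn rou_mul.
rewrite -mulr_suml sum_rou //; have [->|ne] := eqVneq i j.
 by rewrite subnn dvdn0 expr0 mulr1.
have -> : (N %| i - j)%N = false.
 apply/negP => /dvdn_leq; rewrite subn_gt0 ltn_neqAle eq_sym ne ij => /(_ isT).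
 by move=> h; have := leq_trans h (leq_subr j i); rewrite leqNgt (leq_ltn_trans (leq_addr j i)).
by rewrite muln0 mul0r.
Qed.

Lemma Re_circ N th a : Re (circ N th a) = cos (2 * pi * a%:R / N%:R - th).
Proof. by rewrite /circ /rou -cexpD /cexp /= addr0 expR0 mul1r. Qed.
Lemma Re_conj2 (z : R[i]) : (Re z)%:c = (z + conjc z) * 2^-1.
Proof.
have t2 : (2^-1 : R[i]) = (2^-1 : R)%:c by rewrite rmorphV ?unitfE //= rmorph_nat.
rewrite t2 mulrC; apply: complex_eqP; rewrite ?Re_realM ?Im_realM ?ReD ?ImD ?Re_conjc ?Im_conjc /=; by field.
Qed.

Lemma realcX (x : R) n : (x ^+ n)%:c = x%:c ^+ n :> R[i].
Proof. by elim: n => // n IH; rewrite !exprS realcM IH. Qed.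
Lemma realc_nat n : (n%:R : R)%:c = n%:R :> R[i].
Proof. by rewrite rmorph_nat. Qed.
(** N equally spaced angles integrate trigonometric polynomials of degree below N exactly, so these
    are the moments of cos on the circle, whatever the shift th. *)
Lemma sum_cos_pow N (th : R) m : (m < N)%N ->
 \sum_(a < N) cos (2 * pi * a%:R / N%:R - th) ^+ m =
 N%:R * ((~~ odd m)%:R * 'C(m, m./2)%:R / 2 ^+ m).
Proof.
move=> mN; apply: (can_inj (fun x : R => erefl : Re x%:c = x)).
rewrite realc_sum.
under eq_bigr => a _.
 rewrite -Re_circ realcX Re_conj2 exprMn exprDn mulr_suml.
 under eq_bigr => i _ do rewrite -mulrnAl mulrAC -mulr_natr.
 over.
rewrite exchange_big.
have h (i : 'I_m.+1) : \sum_(a < N) circ N th a ^+ (m - i) * conjc (circ N th a) ^+ i * 'C(m, i)%:R * 2^-1 ^+ m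
  = (N * (m == i.*2)%N)%:R * 'C(m, i)%:R * 2^-1 ^+ m.
 have im : (i <= m)%N by rewrite -ltnS.
 rewrite -!mulr_suml sum_circ ?subnK // (_ : (m - i == i)%N = (m == i.*2)) //.
 by rewrite -(eqn_add2r i) subnK // addnn.
transitivity (\sum_(i < m.+1) (N * (m == i.*2)%N)%:R * 'C(m, i)%:R * 2^-1 ^+ m : R[i]).
 by apply: eq_bigr => i _; rewrite -h; apply: eq_bigr => a _; ring.
have t2 : (2^-1 : R[i]) = (2^-1 : R)%:c by rewrite rmorphV ?unitfE //= rmorph_nat.
rewrite t2 -realcX.
have [om|om] := boolP (odd m).
 rewrite big1 ?mul0r ?mulr0 //= => i _; rewrite (_ : (m == i.*2) = false) ?muln0 ?mul0r //.
 by apply/negP => /eqP e; move: om; rewrite e odd_double.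
have em : m = (m./2).*2 by rewrite -[LHS]odd_double_half (negPf om).
have hm : (m./2 < m.+1)%N by rewrite ltnS {2}em -addnn leq_addr.
rewrite (bigD1 (Ordinal hm)) //= -em eqxx muln1 big1 ?addr0; last first.
 move=> i ne; rewrite (_ : (m == i.*2) = false) ?muln0 ?mul0r //.
 apply/negP => /eqP e; case/negP: ne; apply/eqP; apply: val_inj => /=.
 by have := congr1 half e; rewrite doubleK => ->.
by rewrite mul1r !realcM -exprVn !realc_nat mulrA.
Qed.
End RootsOfUnity.

(** * Tails of the exponential series *)

Section ExpTail.
Variable R : realType.

Lemma exp_partial_le (x : R) K : 0 <= x -> \sum_(m < K) x ^+ m / m`!%:R <= expR x.
Proof.
move=> x0; have -> : \sum_(m < K) x ^+ m / m`!%:R = series (exp_coeff x) K.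
 by rewrite /series /= big_mkord.
rewrite /expR; apply: nondecreasing_cvgn_le; last exact: is_cvg_series_exp_coeff.
apply: nondecreasing_series => n _ _; exact: exp_coeff_ge0.
Qed.

Lemma exp_tail_sum (x : R) M K : 0 <= x ->
 \sum_(M <= m < K) x ^+ m / m`!%:R <= x ^+ M / M`!%:R * expR x.
Proof.
move=> x0; rewrite -{1}[M]add0n big_addn big_mkord.
apply: le_trans (ler_wpM2l _ (exp_partial_le (K - M) x0)); last by sign.
rewrite mulr_sumr; apply: ler_sum => i _.
rewrite [leRHS](_ : _ = x ^+ (i + M) * (M`!%:R * i`!%:R)^-1); last by rewrite invfM exprD; ring.
rewrite ler_wpM2l /1/ lef_pV2 /1/ -natrM ler_nat.
have := bin_fact (leq_addr M i); rewrite addKn => <-.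
rewrite mulnC [(i`! * _)%N]mulnC mulnC leq_pmull // bin_gt0 leq_addr //.
Qed.

Lemma exp_taylor (x : R) M : `|expR x - \sum_(m < M) x ^+ m / m`!%:R| <= `|x| ^+ M / M`!%:R * expR `|x|.
Proof.
apply/ler_addgt0Pr => e e0.
have /cvgrPdist_lt /(_ e e0) := (is_cvg_series_exp_coeff x : cvgn _).
rewrite -/(expR x) => -[N0 _ hN].
set K := maxn N0 M; have := hN K (leq_maxl _ _).
have -> : series (exp_coeff x) K = \sum_(m < M) x ^+ m / m`!%:R + \sum_(M <= m < K) x ^+ m / m`!%:R.
 by rewrite /series /= (big_cat_nat (n := M)) ?leq_maxr //= big_mkord.
set A := \sum_(m < M) _; set B := \sum_(M <= m < K) _ => h.
have hB : `|B| <= `|x| ^+ M / M`!%:R * expR `|x|.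
 apply: le_trans (exp_tail_sum M K (normr_ge0 x)); triS.
 by apply: ler_sum => m _; rewrite normrM normrX (ger0_norm (_ : 0 <= m`!%:R^-1)).
have -> : expR x - A = (expR x - (A + B)) + B by ring.
by triD; rewrite addrC; apply: lerD => //; apply: ltW.
Qed.
End ExpTail.

(** * The Bessel function I_0 *)

Section BesselI0.
Variable R : realType.
Implicit Types (t h s : R) (J N n : nat).

Definition I0p t J : R := \sum_(0 <= n < J) (t / 2) ^+ (2 * n) / ((n`!)%:R ^+ 2).

Lemma I0E t : I0 t = limn (I0p t).
Proof. by []. Qed.
Lemma I0_term_ge0 t n : 0 <= (t / 2) ^+ (2 * n) / ((n`!)%:R ^+ 2) :> R.
Proof. by rewrite exprM; apply: divr_ge0; rewrite exprn_ge0 ?sqr_ge0. Qed.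
Lemma I0p_nondec t : nondecreasing_seq (I0p t).
Proof.
move=> m n mn; rewrite /I0p [leRHS](big_cat_nat (n := m)) //= lerDl sumr_ge0 // => i _.
exact: I0_term_ge0.
Qed.

Lemma I0p_le_exp t J : I0p t J <= expR (t ^+ 2 / 4).
Proof.
have x0 : 0 <= t ^+ 2 / 4 by sign.
apply: le_trans (exp_partial_le J x0); rewrite /I0p big_mkord; apply: ler_sum => n _.
have -> : (t / 2) ^+ (2 * n) = (t ^+ 2 / 4) ^+ n by rewrite exprM; congr (_ ^+ n); field.
rewrite ler_wpM2l /1/ lef_pV2 /1/.
by rewrite -natrX ler_nat expnS expn1 leq_pmull ?fact_gt0.
Qed.

Lemma I0p_cvg t : cvgn (I0p t).
Proof.
apply: nondecreasing_is_cvgn; first exact: I0p_nondec.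
by exists (expR (t ^+ 2 / 4)) => _ [J _ <-]; exact: I0p_le_exp.
Qed.

Lemma I0p_le t J : I0p t J <= I0 t.
Proof. by rewrite I0E; apply: nondecreasing_cvgn_le; [exact: I0p_nondec|exact: I0p_cvg]. Qed.
Lemma I0_le_bound t K : (forall J, I0p t J <= K) -> I0 t <= K.
Proof. by move=> h; rewrite I0E; apply: limr_le; [exact: I0p_cvg|near=> J; exact: h]. Unshelve. all: by end_near. Qed.
Lemma I0_ge1 t : 1 <= I0 t.
Proof.
apply: le_trans (I0p_le t 1); rewrite /I0p big_nat1 muln0 expr0 fact0 expr1n divr1 //.
Qed.

Lemma I0_gt0 t : 0 < I0 t.
Proof. by apply: lt_le_trans (I0_ge1 t). Qed.
Lemma I0_ge t : 1 + t ^+ 2 / 4 <= I0 t.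
Proof.
apply: le_trans (I0p_le t 2); rewrite /I0p big_nat_recl //= big_nat1 muln0 muln1 expr0 fact0 !expr1n !divr1.
by rewrite lerD2l; apply: ler_of_eq; field.
Qed.

Lemma I0_le_expsqr t : I0 t <= expR (t ^+ 2 / 4).
Proof. by apply: I0_le_bound => J; exact: I0p_le_exp. Qed.
Lemma I0_mono t s : 0 <= t -> t <= s -> I0 t <= I0 s.
Proof.
move=> t0 ts; apply: I0_le_bound => J; apply: le_trans (I0p_le s J).
apply: ler_sum => n _; rewrite ler_wpM2r /1/ lerXn2r ?nnegrE; lra.
Qed.

(** Discrete form of I_0(t) as the mean of exp(t cos) over the circle; [circavg_cvg] is the limit.
    Finite averages turn bounds for I_0 into termwise inequalities. *)
Definition circavg N t th : R :=
 N%:R^-1 * \sum_(a < N) expR (t * cos (2 * pi * a%:R / N%:R - th)).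

Lemma even_sum (g : nat -> R) J : (forall n, g n.*2.+1 = 0) ->
 \sum_(m < J.*2) g m = \sum_(0 <= n < J) g n.*2.
Proof.
move=> g0; elim: J => [|J IH]; first by rewrite big_ord0 big_geq.
by rewrite doubleS !big_ord_recr IH big_nat_recr //= g0 addr0.
Qed.

Lemma circavg_I0p N J t th : (0 < N)%N -> (J.*2 <= N)%N ->
 `|circavg N t th - I0p t J| <= `|t| ^+ J.*2 / (J.*2)`!%:R * expR `|t|.
Proof.
move=> N0 JN; have Np : 0 < (N%:R : R) by sign.
have -> : I0p t J = N%:R^-1 * \sum_(a < N) \sum_(m < J.*2) (t * cos (2 * pi * a%:R / N%:R - th)) ^+ m / m`!%:R.
 rewrite exchange_big /=.
 have e (m : 'I_J.*2) : \sum_(i < N) (t * cos (2 * pi * i%:R / N%:R - th)) ^+ m / m`!%:R =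
   t ^+ m / m`!%:R * (N%:R * ((~~ odd m)%:R * 'C(m, m./2)%:R / 2 ^+ m)).
  rewrite -(@sum_cos_pow R N th) ?(leq_trans _ JN) // mulr_sumr; apply: eq_bigr => i _.
  by rewrite exprMn; ring.
 under eq_bigr => m _ do rewrite e.
 rewrite mulr_sumr.
 rewrite (even_sum (g := fun m => N%:R^-1 * (t ^+ m / m`!%:R * (N%:R * ((~~ odd m)%:R * 'C(m, m./2)%:R / 2 ^+ m))))); last first.
  by move=> n; rewrite /= odd_double mul0r mul0r !mulr0.
 apply: eq_bigr => n _; rewrite odd_double mul1r doubleK.
 have : ('C(n.*2, n) * (n`! * n`!))%N = (n.*2)`! by have := bin_fact (leq_addr n n); rewrite addnK addnn.
 move=> /(congr1 (fun k : nat => k%:R : R)); rewrite !natrM => bf.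
 rewrite -bf -mul2n exprMn exprVn.
 have [p1 p2] : (n`!%:R : R) != 0 /\ ('C(2 * n, n)%:R : R) != 0 by rewrite !pnatr_eq0 -!lt0n fact_gt0 bin_gt0 mul2n -addnn leq_addr.
 have p3 : (2 ^+ (2 * n) : R) != 0 by rewrite expf_neq0.
 have p4 : (N%:R : R) != 0 by sign.
 move: (2 ^+ (2 * n)) (t ^+ (2 * n)) N%:R ('C(2 * n, n)%:R : R) (n`!%:R : R) p1 p2 p3 p4.
 by clear => a b c d e p1 p2 p3 p4; field; rewrite p1 p2 p3 p4.
rewrite /circavg -mulrBr -sumrB normrM ger0_norm /1/.
rewrite ler_pdivrMl //; triS.
via (\sum_(a < N) `|t| ^+ J.*2 / (J.*2)`!%:R * expR `|t|); last first.
 by rewrite sumr_const card_ord -[leLHS]mulr_natl.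
apply: ler_sum => a _; apply: le_trans (exp_taylor _ _) _.
have ct : `|t * cos (2 * pi * a%:R / N%:R - th)| <= `|t| by rewrite normrM ler_piMr // cos_max.
apply: ler_pM; rewrite ?ler_expR /1/.
by rewrite ler_wpM2r /1/ lerXn2r.
Qed.

Lemma exp_coeff_small t (e : R) : 0 < e -> exists M0 : nat, forall M, (M0 <= M)%N ->
 `|t| ^+ M / M`!%:R * expR `|t| <= e.
Proof.
move=> e0; have E0 : 0 < expR `|t| by sign.
have /cvgrPdist_lt /(_ (e / expR `|t|)) := @cvg_exp_coeff R `|t|.
rewrite divr_gt0 // => /(_ isT) [M0 _ h]; exists M0 => M hM.
have := h M hM; rewrite sub0r normrN /exp_coeff /= ger0_norm; last by sign.
by move=> /ltW; rewrite ler_pdivlMr.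
Qed.

Lemma circavg_cvg t (e : R) : 0 < e -> exists N0 : nat, (0 < N0)%N /\ forall N th, (N0 <= N)%N ->
 `|circavg N t th - I0 t| <= e.
Proof.
move=> e0; have e2 : 0 < e / 2 by lra.
have [M0 h] := exp_coeff_small t e2.
have hc : (I0p t @ \oo --> I0 t)%classic by exact: I0p_cvg.
move/cvgrPdist_lt : hc => /(_ (e / 2) e2) [J0 _ hJ].
set J := maxn J0 M0; exists (J.*2.+1); split => // N th hN.
have hN' : (J.*2 <= N)%N by apply: ltnW.
have := circavg_I0p t th (leq_ltn_trans (leq0n _) hN) hN'.
have M0J : (M0 <= J.*2)%N by rewrite -addnn (leq_trans (leq_maxr J0 M0)) // leq_addr.
have := hJ J (leq_maxl _ _); have := h _ M0J.
move: (_ * expR _) (circavg N t th) (I0p t J) => A B D h1 h2 h3.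
have -> : B - I0 t = (B - D) - (I0 t - D) by ring.
triB; lra.
Qed.

Lemma circavg_le N t th : circavg N t th <= expR `|t|.
Proof.
have [->|N0] := posnP N; first by rewrite /circavg invr0 mul0r expR_ge0.
rewrite ler_pdivrMl /1/; via (\sum_(a < N) expR `|t|).
 apply: ler_sum => a _; rewrite ler_expR (le_trans (ler_norm _)) // normrM ler_piMr // cos_max //.
by rewrite sumr_const card_ord -[leLHS]mulr_natl.
Qed.

Lemma I0_le_exp t : I0 t <= expR `|t|.
Proof.
apply/ler_addgt0Pr => e e0; have [N [N0 h]] := circavg_cvg t e0.
have := h N 0 (leqnn _); have := circavg_le N t 0; rewrite ler_norml => h1 /andP[h2 _]; lra.
Qed.

Lemma circavg_lip N t s th : `|circavg N t th - circavg N s th| <= `|t - s| * expR (`|t| + `|s|).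
Proof.
have [->|N0] := posnP N; first by rewrite /circavg invr0 !mul0r subrr normr0 mulr_ge0.
rewrite /circavg -mulrBr -sumrB normrM ger0_norm /1/ ler_pdivrMl /1/.
triS.
via (\sum_(a < N) `|t - s| * expR (`|t| + `|s|)); last first.
 by rewrite sumr_const card_ord -[leLHS]mulr_natl.
apply: ler_sum => a _; set c := cos _.
have c1 : `|c| <= 1 by apply: cos_max.
have aux (x y : R) : x <= y -> expR y - expR x <= (y - x) * expR y.
 move=> xy; have := expR_ge1Dx (x - y); rewrite expRD expRN.
 have yp := expR_gt0 y; move=> /(ler_wpM2r (ltW yp)); rewrite mulfVK; lra.
have aux2 (x y : R) : `|expR x - expR y| <= `|x - y| * expR (`|x| + `|y|).
 wlog xy : x y / x <= y.
  move=> H; have [h|h] := leP x y; first exact: H.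
  by rewrite distrC (distrC x) (addrC `|x|); apply: H; apply: ltW.
 rewrite distrC ger0_norm ?subr_ge0 ?ler_expR // (distrC x) ger0_norm ?subr_ge0 //.
 step (aux _ _ xy); rewrite ler_wpM2l ?subr_ge0 // ler_expR.
 by have := ler_norm y; have := normr_ge0 x; lra.
apply: le_trans (aux2 _ _) _; rewrite -mulrBl !normrM.
by apply: ler_pM; rewrite ?ler_expR ?lerD ?ler_piMr.
Qed.

Lemma I0_lip t s : `|I0 t - I0 s| <= `|t - s| * expR (`|t| + `|s|).
Proof.
apply/ler_addgt0Pr => e e0; have e2 : 0 < e / 2 by lra.
have [N1 [N10 h1]] := circavg_cvg t e2; have [N2 [N20 h2]] := circavg_cvg s e2.
have := h1 (maxn N1 N2) 0 (leq_maxl _ _); have := h2 (maxn N1 N2) 0 (leq_maxr _ _).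
have := circavg_lip (maxn N1 N2) t s 0.
move: (circavg _ t _) (circavg _ s _) => A B q1 q2 q3.
have -> : I0 t - I0 s = (A - B) - (A - I0 t) + (B - I0 s) by ring.
triD; apply: le_trans (lerD (ler_normB _ _) (lexx _)) _; lra.
Qed.

Lemma I0_continuous : continuous (@I0 R).
Proof.
move=> t; apply/cvgrPdist_le => e e0 /=.
set K := expR (`|t| + (`|t| + 1)); have K0 : 0 < K by sign.
have d0 : 0 < Num.min 1 (e / K) by rewrite lt_min ltr01 divr_gt0.
near=> s.
have hs : `|t - s| <= Num.min 1 (e / K) by near: s; apply: cvgr_dist_le => //; exact: cvg_id.
step (I0_lip t s).
have h1 : `|t - s| <= 1 by sign.
have h2 : `|t - s| <= e / K by step hs; rewrite ge_min lexx orbT.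
have s1 : `|s| <= `|t| + 1.
 have -> : s = t - (t - s) by ring.
 by triB; lra.
via (e / K * K); last by rewrite divfK /1/.
by apply: ler_pM; rewrite /1/ ler_expR lerD2l.
Unshelve. all: by end_near. Qed.

Lemma expR1_le4 : expR 1 <= 4 :> R.
Proof.
have h : expR (2^-1) <= 2 :> R.
 have := @expR_ge1Dx R (- 2^-1); rewrite expRN => h.
 by rewrite -[leLHS]invrK -[leRHS]invrK lef_pV2 /1/; lra.
have -> : expR 1 = expR (2^-1) * expR (2^-1) :> R by rewrite -expRD; congr expR; field.
by have := expR_ge0 (2^-1 : R); nra.
Qed.

Lemma pow2_le_exp n : (2 ^ n)%:R <= expR n%:R :> R.
Proof. by rewrite natrX -[n%:R]mulr1 expRM_natl lerXn2r /1/; have := @expR_ge1Dx R 1; lra. Qed.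
(** The constant 2 in place of 1/2 leaves room for a first-order Taylor estimate when |x| <= 1;
    otherwise |x| <= 2 x^2. *)
Lemma cosh_le (x : R) : expR x + expR (- x) <= 2 * expR (2 * x ^+ 2).
Proof.
have [h|h] := lerP `|x| 1; last first.
 have a : `|x| <= 2 * x ^+ 2 by rewrite -real_normK ?num_real; nra.
 have b1 : expR x <= expR (2 * x ^+ 2) by rewrite ler_expR; have := ler_norm x; lra.
 have b2 : expR (- x) <= expR (2 * x ^+ 2) by rewrite ler_expR; have := ler_norm (- x); rewrite normrN; lra.
 lra.
have e1 : expR `|x| <= 4 by apply: le_trans expR1_le4; rewrite ler_expR.
have := exp_taylor x 2; have := exp_taylor (- x) 2.
rewrite !normrN !big_ord_recr !big_ord0 /= !expr0 !expr1 !fact0 !factS fact0 !muln1 !divr1.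
have x2 : `|x| ^+ 2 = x ^+ 2 by rewrite real_normK ?num_real.
rewrite x2 !ler_norml => /andP[_ u1] /andP[_ u2].
have : x ^+ 2 / 2 * expR `|x| <= x ^+ 2 / 2 * 4 by rewrite ler_wpM2l /1/ divr_ge0.
have := expR_ge1Dx (2 * x ^+ 2); lra.
Qed.

(** The product is a double sum over points a and b; exchanging them turns exp(h (c a - c b)) into a
    hyperbolic cosine, at most exp(2 h^2 (c a - c b)^2) <= exp(8 h^2). In the limit this bounds the
    second differences of log I_0. *)
Lemma circavg_shift N t h th :
 circavg N (t + h) th * circavg N (t - h) th <= circavg N t th ^+ 2 * expR (8 * h ^+ 2).
Proof.
set c := fun a : 'I_N => cos (2 * pi * a%:R / N%:R - th).
rewrite /circavg -/c.
have -> : N%:R^-1 * (\sum_(a < N) expR ((t + h) * cos (2 * pi * a%:R / N%:R - th))) *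
 (N%:R^-1 * \sum_(a < N) expR ((t - h) * cos (2 * pi * a%:R / N%:R - th))) =
 N%:R ^- 2 * \sum_(a < N) \sum_(b < N) expR (t * (c a + c b)) * expR (h * (c a - c b)).
 rewrite [RHS](_ : _ = N%:R ^- 2 * \sum_(a < N) \sum_(b < N) expR ((t + h) * c a) * expR ((t - h) * c b)).
  under [in RHS]eq_bigr => a _ do rewrite -mulr_sumr.
  by rewrite -mulr_suml expr2 invfM; ring.
 by congr (_ * _); apply: eq_bigr => a _; apply: eq_bigr => b _; rewrite -!expRD; congr expR; ring.
have -> : (N%:R^-1 * \sum_(a < N) expR (t * cos (2 * pi * a%:R / N%:R - th))) ^+ 2 =
 N%:R ^- 2 * \sum_(a < N) \sum_(b < N) expR (t * (c a + c b)).
 rewrite [RHS](_ : _ = N%:R ^- 2 * \sum_(a < N) \sum_(b < N) expR (t * c a) * expR (t * c b)).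
  under [in RHS]eq_bigr => a _ do rewrite -mulr_sumr.
  by rewrite -mulr_suml exprMn exprVn expr2; ring.
 by congr (_ * _); apply: eq_bigr => a _; apply: eq_bigr => b _; rewrite -!expRD; congr expR; ring.
rewrite -mulrA ler_wpM2l /1/.
set S := \sum_(a < N) _.
have S2 : S = \sum_(a < N) \sum_(b < N) expR (t * (c a + c b)) * expR (- (h * (c a - c b))).
 rewrite /S exchange_big /=; apply: eq_bigr => a _; apply: eq_bigr => b _.
 by rewrite -!expRD; congr expR; ring.
have -> : S = \sum_(a < N) \sum_(b < N) expR (t * (c a + c b)) * ((expR (h * (c a - c b)) + expR (- (h * (c a - c b)))) / 2).
 have -> : S = (S + S) / 2 by lra.
 rewrite {2}S2 /S -big_split /= mulr_suml; apply: eq_bigr => a _.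
 by rewrite -big_split /= mulr_suml; apply: eq_bigr => b _; ring.
rewrite mulr_suml; apply: ler_sum => a _; rewrite mulr_suml; apply: ler_sum => b _.
rewrite ler_wpM2l /1/ ler_pdivrMr /1/ mulrC; apply: le_trans (cosh_le _) _.
rewrite [leRHS]mulrC ler_wpM2l // ler_expR exprMn.
have : (c a - c b) ^+ 2 <= 4.
 have : `|c a - c b| <= 2.
  by triB; have := cos_max (2 * pi * a%:R / N%:R - th); have := cos_max (2 * pi * b%:R / N%:R - th); rewrite -/(c a) -/(c b); lra.
 by rewrite ler_norml => /andP[]; nra.
have := sqr_ge0 h; nra.
Qed.

Lemma I0_shift t h : I0 (t + h) * I0 (t - h) <= I0 t ^+ 2 * expR (8 * h ^+ 2).
Proof.
have lim s : ((fun N => circavg N s 0) @ \oo --> I0 s)%classic.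
 apply/cvgrPdist_le => e e0; have [N0 [_ H]] := circavg_cvg s e0.
 by exists N0 => // N hN; rewrite distrC; apply: H.
have c1 : ((fun N => circavg N (t + h) 0 * circavg N (t - h) 0) @ \oo --> I0 (t + h) * I0 (t - h))%classic by apply: cvgM; apply: lim.
have c2 : ((fun N => circavg N t 0 * circavg N t 0 * expR (8 * h ^+ 2)) @ \oo -->
  I0 t * I0 t * expR (8 * h ^+ 2))%classic.
 by apply: cvgMr_tmp; apply: cvgM; apply: lim.
rewrite expr2; apply: (ler_cvg_to c1 c2); near=> N.
by rewrite -expr2; exact: circavg_shift.
Unshelve. all: by end_near. Qed.

Lemma ln_I0_ge0 t : 0 <= ln (I0 t).
Proof. by rewrite ln_ge0 // I0_ge1. Qed.
Lemma ln_I0_le t : 0 <= t -> ln (I0 t) <= t.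
Proof.
move=> t0; rewrite -[leRHS]expRK ler_ln ?posrE ?I0_gt0 /1/.
by step (I0_le_exp t); rewrite ger0_norm.
Qed.

Lemma ln_I0_le_sqr t : ln (I0 t) <= t ^+ 2 / 4.
Proof.
move: (I0_gt0 t) (I0_le_expsqr t); move: (I0 t) => i i0 h; by rewrite -[leRHS]expRK ler_ln /1/.
Qed.

Lemma ln_I0_mono t s : 0 <= t -> t <= s -> ln (I0 t) <= ln (I0 s).
Proof. by move=> t0 ts; rewrite ler_ln ?posrE ?I0_gt0 // I0_mono. Qed.
Lemma ln_I0_shift t h : ln (I0 (t + h)) + ln (I0 (t - h)) <= 2 * ln (I0 t) + 8 * h ^+ 2.
Proof.
move: (I0_gt0 (t + h)) (I0_gt0 (t - h)) (I0_gt0 t) (I0_shift t h).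
move: (I0 _) (I0 _) (I0 _) => x y z x0 y0 z0.
rewrite -ler_ln /1/ !lnM /1/ expRK; lra.
Qed.
End BesselI0.

(** * The integral G1 compared with sums over integers *)

Section IntegralG1.
Variable R : realType.
Local Notation mu := (@lebesgue_measure R).

Lemma is_derive_power (K e x : R) : e != 0 -> 0 < x ->
 is_derive x 1 (fun t : R => K / e * t `^ e) (K * x `^ (e - 1)).
Proof.
move=> e0 x0; have h := is_derive1_powR e x0.
apply: is_deriveEq (is_deriveZ (K / e) h).
by rewrite /GRing.scale /= mulrA divfK.
Qed.

Lemma powR_continuous_at (e x : R) : 0 < x -> {for x, continuous (fun t : R => t `^ e)}.
Proof.
move=> x0; apply: differentiable_continuous; apply/derivable1_diffP.
by have [] := is_derive1_powR e x0.
Qed.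

Lemma measurable_ioc (f : R -> R) (a b : R) : 0 <= a ->
 (forall x, 0 < x -> {for x, continuous f}) -> measurable_fun `]a, b]%classic f.
Proof.
move=> a0 cf; apply: (@measurable_funS _ _ _ _ `]a, +oo[%classic) => //.
 by move=> x /=; rewrite !in_itv => /andP[-> _].
apply: open_continuous_measurable_fun => // x; rewrite inE /= in_itv /= andbT => ax.
by apply: cf; apply: le_lt_trans ax.
Qed.

Lemma integral_power (K e a b : R) : e != 0 -> 0 < a -> a <= b ->
 (\int[mu]_(u in `]a, b]) (K * u `^ (e - 1))%:E = (K / e * (b `^ e - a `^ e))%:E)%E.
Proof.
move=> e0 a0; rewrite le_eqVlt => /predU1P[->|ab].
 by rewrite subrr mulr0 set_itvoc0 integral_set0.
have cK x : 0 < x -> {for x, continuous (fun u : R => K * u `^ (e - 1))} by move=> x0; apply: cvgMl_tmp; exact: powR_continuous_at.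
rewrite integral_itv_obnd_cbnd; last by apply/measurable_EFinP; exact: measurable_ioc (ltW a0) cK.
rewrite (@continuous_FTC2 _ _ (fun t => K / e * t `^ e)) //.
- by rewrite -EFinB mulrBr.
- apply: continuous_in_subspaceT => x; rewrite inE /= in_itv /= => /andP[ax _].
 by apply: cK; apply: lt_le_trans ax.
- split.
 + move=> x; rewrite in_itv /= => /andP[ax _].
  by have [] := is_derive_power K e0 (lt_trans a0 ax).
 + apply: cvg_at_right_filter; apply: cvgMl_tmp; exact: powR_continuous_at.
 + apply: cvg_at_left_filter; apply: cvgMl_tmp; apply: powR_continuous_at; exact: lt_trans ab.
- move=> x; rewrite in_itv /= => /andP[ax _]; rewrite derive1E.
 by have [_ ->] := is_derive_power K e0 (lt_trans a0 ax).
Qed.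

Lemma integral_power_ub (f : R -> R) (K e a b : R) : e != 0 -> 0 < a -> a <= b ->
 (forall x, 0 < x -> {for x, continuous f}) -> (forall u, a < u <= b -> 0 <= f u) ->
 (forall u, a < u <= b -> f u <= K * u `^ (e - 1)) ->
 (\int[mu]_(u in `]a, b]) (f u)%:E <= (K / e * (b `^ e - a `^ e))%:E)%E.
Proof.
move=> e0 a0 ab cf f0 fK; rewrite -integral_power //.
have cK x : 0 < x -> {for x, continuous (fun u : R => K * u `^ (e - 1))} by move=> x0; apply: cvgMl_tmp; exact: powR_continuous_at.
apply: ge0_le_integral => //.
- apply/measurable_EFinP; exact: measurable_ioc (ltW a0) cf.
- apply/measurable_EFinP; exact: measurable_ioc (ltW a0) cK.
Qed.

Lemma integral_power_lb (f : R -> R) (K e a b : R) : e != 0 -> 0 < a -> a <= b -> 0 <= K ->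
 (forall x, 0 < x -> {for x, continuous f}) ->
 (forall u, a < u <= b -> K * u `^ (e - 1) <= f u) ->
 ((K / e * (b `^ e - a `^ e))%:E <= \int[mu]_(u in `]a, b]) (f u)%:E)%E.
Proof.
move=> e0 a0 ab K0 cf fK; rewrite -integral_power //.
have cK x : 0 < x -> {for x, continuous (fun u : R => K * u `^ (e - 1))} by move=> x0; apply: cvgMl_tmp; exact: powR_continuous_at.
apply: ge0_le_integral => //.
- by move=> x /=; rewrite in_itv lee_fin => h; rewrite mulr_ge0 ?powR_ge0.
- apply/measurable_EFinP; exact: measurable_ioc (ltW a0) cK.
- apply/measurable_EFinP; exact: measurable_ioc (ltW a0) cf.
Qed.

Lemma integral_ioc_split (f : R -> R) (a b c : R) : 0 <= a -> a <= b -> b <= c ->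
 (forall x, 0 < x -> {for x, continuous f}) -> (forall u, 0 < u -> 0 <= f u) ->
 (\int[mu]_(u in `]a, c]) (f u)%:E = \int[mu]_(u in `]a, b]) (f u)%:E + \int[mu]_(u in `]b, c]) (f u)%:E)%E.
Proof.
move=> a0 ab bc cf f0.
have e : (`]a, c] = `]a, b] `|` `]b, c])%classic by rewrite -itv_bndbnd_setU.
rewrite e ge0_integral_setU //.
- by rewrite -e; apply/measurable_EFinP; exact: measurable_ioc.
- move=> x; rewrite -e /= in_itv lee_fin => /andP[ax _]; apply: f0; exact: le_lt_trans ax.
- rewrite disj_set2E; apply/eqP; rewrite -subset0 => x [] /=; rewrite !in_itv /= => /andP[_ xb] /andP[bx _].
 by move: (lt_le_trans bx xb); rewrite ltxx.
Qed.

Definition posR : set R := `]0, +oo[%classic.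

(** Monotone convergence along the intervals ]1/(n+1), n+1]. *)
Lemma integral_0y_le (f : R -> R) (U : R) :
 (forall x, 0 < x -> {for x, continuous f}) -> (forall u, 0 < u -> 0 <= f u) ->
 (forall a b, 0 < a -> a <= b -> (\int[mu]_(u in `]a, b]) (f u)%:E <= U%:E)%E) ->
 (\int[mu]_(u in posR) (f u)%:E <= U%:E)%E.
Proof.
move=> cf f0 h.
pose F := fun n : nat => `](n.+1%:R : R)^-1, (n.+1%:R : R)]%classic.
have uF : (posR = \bigcup_n F n)%classic.
 rewrite /posR; apply/seteqP; split => x /=.
  rewrite in_itv /= andbT => x0.
  have [n hn] := exists_nat_gt (Num.max x x^-1); exists n => //; rewrite /F /= in_itv /=.
  move: hn; rewrite gt_max => /andP[h1 h2].
  have n1 : (n%:R : R) <= n.+1%:R by rewrite ler_nat.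
  rewrite (le_trans (ltW h1) n1) andbT -[ltRHS]invrK ltf_pV2 /1/.
  exact: lt_le_trans n1.
 move=> [n _]; rewrite /F /= !in_itv /= andbT => /andP[h1 _].
 by apply: lt_trans h1; rewrite invr_gt0 ltr0n.
rewrite uF.
have mF i : measurable_fun (F i) (fun x => (f x)%:E) by apply/measurable_EFinP; apply: measurable_ioc => //; rewrite invr_ge0.
have nd : nondecreasing_seq F.
 move=> m n mn; apply/subsetPset => x; rewrite /F /= !in_itv /= => /andP[h1 h2].
 have mn1 : (m.+1%:R : R) <= n.+1%:R by rewrite ler_nat.
 rewrite (le_trans h2 mn1) andbT (le_lt_trans _ h1) /1/ lef_pV2 /1/.
have F0 i x : F i x -> (0 <= (f x)%:E)%E.
 rewrite /F /= in_itv lee_fin => /andP[h1 _]; apply: f0; apply: lt_trans h1.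
 by sign.
have cv := @ge0_nondecreasing_set_cvg_integral _ (measurableTypeR R) R F (fun x => (f x)%:E)
 (@lebesgue_measure R : measure _ _) nd (fun i => measurable_itv _) mF F0.
rewrite -(cvg_lim _ cv) //; apply: lime_le; first by apply: cvgP cv.
near=> n.
apply: h; rewrite /1/ (@le_trans _ _ 1) ?ler1n /1/ invf_le1 /1/ ler1n /1/.
Unshelve. all: by end_near. Qed.

Lemma integral_0y_ge (f : R -> R) (a b : R) : 0 <= a ->
 (forall x, 0 < x -> {for x, continuous f}) -> (forall u, 0 < u -> 0 <= f u) ->
 (\int[mu]_(u in `]a, b]) (f u)%:E <= \int[mu]_(u in posR) (f u)%:E)%E.
Proof.
move=> a0 cf f0; apply: ge0_subset_integral => //; rewrite /posR //.
- apply/measurable_EFinP; apply: open_continuous_measurable_fun => // x.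
 by rewrite inE /= in_itv andbT => x0; apply: cf.
- by move=> x; rewrite /= in_itv andbT lee_fin; exact: f0.
- by move=> x; rewrite /= !in_itv andbT => /andP[ax _]; exact: le_lt_trans ax.
Qed.

Variable σ : R.
Hypothesis s12 : 2^-1 < σ < 1.
Let s0 : 0 < σ. Proof. by have /andP[] := s12; lra. Qed.
Let s1 : σ < 1. Proof. by have /andP[] := s12. Qed.
Let sn0 : σ != 0. Proof. by sign. Qed.

Definition gI (u : R) : R := ln (I0 u) * u `^ (- 1 - σ^-1).

Lemma gI_ge0 u : 0 <= gI u.
Proof. by rewrite mulr_ge0 ?ln_I0_ge0 /1/. Qed.
Lemma gI_cont x : 0 < x -> {for x, continuous gI}.
Proof.
move=> x0; apply: cvgM; last exact: powR_continuous_at.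
apply: continuous_comp; first exact: I0_continuous.
by apply: continuous_ln; exact: I0_gt0.
Qed.

(** These nodes cut ]0, k] into intervals of equal mass σ k^(-1/σ) for u^(-1-1/σ) du, so that a
    Riemann sum for G1 becomes an unweighted sum over integers n. *)
Definition unode (k : R) (n : nat) : R := k * n%:R `^ (- σ).

Lemma unode_gt0 k n : 0 < k -> (0 < n)%N -> 0 < unode k n.
Proof. by move=> k0 n0; rewrite mulr_gt0 // powR_gt0 // ltr0n. Qed.
Lemma unode_decr k m n : 0 < k -> (0 < m)%N -> (m <= n)%N -> unode k n <= unode k m.
Proof.
move=> k0 m0 mn; have n0 : (0 < n)%N by apply: leq_trans mn.
rewrite ler_pM2l /1/ !powRN lef_pV2 /1/.
by rewrite ge0_ler_powR ?ler_nat /1/ ltW.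
Qed.

Lemma unode_pow k n e : 0 < k -> (0 < n)%N -> unode k n `^ e = k `^ e * n%:R `^ (- σ * e).
Proof. by move=> k0 n0; rewrite powRM /1/ -powRrM. Qed.
Lemma unode_powV k n : 0 < k -> (0 < n)%N -> unode k n `^ (- σ^-1) = n%:R / k `^ σ^-1.
Proof.
move=> k0 n0; rewrite unode_pow // (_ : - σ * - σ^-1 = 1); last by rewrite mulrNN divff.
by rewrite powRr1 // powRN mulrC.
Qed.

Lemma gI_block_ub k n : 0 < k -> (0 < n)%N ->
 (\int[mu]_(u in `]unode k n.+1, unode k n]) (gI u)%:E <= (ln (I0 (unode k n)) * σ / k `^ σ^-1)%:E)%E.
Proof.
move=> k0 n0; have un := unode_gt0 k0 n0; have un1 := unode_gt0 k0 (ltn0Sn n).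
have e0 : - σ^-1 != 0 by rewrite oppr_eq0 invr_eq0.
apply: le_trans (integral_power_ub (K := ln (I0 (unode k n))) e0 un1 (unode_decr k0 n0 (leqnSn n)) gI_cont (fun u _ => gI_ge0 u) _) _.
 move=> u /andP[u1 u2]; rewrite /gI (_ : - σ^-1 - 1 = - 1 - σ^-1); last by ring.
 by rewrite ler_wpM2r /1/ ln_I0_mono /1/ ltW /1/ (lt_trans un1).
rewrite !unode_powV // lee_fin -(natr1 n).
apply: ler_of_eq; field; rewrite sn0 gt_eqF /1/.
Qed.

Lemma gI_block_lb k n : 0 < k -> (0 < n)%N ->
 ((ln (I0 (unode k n.+1)) * σ / k `^ σ^-1)%:E <= \int[mu]_(u in `]unode k n.+1, unode k n]) (gI u)%:E)%E.
Proof.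
move=> k0 n0; have un := unode_gt0 k0 n0; have un1 := unode_gt0 k0 (ltn0Sn n).
have e0 : - σ^-1 != 0 by rewrite oppr_eq0 invr_eq0.
apply: le_trans (integral_power_lb (K := ln (I0 (unode k n.+1))) e0 un1 (unode_decr k0 n0 (leqnSn n)) (ln_I0_ge0 _) gI_cont _).
 rewrite !unode_powV // lee_fin -(natr1 n).
 by apply: ler_of_eq; field; rewrite sn0 gt_eqF ?powR_gt0.
move=> u /andP[u1 u2]; rewrite /gI (_ : - σ^-1 - 1 = - 1 - σ^-1); last by ring.
by rewrite ler_wpM2r /1/ ln_I0_mono /1/ ltW.
Qed.

Lemma gI_blocks k N : 0 < k -> (0 < N)%N ->
 ((\sum_(1 <= n < N) ln (I0 (unode k n.+1)) * σ / k `^ σ^-1)%:E <=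
  \int[mu]_(u in `]unode k N, unode k 1]) (gI u)%:E)%E /\
 (\int[mu]_(u in `]unode k N, unode k 1]) (gI u)%:E <=
  (\sum_(1 <= n < N) ln (I0 (unode k n)) * σ / k `^ σ^-1)%:E)%E.
Proof.
move=> k0; case: N => // N _; elim: N => [|N [IH1 IH2]].
 have -> : (\int[mu]_(u in `]unode k 1, unode k 1]) (gI u)%:E = 0)%E by rewrite set_itvoc0 integral_set0.
 by split; rewrite big_geq.
have dec := unode_decr k0 (ltn0Sn N) (leqnSn N.+1); have dec1 := unode_decr k0 (ltn0Sn 0) (ltn0Sn N : (1 <= N.+1)%N).
rewrite (integral_ioc_split (ltW (unode_gt0 k0 (ltn0Sn N.+1))) dec dec1 gI_cont (fun u _ => gI_ge0 u)).
have b1 := gI_block_lb k0 (ltn0Sn N); have b2 := gI_block_ub k0 (ltn0Sn N).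
have recr (F : nat -> R) : \sum_(1 <= n < N.+2) F n = \sum_(1 <= n < N.+1) F n + F N.+1 by rewrite big_nat_recr.
have aux1 (x y : R) (I J : \bar R) : (x%:E <= I -> y%:E <= J -> (y + x)%:E <= I + J)%E by move=> h1 h2; rewrite EFinD addeC; apply: leeD.
have aux2 (x y : R) (I J : \bar R) : (I <= x%:E -> J <= y%:E -> I + J <= (y + x)%:E)%E by move=> h1 h2; rewrite EFinD addeC; apply: leeD.
have r1 := recr (fun n => ln (I0 (unode k n.+1)) * σ / k `^ σ^-1).
have r2 := recr (fun n => ln (I0 (unode k n)) * σ / k `^ σ^-1).
have q1 := aux1 _ _ _ _ b1 IH1; have q2 := aux2 _ _ _ _ b2 IH2; clear aux1 aux2 b1 b2 IH1 IH2 recr.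
rewrite -r1 in q1; rewrite -r2 in q2.
exact: conj q1 q2.
Qed.

(** Below the last node log I_0(u) <= u^2/4, above the first log I_0(u) <= u, and both remainders
    converge because 1 < 1/σ < 2. *)
Lemma gI_upper k N : 0 < k -> (0 < N)%N ->
 (\int[mu]_(u in posR) (gI u)%:E <=
  ((4 * (2 - σ^-1))^-1 * unode k N `^ (2 - σ^-1) +
  \sum_(1 <= n < N) ln (I0 (unode k n)) * σ / k `^ σ^-1 +
  (σ^-1 - 1)^-1 * k `^ (1 - σ^-1))%:E)%E.
Proof.
move=> k0 N0; apply: integral_0y_le (fun u _ => gI_ge0 u) _; first exact: gI_cont.
have uN := unode_gt0 k0 N0; have u1 : unode k 1 = k by rewrite /unode powR1 mulr1.
have d1 : unode k N <= k by rewrite -{2}u1; apply: unode_decr.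
have iv2 : σ^-1 < 2 by rewrite -[ltRHS]invrK ltf_pV2 /1/; have /andP[] := s12.
have iv1 : 1 < σ^-1 by rewrite invf_gt1.
move=> a b a0 ab; set a' := Num.min a (unode k N); set b' := Num.max b k.
have a'0 : 0 < a' by rewrite lt_min a0.
have a'u : a' <= unode k N by rewrite ge_min lexx orbT.
have b'k : k <= b' by rewrite le_max lexx orbT.
via (\int[mu]_(u in `]a', b']) (gI u)%:E)%E.
 apply: ge0_subset_integral => //.
 - by apply/measurable_EFinP; apply: measurable_ioc (ltW a'0) gI_cont.
 - by move=> x _; rewrite lee_fin gI_ge0.
 - move=> x /=; rewrite !in_itv /= => /andP[h1 h2].
  by rewrite (le_lt_trans _ h1) ?ge_min ?lexx //= le_max h2.
rewrite (integral_ioc_split (ltW a'0) (le_trans a'u d1) b'k gI_cont (fun u _ => gI_ge0 u)).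
rewrite (integral_ioc_split (ltW a'0) a'u d1 gI_cont (fun u _ => gI_ge0 u)).
rewrite !EFinD; apply: leeD; first apply: leeD.
- have e0 : 2 - σ^-1 != 0 by rewrite gt_eqF // subr_gt0.
 apply: le_trans (integral_power_ub (K := 4^-1) e0 a'0 a'u gI_cont (fun u _ => gI_ge0 u) _) _.
  move=> u /andP[u0 _]; have up := lt_trans a'0 u0.
  have -> : 4^-1 * u `^ (2 - σ^-1 - 1) = u ^+ 2 / 4 * u `^ (- 1 - σ^-1).
   rewrite -powR_mulrn /1/ mulrAC -powRD /1/ mulrC.
   by congr (_ `^ _ * _); ring.
  by rewrite ler_wpM2r /1/ ln_I0_le_sqr.
 rewrite lee_fin -invfM ler_wpM2l ?invr_ge0 ?gerBl /1/; lra.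
- by have := (gI_blocks k0 N0).2; rewrite u1.
- have e0 : 1 - σ^-1 != 0 by rewrite lt_eqF // subr_lt0.
 apply: le_trans (integral_power_ub (K := 1) e0 k0 b'k gI_cont (fun u _ => gI_ge0 u) _) _.
  move=> u /andP[u0 _]; have up := lt_trans k0 u0.
  have -> : 1 * u `^ (1 - σ^-1 - 1) = u * u `^ (- 1 - σ^-1).
   rewrite mul1r -{2}(powRr1 (ltW up)) -powRD /1/.
   by congr (_ `^ _); ring.
  by rewrite ler_wpM2r /1/ ln_I0_le /1/ ltW.
 rewrite lee_fin mul1r -[σ^-1 - 1]opprB invrN mulNr -mulrN ler_wnM2l ?invr_le0 //; first by lra.
 by have := powR_ge0 b' (1 - σ^-1); lra.
Qed.

Lemma G1E : G1 σ = fine (\int[mu]_(u in posR) (gI u)%:E)%E.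
Proof. by []. Qed.
Lemma G1_sandwich k N : 0 < k -> (0 < N)%N ->
 let X := k `^ σ^-1 in
 X * G1 σ <= σ * \sum_(1 <= n < N.+1) ln (I0 (unode k n)) +
  (4 * (2 - σ^-1))^-1 * (k ^+ 2 * N%:R `^ (1 - 2 * σ)) + (σ^-1 - 1)^-1 * k /\
 σ * (\sum_(1 <= n < N.+1) ln (I0 (unode k n)) - ln (I0 k)) <= X * G1 σ.
Proof.
move=> k0 N0 X; have X0 : 0 < X by sign.
have up := gI_upper k0 N0; have uN := unode_gt0 k0 N0.
have lo0 : (0 <= \int[mu]_(u in posR) (gI u)%:E)%E by apply: integral_ge0 => u _; rewrite lee_fin gI_ge0.
have lo : ((\sum_(1 <= n < N) ln (I0 (unode k n.+1)) * σ / X)%:E <= \int[mu]_(u in posR) (gI u)%:E)%E.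
 apply: le_trans (gI_blocks k0 N0).1 _; apply: integral_0y_ge gI_cont (fun u _ => gI_ge0 u); exact: ltW.
(* [G1] is [fine] of the integral, which would be 0 if the integral were infinite; the upper bound
   rules this out. *)
have fin : (\int[mu]_(u in posR) (gI u)%:E)%E \is a fin_num by rewrite ge0_fin_numE //; apply: le_lt_trans up (ltry _).
have e : (\int[mu]_(u in posR) (gI u)%:E)%E = (G1 σ)%:E by rewrite G1E fineK.
have eS (F : nat -> R) : \sum_(1 <= n < N) F n * σ / X = (\sum_(1 <= n < N) F n) * σ / X by rewrite mulr_suml mulr_suml.
rewrite e lee_fin -/X in up; rewrite e lee_fin in lo.
rewrite (eS (fun n => ln (I0 (unode k n)))) in up; rewrite (eS (fun n => ln (I0 (unode k n.+1)))) in lo.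
clear e fin lo0.
have kX : k `^ (1 - σ^-1) * X = k by rewrite -powRD /1/ subrK powRr1 /1/ ltW.
have uX : unode k N `^ (2 - σ^-1) * X = k ^+ 2 * N%:R `^ (1 - 2 * σ).
 rewrite unode_pow /1/ mulrAC -powRD /1/ subrK powR_mulrn /1/.
 by congr (_ * _ `^ _); field.
have k1 : unode k 1 = k by rewrite /unode powR1 mulr1.
split.
 step (ler_wpM2l (ltW X0) up).
 rewrite -uX; set S := \sum_(1 <= n < N) _.
 have hS : S <= \sum_(1 <= n < N.+1) ln (I0 (unode k n)) by rewrite [leRHS]big_nat_recr //= lerDl ln_I0_ge0.
 have -> : X * ((4 * (2 - σ^-1))^-1 * unode k N `^ (2 - σ^-1) + S * σ / X + (σ^-1 - 1)^-1 * k `^ (1 - σ^-1)) =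
   σ * S * (X / X) + (4 * (2 - σ^-1))^-1 * (unode k N `^ (2 - σ^-1) * X) + (σ^-1 - 1)^-1 * (k `^ (1 - σ^-1) * X) by ring.
 by rewrite kX divff /1/ mulr1 !lerD2r ler_wpM2l /1/ ltW.
move: lo; rewrite ler_pdivrMr // [X in _ <= X]mulrC; apply: le_trans.
rewrite mulrC ler_wpM2r /1/.
by rewrite (big_ltn (m := 1)) // k1 addrAC subrr add0r big_add1.
Qed.

Lemma G1_gt0 : 0 < G1 σ.
Proof.
have [_] := G1_sandwich ltr01 (ltn0Sn 1).
rewrite powR1 mul1r; apply: lt_le_trans; rewrite mulr_gt0 //.
have u1 : unode 1 1 = 1 by rewrite /unode powR1 mulr1.
have -> : \sum_(1 <= n < 3) ln (I0 (unode 1 n)) - ln (I0 1) = ln (I0 (unode 1 2)) by rewrite big_ltn // big_nat1 u1 addrAC subrr add0r.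
rewrite ln_gt0 //; apply: lt_le_trans (I0_ge _).
by rewrite ltrDl divr_gt0 ?exprn_gt0 ?unode_gt0.
Qed.
End IntegralG1.

(** * The logarithmic moment generating function of the random model *)

Section PrimeLogI0.
Variable R : realType.
Variable σ : R.
Hypothesis s12 : 2^-1 < σ < 1.

Definition MI (N : nat) (k : R) : R :=
 \sum_(1 <= p < N.+1) (prime p)%:R * ln (I0 (unode σ k p)).

(* With X = k^{1/σ}: by partial summation the sum over primes is 1/log X times the
  sum over integers, and the latter is a Riemann sum of the integral defining G1. *)
Lemma MI_asymp : exists C : R, 0 < C /\ forall (k : R) (N : nat), expR 1 <= k -> (0 < N)%N ->
 let X := k `^ σ^-1 in
 `|MI N k - G1 σ * X / ln k| <=
 C * X / ln k * ((Num.sqrt (ln k))^-1 + (X / N%:R) `^ (2 * σ - 1)).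
Proof.
have /andP[s0' s1] := s12; have s0 : 0 < σ by lra.
have sn0 : σ != 0 by sign.
have iv1 : 1 < σ^-1 by rewrite invf_gt1.
have iv2 : σ^-1 < 2 by rewrite -[ltRHS]invrK ltf_pV2 /1/.
have [C [C0 h]] := prime_sum_scaled s12.
set K1 := (4 * (2 - σ^-1))^-1; set K2 := (σ^-1 - 1)^-1.
have K10 : 0 < K1 by rewrite invr_gt0 mulr_gt0; lra.
have K20 : 0 < K2 by rewrite invr_gt0; lra.
exists (C + K1 + (K2 + 1) * K2); split; first by sign.
move=> k N k1 N0 /=; set X := k `^ σ^-1.
have k0 : 0 < k by apply: lt_le_trans k1; apply: expR_gt0.
have X0 : 0 < X by sign.
have l1 : 1 <= ln k by rewrite -[leLHS]expRK ler_ln /1/.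
have l0 : 0 < ln k by lra.
set L := ln k / σ.
have L1 : 1 <= L by rewrite ler_pdivlMr; clear -s1 s0 l1; lra.
have XE : X = expR L by rewrite /X powR_expR // mulrC.
have kE : expR (σ * L) = k by rewrite /L mulrCA divff // mulr1 lnK.
have Lln : ln k <= L by rewrite ler_pdivlMr // ler_piMr // ltW.
have := h L N (fun n => ln (I0 (unode σ k n))) L1 (fun n _ => ln_I0_ge0 _).
have -> : L^-1 = σ / ln k by rewrite invf_div.
rewrite -/(MI N k) -XE.
have hm n : (0 < n)%N -> ln (I0 (unode σ k n.+1)) <= ln (I0 (unode σ k n)).
 by move=> n0; apply: ln_I0_mono; [exact: ltW (unode_gt0 _ _ _)|exact: unode_decr].
move=> /(_ hm); set S := \sum_(1 <= n < N.+1) _.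
have h1 n : (0 < n)%N -> ln (I0 (unode σ k n)) <= expR (σ * L) * n%:R `^ (- σ).
 by move=> n0; rewrite kE; apply: ln_I0_le; exact: ltW (unode_gt0 _ _ _).
have h2 n : (0 < n)%N -> ln (I0 (unode σ k n)) <= expR (2 * σ * L) * n%:R `^ (- (2 * σ)).
 move=> n0; apply: le_trans (ln_I0_le_sqr _) _.
 have -> : expR (2 * σ * L) * n%:R `^ (- (2 * σ)) = unode σ k n ^+ 2.
  rewrite /unode exprMn -kE -expRM_natl -powR_mulrn /1/ -powRrM.
  by congr (expR _ * _ `^ _); ring.
 by rewrite ler_pdivrMr; have := sqr_ge0 (unode σ k n); clear; lra.
move=> /(_ h1 h2) hS.
have [gu gl] := G1_sandwich s12 k0 N0; rewrite -/X -/S -/K1 -/K2 in gu gl.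
set sq := Num.sqrt (ln k).
have sq1 : 1 <= sq by rewrite -[leLHS]sqrtr1 ler_wsqrtr.
have sq2 : sq <= ln k.
 have : sq ^+ 2 = ln k by rewrite sqr_sqrtr // ltW.
 by move: sq1; nra.
(* The boundary terms of the sandwich are O(k), and k is smaller than X = k^(1/σ) by a power of k,
   hence by sqrt(log k) up to a constant. *)
have kX : k <= K2 * X / sq.
 rewrite ler_pdivlMr; last by (clear -sq1; lra).
 rewrite /K2 mulrC ler_pdivlMl; last by (clear -iv1; lra).
 have -> : X = k * k `^ (σ^-1 - 1).
  have es : σ^-1 = 1 + (σ^-1 - 1) by ring.
  by rewrite /X {1}es powRD /1/ powRr1 /1/ ltW.
 rewrite mulrA [leLHS]mulrC ler_wpM2l /1/ powR_expR /1/.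
 apply: le_trans (expR_ge1Dx _); have : 0 <= (σ^-1 - 1) by (clear -iv1; lra).
 by move=> q; have := ler_wpM2l q sq2; clear; lra.
have Np : 0 < (N%:R : R) by sign.
have XN : k ^+ 2 * N%:R `^ (1 - 2 * σ) = X * (X / N%:R) `^ (2 * σ - 1).
 have lX : ln X = L by rewrite XE expRK.
 rewrite !powR_expR /1/ ln_div /1/ lX {1}XE -kE -expRM_natl -!expRD; congr expR; ring.
have e : MI N k - G1 σ * X / ln k = (MI N k - σ / ln k * S) + (σ * S - X * G1 σ) / ln k by field; rewrite gt_eqF.
rewrite e; triD.
have b1 : C * X / (L * Num.sqrt L) <= C * X / ln k * sq^-1.
 rewrite -[leRHS]mulrA -invfM ler_wpM2l ?mulr_ge0 ?(ltW C0) ?(ltW X0) // lef_pV2 ?posrE ?mulr_gt0 ?sqrtr_gt0 //; try (clear -iv1 L1; lra).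
 by apply: ler_pM; rewrite /1/ ler_wsqrtr.
have b2 : `|(σ * S - X * G1 σ) / ln k| <= (K1 * X * (X / N%:R) `^ (2 * σ - 1) + (K2 + 1) * K2 * X / sq) / ln k.
 rewrite normrM (ger0_norm (_ : 0 <= (ln k)^-1)) /1/.
 rewrite ler_wpM2r /1/.
 have q1 : (K2 + 1) * k <= (K2 + 1) * K2 * X / sq by rewrite -!mulrA ler_wpM2l; [(clear -K20; lra)|(clear -K20; lra)|rewrite mulrA].
 have q2 : σ * ln (I0 k) <= k.
  have := ln_I0_le (ltW k0); have := ln_I0_ge0 k; clear -s1; nra.
 rewrite XN in gu.
 have q3 : 0 <= K1 * (X * (X / N%:R) `^ (2 * σ - 1)) by sign.
 have q4 : 0 <= K2 * k by sign.
 rewrite ler_norml; apply/andP; split; lra.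
step (lerD hS b2).
have P0 : 0 <= X / ln k by sign.
have w0 : 0 <= (X / N%:R) `^ (2 * σ - 1) by sign.
apply: le_trans (lerD b1 (lexx _)) _.
have sqi : 0 <= sq^-1 by rewrite invr_ge0; clear -sq1; lra.
move: (_ `^ (2 * σ - 1)) w0 => w w0.
have -> : C * X / ln k / sq + (K1 * X * w + (K2 + 1) * K2 * X / sq) / ln k =
 X / ln k * (C * sq^-1 + K1 * w + (K2 + 1) * K2 * sq^-1) by ring.
rewrite [leRHS](_ : _ = X / ln k * ((C + K1 + (K2 + 1) * K2) * (sq^-1 + w))); last by ring.
rewrite ler_wpM2l //.
have a1 : 0 <= C * w by sign.
have a2 : 0 <= (K2 + 1) * K2 * w by rewrite !mulr_ge0 //; clear -K20; lra.
have a3 : 0 <= K1 * sq^-1 by sign.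
by rewrite mulrDr !mulrDl; clear -a1 a2 a3; lra.
Qed.
End PrimeLogI0.

From mathcomp Require cyclic.

(** * Dirichlet characters modulo a prime *)

Section Characters.
Variable R : realType.
Variable q : nat.
Hypothesis pq : prime q.
Local Notation F := 'F_q.

Lemma natF_eq a b : ((a%:R : F) == b%:R) = (a == b %[mod q])%N.
Proof. by rewrite -(inj_eq val_inj) /= !val_Fp_nat. Qed.
Lemma natF_neq0 n : coprime n q -> (n%:R : F) != 0.
Proof.
move=> c; have := natF_eq n 0; rewrite mulr0n => ->; rewrite mod0n -/(dvdn q n).
by rewrite -prime_coprime // coprime_sym.
Qed.

Lemma unitF_exp (x : F) : x != 0 -> x ^+ q.-1 = 1.
Proof.
move=> x0; apply: (mulfI x0); rewrite mulr1 -exprS prednK ?prime_gt0 //.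
rewrite -[x]natr_Zp -natrX; apply/eqP; rewrite natF_eq; apply/eqP; exact: fermat_little.
Qed.

Lemma exists_prim_root : exists z : F, q.-1.-primitive_root z.
Proof.
have q1 : (0 < q.-1)%N by case: (q) pq => // -[|].
set rs := enum (predC1 (0 : F)).
have /hasP[z _ hz] : has q.-1.-primitive_root rs.
 apply: cyclic.has_prim_root => //.
 - apply/allP => x; rewrite mem_enum => x0.
  by apply/unity_rootP; exact: unitF_exp.
 - exact: enum_uniq.
 - by rewrite -cardE cardC1 card_Fp.
by exists z.
Qed.

(** A discrete logarithm to a primitive root, extended to all naturals with period q; multiples of q
    get the default index 0. *)
Lemma exists_index : exists ind : nat -> nat,
 [/\ forall n, (ind n < q.-1)%N,
   forall m n, coprime m q -> coprime n q -> ind (m * n)%N = ind m + ind n %[mod q.-1],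
   forall n, ind (n + q)%N = ind n,
   forall m n, coprime m q -> coprime n q -> (ind m == ind n) = (m == n %[mod q])
  & forall i, (i < q.-1)%N -> exists n, [/\ coprime n q, (n < q)%N & ind n = i]].
Proof.
have q1 : (0 < q.-1)%N by case: (q) pq => // -[|].
have [z hz] := exists_prim_root.
have hn n : coprime n q -> exists i : 'I_q.-1, (n%:R : F) == z ^+ i.
 move=> c; have [i ->] := prim_rootP hz (unitF_exp (natF_neq0 c)); by exists i.
pose ind n := if [pick i : 'I_q.-1 | (n%:R : F) == z ^+ i] is Some i then val i else 0%N.
have indP n : coprime n q -> (n%:R : F) = z ^+ ind n.
 move=> c; rewrite /ind; case: pickP => [i /eqP //|h].
 by have [i hi] := hn n c; move: (h i); rewrite hi.
have indl n : (ind n < q.-1)%N by rewrite /ind; case: pickP => [i _|_] //; exact: ltn_ord i.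
exists ind; split => //.
- move=> m n cm cn; apply/eqP; rewrite -(eq_prim_root_expr hz) exprD -!indP ?natrM //.
 by rewrite coprimeMl cm.
- move=> n; rewrite /ind natrD pchar_Fp_0 ?addr0 //.
- move=> m n cm cn; rewrite -natF_eq !indP // (eq_prim_root_expr hz) !modn_small //.
- move=> i iq; have zi : z ^+ i != 0.
  rewrite expf_neq0 //; apply/eqP => z0; have := prim_expr_order hz.
  by rewrite z0 expr0n eqn0Ngt q1 => /eqP; rewrite eq_sym oner_eq0.
 have vE : ((val (z ^+ i))%:R : F) = z ^+ i by rewrite natr_Zp.
 have cv : coprime (val (z ^+ i)) q.
  rewrite coprime_sym prime_coprime //; apply/negP => d; case/eqP: zi.
  by rewrite -vE; apply/eqP; have := natF_eq (val (z ^+ i)) 0; rewrite mulr0n mod0n => ->.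
 exists (val (z ^+ i)); split => //.
  by apply: leq_trans (ltn_ord (z ^+ i)) _; rewrite Fp_cast.
 have := indP _ cv; rewrite vE => /eqP; rewrite (eq_prim_root_expr hz) !modn_small //.
 by move/eqP.
Qed.

Local Notation N := q.-1.

Lemma N_gt0 : (0 < N)%N. Proof. by case: (q) pq => // -[|]. Qed.

Lemma rou_cong a b : a = b %[mod N] -> rou R N a = rou R N b.
Proof. by move=> h; rewrite -rou_modn ?N_gt0 // h rou_modn ?N_gt0. Qed.
Lemma rou_prim : N.-primitive_root (rou R N 1).
Proof.
rewrite /primitive_root_of_unity N_gt0; apply/forallP => i.
rewrite unity_rootE -rou_mul mul1n; apply/eqP.
have [->|ne] := eqVneq i.+1 N; first by rewrite rouNN ?N_gt0 // eqxx.
apply/negbTE; apply: rou_neq1; apply/andP; split=> //; rewrite ltn_neqAle ne; exact: ltn_ord.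
Qed.

Lemma rou_inj a b : (rou R N a == rou R N b) = (a == b %[mod N]).
Proof. by rewrite -(eq_prim_root_expr rou_prim) -!rou_mul !mul1n. Qed.
Lemma conjc_rou a b : (a + b = 0 %[mod N])%N -> conjc (rou R N a) = rou R N b.
Proof.
move=> h; have := conjc_inv1 (cabs_rou R N a).
have <- : rou R N a * rou R N b = 1 by rewrite -rouD (rou_cong h) rou0.
have r0 : rou R N a != 0 by rewrite -cabs_eq0 cabs_rou oner_eq0.
by move/(mulfI r0).
Qed.

(** Interface to an enumeration of the characters with the principal one at 0; later proofs see only
    these properties. *)
Definition char_family (ch : nat -> nat -> R[i]) : Prop :=
 [/\ forall j, (j < N)%N -> dirichlet_char q (ch j),
   ch 0%N = principal_char R q /\ (forall j n, ch j n != 0 -> cabs (ch j n) = 1),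
   forall chi, dirichlet_char q chi -> exists2 j, (j < N)%N & chi = ch j,
   forall i j, (i < N)%N -> (j < N)%N -> ch i = ch j -> i = j
  & (forall a b, \sum_(j < N) ch j a * conjc (ch j b) = (N * [&& coprime a q, coprime b q & a == b %[mod q]])%:R) /\
   (forall j, (0 < j < N)%N -> \sum_(n < q) ch j n = 0)].

Lemma char_congr (chi : nat -> R[i]) a b : dirichlet_char q chi -> a = b %[mod q] -> chi a = chi b.
Proof.
move=> [per _ _] ab.
have h m n : chi (n + m * q)%N = chi n by elim: m => [|m IH]; rewrite ?addn0 // mulSn (addnC q) addnA per.
by rewrite (divn_eq a q) (divn_eq b q) ![(_ * q + _)%N]addnC !h ab.
Qed.

Lemma chars_exist : exists ch, char_family ch.
Proof.
have [ind [indl indM indq indI indS]] := exists_index.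
have N0 := N_gt0; have q0 := prime_gt0 pq.
pose ch j n : R[i] := if coprime n q then rou R N (j * ind n) else 0.
have chM j m n : ch j (m * n)%N = ch j m * ch j n.
 rewrite /ch coprimeMl; case: (boolP (coprime m q)) => cm; last by rewrite mul0r.
 case: (boolP (coprime n q)) => cn; last by rewrite mulr0.
 by rewrite -rouD -mulnDr; apply: rou_cong; rewrite -modnMmr indM // modnMmr.
have chn0 j n : (ch j n != 0) = coprime n q by rewrite /ch; case: ifP => _; rewrite ?eqxx // -cabs_eq0 cabs_rou oner_eq0.
have dch j : dirichlet_char q (ch j) by split => // n; rewrite /ch indq -coprime_modl modnDr coprime_modl.
(* The residue of 1 modulo N, since for q = 2 the only index is 0. *)
have [g [cg gq ig]] := indS (1 %% N)%N (ltn_pmod _ N0).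
have indX i : ind (g ^ i)%N = i %[mod N].
 elim: i => [|i IH].
  have h1 : coprime 1 q by rewrite coprime1n.
  have /eqP := indM _ _ h1 h1; rewrite muln1 -{1}[ind 1]addn0 eqn_modDl mod0n eq_sym => /eqP ->.
  by [].
 by rewrite expnS indM ?coprimeXl // -modnDm IH ig modn_mod modnDm add1n.
have gX n : coprime n q -> n = (g ^ ind n)%N %[mod q].
 move=> cn; apply/eqP; rewrite -indI ?coprimeXl //; apply/eqP.
 by have := indX (ind n); rewrite !modn_small.
exists ch; split.
- by move=> j _; exact: dch.
- split; last by move=> j n; rewrite /ch; case: ifP => _; rewrite ?eqxx // cabs_rou.
 by apply/funext => n; rewrite /ch /principal_char mul0n rou0; case: ifP.
- move=> chi dchi; have [per mul nz] := dchi.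
 have c1 : chi 1%N = 1.
  have h0 : chi 1%N != 0 by rewrite nz coprime1n.
  by apply: (mulfI h0); rewrite mulr1 -mul.
 have chiX i : chi (g ^ i)%N = chi g ^+ i by elim: i => [|i IH]; rewrite // expnS mul IH exprS.
 have gN : chi g ^+ N = 1.
  rewrite -chiX -c1; apply: char_congr => //; apply/eqP.
  have h1 : coprime 1 q by rewrite coprime1n.
  rewrite -indI ?coprimeXl //; apply/eqP.
  have := indX N; have := indX 0; rewrite expn0 modnn mod0n !modn_small // => -> ->.
  by [].
 have [j hj] := prim_rootP rou_prim gN; exists (val j); first exact: ltn_ord.
 apply/funext => n; rewrite /ch; case: (boolP (coprime n q)) => cn; last first.
  by apply/eqP; rewrite -[_ == _]negbK nz.
 by rewrite (char_congr dchi (gX n cn)) chiX hj -!rou_mul mul1n.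
- move=> i j iN jN /(congr1 (fun f => f g)); rewrite /ch cg ig => /eqP.
 rewrite rou_inj !modnMmr !muln1 !modn_small //; by move/eqP.
- split.
  move=> a b; rewrite /ch; case: (boolP (coprime a q)) => ca; last first.
   by rewrite big1 ?muln0 // => j _; rewrite mul0r.
  case: (boolP (coprime b q)) => cb; last first.
   by rewrite andFb andbF big1 ?muln0 // => j _; rewrite conjc0 mulr0.
  rewrite !andTb -indI // (eq_bigr (fun j : 'I_N => rou R N (j * (ind a + (N - ind b))))); last first.
   move=> j _; rewrite (@conjc_rou _ (j * (N - ind b))) -?rouD -?mulnDr ?subnKC ?modnMl ?mod0n //.
   exact: ltnW.
  rewrite sum_rou //; congr ((_ * _)%:R); congr nat_of_bool.
  have lb := ltnW (indl b).
  apply/idP/eqP => [|->]; last by rewrite subnKC.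
  rewrite addnBA // => d; have := indl a; have := indl b.
  move: d; case/dvdnP => k; move: (ind a) (ind b) lb; clear -N0; move: N0; move: N => n.
  case: k => [|[|k]] n0 x y yn; rewrite ?mul0n => e yl xl; lia.
 move=> j /andP[j0 jN].
 have e n : ch j n = \sum_(i < N) ((coprime n q && (ind n == i))%:R * rou R N (j * i)).
  rewrite /ch; case: (boolP (coprime n q)) => cn /=; last by rewrite big1 // => i _; rewrite mul0r.
  rewrite (bigD1 (Ordinal (indl n))) //= eqxx mul1r big1 ?addr0 // => i ne.
  by rewrite (_ : ind n == i = false) ?mul0r //; apply/negbTE; rewrite eq_sym; exact: ne.
 under eq_bigr => n _ do rewrite e.
 rewrite exchange_big /= (eq_bigr (fun i : 'I_N => rou R N (i * j))); last first.
  move=> i _; rewrite -mulr_suml mulnC.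
  have [n [cn nq nI]] := indS i (ltn_ord i).
  rewrite (bigD1 (Ordinal nq)) //= cn nI eqxx big1 ?addr0 ?mul1r // => m ne.
  case: (boolP (coprime m q)) => cm //=; rewrite (_ : ind m == i = false) //.
  apply/negbTE; rewrite -nI indI // !modn_small //; exact: ne.
 rewrite sum_rou // (_ : (N %| j)%N = false) ?muln0 //.
 by apply/negP => /(dvdn_leq j0); rewrite leqNgt jN.
Qed.

Lemma char_proportionE ch P : char_family ch ->
 char_proportion q P = (\sum_(j < N) ((0 < j)%N && `[< P (ch j) >])%:R) / N%:R :> R.
Proof.
move=> [dch [ch0 _] chS chI _]; rewrite /char_proportion totient_prime //; congr (_ / _).
pose Q (j : 'I_N) := (0 < j)%N && `[< P (ch j) >].
have := @card_finset 'I_N Q; set A := (X in #|` X|) => cA.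
have inA j : (j \in A) = Q j by rewrite inE.
have -> : ([set chi | dirichlet_char q chi /\ chi <> principal_char R q /\ P chi])%classic =
  ((fun j : 'I_N => ch j) @` [set` A])%classic.
 apply/seteqP; split => [chi /= [d [np p]]|_ /= [j + <-]].
  have [j jN e] := chS chi d; exists (Ordinal jN) => //=.
  rewrite inA /Q /=; apply/andP; split; last by apply/asboolP; rewrite -e.
  by rewrite lt0n; apply/eqP => j0; apply: np; rewrite e j0.
 rewrite inA => /andP[j0 /asboolP pj]; split; first exact: dch.
 split => // e; move: j0; rewrite (chI j 0%N (ltn_ord j) N_gt0) //; by rewrite ch0.
rewrite fset_set_image; last exact: finite_fset.
rewrite set_fsetK card_in_imfset /=; last first.
 by move=> i j _ _ e; apply: val_inj; apply: chI => //; apply: ltn_ord.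
by rewrite cA -sum1_card natr_sum big_mkcond; apply: eq_bigr => j _; rewrite unfold_in; case: ifP.
Qed.

(** Distinct integers below q are distinct residues, so orthogonality leaves only the diagonal. *)
Lemma mean_square ch (a : nat -> R[i]) M : char_family ch -> (M <= q)%N ->
 \sum_(j < N) cabs (\sum_(n < M) a n * ch j n) ^+ 2 <= N%:R * \sum_(n < M) cabs (a n) ^+ 2.
Proof.
move=> [_ _ _ _ [orth _]] Mq.
have e : (\sum_(j < N) cabs (\sum_(n < M) a n * ch j n) ^+ 2)%:c =
  (N%:R * \sum_(n < M) (coprime n q)%:R * cabs (a n) ^+ 2 : R)%:c.
 rewrite realc_sum.
 transitivity (\sum_(n < M) \sum_(m < M) a n * conjc (a m) * \sum_(j < N) ch j n * conjc (ch j m)).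
  transitivity (\sum_(j < N) \sum_(n < M) \sum_(m < M) a n * conjc (a m) * (ch j n * conjc (ch j m))).
   apply: eq_bigr => j _; rewrite -mulc_conjc conjc_sum mulr_suml; apply: eq_bigr => n _.
   by rewrite mulr_sumr; apply: eq_bigr => m _; rewrite conjcM; ring.
  rewrite exchange_big; apply: eq_bigr => n _; rewrite exchange_big; apply: eq_bigr => m _.
  by rewrite mulr_sumr.
 rewrite realcM realc_sum mulr_sumr; apply: eq_bigr => n _.
 rewrite (bigD1 n) //= [X in _ + X]big1 ?addr0; last first.
  move=> m ne; rewrite orth (_ : (n == m %[mod q]) = false) ?andbF ?muln0 ?mulr0 //.
  by rewrite !modn_small ?(leq_trans (ltn_ord _) Mq) //; apply/negbTE; rewrite eq_sym; exact: ne.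
 rewrite orth eqxx andbT andbb mulc_conjc realcM natrM !realc_nat; ring.
move: e => [->] ; rewrite ler_wpM2l /1/ ler_sum /1/ => n _; rewrite ler_piMl /1/.
by case: coprime.
Qed.
End Characters.

(** * Convergence of L(s, chi) and mean bounds for its tail *)

Section CauchySequences.
Variable R : realType.

Lemma real_cauchy (u : nat -> R) :
 (forall e, 0 < e -> exists N0 : nat, forall m n, (N0 <= m)%N -> (N0 <= n)%N -> `|u m - u n| <= e) ->
 cvgn u.
Proof.
move=> h; suff : cauchy_ex (u @ \oo)%classic by move=> /cauchy_exP; exact: cauchy_cvg.
move=> e e0; have e2 : 0 < e / 2 by sign.
have [N0 H] := h _ e2; exists (u N0); exists N0 => // n /= hn.
rewrite /ball; apply: le_lt_trans (H N0 n (leqnn _) hn) _; lra.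
Qed.
End CauchySequences.

Section LTail.
Variable R : realType.
Implicit Types (chi : nat -> R[i]) (s : R) (M N n : nat).

Definition npow (n : nat) (s : R) : R[i] := (n%:R `^ (- s))%:c.
Definition Lp chi M s : R[i] := \sum_(1 <= n < M) chi n * npow n s.
Definition Tc chi M : R[i] := \sum_(k < M) chi k.

Lemma Re_Lp chi M s : Re (Lp chi M s) = \sum_(1 <= n < M) Re (chi n) * n%:R `^ (- s).
Proof. by rewrite Re_sum; apply: eq_bigr => n _; rewrite mulrC Re_realM mulrC. Qed.
Lemma Im_Lp chi M s : Im (Lp chi M s) = \sum_(1 <= n < M) Im (chi n) * n%:R `^ (- s).
Proof. by rewrite Im_sum; apply: eq_bigr => n _; rewrite mulrC Im_realM mulrC. Qed.
Lemma abel_c chi (a : nat -> R) M N : (M <= N)%N ->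
 \sum_(M <= n < N) chi n * (a n)%:c = Tc chi N * (a N)%:c - Tc chi M * (a M)%:c +
 \sum_(M <= n < N) Tc chi n.+1 * (a n - a n.+1)%:c.
Proof.
elim: N => [|N IH]; first by rewrite leqn0 => /eqP ->; rewrite !big_geq // subrr addr0.
rewrite leq_eqVlt => /predU1P[->|]; first by rewrite !big_geq // subrr addr0.
rewrite ltnS => MN; rewrite !big_nat_recr //= IH // realcD realcN.
have -> : Tc chi N.+1 = Tc chi N + chi N by rewrite /Tc big_ord_recr.
ring.
Qed.

Lemma powRN_mono n (s t : R) : (0 < n)%N -> s <= t -> (n%:R : R) `^ (- t) <= n%:R `^ (- s).
Proof. by move=> n0 st; rewrite ler_powR ?ler1n // lerN2. Qed.
Lemma ln_ge1_nat n : (4 <= n)%N -> 1 <= ln (n%:R : R).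
Proof.
move=> n4; rewrite -[leLHS]expRK ler_ln ?posrE ?ltr0n ?(leq_trans _ n4) /1/.
by step (expR1_le4 R); rewrite ler_nat.
Qed.

(** Uniform in s >= σ: the mean value theorem gives a factor s, and s <= 1 + (s - σ) <= n^(s - σ)
    because log n >= 1 for n >= 4. *)
Lemma pow_diff (σ s : R) n : 0 < σ <= 1 -> σ <= s -> (4 <= n)%N ->
 0 <= (n%:R : R) `^ (- s) - n.+1%:R `^ (- s) <= n%:R `^ (- σ - 1).
Proof.
move=> /andP[s0 s1] ss n4; have n0 : (0 < n)%N by apply: leq_trans n4.
have np : 0 < (n%:R : R) by sign.
have sp : 0 < s by apply: lt_le_trans ss.
apply/andP; split.
 rewrite subr_ge0 !powRN lef_pV2 /1/.
 by rewrite ge0_ler_powR ?ler_nat /1/.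
have [|||c] := @MVT_segment R (fun t => t `^ (- s)) (fun t => - s * t `^ (- s - 1)) n%:R (n%:R + 1).
- by rewrite lerDl.
- by move=> t; rewrite in_itv => /andP[xt _]; apply: is_derive1_powR; apply: lt_trans xt.
- apply: derivable_within_continuous => t; rewrite in_itv /= => /andP[xt _].
 by have [] := is_derive1_powR (- s) (lt_le_trans np xt).
rewrite in_itv /= => /andP[nc _] e.
rewrite -natr1 -opprB e addrAC subrr add0r mulr1 mulNr opprK.
have c0 : 0 < c by apply: lt_le_trans nc.
via (s * n%:R `^ (- s - 1)).
 rewrite ler_wpM2l /1/ -opprD !powRN lef_pV2 /1/.
 by rewrite ge0_ler_powR /1/; lra.
have l1 := ln_ge1_nat n4.
have -> : - s - 1 = - (s - σ) + (- σ - 1) by ring.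
rewrite powRD /1/ mulrA ler_piMl /1/.
rewrite powRN ler_pdivrMr /1/ mul1r powR_expR /1/.
apply: le_trans (expR_ge1Dx _); have : (s - σ) * 1 <= (s - σ) * ln n%:R.
 by rewrite ler_wpM2l // subr_ge0.
lra.
Qed.

Lemma Lp_tail chi (σ s : R) M N : 0 < σ <= 1 -> σ <= s -> (4 <= M <= N)%N ->
 cabs (Lp chi N s - Lp chi M s) <= cabs (Tc chi N) * N%:R `^ (- σ) + cabs (Tc chi M) * M%:R `^ (- σ) +
  \sum_(M <= n < N) cabs (Tc chi n.+1) * n%:R `^ (- σ - 1).
Proof.
move=> s01 ss /andP[M4 MN].
have -> : Lp chi N s - Lp chi M s = \sum_(M <= n < N) chi n * npow n s by rewrite /Lp (big_cat_nat (n := M)) ?(leq_trans _ M4) // addrAC subrr add0r.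
rewrite (abel_c _ (fun n => n%:R `^ (- s)) MN).
have M0 : (0 < M)%N by apply: leq_trans M4.
triD; apply: lerD.
 triB; rewrite !cabsM !cabs_real !ger0_norm /1/.
 by apply: lerD; rewrite ler_wpM2l /1/ powRN_mono /1/ (leq_trans M0).
triS; apply: ler_sum_nat => n /andP[Mn nN].
have /andP[d0 d1] := pow_diff s01 ss (leq_trans M4 Mn).
by rewrite cabsM cabs_real ger0_norm // ler_wpM2l ?cabs_ge0.
Qed.

Lemma sum_pow_tail (σ : R) M N : 2^-1 < σ <= 1 -> (4 <= M)%N ->
 \sum_(M <= n < N) (n%:R : R) `^ (- σ - 1) <= 4 * M%:R `^ (- σ).
Proof.
move=> /andP[s0 s1] M4; have sp : 0 < σ by lra.
case: M M4 => // M M4; have M0 : (0 < M)%N by rewrite -ltnS (leq_trans _ M4).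
have [NM|MN] := leqP N M.+1; first by rewrite big_geq /1/ mulr_ge0.
rewrite big_add1; step (sum_powRN_tail N.-1 sp M0).
have h : M%:R `^ (- σ) <= 2 * M.+1%:R `^ (- σ).
 rewrite !powRN -[leLHS]mul1r ler_pdivrMr /1/ mulrAC ler_pdivlMr /1/ mul1r.
 via ((2 * M%:R) `^ σ).
  rewrite ge0_ler_powR /1/ -natrM ler_nat mul2n -addnn -addn1 leq_add2l /1/.
 rewrite powRM /1/ ler_wpM2r /1/ -[leRHS]powRr1 /1/ ler_powR /1/ ler1n /1/.
via (2 * M.+1%:R `^ (- σ) / σ); first by rewrite ler_wpM2r /1/.
rewrite ler_pdivrMr /1/ mulrAC ler_wpM2r /1/; lra.
Qed.

Definition npchar (q : nat) chi : Prop :=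
 [/\ dirichlet_char q chi, \sum_(n < q) chi n = 0 & forall n, cabs (chi n) <= 1].

Lemma Tc_mod q chi n : npchar q chi -> Tc chi n = Tc chi (n %% q).
Proof.
move=> [dchi s0 _]; rewrite {1}(divn_eq n q); elim: (n %/ q)%N => [|k IH]; first by rewrite mul0n.
rewrite mulSn -addnA -{}IH; move: (_ * q + _)%N => r.
rewrite /Tc big_split_ord /= s0 add0r; apply: eq_bigr => i _.
by have [per _ _] := dchi; rewrite addnC per.
Qed.

Lemma Tc_le chi n : (forall n, cabs (chi n) <= 1) -> cabs (Tc chi n) <= n%:R.
Proof.
move=> h; triS.
via (\sum_(k < n) (1 : R)); first by apply: ler_sum.
by rewrite sumr_const card_ord.
Qed.

Lemma Tc_leq q chi n : (0 < q)%N -> npchar q chi -> cabs (Tc chi n) <= q%:R.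
Proof.
move=> q0 h; rewrite (Tc_mod n h); have [_ _ h1] := h.
by apply: le_trans (Tc_le _ h1) _; rewrite ler_nat ltnW // ltn_pmod.
Qed.

Section FixSigma.
Variable σ : R.
Hypothesis s12 : 2^-1 < σ < 1.
Let s01 : 0 < σ <= 1. Proof. by have /andP[a b] := s12; apply/andP; split; lra. Qed.
Let s01' : 2^-1 < σ <= 1. Proof. by have /andP[a b] := s12; apply/andP; split; lra. Qed.
Let s0 : 0 < σ. Proof. by have /andP[] := s01. Qed.

Lemma Lp_tail_crude q chi s M N : (0 < q)%N -> npchar q chi -> σ <= s -> (4 <= M <= N)%N ->
 cabs (Lp chi N s - Lp chi M s) <= 6 * q%:R * M%:R `^ (- σ).
Proof.
move=> q0 h ss MN; have /andP[M4 MN'] := MN.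
have M0 : (0 < M)%N by apply: leq_trans M4.
step (Lp_tail chi s01 ss MN).
have T n := Tc_leq n q0 h.
have a1 : cabs (Tc chi N) * N%:R `^ (- σ) <= q%:R * M%:R `^ (- σ).
 apply: ler_pM; rewrite /1/ !powRN lef_pV2 ?posrE ?powR_gt0 ?ltr0n ?(leq_trans M0) /1/.
 by rewrite ge0_ler_powR ?ler_nat /1/.
have a2 : cabs (Tc chi M) * M%:R `^ (- σ) <= q%:R * M%:R `^ (- σ) by rewrite ler_wpM2r.
have a3 : \sum_(M <= n < N) cabs (Tc chi n.+1) * n%:R `^ (- σ - 1) <= q%:R * (4 * M%:R `^ (- σ)).
 apply: le_trans (ler_wpM2l _ (sum_pow_tail N s01' M4)) => //.
 by rewrite mulr_sumr; apply: ler_sum => n _; rewrite ler_wpM2r.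
lra.
Qed.

Lemma powRN_small (K e : R) : 0 < e -> exists M0 : nat, (4 <= M0)%N /\ forall M, (M0 <= M)%N -> K * M%:R `^ (- σ) <= e.
Proof.
move=> e0; have [M0 h] := exists_nat_gt (((1 + `|K|) / e) `^ σ^-1).
exists (maxn 4 M0); split; first exact: leq_maxl.
move=> M; rewrite geq_max => /andP[M4 MM].
have Mp : 0 < (M%:R : R) by rewrite ltr0n (leq_trans _ M4).
rewrite powRN ler_pdivrMr /1/ -ler_pdivrMl /1/.
via ((1 + `|K|) / e); first by rewrite mulrC ler_wpM2r /1/; have := ler_norm K; lra.
have x0 : 0 <= (1 + `|K|) / e by sign.
rewrite -[leLHS](powRr1 x0) -[X in _ `^ X](mulVf (_ : σ != 0)) /1/ powRrM.
rewrite ge0_ler_powR /1/; step (ltW h); by rewrite ler_nat.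
Qed.

(** [p] below is the real or the imaginary part, the two limits that define [Lfun]. The rate is
    uniform in s, which later gives continuity. *)
Lemma Lp_cvg q chi (e : R) : (0 < q)%N -> npchar q chi -> 0 < e ->
 exists M0 : nat, (4 <= M0)%N /\ forall M s, (M0 <= M)%N -> σ <= s -> cabs (Defs.Lfun s chi - Lp chi M s) <= e.
Proof.
move=> q0 h e0; have e4 : 0 < e / 4 by sign.
have small (d : R) : 0 < d -> exists M0 : nat, (4 <= M0)%N /\ forall M N s, (M0 <= M)%N -> (M0 <= N)%N -> σ <= s ->
 cabs (Lp chi N s - Lp chi M s) <= d.
 move=> d0; have [M0 [M4 H]] := powRN_small (6 * q%:R) d0; exists M0; split => // M N s hM hN ss.
 wlog MN : M N hM hN / (M <= N)%N.
  by move=> W; have [l|/ltnW l] := leqP M N; [exact: W|rewrite cabs_distC; exact: W].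
 apply: le_trans (Lp_tail_crude q0 h ss _) (H M hM); by rewrite MN (leq_trans M4).
have cv (p : R[i] -> R) s : (forall z w, p z - p w = p (z - w)) -> (forall z, `|p z| <= cabs z) -> σ <= s ->
  cvgn (fun N => p (Lp chi N s)).
 move=> pB pa ss; apply: real_cauchy => d d0; have [M0 [_ H]] := small d d0; exists M0 => m n hm hn.
 by rewrite pB; apply: le_trans (pa _) _; exact: H.
have lim (p : R[i] -> R) s M : (forall z w, p z - p w = p (z - w)) -> (forall z, `|p z| <= cabs z) -> σ <= s ->
  (forall N, (M <= N)%N -> cabs (Lp chi N s - Lp chi M s) <= e / 4) ->
  `|limn (fun N => p (Lp chi N s)) - p (Lp chi M s)| <= e / 2.
 move=> pB pa ss hM.
 have c : ((fun N => p (Lp chi N s)) @ \oo --> limn (fun N => p (Lp chi N s)))%classic by exact: cv.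
 move/cvgrPdist_le : c => /(_ _ e4) [N0 _ hN].
 have q1 := hN (maxn N0 M) (leq_maxl _ _); have q2 := hM (maxn N0 M) (leq_maxr _ _).
 have q3 := le_trans (pa _) q2; rewrite -pB in q3.
 move: q1 q3; set l := limn _; set a := p (Lp chi _ s); set b := p (Lp chi M s) => q1 q3.
 have -> : l - b = (l - a) + (a - b) by ring.
 by triD; lra.
have [M0 [M4 H]] := small (e / 4) e4; exists M0; split => // M s hM ss.
have hM' N : (M <= N)%N -> cabs (Lp chi N s - Lp chi M s) <= e / 4 by move=> MN; apply: H => //; apply: leq_trans MN.
have r1 := lim (@Re R) s M (fun z w => esym (etrans (ReD z (- w)) (congr1 _ (ReN w)))) (@ler_Re_cabs R) ss hM'.
have r2 := lim (@Im R) s M (fun z w => esym (etrans (ImD z (- w)) (congr1 _ (ImN w)))) (@ler_Im_cabs R) ss hM'.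
apply: le_trans (ler_cabs_ReIm _) _; rewrite ReD ImD ReN ImN /=.
have -> : L_re s chi = limn (fun N => Re (Lp chi N s)) by rewrite /L_re; under eq_fun => N do rewrite -Re_Lp.
have -> : L_im s chi = limn (fun N => Im (Lp chi N s)) by rewrite /L_im; under eq_fun => N do rewrite -Im_Lp.
by step (lerD r1 r2); lra.
Qed.

(** The part of the tail bound that is averaged over characters. Beyond q^4 the trivial bound q for
    character sums is enough, as q q^(-4σ) <= 1/q. *)
Definition Dtail q chi z : R := cabs (Tc chi z) * z%:R `^ (- σ) +
 \sum_(z <= n < q ^ 4) cabs (Tc chi n.+1) * n%:R `^ (- σ - 1).

Lemma Lfun_tail q chi z s : npchar q chi -> (4 <= z <= q)%N -> σ <= s ->
 cabs (Defs.Lfun s chi - Lp chi z s) <= Dtail q chi z + 5 / q%:R.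
Proof.
move=> h /andP[z4 zq] ss; have q4 : (4 <= q)%N by apply: leq_trans zq.
have q0 : (0 < q)%N by apply: leq_trans q4.
have qp : 0 < (q%:R : R) by sign.
set Q := (q ^ 4)%N.
have qQ : (q <= Q)%N by rewrite -{1}(expn1 q) leq_pexp2l.
have zQ : (z <= Q)%N by apply: leq_trans qQ.
have Qs : q%:R * Q%:R `^ (- σ) <= q%:R^-1.
 have -> : q%:R * Q%:R `^ (- σ) = q%:R `^ (1 - 4 * σ).
  rewrite natrX -powR_mulrn /1/ -powRrM -{1}(powRr1 (ltW qp)) -powRD /1/.
  by congr (_ `^ _); ring.
 rewrite -powR_inv1 /1/ ler_powR ?ler1n /1/; have /andP[a b] := s12; lra.
apply/ler_addgt0Pr => e e0; have [M0 [_ H]] := Lp_cvg q0 h e0.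
set N := maxn M0 Q; have := H N s (leq_maxl _ _) ss => hN.
have QN : (Q <= N)%N by apply: leq_maxr.
have zN : (4 <= z <= N)%N by rewrite z4 (leq_trans zQ).
have := Lp_tail chi s01 ss zN; rewrite (big_cat_nat (n := Q)) //=.
set A := cabs (Tc chi z) * _; set B := \sum_(z <= n < Q) _; set C := \sum_(Q <= n < N) _; set D := cabs (Tc chi N) * _ => hh.
have T n := Tc_leq n q0 h.
have Q0 : (0 < Q)%N by apply: leq_trans qQ.
have hC : C <= 4 * q%:R^-1.
 via (q%:R * (4 * Q%:R `^ (- σ))); last by rewrite mulrCA ler_wpM2l.
 apply: le_trans (ler_wpM2l (ltW qp) (sum_pow_tail N s01' (leq_trans q4 qQ))).
 by rewrite mulr_sumr; apply: ler_sum => n _; rewrite ler_wpM2r.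
have hD : D <= q%:R^-1.
 apply: le_trans Qs; apply: ler_pM; rewrite /1/ !powRN lef_pV2 ?posrE ?powR_gt0 ?ltr0n ?(leq_trans Q0) /1/.
 by rewrite ge0_ler_powR ?ler_nat /1/.
have -> : Defs.Lfun s chi - Lp chi z s = (Defs.Lfun s chi - Lp chi N s) + (Lp chi N s - Lp chi z s) by ring.
triD; rewrite /Dtail -/A -/Q -/B; lra.
Qed.

Lemma family_npchar q ch j : char_family q ch -> (0 < j < q.-1)%N -> npchar q (ch j).
Proof.
move=> [dch [_ c1] _ _ [_ sz]] hj; have /andP[_ jN] := hj; split; [exact: dch|exact: sz|].
by move=> n; have [->|h] := eqVneq (ch j n) 0; rewrite ?cabs0 /1/ c1.
Qed.

(** Square-root cancellation on average: reduce n to r modulo q, where the mean square of the sum is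
    at most r, and pass to the first moment by 2 x <= x^2/sqrt r + sqrt r. *)
Lemma Tc_mean q ch n : prime q -> char_family q ch ->
 \sum_(j < q.-1 | (0 < j)%N) cabs (Tc (ch j) n) <= q.-1%:R * Num.sqrt n%:R.
Proof.
move=> pq hc; have q0 := prime_gt0 pq; set r := (n %% q)%N.
have rn : (r <= n)%N by apply: leq_mod.
have rq : (r <= q)%N by rewrite ltnW // ltn_pmod.
rewrite (eq_bigr (fun j : 'I_q.-1 => cabs (Tc (ch j) r))); last first.
 by move=> j j0; rewrite -(Tc_mod n (family_npchar hc _)) // j0 ltn_ord.
have [r0|r0] := posnP r.
 rewrite big1 /1/ => j _; by rewrite r0 /Tc big_ord0 cabs0.
have rp : 0 < Num.sqrt r%:R :> R by sign.
have rr : Num.sqrt r%:R ^+ 2 = r%:R :> R by rewrite sqr_sqrtr.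
via (\sum_(j < q.-1) (cabs (Tc (ch j) r) ^+ 2 / Num.sqrt r%:R + Num.sqrt r%:R) / 2).
 via (\sum_(j < q.-1) cabs (Tc (ch j) r)).
  by rewrite big_mkcond; apply: ler_sum => j _; case: ifP => // _; exact: cabs_ge0.
 apply: ler_sum => j _; rewrite ler_pdivlMr /1/ -(ler_pM2r rp) mulrDl divfK /1/ -expr2.
 have := sqr_ge0 (cabs (Tc (ch j) r) - Num.sqrt r%:R); nra.
rewrite -mulr_suml big_split /= -mulr_suml sumr_const card_ord.
have := mean_square (fun=> 1) hc rq; rewrite cabs1 expr1n sumr_const card_ord => ms.
have {}ms : \sum_(j < q.-1) cabs (Tc (ch j) r) ^+ 2 <= q.-1%:R * r%:R.
 by apply: le_trans ms; apply: ler_sum => j _; rewrite /Tc; under [X in _ <= cabs X ^+ 2]eq_bigr => k _ do rewrite mul1r.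
rewrite ler_pdivrMr //; via (q.-1%:R * r%:R / Num.sqrt r%:R + q.-1%:R * Num.sqrt r%:R).
 by rewrite -[Num.sqrt _ *+ _]mulr_natl lerD2r ler_wpM2r.
rewrite -mulrA -{1}rr expr2 mulfK /1/.
have : Num.sqrt r%:R <= Num.sqrt n%:R :> R by rewrite ler_wsqrtr // ler_nat.
by move=> /(ler_wpM2l (ler0n R q.-1)); lra.
Qed.

Lemma Dtail_mean : exists C : R, 0 < C /\ forall q ch z, prime q -> char_family q ch -> (4 <= z <= q)%N ->
 \sum_(j < q.-1 | (0 < j)%N) Dtail q (ch j) z <= q.-1%:R * (C * z%:R `^ (2^-1 - σ)).
Proof.
set a := σ - 2^-1; have a0 : 0 < a by have /andP[u v] := s12; rewrite /a; lra.
exists (1 + 2 * (2 `^ a / a)); split; first by sign.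
move=> q ch z pq hc /andP[z4 zq]; have z0 : (0 < z)%N by apply: leq_trans z4.
have zp : 0 < (z%:R : R) by sign.
have -> : 2^-1 - σ = - a by rewrite /a; ring.
rewrite big_split -mulr_suml exchange_big /=.
via (q.-1%:R * Num.sqrt z%:R * z%:R `^ (- σ) +
  \sum_(z <= n < q ^ 4) q.-1%:R * (2 * n%:R `^ (- a - 1))).
 apply: lerD; first by rewrite ler_wpM2r /1/ Tc_mean.
 apply: ler_sum_nat => n /andP[zn _].
 have n0 : (0 < n)%N by apply: leq_trans zn.
 rewrite -mulr_suml; via (q.-1%:R * Num.sqrt n.+1%:R * n%:R `^ (- σ - 1)).
  by rewrite ler_wpM2r /1/ Tc_mean.
 rewrite -mulrA ler_wpM2l //.
 have -> : n%:R `^ (- a - 1) = n%:R `^ 2^-1 * n%:R `^ (- σ - 1) by rewrite -powRD /1/; congr (_ `^ _); rewrite /a; ring.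
 rewrite [leRHS]mulrA ler_wpM2r /1/ powR12_sqrt /1/.
 rewrite -(@ler_pXn2r _ 2) /1/ exprMn !sqr_sqrtr /1/ -natrX -natrM ler_nat.
 by rewrite (_ : 2 ^ 2 = 4)%N; lia.
rewrite -mulr_sumr -mulr_sumr -[X in X + _]mulrA -mulrDr ler_wpM2l // [leRHS]mulrDl mul1r; apply: lerD.
 have -> : - a = 2^-1 + - σ by rewrite /a; ring.
 by rewrite powRD /1/ powR12_sqrt /1/ ltW.
rewrite -mulrA ler_wpM2l //.
case: z z4 {zq} z0 zp => // z z4 _ zp.
have z1 : (0 < z)%N by rewrite -ltnS (leq_trans _ z4).
rewrite big_add1; apply: le_trans (sum_powRN_tail _ a0 z1) _.
rewrite mulrAC ler_wpM2r /1/ !powRN -[leLHS]mul1r ler_pdivrMr /1/ mulrAC.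
rewrite ler_pdivlMr /1/ mul1r -powRM /1/ ge0_ler_powR /1/.
by rewrite -natrM ler_nat mul2n -addnn -addn1 leq_add2l.
Qed.
End FixSigma.
End LTail.

(** * Dirichlet polynomials on the half-line and their suprema *)

Section DirichletPolynomials.
Variable R : realType.
Implicit Types (chi : nat -> R[i]) (a : nat -> R) (s t σ : R) (M n : nat).

(** n^-s as an exponential, differentiable in s for every n; the junk value at n = 0 is 1. *)
Definition nexp n s : R := expR (- (s * ln n%:R)).

Lemma nexp_ge0 n s : 0 <= nexp n s. Proof. exact: expR_ge0. Qed.

Lemma nexp_powR n s : (0 < n)%N -> n%:R `^ (- s) = nexp n s.
Proof. by move=> n0; rewrite powR_expR /1/ mulNr. Qed.
Lemma is_derive_lin (c d x : R) : is_derive x 1 (fun t : R => c * t + d) c.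
Proof.
have := is_deriveD (is_deriveZ c (@is_derive_id _ R x 1)) (@is_derive_cst _ _ _ d x 1).
by apply: is_deriveEq; rewrite /GRing.scale /= mulr1 addr0.
Qed.

Lemma is_deriveMl (f : R -> R) (c x d : R) : is_derive x 1 f d -> is_derive x 1 (fun t : R => c * f t) (c * d).
Proof. by move=> h; exact: (is_deriveZ c h). Qed.
Lemma is_deriveDf (f g : R -> R) (x d e : R) : is_derive x 1 f d -> is_derive x 1 g e ->
 is_derive x 1 (fun t : R => f t + g t) (d + e).
Proof. by move=> h1 h2; exact: (is_deriveD h1 h2). Qed.
Lemma is_derive_explin (c d x : R) : is_derive x 1 (fun t : R => expR (c * t + d)) (c * expR (c * x + d)).
Proof.
have := @is_derive1_comp _ expR _ _ _ _ (is_derive_expR _) (is_derive_lin c d x).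
by apply: is_deriveEq; rewrite mulrC.
Qed.

Lemma is_derive_nexp n s : is_derive s 1 (nexp n) (- ln n%:R * nexp n s).
Proof.
have -> : nexp n = (fun t => expR (- ln n%:R * t + 0)) by apply/funext => t; rewrite /nexp; congr expR; ring.
exact: is_derive_explin.
Qed.

Definition DP chi a M s : R[i] := \sum_(1 <= n < M) chi n * (a n * nexp n s)%:c.

Lemma cderiv_DP chi a M s : cderiv (DP chi a M) s (DP chi (fun n => - (ln n%:R * a n)) M s).
Proof.
apply: cderiv_sum => n _; apply: cderivZ; apply: cderiv_real.
have := is_deriveZ (a n) (is_derive_nexp n s).
by apply: is_deriveEq; rewrite /GRing.scale /=; ring.
Qed.

Lemma DP_norm chi a M s : (forall n, cabs (chi n) <= 1) ->
 cabs (DP chi a M s) <= \sum_(1 <= n < M) `|a n| * nexp n s.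
Proof.
move=> h; triS; apply: ler_sum => n _.
by rewrite cabsM cabs_real normrM (ger0_norm (nexp_ge0 _ _)) ler_piMl ?mulr_ge0 ?nexp_ge0.
Qed.

(** The integral of exp(x - σ) (m n)^-x over [s, +oo). Summed in [Qc], it is the integral of exp(x -
    σ) |DP(x)|^2 in closed form. The lemmas below let coefficients vanish below 4, so that log(m n)
    > 1 and the integral converges. The growing weight is what allows a supremum to be recovered. *)
Definition Qw σ m n s : R :=
 expR (s - σ - s * (ln m%:R + ln n%:R)) / (ln m%:R + ln n%:R - 1).

Definition Qc chi a M σ s : R[i] :=
 \sum_(1 <= m < M) \sum_(1 <= n < M) chi m * conjc (chi n) * (a m * a n * Qw σ m n s)%:c.

Lemma cderiv_Qc chi a M σ s : (forall n, (n < 4)%N -> a n = 0) ->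
 cderiv (Qc chi a M σ) s (- (expR (s - σ) * cabs (DP chi a M s) ^+ 2)%:c).
Proof.
move=> a4.
have -> : - (expR (s - σ) * cabs (DP chi a M s) ^+ 2)%:c =
 \sum_(1 <= m < M) \sum_(1 <= n < M) chi m * conjc (chi n) *
  (a m * a n * (- expR (s - σ - s * (ln m%:R + ln n%:R))))%:c.
 rewrite realcM -mulc_conjc conjc_sum mulr_suml mulr_sumr -sumrN; apply: eq_bigr => m _.
 rewrite mulr_sumr mulr_sumr -sumrN; apply: eq_bigr => n _.
 rewrite conjcM conjc_real.
 have -> : expR (s - σ - s * (ln m%:R + ln n%:R)) = expR (s - σ) * nexp m s * nexp n s :> R by rewrite /nexp -!expRD; congr expR; ring.
 by rewrite !realcM !realcN !realcM; ring.
apply: cderiv_sum => m _; apply: cderiv_sum => n _; apply: cderivZ; apply: cderiv_real.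
have [m4|m4] := ltnP m 4.
 have -> : (fun t => a m * a n * Qw σ m n t) = (fun=> 0) by apply/funext => t; rewrite a4 // !mul0r.
 by apply: is_deriveEq (is_derive_cst _ _ _); rewrite a4 // !mul0r.
have [n4|n4] := ltnP n 4.
 have -> : (fun t => a m * a n * Qw σ m n t) = (fun=> 0) by apply/funext => t; rewrite (a4 n) // mulr0 mul0r.
 by apply: is_deriveEq (is_derive_cst _ _ _); rewrite (a4 n) // mulr0 mul0r.
have lm := ln_ge1_nat R m4; have ln_ := ln_ge1_nat R n4.
set l := ln m%:R + ln n%:R; have l1 : 0 < l - 1 by rewrite /l; lra.
have h := is_deriveMl (a m * a n / (l - 1)) (is_derive_explin (1 - l) (- σ) s).
have -> : (fun t => a m * a n * Qw σ m n t) = (fun t : R => a m * a n / (l - 1) * expR ((1 - l) * t - σ)).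
 apply/funext => t; rewrite /Qw -/l.
 have -> : (1 - l) * t - σ = t - σ - t * l by ring.
 ring.
apply: is_deriveEq h.
have -> : (1 - l) * s - σ = s - σ - s * l by ring.
by field; rewrite gt_eqF.
Qed.

Definition Qd chi a M σ s : R := Re (Qc chi a M σ s).

Lemma is_derive_Qd chi a M σ s : (forall n, (n < 4)%N -> a n = 0) ->
 is_derive s 1 (Qd chi a M σ) (- (expR (s - σ) * cabs (DP chi a M s) ^+ 2)).
Proof. by move=> a4; have [] := cderiv_Qc chi M σ s a4; rewrite ReN. Qed.
Lemma Qd_decr chi a M σ s t : (forall n, (n < 4)%N -> a n = 0) -> s <= t ->
 Qd chi a M σ t <= Qd chi a M σ s.
Proof.
move=> a4 st; rewrite -lerN2.
apply: (@derive_ge0_le R (fun x => - Qd chi a M σ x) (fun x => expR (x - σ) * cabs (DP chi a M x) ^+ 2)) => //.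
- move=> x _; have := is_deriveN (is_derive_Qd chi M σ x a4); by rewrite opprK.
- by move=> x _; rewrite mulr_ge0 ?exprn_ge0 ?cabs_ge0.
Qed.

Lemma Qd_small chi a M σ : (forall n, (n < 4)%N -> a n = 0) -> (forall n, cabs (chi n) <= 1) ->
 0 <= σ -> exists K : R, 0 <= K /\ forall s, 0 <= s -> `|Qd chi a M σ s| <= K * expR (- s).
Proof.
move=> a4 c1 s0; exists (\sum_(1 <= m < M) \sum_(1 <= n < M) `|a m * a n|); split.
 by sign.
move=> s sp; apply: le_trans (ler_Re_cabs _) _; rewrite mulr_suml.
triS; apply: ler_sum => m _; rewrite mulr_suml.
triS; apply: ler_sum => n _.
rewrite !cabsM cabs_conjc cabs_real normrM.
have [m4|m4] := ltnP m 4; first by rewrite a4 // !mul0r normr0 !mul0r mulr0.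
have [n4|n4] := ltnP n 4; first by rewrite (a4 n) // mulr0 normr0 !mul0r mulr0.
have lm := ln_ge1_nat R m4; have ln_ := ln_ge1_nat R n4.
via (1 * (`|a m * a n| * `|Qw σ m n s|)).
 rewrite ler_wpM2r /1/; have := c1 m; have := c1 n; have := cabs_ge0 (chi m); have := cabs_ge0 (chi n); nra.
rewrite mul1r ler_wpM2l /1/ /Qw normrM ger0_norm /1/.
set l := ln m%:R + ln n%:R; have l1 : 1 <= l - 1 by rewrite /l; lra.
rewrite ger0_norm ?invr_ge0; last by lra.
rewrite ler_pdivrMr; last by lra.
via (expR (- s)); last by rewrite ler_peMr.
rewrite ler_expR; nra.
Qed.

(** A decreasing function that tends to 0. *)
Lemma Qd_ge0 chi a M σ s : (forall n, (n < 4)%N -> a n = 0) -> (forall n, cabs (chi n) <= 1) ->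
 0 <= σ -> 0 <= s -> 0 <= Qd chi a M σ s.
Proof.
move=> a4 c1 s0 sp; have [K [K0 hK]] := Qd_small M a4 c1 s0.
rewrite leNgt; apply/negP => h.
set d := - Qd chi a M σ s; have d0 : 0 < d by rewrite oppr_gt0.
set t := s + K / d.
have K2 : 0 <= K / d by sign.
have st : s <= t by rewrite lerDl.
have tp : 0 <= t by lra.
have := hK t tp; have := Qd_decr chi M σ a4 st.
have e : K * expR (- t) < d.
 rewrite expRN ltr_pdivrMr /1/ mulrC -ltr_pdivrMr /1/.
 by apply: lt_le_trans (expR_ge1Dx _); rewrite /t; lra.
rewrite ler_norml => h1 /andP[h2 _]; move: h1 h2 e; rewrite /d; lra.
Qed.

(* The majorant g(t) = (lam e^{σ - t} + Qd(t)/lam)/2 satisfies -g' >= |DP(t)| by AM-GM, and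
  the mean of Qd over the characters is a diagonal sum. *)
Lemma sup_bound chi a M σ lam B (f f' : R -> R[i]) s t :
 (forall n, (n < 4)%N -> a n = 0) -> (forall n, cabs (chi n) <= 1) -> 0 <= σ -> 0 < lam ->
 Qd chi a M σ σ <= lam ^+ 2 -> 0 <= B -> σ <= s -> s <= t ->
 (forall x, s <= x <= t -> cderiv f x (f' x)) ->
 (forall x, s <= x <= t -> cabs (f' x) <= B * cabs (DP chi a M x)) ->
 cabs (f t - f s) <= B * lam.
Proof.
move=> a4 c1 s0 l0 hQ B0 ss st df bf.
pose g (x : R) : R := - B * ((lam * expR (σ - x) + Qd chi a M σ x / lam) / 2).
pose g' (x : R) : R := B * ((lam * expR (σ - x) + expR (x - σ) * cabs (DP chi a M x) ^+ 2 / lam) / 2).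
have dg (x : R) : is_derive x 1 g (g' x).
 have h3 := is_derive_Qd chi M σ x a4.
 have h := is_deriveMl (- B / 2) (is_deriveDf (is_deriveMl lam (is_derive_explin (-1) σ x)) (is_deriveMl lam^-1 h3)).
 have -> : g = (fun y : R => - B / 2 * (lam * expR (-1 * y + σ) + lam^-1 * Qd chi a M σ y)).
  apply/funext => y; rewrite /g.
  have -> : -1 * y + σ = σ - y by ring.
  ring.
 apply: is_deriveEq h; rewrite /g'.
 have -> : -1 * x + σ = σ - x by ring.
 ring.
via (g t - g s).
 apply: (@cabs_le_of_derive _ f f' g g' s t st df (fun x _ => dg x)) => x hx.
 step (bf x hx); rewrite /g' ler_wpM2l //.
 set D := cabs _; set E := expR (σ - x); have E0 : 0 < E by sign.
 have -> : expR (x - σ) = E^-1 by rewrite /E -expRN opprB.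
 have u0 : 0 < lam * E by sign.
 have -> : E^-1 * D ^+ 2 / lam = D ^+ 2 / (lam * E) by rewrite invfM; ring.
 rewrite ler_pdivlMr /1/ -(ler_pM2r u0) mulrDl divfK /1/.
 have := sqr_ge0 (D - lam * E); nra.
have tp : 0 <= t by lra.
have Qt := Qd_ge0 M a4 c1 s0 tp; have Qs := Qd_decr chi M σ a4 ss.
have E1 : expR (σ - s) <= 1 by rewrite expR_le1; lra.
have E2 := expR_ge0 (σ - t).
have -> : g t - g s = B * ((lam * expR (σ - s) + Qd chi a M σ s / lam - (lam * expR (σ - t) + Qd chi a M σ t / lam)) / 2).
 by rewrite /g; ring.
rewrite ler_wpM2l // ler_pdivrMr //.
have q1 : Qd chi a M σ s / lam <= lam by rewrite ler_pdivrMr // -expr2; apply: le_trans hQ.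
have q2 : 0 <= Qd chi a M σ t / lam by sign.
have q3 : lam * expR (σ - s) <= lam by rewrite ler_piMr // ltW.
have q4 : 0 <= lam * expR (σ - t) by sign.
lra.
Qed.

Lemma Qd_mean q ch a M σ : char_family q ch -> (M <= q)%N -> (forall n, (n < 4)%N -> a n = 0) ->
 \sum_(j < q.-1) Qd (ch j) a M σ σ <= q.-1%:R * \sum_(1 <= n < M) a n ^+ 2 * nexp n (2 * σ).
Proof.
move=> [_ _ _ _ [orth _]] Mq a4.
have -> : \sum_(j < q.-1) Qd (ch j) a M σ σ =
 \sum_(1 <= n < M) q.-1%:R * ((coprime n q)%:R * (a n * a n * Qw σ n n σ)).
 rewrite -Re_sum /Qc.
 have -> : \sum_(j < q.-1) \sum_(1 <= m < M) \sum_(1 <= n < M) ch j m * conjc (ch j n) * (a m * a n * Qw σ m n σ)%:c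
  = \sum_(1 <= n < M) (q.-1%:R * ((coprime n q)%:R * (a n * a n * Qw σ n n σ)))%:c.
  rewrite exchange_big /=; apply: eq_big_nat => m /andP[m1 mM].
  rewrite exchange_big (bigD1_seq m) ?iota_uniq ?mem_index_iota ?m1 //=.
  rewrite -mulr_suml orth eqxx andbT andbb big_nat_cond big1 ?addr0.
   by rewrite !realcM natrM !realc_nat; ring.
  move=> n /andP[/andP[n1 nM] ne]; rewrite -mulr_suml orth !modn_small ?(leq_trans _ Mq) //.
  by rewrite eq_sym (negPf ne) !andbF muln0 mul0r.
 by rewrite Re_sum.
rewrite mulr_sumr; apply: ler_sum_nat => n /andP[n1 nM]; rewrite ler_wpM2l //.
have [n4|n4] := ltnP n 4; first by rewrite a4 // expr0n !mul0r mulr0.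
have l1 := ln_ge1_nat R n4.
have Q0 : Qw σ n n σ <= nexp n (2 * σ).
 rewrite /Qw ler_pdivrMr; last by lra.
 have -> : expR (σ - σ - σ * (ln n%:R + ln n%:R)) = nexp n (2 * σ) :> R by rewrite /nexp; congr expR; ring.
 by rewrite ler_peMr ?nexp_ge0; lra.
have Q1 : 0 <= Qw σ n n σ by rewrite divr_ge0 /1/; lra.
rewrite -expr2; via (a n ^+ 2 * Qw σ n n σ).
 by case: coprime; rewrite ?mul1r ?mul0r /1/ mulr_ge0.
by rewrite ler_wpM2l /1/.
Qed.
End DirichletPolynomials.

(** * High moments of sums over blocks of primes *)

Section PrimeBlocks.
Variable R : realType.
Implicit Types (chi : nat -> R[i]) (a b : nat -> R) (s t σ V : R) (u v M n m : nat).

Lemma nexpM d e s : (0 < d)%N -> (0 < e)%N -> nexp (d * e) s = nexp d s * nexp e s :> R.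
Proof.
by move=> d0 e0; rewrite /nexp -expRD natrM lnM /1/; congr expR; ring.
Qed.

Definition conv a b u v n : R :=
 \sum_(1 <= d < u) \sum_(1 <= e < v) ((d * e == n)%N)%:R * (a d * b e).

Lemma DP_mul chi a b u v M s : (forall d e, chi (d * e)%N = chi d * chi e) ->
 (forall d e, (d < u)%N -> (e < v)%N -> (d * e < M)%N) ->
 DP chi a u s * DP chi b v s = DP chi (conv a b u v) M s.
Proof.
move=> cM dM; rewrite /DP mulr_suml.
transitivity (\sum_(1 <= d < u) \sum_(1 <= e < v) \sum_(1 <= n < M) chi n * (((d * e == n)%N)%:R * (a d * b e) * nexp n s)%:c).
 apply: eq_big_nat => d /andP[d0 du]; rewrite mulr_sumr; apply: eq_big_nat => e /andP[e0 ev].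
 rewrite (bigD1_seq (d * e)%N) ?iota_uniq ?mem_index_iota ?muln_gt0 ?d0 ?e0 ?dM //=.
 rewrite eqxx mul1r big1 ?addr0; last by move=> n ne; rewrite eq_sym (negPf ne) !mul0r mulr0.
 by rewrite cM nexpM // !realcM; ring.
under eq_bigr => d _ do rewrite exchange_big /=.
rewrite exchange_big; apply: eq_bigr => n _; rewrite /conv !mulr_suml realc_sum mulr_sumr; apply: eq_bigr => d _.
by rewrite mulr_suml realc_sum mulr_sumr.
Qed.

Fixpoint pconv a v m : nat -> R :=
 if m is m'.+1 then conv a (pconv a v m') v (v ^ m').+1 else fun n => (n == 1%N)%:R.

Lemma DP_pow chi a v m s : (forall d e, chi (d * e)%N = chi d * chi e) -> chi 1%N = 1 ->
 DP chi a v s ^+ m = DP chi (pconv a v m) (v ^ m).+1 s.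
Proof.
move=> cM c1; elim: m => [|m IH].
 by rewrite expr0 /DP expn0 big_nat1 c1 mul1r /nexp ln1 mulr0 oppr0 expR0 mulr1.
rewrite exprS IH; apply: DP_mul => // d e du ev; rewrite ltnS expnS.
by apply: leq_mul; [exact: ltnW|].
Qed.

Definition pind u n : R := (prime n && (u <= n)%N)%:R.

Lemma pconv_ge0 u v m n : 0 <= pconv (pind u) v m n.
Proof.
elim: m n => [|m IH] n /=; first by case: eqP.
by apply: sumr_ge0 => d _; apply: sumr_ge0 => e _; rewrite !mulr_ge0.
Qed.

Lemma pconv_support u v m n : pconv (pind u) v m n != 0 ->
 (size (primes n) <= m)%N /\ ((0 < m)%N -> (u <= n)%N).
Proof.
elim: m n => [|m IH] n /=; first by case: (eqVneq n 1%N) => [->|_]; rewrite ?eqxx.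
move=> h.
have [d [e [dp ud e0 ne en]]] : exists d e, [/\ prime d, (u <= d)%N, (0 < e)%N, pconv (pind u) v m e != 0 & (d * e)%N = n].
 apply/not_existsP => H; case/eqP: h; rewrite /conv big_nat big1 // => d /andP[d0 _].
 rewrite big_nat big1 // => e /andP[e0 _]; case: (eqVneq (d * e)%N n) => [en|]; last by rewrite mul0r.
 rewrite mul1r /pind; case: (boolP (prime d && _)) => [/andP[dp ud]|]; last by rewrite mul0r.
 have [->|ne] := eqVneq (pconv (pind u) v m e) 0; first by rewrite mulr0.
 by exfalso; apply: (H d); exists e.
have [IH1 _] := IH e ne; split; last by move=> _; rewrite -en (leq_trans ud) // leq_pmulr.
have -> : size (primes n) = size (undup (d :: primes e)).
 rewrite -en; apply: perm_size; apply: uniq_perm; rewrite ?primes_uniq ?undup_uniq // => p.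
 rewrite mem_undup !(mem_primes, inE) muln_gt0 (prime_gt0 dp) e0 /=.
 case: (boolP (prime p)) => /= [pp|np]; first by rewrite Euclid_dvdM // dvdn_prime2.
 by case: (eqVneq p d) => // pd; rewrite pd dp in np.
by apply: leq_trans (size_undup _) _.
Qed.

(** The coefficient counts ordered factorizations of n into m primes from the block. Induction on m:
    the first prime is one of the prime divisors of n, of which there are at most as many as
    factors. *)
Lemma pconv_le u v m n : (0 < n)%N -> pconv (pind u) v m n <= m`!%:R.
Proof.
elim: m n => [|m IH] n n0; first by rewrite /= fact0; case: eqP.
have [->|h] := eqVneq (pconv (pind u) v m.+1 n) 0; first by sign.
have [sz _] := pconv_support h; rewrite /= /conv.
via (\sum_(1 <= d < v) ((d \in primes n)%:R * m`!%:R)); last first.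
 rewrite -mulr_suml factS natrM ler_wpM2r // -natr_sum ler_nat; apply: leq_trans sz.
 rewrite -big_mkcond sum1_count -size_filter; apply: uniq_leq_size; first by rewrite filter_uniq ?iota_uniq.
 by move=> p; rewrite mem_filter => /andP[].
apply: ler_sum_nat => d /andP[d0 dv].
have [dn|dn] := boolP (d \in primes n); last first.
 rewrite mul0r big_nat big1 // => e /andP[e0 _].
 case: (eqVneq (d * e)%N n) => [en|]; last by rewrite mul0r.
 rewrite mul1r /pind; case: (boolP (prime d && _)) => [/andP[dp ud]|]; last by rewrite mul0r.
 by case/negP: dn; rewrite mem_primes dp n0 -en dvdn_mulr.
rewrite mul1r; move: dn; rewrite mem_primes => /and3P[dp _ /dvdnP[e ne]].
have e0 : (0 < e)%N by move: n0; rewrite ne muln_gt0 => /andP[].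
have e1 : \sum_(1 <= i < (v ^ m).+1) (d * i == n)%N%:R * (pind u d * pconv (pind u) v m i) <=
  \sum_(1 <= i < (v ^ m).+1) (i == e)%:R * pconv (pind u) v m e.
 apply: ler_sum => i _; have -> : (d * i == n)%N = (i == e) by rewrite ne mulnC eqn_pmul2r.
 case: (eqVneq i e) => [->|]; rewrite ?mul0r // !mul1r ler_piMl ?pconv_ge0 // /pind.
 by case: (_ && _).
apply: le_trans e1 _; rewrite -mulr_suml; apply: le_trans (IH e e0).
rewrite ler_piMl ?pconv_ge0 // -natr_sum -[leRHS]/(1%:R) ler_nat -big_mkcond sum1_count.
by rewrite count_uniq_mem ?iota_uniq // leq_b1.
Qed.

Definition bsum u v σ : R := \sum_(1 <= p < v) pind u p * nexp p (2 * σ).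

(** One of the two factors is at most m!; the rest is the m-th power of the diagonal sum over
    primes. *)
Lemma pconv_sum u v m σ :
 \sum_(1 <= n < (v ^ m).+1) pconv (pind u) v m n ^+ 2 * nexp n (2 * σ) <= m`!%:R * bsum u v σ ^+ m.
Proof.
have -> : bsum u v σ ^+ m = \sum_(1 <= n < (v ^ m).+1) pconv (pind u) v m n * nexp n (2 * σ).
 have h := @DP_pow (fun=> 1) (pind u) v m (2 * σ) (fun d e => esym (mulr1 1)) erefl.
 have E a M : DP (fun=> 1) a M (2 * σ) = (\sum_(1 <= n < M) a n * nexp n (2 * σ))%:c.
  by rewrite /DP realc_sum; apply: eq_bigr => n _; rewrite mul1r.
 by move: h; rewrite !E -realcX => -[].
rewrite mulr_sumr; apply: ler_sum_nat => n /andP[n0 _].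
by rewrite expr2 mulrA ler_wpM2r ?nexp_ge0 // ler_wpM2r ?pconv_ge0 // pconv_le.
Qed.

Lemma markov_count (N : nat) (F : 'I_N -> R) (c : R) : 0 <= c -> (forall j, 0 <= F j) ->
 c * \sum_(j < N) ((c < F j)%R)%:R <= \sum_(j < N) F j.
Proof.
move=> c0 F0; rewrite mulr_sumr; apply: ler_sum => j _.
by case: ltP => h; rewrite ?mulr1 ?mulr0 // ltW.
Qed.

Definition PB chi u v s : R[i] := DP chi (pind u) v s.

Lemma block_pointwise q (ch : nat -> nat -> R[i]) u v m σ V : prime q -> char_family q ch -> (v ^ m < q)%N -> 0 <= V ->
 V ^+ (2 * m) * \sum_(j < q.-1) ((V < cabs (PB (ch j) u v σ))%R)%:R <=
 q.-1%:R * (m`!%:R * bsum u v σ ^+ m).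
Proof.
move=> pq hc vq V0; have [dch _ _ _ _] := hc.
via (\sum_(j < q.-1) cabs (PB (ch j) u v σ ^+ m) ^+ 2).
 rewrite mulr_sumr; apply: ler_sum => j _; case: ltP => h; rewrite ?mulr1 ?mulr0 /1/.
 by rewrite cabsX -exprM mulnC lerXn2r /1/ ltW.
have hch (j : 'I_q.-1) : ch j 1%N = 1.
 have [_ cM cnz] := dch j (ltn_ord j).
 have h0 : ch j 1%N != 0 by rewrite cnz coprime1n.
 by apply: (mulfI h0); rewrite mulr1 -cM.
pose b n : R[i] := ((n != 0%N)%:R * (pconv (pind u) v m n * nexp n σ)%:c).
have e (j : 'I_q.-1) : PB (ch j) u v σ ^+ m = \sum_(n < (v ^ m).+1) b n * ch j n.
 have [_ cM _] := dch j (ltn_ord j).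
 rewrite /PB (DP_pow (pind u) v m σ cM (hch j)) /DP -(big_mkord xpredT (fun n => b n * ch j n)).
 rewrite [RHS]big_ltn // /b eqxx !mul0r add0r; apply: eq_big_nat => n /andP[n0 _].
 by rewrite -lt0n n0 mul1r mulrC.
under eq_bigr => j _ do rewrite e.
step (mean_square b hc vq); rewrite ler_wpM2l //.
apply: le_trans (pconv_sum u v m σ).
rewrite -(big_mkord xpredT (fun n => cabs (b n) ^+ 2)) big_ltn // /b eqxx mul0r cabs0 expr0n add0r.
apply: ler_sum_nat => n /andP[n0 _]; rewrite -lt0n n0 mul1r cabs_real.
rewrite real_normK ?num_real /1/ exprMn ler_wpM2l /1/ /nexp -expRM_natl ler_expR le_eqVlt.
by apply/orP; left; apply/eqP; ring.
Qed.

Lemma nexp_decay n s t : (4 <= n)%N -> 0 <= t -> s <= t -> nexp n t <= expR (- t).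
Proof.
move=> n4 t0 st; rewrite /nexp ler_expR lerN2; have := ln_ge1_nat R n4; nra.
Qed.

(** The m-th power of the block is a polynomial of length at most q. Applying [sup_bound] to it and
    its own derivative costs a factor log^2 q in the count, since the coefficients of the derivative
    carry log n. *)
Lemma block_sup q (ch : nat -> nat -> R[i]) u v m σ V : prime q -> char_family q ch -> (4 <= u)%N -> (0 < m)%N ->
 (v ^ m < q)%N -> 0 < V -> 0 <= σ -> exists bad : nat -> bool,
 V ^+ (2 * m) * \sum_(j < q.-1) (bad j)%:R <= q.-1%:R * (ln q%:R ^+ 2 * (m`!%:R * bsum u v σ ^+ m)) /\
 (forall j s, (0 < j < q.-1)%N -> ~~ bad j -> σ <= s -> cabs (PB (ch j) u v s) <= V).
Proof.
move=> pq hc u4 m0 vq V0 s0; have [dch _ _ _ _] := hc.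
pose al := pconv (pind u) v m; set M := (v ^ m).+1.
pose a n : R := - (ln n%:R * al n).
have al4 n : (n < 4)%N -> al n = 0.
 move=> n4; apply/eqP; apply: contraT => /pconv_support[_ /(_ m0) un].
 by move: (leq_trans u4 un); rewrite leqNgt n4.
have a4 n : (n < 4)%N -> a n = 0 by move=> n4; rewrite /a al4 // mulr0 oppr0.
have c1 (j : nat) : (j < q.-1)%N -> forall n, cabs (ch j n) <= 1.
 move=> jN n; have [_ [_ h] _ _ _] := hc; have [->|h0] := eqVneq (ch j n) 0; rewrite ?cabs0 /1/ h /1/.
exists (fun j => (V ^+ (2 * m) < Qd (ch j) a M σ σ)%R); split.
 apply: le_trans (markov_count (F := fun j : 'I_q.-1 => Qd (ch j) a M σ σ) _ _) _.
 - by sign.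
 - by move=> j; apply: Qd_ge0 => //; apply: c1.
 step (Qd_mean σ hc vq a4); rewrite ler_wpM2l //.
 apply: le_trans (ler_wpM2l (sqr_ge0 _) (pconv_sum u v m σ)); rewrite mulr_sumr !big_nat.
 apply: ler_sum => n /andP[n0 nM]; rewrite /a sqrrN exprMn -mulrA ler_wpM2r //; first by rewrite mulr_ge0 ?sqr_ge0 ?nexp_ge0.
 have nq : ln n%:R <= ln q%:R :> R by rewrite ler_ln /1/ ler_nat; apply: ltnW; apply: leq_trans nM vq.
 have := @ln_natr_ge0 R n; nra.
move=> j s /andP[j0 jN]; rewrite -leNgt => nb ss.
have [_ cM cnz] := dch j jN.
have ch1 : ch j 1%N = 1.
 have h0 : ch j 1%N != 0 by rewrite cnz coprime1n.
 by apply: (mulfI h0); rewrite mulr1 -cM.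
have Vm0 : 0 < V ^+ m by sign.
rewrite -(@ler_pXn2r _ m) /1/ -cabsX /PB (DP_pow (pind u) v m s cM ch1) -/al -/M.
apply/ler_addgt0Pr => e e0.
set K := \sum_(1 <= n < M) `|al n|; have K0 : 0 <= K by sign.
set t := s + K / e; have Ke : 0 <= K / e by sign.
have st : s <= t by rewrite lerDl.
have tp : 0 <= t by lra.
have ht : cabs (DP (ch j) al M t) <= e.
 step (DP_norm al M t (c1 j jN)).
 via (K * expR (- t)).
  rewrite mulr_suml; apply: ler_sum => n _; have [n4|n4] := ltnP n 4; first by rewrite al4 // normr0 !mul0r.
  by rewrite ler_wpM2l // (nexp_decay n4 tp st).
 rewrite expRN ler_pdivrMr /1/ mulrC -ler_pdivrMr /1/.
 by apply: le_trans (expR_ge1Dx _); rewrite /t; lra.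
have nb' : Qd (ch j) a M σ σ <= (V ^+ m) ^+ 2 by rewrite -exprM mulnC.
have h : cabs (DP (ch j) al M t - DP (ch j) al M s) <= 1 * V ^+ m.
 apply: (@sup_bound _ (ch j) a M σ (V ^+ m) 1 (DP (ch j) al M) (DP (ch j) a M)) => //; first exact: c1.
 - by move=> x _; exact: cderiv_DP.
 - by move=> x _; rewrite mul1r.
have -> : DP (ch j) al M s = DP (ch j) al M t - (DP (ch j) al M t - DP (ch j) al M s) by ring.
by triB; rewrite addrC lerD // -[leRHS]mul1r.
Qed.
End PrimeBlocks.

(** * A truncated logarithm of L *)

Section LogPolynomial.
Variable R : realType.
Implicit Types (chi : nat -> R[i]) (a : nat -> R) (s t σ : R) (w M n : nat).

Definition charlike chi : Prop :=
 [/\ forall d e, chi (d * e)%N = chi d * chi e, chi 1%N = 1 & forall n, cabs (chi n) <= 1].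

Lemma family_charlike q (ch : nat -> nat -> R[i]) j : char_family q ch -> (j < q.-1)%N -> charlike (ch j).
Proof.
move=> hc jN; have [dch [_ h1] _ _ _] := hc; have [_ cM cnz] := dch j jN; split=> //.
- have h0 : ch j 1%N != 0 by rewrite cnz coprime1n.
 by apply: (mulfI h0); rewrite mulr1 -cM.
- by move=> n; have [->|h0] := eqVneq (ch j n) 0; rewrite ?cabs0 /1/ h1.
Qed.

Lemma cabs_expN_1 (z : R[i]) : cabs (cexp (- z) - 1) <= cabs z * expR (cabs z).
Proof.
have z0 := cabs_ge0 z; have [h|h] := leP 0 (Re z).
 rewrite cabs_distC; step (expN_rem1 h); rewrite ler_peMr //.
 by apply: le_trans (expR_ge1Dx _); rewrite lerDl.
have -> : cexp (- z) - 1 = cexp (- z) * (1 - cexp (- - z)) by rewrite mulrBr mulr1 -cexpD subrr cexp0.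
rewrite cabsM cabs_cexp mulrC ler_pM /1/.
 by rewrite -(cabsN z); apply: expN_rem1; rewrite ReN; lra.
by rewrite ler_expR ReN; have := ler_Re_cabs z; have := ler_norm (- Re z); rewrite normrN; lra.
Qed.

Lemma DP_vanish chi a M (e : R) : (forall n, cabs (chi n) <= 1) -> a 1%N = 0 -> 0 < e ->
 exists T : R, forall t, T <= t -> cabs (DP chi a M t) <= e.
Proof.
move=> c1 a1 e0; set K := \sum_(1 <= n < M) `|a n|; have K0 : 0 <= K by sign.
have l2 : 0 < ln (2 : R) by rewrite ln_gt0 // ltr1n.
exists (K / e / ln 2) => t ht; step (DP_norm a M t c1).
have Ke : 0 <= K / e by sign.
have t0 : 0 <= t by apply: le_trans ht; rewrite divr_ge0 // ltW.
via (K * expR (- (t * ln 2))).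
 rewrite mulr_suml; apply: ler_sum_nat => n /andP[n1 _].
 have [->|n2] := eqVneq n 1%N; first by rewrite a1 normr0 !mul0r.
 rewrite ler_wpM2l /1/ /nexp ler_expR lerN2 ler_wpM2l /1/ ler_ln /1/ ler_nat.
 by rewrite ltn_neqAle eq_sym n2.
rewrite expRN ler_pdivrMr /1/ mulrC -ler_pdivrMr /1/.
by apply: le_trans (expR_ge1Dx _); rewrite ler_pdivrMr in ht; lra.
Qed.

Lemma DP_sub1 chi w t : chi 1%N = 1 -> (1 < w)%N ->
 DP chi (fun n => 1 - (n == 1%N)%:R) w t = DP chi (fun=> 1) w t - 1.
Proof.
move=> ch1 w1; rewrite /DP (big_ltn w1) [X in _ = X - 1](big_ltn w1) subrr mul0r mulr0 add0r ch1 !mul1r.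
rewrite {2}/nexp ln1 mulr0 oppr0 expR0 addrAC subrr add0r.
by apply: eq_big_nat => n /andP[n2 _]; rewrite (gtn_eqF n2) subr0.
Qed.

Definition lamc n : R := vM R n / ln n%:R.
Definition Pw chi w s := DP chi lamc w s.
(** Coefficients of D' - D P', where D is the series of L cut at w and P is [Pw]. They vanish below
    w because log is the divisor sum of Lambda; this is why D exp(-P) varies little. *)
Definition rho w n : R := - ((n < w)%N%:R * ln n%:R) + conv (fun=> 1) (vM R) w w n.

Lemma sum_vM_nat M n : (0 < n < M)%N -> \sum_(1 <= e < M) (e %| n)%:R * vM R e = ln n%:R.
Proof.
move=> /andP[n0 nM]; rewrite -sum_vM // (@sum_divisors_bound _ (fun d _ => vM R d) n M n0 nM).
rewrite -(big_mkord (fun d => (0 < d)%N && (d %| n)%N) (fun d => vM R d)) [RHS]big_mkcond /=.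
rewrite [RHS]big_ltn ?(leq_ltn_trans _ nM) //= add0r; apply: eq_big_nat => e /andP[-> _] /=.
by case: (e %| n)%N; rewrite ?mul1r ?mul0r.
Qed.

Lemma conv1E w n : (0 < n)%N ->
 conv (fun=> 1) (vM R) w w n = \sum_(1 <= e < w) ((e %| n) && (n %/ e < w))%N%:R * vM R e.
Proof.
move=> n0; rewrite /conv exchange_big /=; apply: eq_big_nat => e /andP[e0 _].
under eq_bigr => d _ do rewrite mul1r.
rewrite -mulr_suml; congr (_ * _).
case: (boolP (e %| n)%N) => [/dvdnP[k nk]|ne] /=; last first.
 by rewrite big1 // => d _; case: eqP => // dn; case/negP: ne; rewrite -dn dvdn_mull.
have k0 : (0 < k)%N by move: n0; rewrite nk muln_gt0 => /andP[].
rewrite nk mulnK // -natr_sum -big_mkcond sum1_count.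
rewrite (eq_count (a2 := pred1 k)); last by move=> d; rewrite eqn_pmul2r.
by rewrite count_uniq_mem ?iota_uniq // mem_index_iota k0.
Qed.

Lemma rho_small w n : (0 < n < w)%N -> rho w n = 0.
Proof.
move=> nw; have /andP[n0 n1] := nw; rewrite /rho n1 mul1r conv1E // -(sum_vM_nat nw).
rewrite [X in _ + X](_ : _ = \sum_(1 <= e < w) (e %| n)%:R * vM R e) ?addNr //.
apply: eq_bigr => e _; congr (_%:R * _).
by rewrite (leq_ltn_trans (leq_div _ _) n1) andbT.
Qed.

Lemma rho_le w n : (0 < n)%N -> `|rho w n| <= ln n%:R.
Proof.
move=> n0; have l0 := ln_natr_ge0 R n.
have [nw|wn] := ltnP n w; first by rewrite rho_small ?n0 // normr0.
rewrite /rho ltnNge wn mul0r oppr0 add0r conv1E // ger0_norm; last first.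
 by apply: sumr_ge0 => e _; rewrite mulr_ge0 ?vM_ge0.
rewrite -(@sum_vM_nat n.+1) ?n0 ?leqnn //.
via (\sum_(1 <= e < w) (e %| n)%:R * vM R e).
 by apply: ler_sum => e _; rewrite ler_wpM2r ?vM_ge0; case: (e %| n)%N; case: (_ < _)%N.
have [w1|w1] := posnP w; first by rewrite w1 big_geq // sumr_ge0 // => e _; rewrite mulr_ge0 ?vM_ge0.
rewrite [leRHS](big_cat_nat (n := w)) ?(leq_trans wn) //= lerDl.
by apply: sumr_ge0 => e _; rewrite mulr_ge0 ?vM_ge0.
Qed.

Lemma DP_widen chi a w M s : (0 < w)%N -> (w <= M)%N ->
 DP chi a w s = DP chi (fun n => (n < w)%N%:R * a n) M s.
Proof.
move=> w0 wM; rewrite /DP [RHS](big_cat_nat (n := w)) //= [X in _ = _ + X]big_nat.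
rewrite [X in _ = _ + X]big1 ?addr0; last by move=> n /andP[wn _]; rewrite ltnNge wn !mul0r mulr0.
by apply: eq_big_nat => n /andP[_ ->]; rewrite mul1r.
Qed.

Lemma DPD chi a b M s : DP chi a M s + DP chi b M s = DP chi (fun n => a n + b n) M s.
Proof. by rewrite /DP -big_split /=; apply: eq_bigr => n _; rewrite -mulrDr -realcD mulrDl. Qed.
Lemma log_derivative chi w s : charlike chi -> (0 < w)%N ->
 cderiv (fun x => DP chi (fun=> 1) w x * cexp (- Pw chi w x)) s
  (DP chi (rho w) (w * w) s * cexp (- Pw chi w s)).
Proof.
move=> [cM _ _] w0.
have h1 := cderiv_DP chi (fun=> 1) w s.
have h2 := cderiv_DP chi lamc w s.
have h3 := cderiv_cexp (cderivZ (-1) h2).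
have -> : (fun x => DP chi (fun=> 1) w x * cexp (- Pw chi w x)) = (fun x => DP chi (fun=> 1) w x * cexp (-1 * DP chi lamc w x)).
 by apply/funext => x; rewrite mulN1r.
apply: cderivEq (cderivM h1 h3); rewrite mulN1r -/(Pw chi w s).
have -> : DP chi (fun n => - (ln n%:R * lamc n)) w s = - DP chi (vM R) w s.
 rewrite /DP -sumrN; apply: eq_big_nat => n /andP[n1 _]; rewrite mulNr realcN mulrN; congr (- (_ * (_ * _)%:C)%C).
 have [->|n2] := eqVneq n 1%N; first by rewrite vM1 ln1 mul0r.
 rewrite /lamc mulrCA divff ?mulr1 // gt_eqF // ln_gt0 // ltr1n ltn_neqAle eq_sym n2 //.
rewrite mulN1r opprK mulrA -mulrDl; congr (_ * _).
rewrite (@DP_mul _ chi _ _ w w (w * w)) //; last first.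
 by move=> d e dw ew; apply: ltn_mul.
rewrite (@DP_widen _ _ w (w * w)) ?leq_pmull // DPD.
by congr DP; apply/funext => n; rewrite /rho mulr1 mulrN.
Qed.

(** D exp(-P) tends to 1 at +oo. Its derivative is exp(-P) times the polynomial with coefficients
    [rho], so [sup_bound] carries the value 1 back to all of [σ, +oo). The factor exp H is the price
    of exp(-P), so H must be a small multiple of log q. *)
Lemma log_poly_approx chi w σ lam H : charlike chi -> (4 <= w)%N -> 0 <= σ -> 0 < lam ->
 Qd chi (fun n => (0 < n)%N%:R * rho w n) (w * w) σ σ <= lam ^+ 2 ->
 (forall s, σ <= s -> cabs (Pw chi w s) <= H) ->
 forall s, σ <= s -> cabs (DP chi (fun=> 1) w s * cexp (- Pw chi w s) - 1) <= expR H * lam.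
Proof.
move=> cl w4 s0 l0 hQ hH s ss; have [cM ch1 c1] := cl.
set f := fun x => DP chi (fun=> 1) w x * cexp (- Pw chi w x).
have w0 : (0 < w)%N by apply: leq_trans w4.
apply/ler_addgt0Pr => e e0.
set d := Num.min 1 (e / 16); have d0 : 0 < d by rewrite lt_min ltr01 divr_gt0.
have [T1 h1] := @DP_vanish chi (fun n => 1 - (n == 1%N)%:R) w d c1 (subrr 1) d0.
have lam1 : lamc 1 = 0 by rewrite /lamc vM1 mul0r.
have [T2 h2] := @DP_vanish chi lamc w d c1 lam1 d0.
set t := Num.max s (Num.max T1 T2).
have st : s <= t by rewrite le_max lexx.
have {h1} h1 := h1 t; have {h2} h2 := h2 t.
have {}h1 : cabs (DP chi (fun=> 1) w t - 1) <= d.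
 have := h1 _; rewrite !le_max lexx orbT => /(_ isT).
 by rewrite DP_sub1 // (leq_trans _ w4).
have {}h2 : cabs (Pw chi w t) <= d by apply: h2; rewrite !le_max lexx !orbT.
have ft : cabs (f t - 1) <= e.
 have -> : f t - 1 = (DP chi (fun=> 1) w t - 1) * (1 + (cexp (- Pw chi w t) - 1)) + (cexp (- Pw chi w t) - 1) by rewrite /f; ring.
 triD; rewrite cabsM.
 have h3 := cabs_expN_1 (Pw chi w t).
 have d1 : d <= 1 by rewrite ge_min lexx.
 have d2 : d <= e / 16 by rewrite ge_min lexx orbT.
 have e4 : expR (cabs (Pw chi w t)) <= 4 by apply: le_trans (expR1_le4 R); rewrite ler_expR; lra.
 have h4 : cabs (cexp (- Pw chi w t) - 1) <= 4 * d.
  step h3; rewrite mulrC ler_pM /1/.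
 have h5 := ler_cabsD 1 (cexp (- Pw chi w t) - 1); rewrite cabs1 in h5.
 move: (cabs_ge0 (DP chi (fun=> 1) w t - 1)) (cabs_ge0 (1 + (cexp (- Pw chi w t) - 1))) h1 h4 h5.
 move: (cabs _) (cabs _) (cabs _) => A B D A0 B0 hA hD hB; clear -A0 B0 hA hD hB d1 d2 d0.
 have : D * B <= d * 5 by apply: ler_pM => //; lra.
 lra.
have a4 n : (n < 4)%N -> (0 < n)%N%:R * rho w n = 0 by case: n => [|n] n4; rewrite ?mul0r // rho_small ?mulr0 // (leq_trans n4).
have fst : cabs (f t - f s) <= expR H * lam.
 apply: (@sup_bound _ chi (fun n => (0 < n)%N%:R * rho w n) (w * w) σ lam (expR H) f
  (fun x => DP chi (rho w) (w * w) x * cexp (- Pw chi w x))) => //.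
 - by move=> x _; apply: log_derivative.
 move=> x /andP[sx _]; rewrite cabsM mulrC.
 have -> : DP chi (rho w) (w * w) x = DP chi (fun n => (0 < n)%N%:R * rho w n) (w * w) x.
  by rewrite /DP; apply: eq_big_nat => n /andP[-> _]; rewrite mul1r.
 rewrite ler_wpM2r /1/ cabs_cexp ler_expR.
 apply: le_trans (hH x (le_trans ss sx)); rewrite -(cabsN (Pw chi w x)).
 exact: le_trans (ler_norm _) (ler_Re_cabs _).
have -> : f s - 1 = (f t - 1) - (f t - f s) by ring.
by triB; rewrite addrC lerD.
Qed.

(** The length w^2 <= q lets orthogonality act, and coefficients that start at n = w save w^(1 -
    2σ). *)
Lemma rho_mean q (ch : nat -> nat -> R[i]) w σ : 2^-1 < σ < 1 -> char_family q ch ->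
 (4 <= w)%N -> (w * w <= q)%N ->
 \sum_(j < q.-1) Qd (ch j) (fun n => (0 < n)%N%:R * rho w n) (w * w) σ σ <=
 q.-1%:R * (ln q%:R ^+ 2 * (w.-1%:R `^ (1 - 2 * σ) / (2 * σ - 1))).
Proof.
move=> /andP[s1 s2] hc w4 wq.
have w0 : (0 < w)%N by apply: leq_trans w4.
have q0 : (0 < q)%N by apply: leq_trans wq; rewrite muln_gt0 w0.
have a4 n : (n < 4)%N -> (0 < n)%N%:R * rho w n = 0 by case: n => [|n] n4; rewrite ?mul0r // rho_small ?mulr0 // (leq_trans n4).
step (Qd_mean σ hc wq a4); rewrite ler_wpM2l //.
rewrite (big_cat_nat (n := w)) ?leq_pmull //= big_nat big1 ?add0r; last first.
 by move=> n nw; rewrite rho_small // mulr0 expr0n mul0r.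
have a0 : 0 < 2 * σ - 1 by lra.
have w1 : (0 < w.-1)%N by rewrite -subn1 subn_gt0 (leq_trans _ w4).
have h := @sum_powRN_tail R (2 * σ - 1) w.-1 (w * w).-1 a0 w1.
via (ln q%:R ^+ 2 * \sum_(w.-1 <= n < (w * w).-1) n.+1%:R `^ (- (2 * σ - 1) - 1)); last first.
 rewrite ler_wpM2l /1/; apply: le_trans h _.
 by have -> : - (2 * σ - 1) = 1 - 2 * σ by ring.
have -> : \sum_(w.-1 <= n < (w * w).-1) n.+1%:R `^ (- (2 * σ - 1) - 1) = \sum_(w <= n < w * w) n%:R `^ (- (2 * σ)).
 rewrite -[in RHS](prednK w0) [RHS]big_add1 (prednK w0).
 by apply: eq_bigr => n _; congr (_ `^ _); ring.
rewrite mulr_sumr; apply: ler_sum_nat => n /andP[wn nM].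
have n0 : (0 < n)%N by apply: leq_trans wn.
rewrite n0 mul1r nexp_powR // ler_wpM2r ?nexp_ge0 //.
have nq : ln n%:R <= ln q%:R :> R by rewrite ler_ln /1/ ler_nat ltnW /1/ (leq_trans nM).
by rewrite -real_normK ?num_real /1/ lerXn2r /1/; apply: le_trans nq; exact: rho_le.
Qed.
End LogPolynomial.

(** * Uniform bounds for prime blocks outside small exceptional sets *)

Section SupBounds.
Variable (R : realType) (σ : R).
Hypothesis s12 : 2^-1 < σ < 1.
Implicit Types (chi : nat -> R[i]) (s : R) (u v w m n : nat).

Lemma nexp_mono n s t : s <= t -> nexp n t <= nexp n s :> R.
Proof. by move=> st; rewrite /nexp ler_expR lerN2 ler_wpM2r // ln_natr_ge0. Qed.
(** Proper prime powers contribute at most the sum over p of p^(-2σ)/(1 - 2^-σ), which converges as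
    σ > 1/2. *)
Lemma Pw_primes : exists C : R, 0 < C /\ forall chi w s, charlike chi -> σ <= s ->
 cabs (Pw chi w s - PB chi 1 w s) <= C.
Proof.
have /andP[s1 s2] := s12.
set x2 : R := nexp 2 σ.
have l2 : 0 < ln (2 : R) by rewrite ln_gt0 // ltr1n.
have sp : 0 < σ by lra.
have x21 : 0 < 1 - x2 by rewrite subr_gt0 /x2 /nexp expR_lt1 oppr_lt0 mulr_gt0.
have a0 : 0 < 2 * σ - 1 by lra.
exists ((2 * σ - 1)^-1 / (1 - x2)); split; first by sign.
move=> chi w s [_ _ c1] ss.
via (\sum_(1 <= n < w) (~~ prime n)%:R * lamc R n * nexp n σ).
 rewrite /Pw /PB /DP -sumrB; triS; rewrite !big_nat.
 apply: ler_sum => n /andP[n1 _]; rewrite -mulrBr -realcN -realcD -mulrBl cabsM cabs_real.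
 have L0 : 0 <= lamc R n by rewrite divr_ge0 ?vM_ge0 /1/.
 have -> : lamc R n - pind R 1 n = (~~ prime n)%:R * lamc R n.
  rewrite /pind n1 andbT; case: (boolP (prime n)) => [pn|_]; last by rewrite subr0 mul1r.
  by rewrite mul0r /lamc vM_prime // divff ?subrr // gt_eqF // ln_gt0 // ltr1n prime_gt1.
 have A0 : 0 <= (~~ prime n)%:R * lamc R n by sign.
 rewrite ger0_norm; last by rewrite (mulr_ge0 A0) ?nexp_ge0.
 via (1 * ((~~ prime n)%:R * lamc R n * nexp n s)).
  by apply: ler_wpM2r (c1 n); rewrite (mulr_ge0 A0) ?nexp_ge0.
 by rewrite mul1r ler_wpM2l // nexp_mono.
via (\sum_(1 <= n < w) \sum_(2 <= p < w) \sum_(2 <= k < w) ((p ^ k == n)%N)%:R * nexp p σ ^+ k).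
 apply: ler_sum_nat => n /andP[n1 nw].
 have T0 : 0 <= \sum_(2 <= p < w) \sum_(2 <= k < w) ((p ^ k == n)%N)%:R * nexp p σ ^+ k :> R.
  by apply: sumr_ge0 => p _; apply: sumr_ge0 => k _; rewrite mulr_ge0 ?exprn_ge0 ?nexp_ge0.
 have [pn|np] := boolP (prime n); first by rewrite !mul0r.
 rewrite mul1r; have [h|/vM_neq0 [p [k [pp k0 nE]]]] := eqVneq (vM R n) 0; first by rewrite /lamc h !mul0r.
 have k2 : (1 < k)%N by case: k k0 nE => [|[|k]] // _ nE; rewrite nE expn1 pp in np.
 have p1 := prime_gt1 pp; have pk : (p < p ^ k)%N by rewrite -[ltnLHS]expn1 ltn_exp2l.
 have kk : (k < p ^ k)%N by apply: ltn_expl; exact: prime_gt1.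
 rewrite (bigD1_seq p) ?iota_uniq ?mem_index_iota ?prime_gt1 //=; last by rewrite (ltn_trans pk) -?nE.
 rewrite (bigD1_seq k) ?iota_uniq ?mem_index_iota ?k2 //=; last by rewrite (ltn_trans kk) -?nE.
 rewrite -nE eqxx mul1r -addrA -[leLHS]addr0 lerD //; last first.
  by rewrite addr_ge0 ?sumr_ge0 // => i _; rewrite ?sumr_ge0 // => *; rewrite mulr_ge0 ?exprn_ge0 ?nexp_ge0.
 via (1 * nexp n σ).
  rewrite ler_wpM2r ?nexp_ge0 // /lamc; have l0 := ln_natr_ge0 R n.
  have [->|ln0] := eqVneq (ln n%:R : R) 0; first by rewrite invr0 mulr0.
  by rewrite ler_pdivrMr ?mul1r ?vM_le_ln // lt_def ln0.
 rewrite mul1r nE; apply: ler_of_eq.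
 by rewrite /nexp natrX lnXn /1/ -expRM_natl; congr expR; rewrite -mulr_natr; ring.
rewrite exchange_big /=.
via (\sum_(2 <= p < w) nexp p (2 * σ) / (1 - x2)); last first.
 rewrite -mulr_suml ler_wpM2r ?invr_ge0 ?(ltW x21) //.
 have := @sum_powRN_tail R (2 * σ - 1) 1 w.-1 a0 isT; rewrite powR1 mul1r; apply: le_trans.
 rewrite big_add1; apply: ler_of_eq; apply: eq_bigr => n _.
 by rewrite -nexp_powR //; congr (_ `^ _); ring.
apply: ler_sum_nat => p /andP[p2 pw]; rewrite exchange_big /=.
set x : R := nexp p σ; have x0 : 0 <= x by apply: nexp_ge0.
have xx : x <= x2.
 rewrite /x /x2 /nexp ler_expR lerN2 ler_wpM2l ?ler_ln ?posrE ?ltr0n ?ler_nat //; first by lra.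
 exact: ltnW.
have -> : nexp p (2 * σ) = x ^+ 2 by rewrite /x /nexp -expRM_natl; congr expR; ring.
via (\sum_(2 <= k < w) x ^+ k).
 apply: ler_sum => k _; rewrite -mulr_suml ler_piMl /1/ -natr_sum -[leRHS]/(1%:R) ler_nat.
 rewrite -big_mkcond sum1_count (@eq_count _ _ (pred1 (p ^ k)%N)); last by move=> n; rewrite eq_sym.
 by rewrite count_uniq_mem ?iota_uniq // leq_b1.
rewrite ler_pdivlMr //.
have h W : (\sum_(2 <= k < W.+2) x ^+ k) * (1 - x) = x ^+ 2 - x ^+ W.+2.
 by elim: W => [|W IH]; [rewrite big_geq // mul0r subrr|rewrite big_nat_recr //= mulrDl IH (exprS x W.+2); ring].
have S0 : 0 <= \sum_(2 <= k < w) x ^+ k by sign.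
via ((\sum_(2 <= k < w) x ^+ k) * (1 - x)); first by rewrite ler_wpM2l; clear -xx S0; lra.
have [W ->] : exists W, w = W.+2 by exists w.-2; move: p2 pw; case: w {S0} => [|[|W]]; case: p {x x0 xx h}=> [|[]].
by rewrite h lerBlDr lerDl exprn_ge0.
Qed.

Lemma PBE chi u v s : (0 < u)%N -> PB chi u v s = \sum_(u <= n < v) chi n * ((prime n)%:R * nexp n s)%:c.
Proof.
move=> u0; rewrite /PB /DP; have [vu|uv] := leqP v u.
 rewrite (big_geq vu) big_nat big1 // => n /andP[_ nv].
 by rewrite /pind leqNgt (leq_trans nv vu) andbF mul0r mulr0.
rewrite (big_cat_nat u0 (ltnW uv)) /= [X in X + _]big_nat big1 ?add0r; last first.
 by move=> n /andP[_ nu]; rewrite /pind leqNgt nu andbF mul0r mulr0.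
by apply: eq_big_nat => n /andP[un _]; rewrite /pind un andbT.
Qed.

Lemma PB_cat chi u x v s : (0 < u)%N -> (u <= x)%N -> (x <= v)%N ->
 PB chi u v s = PB chi u x s + PB chi x v s.
Proof.
move=> u0 ux xv; rewrite !PBE ?(leq_trans u0) //; exact: big_cat_nat.
Qed.

Lemma PB_empty chi u v s : (0 < u)%N -> (v <= u)%N -> PB chi u v s = 0.
Proof. by move=> u0 vu; rewrite PBE // big_geq. Qed.
Lemma bsum_le : exists C : R, 0 < C /\ forall u v, (1 < u)%N ->
 bsum u v σ <= C * u%:R `^ (1 - 2 * σ) / ln u%:R.
Proof.
have /andP[s1 s2] := s12; have [|C [C0 h]] := @prime_powR_tail R (2 * σ); first by lra.
exists C; split=> // u v u1; have u0 : (0 < u)%N by apply: ltnW.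
apply: le_trans (h u v u1); rewrite /bsum; have [vu|uv] := leqP v u.
 rewrite (big_geq vu) big_nat big1 // => n /andP[_ nv].
 by rewrite /pind leqNgt (leq_trans nv vu) andbF mul0r.
rewrite (big_cat_nat u0 (ltnW uv)) /= [X in X + _]big_nat big1 ?add0r; last first.
 by move=> n /andP[_ nu]; rewrite /pind leqNgt nu andbF mul0r.
apply: ler_sum_nat => n /andP[un _].
by rewrite /pind un andbT nexp_powR // (leq_trans u0 un).
Qed.

Lemma bsum_ge0 u v : 0 <= bsum u v σ :> R.
Proof. by apply: sumr_ge0 => n _; rewrite mulr_ge0 ?nexp_ge0. Qed.
Lemma fact_le_exp m : (m`! <= m ^ m)%N.
Proof.
elim: m => // m IH; rewrite factS expnS leq_mul //; apply: leq_trans IH _.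
by case: m => // m; rewrite leq_exp2r.
Qed.

Lemma nat_powR_exp (x : nat) (e : R) m : (x%:R `^ e) ^+ m = (x ^ m)%N%:R `^ e.
Proof. by rewrite -powR_mulrn /1/ -powRrM mulrC powRrM powR_mulrn /1/ natrX. Qed.
(** Moment of order 2m with m maximal for u^(k m) < q. As m <= log q, the last hypothesis makes m
    times the diagonal sum at most V^2 u^-e. The m-th power saves u^(-e m), at most q^(-e/(2k))
    because q <= u^(k (m+1)) <= u^(2 k m). *)
Lemma block_gen (C : R) : 0 < C -> (forall u v, (1 < u)%N -> bsum u v σ <= C * u%:R `^ (1 - 2 * σ) / ln u%:R) ->
 forall q (ch : nat -> nat -> R[i]) u k v (V e : R), prime q -> char_family q ch -> (4 <= u)%N -> (0 < k)%N ->
 (v <= u ^ k)%N -> (u ^ k < q)%N -> 0 < V -> 0 < e ->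
 ln q%:R * (C * u%:R `^ (1 - 2 * σ)) <= V ^+ 2 * u%:R `^ (- e) ->
 exists bad : nat -> bool,
  \sum_(j < q.-1) (bad j)%:R <= q.-1%:R * (ln q%:R ^+ 2 * q%:R `^ (- (e / (2 * k%:R)))) /\
  forall j s, (0 < j < q.-1)%N -> ~~ bad j -> σ <= s -> cabs (PB (ch j) u v s) <= V.
Proof.
move=> C0 hC q ch u k v V e pq hc u4 k0 vk kq V0 e0 hV; have /andP[s1 s2] := s12.
set x := (u ^ k)%N; have u0 : (0 < u)%N by apply: leq_trans u4.
have u1 : (1 < u)%N by apply: leq_trans u4.
have x4 : (4 <= x)%N by apply: leq_trans u4 _; rewrite -[leqLHS]expn1 leq_exp2l.
have x1 : (1 < x)%N by apply: leq_trans x4.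
have q1 : (0 < q.-1)%N by rewrite -subn1 subn_gt0 prime_gt1.
have /andP[m1 m2] := trunc_log_bounds x1 q1; set m := trunc_log x q.-1 in m1 m2.
have m0 : (0 < m)%N by rewrite lt0n; apply/eqP => mm; move: m2; rewrite mm expn1 ltnNge -ltnS prednK ?prime_gt0 // kq.
have xmq : (x ^ m < q)%N by rewrite -(prednK (prime_gt0 pq)) ltnS.
have qxm : (q <= x ^ m.+1)%N by rewrite -(prednK (prime_gt0 pq)).
have vmq : (v ^ m < q)%N by apply: leq_ltn_trans xmq; rewrite leq_exp2r.
have s0 : 0 <= σ by lra.
have [bad [hb hp]] := block_sup pq hc u4 m0 vmq V0 s0; exists bad; split=> //.
have Vm : 0 < V ^+ (2 * m) by sign.
rewrite -(ler_pM2l Vm); apply: le_trans hb _.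
rewrite [leRHS]mulrCA ler_wpM2l /1/ [leRHS]mulrCA ler_wpM2l /1/.
have my : m%:R <= ln q%:R :> R.
 have h1 := ln_ge1_nat R x4; via (m%:R * ln x%:R); first by rewrite ler_peMr.
 rewrite mulr_natl -lnXn ?ltr0n ?(ltnW x1) // -natrX ler_ln ?posrE ?ltr0n ?(prime_gt0 pq) ?expn_gt0 ?u0 //.
 by rewrite ler_nat ltnW.
have bu : bsum u v σ <= C * u%:R `^ (1 - 2 * σ).
 step (hC u v u1); have := ln_ge1_nat R u4 => h1.
 by rewrite ler_pdivrMr /1/ ler_peMr /1/ mulr_ge0.
have B0 := bsum_ge0 u v.
via ((ln q%:R * (C * u%:R `^ (1 - 2 * σ))) ^+ m).
 rewrite exprMn ler_pM /1/; last by rewrite lerXn2r /1/ mulr_ge0.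
 via (m%:R ^+ m); first by rewrite -natrX ler_nat fact_le_exp.
 by rewrite lerXn2r /1/.
via ((V ^+ 2 * u%:R `^ (- e)) ^+ m).
 by rewrite lerXn2r /1/.
rewrite exprMn -exprM ler_wpM2l /1/ nat_powR_exp.
have up : 0 < ((u ^ m)%N%:R : R) by rewrite ltr0n expn_gt0 u0.
rewrite !powR_expR /1/ ler_expR mulNr mulNr lerN2 -mulrA ler_wpM2l /1/.
rewrite mulrC ler_pdivrMr /1/ [leRHS]mulrC -natrM mulr_natl -lnXn /1/ -natrX.
rewrite ler_ln ?posrE ?ltr0n ?(prime_gt0 pq) ?expn_gt0 ?u0 // ler_nat.
apply: leq_trans qxm _; rewrite /x -!expnM leq_exp2l // mulnCA mulnA [leqLHS]mulnC leq_mul2r.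
by apply/orP; right; rewrite mul2n -addnn -addn1 leq_add2l.
Qed.
End SupBounds.

(** * Conditions that hold for all large arguments *)

Section Eventually.
Variable R : realType.

Definition ev (P : R -> Prop) := exists T0 : R, forall T, T0 <= T -> P T.

Lemma evI (P Q : R -> Prop) : ev P -> ev Q -> ev (fun T => P T /\ Q T).
Proof.
move=> [T1 h1] [T2 h2]; exists (Num.max T1 T2) => T; rewrite ge_max => /andP[a b].
by split; [apply: h1|apply: h2].
Qed.

Lemma ev_ge (K : R) : ev (fun T => K <= T). Proof. by exists K. Qed.

Lemma ev_powR (K a : R) : 0 < a -> ev (fun T => K <= T `^ a).
Proof.
move=> a0; exists ((Num.max K 0) `^ a^-1) => T h; have m0 : 0 <= Num.max K 0 by rewrite le_max lexx orbT.
via (Num.max K 0); first by rewrite le_max lexx.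
by rewrite -[leLHS]powRr1 /1/ -(mulVf (lt0r_neq0 a0)) powRrM ge0_ler_powR ?nnegrE /1/ (le_trans _ h) ?powR_ge0.
Qed.

Lemma ev_exp (K c : R) n : 0 < c -> ev (fun T => K * T ^+ n <= expR (c * T)).
Proof.
move=> c0; set D := c ^+ n.+1 / n.+1`!%:R; have D0 : 0 < D by sign.
exists (Num.max 0 (K / D)) => T; rewrite ge_max => /andP[T0 KT].
via ((c * T) ^+ n.+1 / n.+1`!%:R); last first.
 apply: le_trans (exp_partial_le n.+2 _); last by sign.
 rewrite [leRHS]big_ord_recr /= lerDr; apply: sumr_ge0 => i _.
 by sign.
rewrite exprMn (exprS T) [leRHS](_ : _ = D * T * T ^+ n); last by rewrite /D; ring.
by rewrite ler_wpM2r /1/ mulrC -ler_pdivrMr.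
Qed.

Lemma trunc_bounds (T : R) : 2 <= T -> (Num.truncn T)%:R <= T /\ T <= 2 * (Num.truncn T)%:R.
Proof.
move=> T2; have T0 : 0 <= T by lra.
have := truncn_itv T0; rewrite -natr1 => /andP[h1 h2]; split => //.
suff : 1 <= (Num.truncn T)%:R :> R by lra.
by rewrite ler1n; case: (Num.truncn T) h2 => //=; lra.
Qed.

Lemma ev_trunc (P : R -> Prop) : ev P -> ev (fun T => P (Num.truncn T)%:R).
Proof.
move=> [T0 h]; exists (Num.max 2 (2 * T0)) => T; rewrite ge_max => /andP[T2 hT].
by apply: h; have [] := trunc_bounds T2; lra.
Qed.
End Eventually.

(** * Chains of blocks whose endpoints are squared *)

Section Chain.
Variable (R : realType) (σ : R).
Hypothesis s12 : 2^-1 < σ < 1.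
Implicit Types (s : R) (u v w m n : nat).
Let a := 2 * σ - 1.

(** Each block runs from u to u^2 at most, so [block_gen] applies with k = 2 and saves the same
    power q^(-a/8) in every block; the tolerance 1/log q per block keeps the total of log q blocks
    at most 1. *)
Lemma block_chain (C : R) : 0 < C -> (forall u v, (1 < u)%N -> bsum u v σ <= C * u%:R `^ (1 - 2 * σ) / ln u%:R) ->
 forall q (ch : nat -> nat -> R[i]) Y w, prime q -> char_family q ch -> (4 <= Y)%N -> (w * w <= q)%N ->
 1 <= ln (q%:R : R) -> C * ln q%:R ^+ 3 <= Y%:R `^ (a / 2) ->
 forall J, exists bad : nat -> bool,
  \sum_(j < q.-1) (bad j)%:R <= J%:R * (q.-1%:R * (ln q%:R ^+ 2 * q%:R `^ (- (a / 8)))) /\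
  forall j s, (0 < j < q.-1)%N -> ~~ bad j -> σ <= s ->
   cabs (PB (ch j) Y (minn w (Y ^ (2 ^ J))) s) <= J%:R / ln q%:R.
Proof.
move=> C0 hC q ch Y w pq hc Y4 wq T1 hY; have /andP[s1 s2] := s12.
have a0 : 0 < a by rewrite /a; lra.
have T0 : 0 < ln (q%:R : R) by lra.
have Y0 : (0 < Y)%N by apply: leq_trans Y4.
elim=> [|J [bad [hb hp]]].
 exists (fun=> false); split; first by rewrite mul0r big1.
 by move=> j s _ _ _; rewrite expn0 expn1 PB_empty ?geq_minr // cabs0 mul0r.
set u := (Y ^ (2 ^ J))%N.
have Yu : (Y <= u)%N by rewrite -[leqLHS]expn1 leq_exp2l ?expn_gt0 // (leq_trans _ Y4).
have u0 : (0 < u)%N by apply: leq_trans Yu.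
have uS : (Y ^ (2 ^ J.+1) = u ^ 2)%N by rewrite /u -expnM expnSr.
have [wu|uw] := leqP w u.
 exists bad; split.
  by step hb; rewrite ler_wpM2r ?ler_nat /1/ !mulr_ge0.
 move=> j s h1 h2 h3; have := hp j s h1 h2 h3; rewrite -/u (minn_idPl wu).
 rewrite uS (minn_idPl _); last by apply: leq_trans wu _; rewrite -[leqLHS]expn1 leq_exp2l ?(leq_trans _ (leq_trans Y4 Yu)).
 by move=> h; step h; rewrite ler_wpM2r /1/ ler_nat.
have u4 : (4 <= u)%N by apply: leq_trans Yu.
have u2q : (u ^ 2 < q)%N by apply: leq_trans wq; rewrite -mulnn; apply: ltn_mul.
have e0 : 0 < a / 2 by sign.
have V0 : 0 < (ln (q%:R : R))^-1 by sign.
have cond : ln q%:R * (C * u%:R `^ (1 - 2 * σ)) <= (ln q%:R)^-1 ^+ 2 * u%:R `^ (- (a / 2)).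
 have hu : C * ln q%:R ^+ 3 <= u%:R `^ (a / 2) by step hY; rewrite ge0_ler_powR /1/ ler_nat.
 have -> : u%:R `^ (1 - 2 * σ) = u%:R `^ (- (a / 2)) / u%:R `^ (a / 2) :> R by rewrite -powRN -powRD /1/; congr (_ `^ _); rewrite /a; field.
 set U := u%:R `^ (a / 2) in hu *; have U0 : 0 < U by sign.
 set W := u%:R `^ (- (a / 2)); have W0 : 0 < W by sign.
 rewrite [leLHS](_ : _ = C * ln q%:R ^+ 3 / U * ((ln q%:R)^-1 ^+ 2 * W)); last by field; rewrite !gt_eqF.
 by rewrite ler_piMl /1/ ler_pdivrMr /1/ mul1r.
have [bad2 [hb2 hp2]] := block_gen s12 C0 hC pq hc u4 (isT : (0 < 2)%N) (geq_minr w (u ^ 2)) u2q V0 e0 cond.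
exists (fun j => bad j || bad2 j); split.
 rewrite -natr1 mulrDl mul1r; via (\sum_(j < q.-1) ((bad j)%:R + (bad2 j)%:R)).
  by apply: ler_sum => j _; case: (bad j); case: (bad2 j) => /=; rewrite ?add0r // lerDl.
 rewrite big_split lerD //; apply: le_trans hb2 _.
 by rewrite (_ : a / 2 / (2 * 2%:R) = a / 8) //; field.
move=> j s h1; rewrite negb_or => /andP[h2 h3] ss; rewrite uS (@PB_cat _ _ _ u) // ?leq_min ?(ltnW uw) /=; last first.
 by rewrite -[leqLHS]expn1 leq_exp2l // (leq_trans _ u4).
triD; rewrite -natr1 mulrDl mul1r lerD //.
 by have := hp j s h1 h2 ss; rewrite -/u (minn_idPr (ltnW uw)).
exact: hp2.
Qed.
End Chain.

(** * The exceptional set and the approximation of L *)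

Section GoodSet.
Variable (R : realType) (σ : R).
Hypothesis s12 : 2^-1 < σ < 1.
Implicit Types (s T : R) (u v w m n : nat).

Lemma PB_head chi y s : charlike chi -> σ <= s ->
 cabs (PB chi 1 y s) <= y%:R `^ (1 - σ) / (1 - σ).
Proof.
have /andP[s1 s2] := s12; have sp : 0 < σ < 1 by rewrite s2 andbT; lra.
move=> [_ _ c1] ss; apply: le_trans (DP_norm _ _ _ c1) _; apply: le_trans (sum_powRN_head y sp).
have [y0|y0] := posnP y; first by rewrite y0 !big_geq.
rewrite [leRHS]big_nat_recr //= -[leLHS]addr0 lerD /1/; apply: ler_sum_nat => n /andP[n1 _].
rewrite nexp_powR /1/ -[leRHS]mul1r ler_pM ?nexp_ge0 ?nexp_mono /1/ /pind.
by case: (_ && _); rewrite ?normr1 ?normr0.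
Qed.

Lemma Lp_DP chi w s : Lp chi w s = DP chi (fun=> 1) w s :> R[i].
Proof. by rewrite /Lp /DP; apply: eq_big_nat => n /andP[n1' _]; rewrite mul1r /npow nexp_powR. Qed.
Lemma sum_orb N (b1 b2 : nat -> bool) :
 \sum_(j < N) ((b1 j || b2 j)%:R : R) <= \sum_(j < N) (b1 j)%:R + \sum_(j < N) (b2 j)%:R.
Proof.
rewrite -big_split /=; apply: ler_sum => j _.
by case: (b1 j); case: (b2 j) => /=; rewrite ?add0r // lerDl.
Qed.

Lemma term_le (K T d c x : R) k : 1 <= T -> (k <= 3)%N -> 0 <= c <= K -> 2 * d <= x ->
 c * T ^+ k * expR (- (x * T)) <= K * T ^+ 3 * expR (- (2 * d * T)).
Proof.
move=> T1 k3 /andP[c0 cK] dx; have T0 : 0 <= T by lra.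
rewrite ler_pM /1/; last by rewrite ler_expR lerN2 ler_wpM2r.
by rewrite ler_pM /1/ ler_weXn2l.
Qed.

Lemma head_small (eta T : R) y : 0 < eta -> 1 <= T -> y%:R <= T ->
 4 / (eta * (1 - σ)) <= T `^ σ -> 4 / eta <= T `^ (σ / 2) ->
 y%:R `^ (1 - σ) / (1 - σ) <= eta * T / 4 /\ T `^ (1 - σ / 2) <= eta * T / 4.
Proof.
have /andP[s1 s2] := s12; move=> e0 T1 yT h1 h2; have Tp : 0 < T by lra.
have s3 : 0 < 1 - σ by lra.
have p1 := powR_gt0 σ Tp; have p2 := powR_gt0 (σ / 2) Tp.
split.
 via (T `^ (1 - σ) / (1 - σ)).
  by rewrite ler_wpM2r ?invr_ge0 ?(ltW s3) // ge0_ler_powR ?nnegrE ?(ltW s3) ?(ltW Tp).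
 rewrite powRB /1/ powRr1 /1/ ler_pdivrMr /1/ ler_pdivrMr /1/.
 rewrite ler_pdivrMr /1/ in h1; clear -h1 Tp; nra.
rewrite powRB /1/ powRr1 /1/ ler_pdivrMr /1/.
rewrite ler_pdivrMr // in h2; clear -h2 Tp; nra.
Qed.

Lemma cabs_cexpN_le (P : R[i]) (H : R) : cabs P <= H -> cabs (cexp (- P)) <= expR H.
Proof.
move=> h; rewrite cabs_cexp ler_expR; apply: le_trans h; rewrite -(cabsN P).
exact: le_trans (ler_norm _) (ler_Re_cabs _).
Qed.

Lemma approx_half (L0 L1 P : R[i]) (D H : R) : cabs (L1 * cexp (- P) - 1) <= 4^-1 ->
 cabs (L0 - L1) <= D -> cabs P <= H -> D * expR H <= 4^-1 -> cabs (L0 * cexp (- P) - 1) <= 2^-1.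
Proof.
move=> h1 h2 /cabs_cexpN_le h3 h4.
have -> : L0 * cexp (- P) - 1 = (L1 * cexp (- P) - 1) + (L0 - L1) * cexp (- P) by ring.
triD; rewrite (cabsM (L0 - L1)).
have h5 : cabs (L0 - L1) * cabs (cexp (- P)) <= D * expR H by rewrite ler_pM /1/.
move: h1 h4 h5; move: (_ * _) (_ * _) (cabs _) => x z t; lra.
Qed.

(** Primes below y = floor(T) are bounded trivially, those in [y, y^B) by T^(1 - σ/2) and those from
    y^B to w, about q^(1/2), by 1, uniformly in s >= σ. The resulting bound eta T for |P| is coarse,
    but it enters only as exp(eta T) against a saved power of q. The block [y, y^B) stays in the
    conclusion, to be bounded more sharply at the single point σ. *)
Lemma good_set : exists (d K : R) (B : nat), [/\ 0 < d, 0 < K, (0 < B)%N &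
 ev (fun T => forall q (ch : nat -> nat -> R[i]), prime q -> char_family q ch -> ln q%:R = T ->
 exists bad : nat -> bool, [/\ \sum_(j < q.-1) (bad j)%:R <= q.-1%:R * expR (- (d * T)), bad 0%N &
  forall j, (j < q.-1)%N -> ~~ bad j -> exists w : nat,
   (forall s, σ <= s -> cabs (Defs.Lfun s (ch j) * cexp (- Pw (ch j) w s) - 1) <= 2^-1) /\
   cabs (Pw (ch j) w σ - (PB (ch j) 1 (Num.truncn T) σ +
    PB (ch j) (Num.truncn T) (Num.truncn T ^ B) σ)) <= K])].
Proof.
have /andP[s1 s2] := s12; set a := 2 * σ - 1; have a0 : 0 < a by rewrite /a; lra.
have a1 : a < 1 by rewrite /a; lra.
have sp : 0 < σ by lra.
have [Cp [Cp0 hCp]] := Pw_primes s12; have [C [C0 hC]] := bsum_le s12.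
have [Cd [Cd0 hCd]] := Dtail_mean s12.
(* a B >= 8 gives (y^B)^(a/2) >= y^4, which exceeds the C T^3 that the chain of blocks asks for. *)
set B := (Num.truncn (8 / a)).+1.
have hB : 8 <= a * B%:R.
 have := truncn_itv (ltW (divr_gt0 (ltr0Sn R 7) a0)) => /andP[_ h].
 by rewrite mulrC -ler_pdivrMr // ltW.
have B0 : 0 < (B%:R : R) by sign.
have B1 : 1 <= (B%:R : R) by rewrite ler1n.
(* The cut at w saves q^(-a/4) in the mean of [Qd] and q^(-a/8) in that of [Dtail]; these beat the
   tolerances exp(-2 eta T) = q^(-a/8) and exp(-eta T) = q^(-a/16), up to constants. *)
set eta := a / 16; have eta0 : 0 < eta by sign.
(* 2 d is at most each of the five exponents saved by the exceptional sets; half of it pays for T^3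
   and the constants. *)
set d := a / (64 * B%:R); have d0 : 0 < d by sign.
have dB : d * (64 * B%:R) = a by rewrite divfK // gt_eqF // mulr_gt0.
have da : 64 * d <= a by rewrite -dB; clear -B1 d0; nra.
set K1 := 16 / a + 8 * Cd + 3.
have K1a : 16 / a <= K1 by rewrite /K1; clear -Cd0; lra.
have K13 : 3 <= K1 by rewrite /K1; have := divr_gt0 (ltr0Sn R 15) a0; clear -Cd0; lra.
have K1c : 8 * Cd <= K1 by rewrite /K1; have := divr_gt0 (ltr0Sn R 15) a0; clear; lra.
exists d, (Cp + 1), B; split=> //; first by lra.
have e1 : 0 < σ / 2 by sign.
have q4 : 0 < (4 : R)^-1 by sign.
have eta1 : 0 < 1 - eta by rewrite /eta; lra.
have s3 : 0 < 1 - σ by clear -s2; lra.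
have d1 : 2 * d <= 1 by clear -da a1; lra.
have d2 : 2 * d <= a / 8 by clear -d0 da; lra.
have d3 : 2 * d <= a / 16 by clear -d0 da; lra.
have d4 : 2 * d <= σ / 2 / (2 * B%:R).
 rewrite ler_pdivlMr /1/ (_ : 2 * d * (2 * B%:R) = a / 16); first by (clear -s1 a1; lra).
 by rewrite -dB; field.
have k0 : 0 <= (2 : R) <= K1 by clear -K13; apply/andP; split; lra.
have k1 : 0 <= 16 / a <= K1 by sign.
have k2 : 0 <= 8 * Cd <= K1 by sign.
have k3 : 0 <= (1 : R) <= K1 by clear -K13; apply/andP; split; lra.
have [T0 hT] := evI (evI (evI (ev_trunc (ev_ge (Num.max 4 (8 * C)))) (ev_trunc (ev_powR C e1)))
 (evI (ev_exp 1 B q4) (ev_exp 3 0 q4))) (evI (evI (evI (ev_ge (4 * (Cp + 1) / eta)) (ev_powR (4 / (eta * (1 - σ))) sp))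
 (evI (ev_powR (4 / eta) e1) (ev_exp 40 0 eta1))) (evI (ev_exp (5 * K1) 3 d0) (ev_ge 4))).
exists T0 => T {}/hT; set y := Num.truncn T => -[[[E1 E3] [E4 E5]] [[[E6 E6'] [E6'' E7]] [E8 T4]]] q ch pq hc qT.
rewrite mul1r in E4; rewrite expr0 mulr1 in E5; rewrite expr0 mulr1 in E7.
move: E1; rewrite ge_max => /andP[y4 yC]; rewrite (ler_nat _ 4) in y4.
have T1 : 1 <= T by clear -T4; lra.
have E6c : Cp + 1 <= eta * T / 4 by rewrite ler_pdivrMr // in E6; clear -E6; lra.
have [yT Ty] : y%:R <= T /\ T <= 2 * y%:R by apply: trunc_bounds; clear -T4; lra.
have Tp : 0 < T by clear -T1; lra.
have yp : 0 < (y%:R : R) by clear -Ty T1; lra.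
have [hs1 hs2] := head_small eta0 T1 yT E6' E6''.
have q0 : (0 < q)%N by exact: prime_gt0.
have qE : q%:R = expR T by rewrite -qT lnK // posrE ltr0n.
have qpow (x : R) : q%:R `^ x = expR (x * T) by rewrite powR_expR /1/ qT.
set X := expR (4^-1 * T) in E4 E5.
have XX : X ^+ 2 = expR (T / 2) by rewrite /X -expRM_natl; congr expR; field.
have XX4 : X ^+ 4 = expR T by rewrite /X -expRM_natl; congr expR; field.
set w := Num.truncn (X ^+ 2).
have /andP[w1 w2] : w%:R <= X ^+ 2 < w.+1%:R by apply: truncn_itv; rewrite exprn_ge0 // expR_ge0.
have Xw : X + 1 <= w%:R by move: w2; rewrite -natr1; clear -E5; nra.
have w4 : (4 <= w)%N by rewrite -(ler_nat R); clear -E5 Xw; lra.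
have wp : X <= w.-1%:R by move: Xw; rewrite -{1}(@prednK w) ?(leq_trans _ w4) // -natr1; clear; lra.
have wq : (w * w <= q)%N by rewrite -(ler_nat R) natrM qE -XX4 (exprM _ 2 2) -expr2 lerXn2r /1/ exprn_ge0 expR_ge0.
set Y := (y ^ B)%N.
have YX : Y%:R <= X by rewrite natrX; apply: le_trans E4; rewrite lerXn2r /1/ ltW.
have y1 : (1 < y)%N by apply: leq_trans y4.
have yY : (y <= Y)%N by rewrite -[leqLHS]expn1 leq_exp2l.
have Y4 : (4 <= Y)%N := leq_trans y4 yY.
have Yw : (Y <= w)%N by rewrite -(ler_nat R); clear -YX Xw; lra.
have hw4q : (4 <= w <= q)%N by rewrite w4 (leq_trans _ wq) // leq_pmulr // (leq_trans _ w4).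
have wlq : (w < q)%N by apply: leq_trans wq; rewrite ltn_Pmulr // (leq_trans _ w4).
have Yq : (Y < q)%N by apply: leq_ltn_trans wlq.
have qT1 : 1 <= ln (q%:R : R) by rewrite qT.
have condY : C * ln q%:R ^+ 3 <= Y%:R `^ (a / 2).
 rewrite qT; via (y%:R ^+ 4).
  have h3 : T ^+ 3 <= (2 * y%:R) ^+ 3 by rewrite lerXn2r /1/ mulr_ge0.
  step (ler_wpM2l (ltW C0) h3); rewrite exprMn (exprS _ 3) mulrA ler_wpM2r /1/; clear -yC; lra.
 rewrite -nat_powR_exp -[leRHS]powR_mulrn /1/ -powRrM -[leLHS]powR_mulrn /1/.
 by rewrite ler_powR ?ler1n ?(leq_trans _ y4) //; clear -hB; lra.
have [b3 [hb3 hp3]] := block_chain s12 C0 hC pq hc Y4 wq qT1 condY y.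
have V0 : 0 < T `^ (1 - σ / 2) by sign.
have cond4 : ln q%:R * (C * y%:R `^ (1 - 2 * σ)) <= (T `^ (1 - σ / 2)) ^+ 2 * y%:R `^ (- (σ / 2)).
 rewrite qT -powR_mulrn /1/ -powRrM.
 have -> : (1 - σ / 2) * 2%:R = 1 + (1 - σ) by field.
 have -> : T `^ (1 + (1 - σ)) = T * T `^ (1 - σ) by rewrite powRD /1/ powRr1 ?(ltW Tp).
 rewrite -[leRHS]mulrA ler_wpM2l /1/.
 via (y%:R `^ (σ / 2) * y%:R `^ (1 - 2 * σ)); first by rewrite ler_wpM2r.
 via (y%:R `^ (1 - σ) * y%:R `^ (- (σ / 2))).
  by rewrite -!powRD /1/; apply: ler_of_eq; congr (_ `^ _); field.
 by rewrite ler_wpM2r /1/ ge0_ler_powR ?nnegrE ?(ltW s3) ?(ltW Tp).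
have [b4 [hb4 hp4]] := block_gen s12 C0 hC pq hc y4 (isT : (0 < B)%N) (leqnn Y) Yq V0 e1 cond4.
set lam := expR (- (eta * T)) / 4; have lam0 : 0 < lam by sign.
pose Qj j := Qd (ch j) (fun n => (0 < n)%N%:R * rho R w n) (w * w) σ σ.
pose b1 j := (lam ^+ 2 < Qj j)%R.
pose b2 j := (0 < j)%N && (expR (- (eta * T)) / 8 < Dtail σ q (ch j) w)%R.
have cl j : (j < q.-1)%N -> charlike (ch j) by apply: family_charlike.
have N0 : 0 <= q.-1%:R :> R by [].
have a4 n : (n < 4)%N -> (0 < n)%N%:R * rho R w n = 0 by case: n => [|n] n4; rewrite ?mul0r // rho_small ?mulr0 // (leq_trans n4).
have hb1 : \sum_(j < q.-1) (b1 j)%:R <= q.-1%:R * (16 / a * T ^+ 2 * expR (- (a / 8 * T))).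
 have l2 : 0 < lam ^+ 2 by sign.
 rewrite -(ler_pM2l l2); apply: le_trans (markov_count (F := fun j : 'I_q.-1 => Qj j) (ltW l2) _) _.
  by move=> j; have [_ _ c1] := cl j (ltn_ord j); apply: Qd_ge0; rewrite ?(ltW sp).
 step (rho_mean s12 hc w4 wq); rewrite qT [leRHS]mulrCA ler_wpM2l //.
 have hw : w.-1%:R `^ (1 - 2 * σ) <= expR (- (a * (4^-1 * T))).
  have w0 : 0 < (w.-1%:R : R) by apply: lt_le_trans wp; exact: expR_gt0.
  rewrite powR_expR // ler_expR -/a (_ : 1 - 2 * σ = - a); last by rewrite /a; ring.
  by rewrite mulNr lerN2 ler_wpM2l /1/ -(expRK (4^-1 * T)) -/X ler_ln /1/ expR_gt0.
 have -> : lam ^+ 2 * (16 / a * T ^+ 2 * expR (- (a / 8 * T))) = T ^+ 2 * (expR (- (a * (4^-1 * T))) / a).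
  rewrite /lam exprMn -expRM_natl exprVn (_ : (4 : R) ^+ 2 = 16); last by rewrite expr2; ring.
  have -> : - (a * (4^-1 * T)) = 2%:R * - (eta * T) + - (a / 8 * T) by rewrite /eta; field.
  by rewrite expRD; field; rewrite gt_eqF.
 by rewrite ler_wpM2l /1/ ler_wpM2r /1/ invr_ge0 ltW.
have hb2 : \sum_(j < q.-1) (b2 j)%:R <= q.-1%:R * (8 * Cd * expR (- (a / 16 * T))).
 have l2 : 0 < expR (- (eta * T)) / 8 by sign.
 have h48 : (4 <= w <= q)%N by rewrite w4 ltnW.
 rewrite -(ler_pM2l l2); via (\sum_(j < q.-1 | (0 < j)%N) Dtail σ q (ch j) w).
  rewrite [leRHS]big_mkcond mulr_sumr; apply: ler_sum => j _; rewrite /b2; case: ifP => _ /=; last by rewrite mulr0.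
  have D0 : 0 <= Dtail σ q (ch j) w by rewrite addr_ge0 /1/ => n _; rewrite mulr_ge0.
  by case: ltP => h; [rewrite mulr1; exact: ltW|rewrite mulr0].
 step (hCd q ch w pq hc h48); rewrite [leRHS]mulrCA ler_wpM2l //.
 have hw : w%:R `^ (2^-1 - σ) <= expR (- (a / 2 * (4^-1 * T))).
  have w0 : 0 < (w%:R : R) by rewrite ltr0n (leq_trans _ w4).
  rewrite powR_expR // ler_expR (_ : 2^-1 - σ = - (a / 2)); last by rewrite /a; field.
  rewrite mulNr lerN2 ler_wpM2l /1/ -(expRK (4^-1 * T)) -/X ler_ln /1/; clear -Xw; lra.
 have -> : expR (- (eta * T)) / 8 * (8 * Cd * expR (- (a / 16 * T))) = Cd * expR (- (a / 2 * (4^-1 * T))).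
  have -> : - (a / 2 * (4^-1 * T)) = - (eta * T) + - (a / 16 * T) by rewrite /eta; field.
  by rewrite expRD; field.
 by rewrite ler_wpM2l // ltW.
(* The principal character, at index 0, is put among the bad ones: its Dirichlet series diverges for
   σ < 1. *)
exists (fun j => (j == 0%N) || (b1 j || (b2 j || (b3 j || b4 j)))); split=> //.
 have hb0 : \sum_(j < q.-1) ((j == 0 :> nat)%:R : R) <= q.-1%:R * (2 * T ^+ 0 * expR (- (1 * T))).
  via 1.
   have h1 : \sum_(j < q.-1) ((j == 0 :> nat)%:R : R) = (\sum_(0 <= j < q.-1) (j == 0%N))%N%:R by rewrite big_mkord natr_sum.
   rewrite h1 -[leRHS]/(1%:R) ler_nat -big_mkcond sum1_count count_uniq_mem ?iota_uniq // leq_b1 //.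
  rewrite expr0 mulr1 mul1r expRN -qE mulrA ler_pdivlMr /1/ mul1r -natrM ler_nat.
  by rewrite -{1}(prednK q0) muln2 -addnn -addn1 leq_add2l -subn1 subn_gt0 prime_gt1.
 have t0 : 2 * T ^+ 0 * expR (- (1 * T)) <= K1 * T ^+ 3 * expR (- (2 * d * T)) by apply: term_le.
 have t1 : 16 / a * T ^+ 2 * expR (- (a / 8 * T)) <= K1 * T ^+ 3 * expR (- (2 * d * T)) by apply: term_le.
 have t2 : 8 * Cd * T ^+ 0 * expR (- (a / 16 * T)) <= K1 * T ^+ 3 * expR (- (2 * d * T)) by apply: term_le.
 have t3 : 1 * T ^+ 3 * expR (- (a / 8 * T)) <= K1 * T ^+ 3 * expR (- (2 * d * T)) by apply: term_le.
 have t4 : 1 * T ^+ 2 * expR (- (σ / 2 / (2 * B%:R) * T)) <= K1 * T ^+ 3 * expR (- (2 * d * T)) by apply: term_le.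
 have hb3' : \sum_(j < q.-1) (b3 j)%:R <= q.-1%:R * (1 * T ^+ 3 * expR (- (a / 8 * T))).
  apply: le_trans hb3 _; rewrite qT qpow -/a mulrCA ler_wpM2l // mul1r (exprS T 2) -[leRHS]mulrA mulNr.
  by rewrite ler_wpM2r /1/ mulr_ge0.
 have hb4' : \sum_(j < q.-1) (b4 j)%:R <= q.-1%:R * (1 * T ^+ 2 * expR (- (σ / 2 / (2 * B%:R) * T))) by step hb4; rewrite qT qpow mul1r mulNr.
 have E8' : 5 * (K1 * T ^+ 3 * expR (- (2 * d * T))) <= expR (- (d * T)).
  via (expR (d * T) * expR (- (2 * d * T))); last first.
   by rewrite -expRD ler_expR; apply: ler_of_eq; ring.
  rewrite [leLHS](_ : _ = 5 * K1 * T ^+ 3 * expR (- (2 * d * T))); last by ring.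
  by rewrite ler_wpM2r.
 rewrite expr0 mulr1 in t2.
 apply: le_trans (sum_orb _ (fun j => j == 0%N) (fun j => b1 j || (b2 j || (b3 j || b4 j)))) _.
 apply: le_trans (lerD (lexx _) (sum_orb _ b1 (fun j => b2 j || (b3 j || b4 j)))) _.
 apply: le_trans (lerD (lexx _) (lerD (lexx _) (sum_orb _ b2 (fun j => b3 j || b4 j)))) _.
 apply: le_trans (lerD (lexx _) (lerD (lexx _) (lerD (lexx _) (sum_orb _ b3 b4)))) _.
 step (lerD hb0 (lerD hb1 (lerD hb2 (lerD hb3' hb4')))).
 rewrite -!mulrDr ler_wpM2l //; apply: le_trans E8'.
 move: t0 t1 t2 t3 t4; clear; move: (K1 * _ * _) => G; lra.
move=> j jN; rewrite !negb_or => /and5P[j0 n1 n2 n3 n4]; rewrite -lt0n in j0.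
have jj : (0 < j < q.-1)%N by rewrite j0.
have clj := cl j jN; exists w.
(* y squarings pass w: Y^(2^y) >= 4^y >= exp(T/2) >= w. *)
have wY : minn w (Y ^ (2 ^ y)) = w.
 apply/minn_idPl; rewrite -(ler_nat R); apply: le_trans w1 _.
 via (4 ^+ y).
  rewrite XX; via (expR y%:R); first by rewrite ler_expR; clear -Ty; lra.
  by rewrite -[y%:R]mulr1 expRM_natl lerXn2r /1/ expR1_le4.
 via (Y%:R ^+ y); first by rewrite lerXn2r /1/ (ler_nat _ 4).
 by rewrite -natrX ler_nat leq_exp2l ?(leq_trans _ Y4) // ltnW // ltn_expl.
have split_ s : PB (ch j) 1 w s = PB (ch j) 1 y s + PB (ch j) y Y s + PB (ch j) Y w s.
 have y0 : (0 < y)%N by apply: ltnW.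
 by rewrite (@PB_cat _ (ch j) 1 Y w s isT (leq_trans y0 yY) Yw) (@PB_cat _ (ch j) 1 y Y s isT y0 yY).
have h3 s : σ <= s -> cabs (PB (ch j) Y w s) <= 1.
 move=> ss; have := hp3 j s jj n3 ss; rewrite wY qT => h; apply: le_trans h _.
 by rewrite ler_pdivrMr // mul1r.
split; last first.
 rewrite -/Y (_ : _ - _ = (Pw (ch j) w σ - PB (ch j) 1 w σ) + PB (ch j) Y w σ); last by rewrite split_; ring.
 by triD; apply: lerD; [exact: hCp|exact: h3].
have hH s : σ <= s -> cabs (Pw (ch j) w s) <= eta * T.
 move=> ss; rewrite (_ : Pw (ch j) w s = (Pw (ch j) w s - PB (ch j) 1 w s) + (PB (ch j) 1 y s + (PB (ch j) y Y s + PB (ch j) Y w s))); last first.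
  by rewrite split_; ring.
 have c1 := hCp (ch j) w s clj ss; have c2 := PB_head y clj ss.
 have c3 := hp4 j s jj n4 ss; have c4 := h3 s ss.
 have c1' := E6c.
 do 3 (triD; rewrite -lerBrDl).
 rewrite !lerBrDl; move: c1 c2 c3 c4 hs1 hs2 c1' Cp0; clear; move: (cabs _) (cabs _) (cabs _) (cabs _) (_ / (1 - σ)) (T `^ _) (eta * T) => x1 x2 x3 x4 x5 x6 x7; lra.
move=> s ss.
have hQ : Qj j <= lam ^+ 2 by rewrite leNgt.
have h1 := log_poly_approx clj w4 (ltW sp) lam0 hQ hH ss.
have h2 := Lfun_tail s12 (family_npchar hc jj) hw4q ss.
have h2' : Dtail σ q (ch j) w + 5 / q%:R <= expR (- (eta * T)) / 8 + 5 / q%:R by rewrite lerD2r leNgt; move: n2; rewrite /b2 j0.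
apply: (approx_half _ (le_trans h2 h2') (hH s ss)).
 by rewrite Lp_DP; step h1; rewrite /lam mulrA -expRD subrr expR0 mul1r.
rewrite mulrDl mulrAC -expRD addNr expR0 mul1r qE -mulrA -expRN -expRD.
have -> : - T + eta * T = - ((1 - eta) * T) by ring.
rewrite expRN; move: E7; clear; move: (expR _) => z hz.
have : 5 / z <= 8^-1 by rewrite ler_pdivrMr; lra.
lra.
Qed.
End GoodSet.

(** * Continuous branches of log L *)

Section ContinuousLog.
Variable (R : realType) (σ : R).
Hypothesis s12 : 2^-1 < σ < 1.
Implicit Types (s t : R) (chi : nat -> R[i]).
Local Open Scope classical_set_scope.

Lemma cderiv_cont (f f' : R -> R[i]) : (forall x, cderiv f x (f' x)) ->
 continuous (fun t => Re (f t)) /\ continuous (fun t => Im (f t)).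
Proof.
move=> h; split=> x; apply: differentiable_continuous; apply/derivable1_diffP; have [] := h x; first by case.
by move=> _ [].
Qed.

Lemma unif_cont (f : R -> R) :
 (forall e, 0 < e -> exists g : R -> R, continuous g /\ forall s, `|f s - g s| <= e) -> continuous f.
Proof.
move=> h x; apply/cvgrPdist_le => e e0.
have e3 : 0 < e / 3 by sign.
have [g [cg hg]] := h _ e3.
have := cg x; move/cvgrPdist_le => /(_ _ e3); apply: filterS => t ht.
have -> : f x - f t = (f x - g x) + (g x - g t) - (f t - g t) by ring.
triB; via (e / 3 + e / 3 + e / 3); last by lra.
by apply: lerD => //; triD; apply: lerD.
Qed.

Lemma cvg_pinf (f : R -> R) (l : R) : (forall e, 0 < e -> exists T : R, forall t, T <= t -> `|f t - l| <= e) ->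
 f x @[x --> +oo%R] --> l.
Proof.
move=> h; apply/cvgrPdist_le => e e0; have [T hT] := h e e0.
exists T; split; first exact: num_real.
by move=> t Tt; rewrite distrC; apply: hT; exact: ltW.
Qed.

(** D tends to 0 and never meets a zero of cos, so by the intermediate value theorem it cannot reach
    pi/2 or -pi/2. *)
Lemma small_angle (D : R -> R) : {within `[σ, +oo[%classic, continuous D} -> D x @[x --> +oo%R] --> (0 : R) ->
 (forall s, σ <= s -> 0 < cos (D s)) -> `|D σ| < pi / 2.
Proof.
move=> cD lD hD; have p1 := pihalf_ge1 R.
have [T [sT hT]] : exists T, σ <= T /\ `|D T| < 1.
 move/cvgrPdist_lt : lD => /(_ 1 ltr01) [T [_ hT]]; exists (Num.max σ (T + 1)).
 rewrite le_max lexx; split=> //; have := hT (Num.max σ (T + 1)); rewrite sub0r normrN; apply.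
 by rewrite lt_max ltrDl ltr01 orbT.
have cD' : {within `[σ, T]%classic, continuous D} by apply: continuous_subspaceW cD => x /=; rewrite !in_itv => /andP[-> _].
have nv v : cos v = 0 -> ~ (Num.min (D σ) (D T) <= v <= Num.max (D σ) (D T)).
 move=> v0 hv; have [c] := IVT sT cD' hv; rewrite in_itv /= => /andP[sc _] Dc.
 by have := hD c sc; rewrite Dc v0 ltxx.
rewrite ltNge; apply/negP => h; move: hT; rewrite ltr_norml => /andP[h1 h2].
have [d0|d0] := leP 0 (D σ).
 rewrite ger0_norm // in h; apply: (nv (pi / 2)); first exact: cos_pihalf.
 by rewrite ge_min le_max h; apply/andP; split=> //; apply/orP; right; lra.
rewrite ltr0_norm // in h; apply: (nv (- (pi / 2))); first by rewrite cosN cos_pihalf.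
by rewrite ge_min le_max; apply/andP; split; apply/orP; [left|right]; lra.
Qed.

(** The principal logarithm on the half-plane Re z > 0. *)
Definition clog (z : R[i]) : R[i] := Complex (ln (cabs z)) (atan (Im z / Re z)).

Lemma cexp_clog z : 0 < Re z -> cexp (clog z) = z.
Proof.
case: z => x y /= x0; rewrite /clog /cexp /=; set t := y / x.
have z0 : 0 < cabs (Complex x y) by rewrite cabs_gt0; apply/eqP => -[h]; rewrite h ltxx in x0.
have q0 : 0 < Num.sqrt (1 + t ^+ 2) by sign.
have zE : cabs (Complex x y) = x * Num.sqrt (1 + t ^+ 2).
 rewrite /cabs /= -[x in RHS]ger0_norm /1/ -sqrtr_sqr -sqrtrM /1/; congr Num.sqrt.
 by rewrite /t; field; rewrite gt_eqF.
have c1 : cabs (Complex x y) * cos (atan t) = x by rewrite cos_atan zE mulfK // gt_eqF.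
have c0 : cos (atan t) != 0 by rewrite cos_atan invr_neq0 // gt_eqF.
have sE : sin (atan t) = t * cos (atan t) by rewrite -{2}(atanK t) /tan divfK.
by rewrite lnK /1/ sE c1 mulrCA c1 /t divfK ?gt_eqF.
Qed.

Section Character.
Variables (q : nat) (chi : nat -> R[i]) (w : nat).
Hypotheses (q0 : (0 < q)%N) (npc : npchar q chi) (cl : charlike chi).
Hypothesis hw : forall s, σ <= s -> cabs (Defs.Lfun s chi * cexp (- Pw chi w s) - 1) <= 2^-1.

Let h s := Defs.Lfun s chi * cexp (- Pw chi w s).

Lemma Lfun_h s : Defs.Lfun s chi = cexp (Pw chi w s) * h s.
Proof. by rewrite /h mulrCA -cexpD subrr cexp0 mulr1. Qed.
Lemma h_bounds s : σ <= s -> [/\ 2^-1 <= Re (h s), 2^-1 <= cabs (h s) & cabs (h s) <= 3 / 2].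
Proof.
move=> ss; have := hw ss; rewrite -/(h s) => hh; split.
- by have := le_trans (ler_Re_cabs _) hh; rewrite ReD ReN ler_norml => /andP[] /=; lra.
- by have := lerB_cabs 1 (h s); rewrite cabs1 cabs_distC; lra.
- by have := lerB_cabs (h s) 1; rewrite cabs1; lra.
Qed.

Lemma logabs_approx : 0 < cabs (Defs.Lfun σ chi) /\
 `|ln (cabs (Defs.Lfun σ chi)) - Re (Pw chi w σ)| <= 1.
Proof.
have [_ h1 h2] := h_bounds (lexx σ).
have h0 : 0 < cabs (h σ) by lra.
rewrite Lfun_h cabsM cabs_cexp; split; first by sign.
rewrite lnM /1/ expRK addrAC subrr add0r ler_norml.
have l2 : ln (2 : R) <= 1 by have := @expR_ge1Dx R (ln 2); rewrite lnK /1/; lra.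
apply/andP; split.
 have : ln (2^-1) <= ln (cabs (h σ)) by rewrite ler_ln /1/.
 by rewrite lnV /1/; lra.
by apply: le_trans l2; rewrite ler_ln /1/; lra.
Qed.

Lemma Pw_cont : continuous (fun t => Re (Pw chi w t)) /\ continuous (fun t => Im (Pw chi w t)).
Proof. exact: (cderiv_cont (fun x => cderiv_DP chi (@lamc R) w x)). Qed.
Lemma Pw_vanish e : 0 < e -> exists T : R, forall t, T <= t -> cabs (Pw chi w t) <= e.
Proof. by have [_ _ c1] := cl; apply: DP_vanish => //; rewrite /lamc vM1 mul0r. Qed.
(** The bound must hold for every branch g that [argL_gt] admits: g - P is a continuous logarithm of
    h, which stays in the right half-plane, so its imaginary part stays below pi/2 < 2. *)
Lemma arg_upper τ : argL_gt σ τ chi -> τ < Im (Pw chi w σ) + 2.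
Proof.
move=> [g [eg _ cg [_ lg] tg]].
have [_ cP] := Pw_cont.
have cD : {within `[σ, +oo[, continuous (fun s => Im (g s) - Im (Pw chi w s))}.
 by move=> x; apply: cvgB; [exact: cg|exact: (continuous_subspaceT cP)].
have lP : Im (Pw chi w x) @[x --> +oo%R] --> (0 : R).
 apply: cvg_pinf => e e0; have [T hT] := Pw_vanish e0; exists T => t Tt.
 by rewrite subr0; apply: le_trans (ler_Im_cabs _) (hT t Tt).
have lD : Im (g x) - Im (Pw chi w x) @[x --> +oo%R] --> (0 : R) by rewrite -[X in _ --> X](subrr 0); apply: cvgB.
have := small_angle cD lD _; rewrite ltr_norml => H.
have /andP[_ h2] : - (pi / 2) < Im (g σ) - Im (Pw chi w σ) < pi / 2.
 apply: H => s ss; have [h1 _ _] := h_bounds ss.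
 have hE : h s = cexp (g s - Pw chi w s) by rewrite cexpD eg.
 move: h1; rewrite hE /= ImD ImN.
 have := expR_gt0 (Re (g s - Pw chi w s)); set E := expR _ => E0 h1.
 by rewrite -(pmulr_rgt0 _ E0); lra.
by have := pihalf_lt2 R; lra.
Qed.

(** Precomposing with max(s, σ) extends functions from [σ, +oo) to the whole line, where continuity
    is an unrestricted statement. *)
Let mx s := Num.max s σ.
Let ccont (f : R -> R[i]) := continuous (fun t => Re (f t)) /\ continuous (fun t => Im (f t)).

Lemma mx_cont : continuous mx.
Proof. by move=> x; apply: (@continuous_max R R id (fun=> σ)); [exact: cvg_id|exact: cvg_cst]. Qed.
Lemma mx_ge s : σ <= mx s. Proof. by rewrite le_max lexx orbT. Qed.

Lemma ccont_mx (f f' : R -> R[i]) : (forall x, cderiv f x (f' x)) -> ccont (fun s => f (mx s)).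
Proof.
move=> hd; have [h1 h2] := cderiv_cont hd.
by split=> x; [apply: (continuous_comp (@mx_cont x) (h1 _))|apply: (continuous_comp (@mx_cont x) (h2 _))].
Qed.

Lemma ccontM f g : ccont f -> ccont g -> ccont (fun s => f s * g s).
Proof.
move=> [f1 f2] [g1 g2]; split=> x.
 have -> : (fun t => Re (f t * g t)) =
  (fun t => Re (f t) * Re (g t) - Im (f t) * Im (g t)).
  by apply/funext => t; rewrite ReM.
 by apply: cvgB; apply: cvgM; [exact: f1|exact: g1|exact: f2|exact: g2].
have -> : (fun t => Im (f t * g t)) =
 (fun t => Re (f t) * Im (g t) + Im (f t) * Re (g t)).
 by apply/funext => t; rewrite ImM.
by apply: cvgD; apply: cvgM; [exact: f1|exact: g2|exact: f2|exact: g1].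
Qed.

(** A uniform limit of Dirichlet polynomials. *)
Lemma Lfun_cont : ccont (fun s => Defs.Lfun (mx s) chi).
Proof.
have H e : 0 < e -> exists M, forall s, cabs (Defs.Lfun (mx s) chi - DP chi (fun=> 1) M (mx s)) <= e.
 move=> e0; have [M0 [_ hM]] := Lp_cvg s12 q0 npc e0.
 by exists M0 => s; rewrite -Lp_DP; apply: hM => //; exact: mx_ge.
have hd M := ccont_mx (fun x => cderiv_DP chi (fun=> 1) M x).
split; apply: unif_cont => e e0; have [M hM] := H e e0; have [h1 h2] := hd M.
- exists (fun s => Re (DP chi (fun=> 1) M (mx s))); split=> // s.
 by rewrite -ReN -ReD; apply: le_trans (ler_Re_cabs _) (hM s).
- exists (fun s => Im (DP chi (fun=> 1) M (mx s))); split=> // s.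
 by rewrite -ImN -ImD; apply: le_trans (ler_Im_cabs _) (hM s).
Qed.

Lemma h_cont : ccont (fun s => h (mx s)).
Proof.
apply: ccontM; first exact: Lfun_cont.
apply: (@ccont_mx (fun x => cexp (- Pw chi w x)) (fun x => - DP chi (fun n => - (ln n%:R * lamc R n)) w x * cexp (- Pw chi w x))).
move=> x; have := cderiv_cexp (cderivZ (-1) (cderiv_DP chi (@lamc R) w x)).
have -> : (fun t => cexp (-1 * DP chi (lamc R) w t)) = (fun x => cexp (- Pw chi w x)) by apply/funext => t; rewrite mulN1r.
by rewrite !mulN1r.
Qed.

Lemma h_lim e : 0 < e -> exists T : R, forall t, T <= t -> cabs (h (mx t) - 1) <= e.
Proof.
move=> e0; have [_ ch1 c1] := cl; set d := Num.min 1 (e / 32); have d0 : 0 < d by rewrite lt_min ltr01 divr_gt0.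
have d1 : d <= 1 by rewrite ge_min lexx.
have d2 : d <= e / 32 by rewrite ge_min lexx orbT.
have [M [M4 hM]] := Lp_cvg s12 q0 npc d0.
have [T1 h1] := @DP_vanish _ chi (fun n => 1 - (n == 1%N)%:R) M d c1 (subrr 1) d0.
have [T2 h2] := Pw_vanish d0.
exists (Num.max T1 T2) => t; rewrite ge_max => /andP[t1 t2].
have mt : t <= mx t by rewrite le_max lexx.
have {}h1 := h1 _ (le_trans t1 mt); have {}h2 := h2 _ (le_trans t2 mt).
rewrite DP_sub1 ?(leq_trans _ M4) // in h1.
have hL := hM M (mx t) (leqnn M) (mx_ge t); rewrite Lp_DP in hL.
set L := Defs.Lfun _ _ in hL; set Lp := DP _ _ _ _ in h1 hL; set P := Pw _ _ _ in h2.
have -> : h (mx t) - 1 = ((L - Lp) + (Lp - 1)) * cexp (- P) + (cexp (- P) - 1) by rewrite /h -/L -/P; ring.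
have h3 := cabs_expN_1 P.
have e4 : expR (cabs P) <= 4 by apply: le_trans (expR1_le4 R); rewrite ler_expR; lra.
have e5 := cabs_cexpN_le (lexx (cabs P)).
triD; rewrite cabsM.
have h6 : cabs (L - Lp + (Lp - 1)) <= d + d by triD; apply: lerD.
have h7 : cabs (L - Lp + (Lp - 1)) * cabs (cexp (- P)) <= (d + d) * 4 by apply: ler_pM; rewrite ?cabs_ge0 ?(le_trans e5).
have h8 : cabs P * expR (cabs P) <= d * 4 by apply: ler_pM; rewrite ?cabs_ge0.
by have := le_trans h3 h8; lra.
Qed.

(** Here a branch must be exhibited: P plus the principal logarithm of h. *)
Lemma arg_lower τ : τ + 2 < Im (Pw chi w σ) -> argL_gt σ τ chi.
Proof.
move=> ht; exists (fun s => Pw chi w (mx s) + clog (h (mx s))).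
have mE s : σ <= s -> mx s = s by move=> ss; rewrite /mx max_l.
have [h1 h2] := h_cont.
have [P1 P2] := ccont_mx (fun x => cderiv_DP chi (@lamc R) w x).
have Re0 x : 0 < Re (h (mx x)) by have [] := h_bounds (mx_ge x); lra.
have ab0 x : 0 < cabs (h (mx x)) by have [] := h_bounds (mx_ge x); lra.
have LP e : 0 < e -> exists T : R, forall t, T <= t -> cabs (Pw chi w (mx t)) <= e.
 move=> e0; have [T hT] := Pw_vanish e0; exists T => t Tt; apply: hT; apply: le_trans Tt _.
 by rewrite le_max lexx.
have habs : continuous (fun s => cabs (h (mx s))).
 move=> x; apply: (@continuous_comp _ _ _ (fun s => Re (h (mx s)) ^+ 2 + Im (h (mx s)) ^+ 2) Num.sqrt); last exact: sqrt_continuous.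
 by apply: cvgD; apply: cvgM; [exact: h1|exact: h1|exact: h2|exact: h2].
split.
- move=> s ss; rewrite mE // cexpD cexp_clog -?Lfun_h //.
 by have := Re0 s; rewrite mE.
- apply: continuous_subspaceT => x.
 have -> : (fun s => Re (Pw chi w (mx s) + clog (h (mx s)))) = (fun s => Re (Pw chi w (mx s)) + ln (cabs (h (mx s)))) by apply/funext => s; rewrite ReD.
 apply: cvgD; first exact: P1.
 exact: (continuous_comp (habs x) (continuous_ln (ab0 x))).
- apply: continuous_subspaceT => x.
 have -> : (fun s => Im (Pw chi w (mx s) + clog (h (mx s)))) = (fun s => Im (Pw chi w (mx s)) + atan (Im (h (mx s)) / Re (h (mx s)))).
  by apply/funext => s; rewrite ImD.
 apply: cvgD; first exact: P2.
 apply: (@continuous_comp _ _ _ (fun s => Im (h (mx s)) / Re (h (mx s))) atan); last exact: continuous_atan.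
 by apply: cvgM; [exact: h2|apply: cvgV; [rewrite gt_eqF|exact: h1]].
- have hr : Re (h (mx x)) @[x --> +oo%R] --> (1 : R).
  apply: cvg_pinf => e e0; have [T hT] := h_lim e0; exists T => t Tt.
  by apply: le_trans (hT t Tt); rewrite -[1]/(Re (1 : R[i])) -ReN -ReD ler_Re_cabs.
 have hi : Im (h (mx x)) @[x --> +oo%R] --> (0 : R).
  apply: cvg_pinf => e e0; have [T hT] := h_lim e0; exists T => t Tt.
  by apply: le_trans (hT t Tt); rewrite -[0]/(Im (1 : R[i])) -ImN -ImD ler_Im_cabs.
 have ha : cabs (h (mx x)) @[x --> +oo%R] --> (1 : R).
  apply: cvg_pinf => e e0; have [T hT] := h_lim e0; exists T => t Tt.
  apply: le_trans (hT t Tt); rewrite ler_norml -cabs1 lerB_cabs andbT lerNl opprB.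
  by rewrite cabs_distC lerB_cabs.
 split.
  have -> : (fun s => Re (Pw chi w (mx s) + clog (h (mx s)))) = (fun s => Re (Pw chi w (mx s)) + ln (cabs (h (mx s)))) by apply/funext => s; rewrite ReD.
  rewrite -[X in _ --> X](addr0 0) -{2}(ln1 R); apply: cvgD.
   apply: cvg_pinf => e e0; have [T hT] := LP e e0; exists T => t Tt.
   by rewrite subr0; apply: le_trans (ler_Re_cabs _) (hT t Tt).
  exact: (@cvg_comp _ _ _ (fun s => cabs (h (mx s))) (@ln R) _ _ _ ha (continuous_ln ltr01)).
 have -> : (fun s => Im (Pw chi w (mx s) + clog (h (mx s)))) = (fun s => Im (Pw chi w (mx s)) + atan (Im (h (mx s)) / Re (h (mx s)))).
  by apply/funext => s; rewrite ImD.
 rewrite -[X in _ --> X](addr0 0) -{2}(atan0 R) -{2}(mul0r (1 : R)^-1); apply: cvgD.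
  apply: cvg_pinf => e e0; have [T hT] := LP e e0; exists T => t Tt.
  by rewrite subr0; apply: le_trans (ler_Im_cabs _) (hT t Tt).
 have hc : Im (h (mx x)) / Re (h (mx x)) @[x --> +oo%R] --> (0 / 1 : R) by apply: cvgM => //; apply: cvgV => //; exact: oner_neq0.
 exact: (@cvg_comp _ _ _ (fun s => Im (h (mx s)) / Re (h (mx s))) (@atan R) _ _ _ hc (@continuous_atan R (0 / 1))).
- rewrite mE // ImD; have := atan_gtNpi2 (Im (h σ) / Re (h σ)); have := pihalf_lt2 R.
 by rewrite /clog /=; lra.
Qed.
End Character.
End ContinuousLog.

(** * Exponential moments by orthogonality *)

Section ExpMoment.
Variable R : realType.

Section Weights.
Variables (F : fieldType) (Y A : nat).
Implicit Types (x : nat -> F) (a : {ffun 'I_Y -> 'I_A}).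
(** One monomial in the product of the exponential series of the x i, each cut at degree A; a is its
    vector of exponents. *)
Definition wt x a : F := \prod_(i < Y) (x i ^+ a i / (a i)`!%:R).
Definition deg a : nat := (\sum_(i < Y) a i)%N.

Lemma prod_expsum x : \prod_(i < Y) \sum_(n < A) x i ^+ n / n`!%:R = \sum_a wt x a.
Proof. by rewrite (bigA_distr_bigA (fun (i : 'I_Y) (n : 'I_A) => x i ^+ n / n`!%:R)). Qed.
Lemma wtZ (c : F) x a : wt (fun i => c * x i) a = c ^+ deg a * wt x a.
Proof.
rewrite /wt /deg (big_morph _ (exprD c) (expr0 c)) -big_split /=.
by apply: eq_bigr => i _; rewrite exprMn mulrA.
Qed.
End Weights.

Lemma wt_ge0 Y A (x : nat -> R) (a : {ffun 'I_Y -> 'I_A}) : (forall i, 0 <= x i) -> 0 <= wt x a.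
Proof. by move=> x0; apply: prodr_ge0 => i _; rewrite divr_ge0 ?exprn_ge0. Qed.
Lemma realcV (x : R) : (x^-1)%:c = x%:c^-1 :> R[i].
Proof. by rewrite -[LHS]/(real_complex R x^-1) fmorphV. Qed.

(** exp(t z) minus its Taylor polynomial of degree below K. With recursion on K, the derivative of
    one remainder is z times the previous one, so the comparison with |z| in place of z follows by
    induction. *)
Fixpoint exprem (z : R[i]) K (t : R) : R[i] :=
 if K is K'.+1 then exprem z K' t - z ^+ K' * (K'`!%:R^-1 * t ^+ K')%:c else cexp (t%:c * z).

Lemma cderiv_exprem z K t : cderiv (exprem z K.+1) t (z * exprem z K t).
Proof.
elim: K => [|K IH].
 apply: cderivEq (cderivD (cderiv_cexp (cderiv_line z t)) (cderiv_cst (- (z ^+ 0 * (0`!%:R^-1 * t ^+ 0)%:c)) t)).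
 by rewrite addr0.
have h := cderivZ (- z ^+ K.+1) (cderiv_real (is_derive_monomial (K.+1`!%:R^-1) K t)).
have := cderivD IH h.
have -> : (fun x : R => exprem z K.+1 x + - z ^+ K.+1 * (K.+1`!%:R^-1 * x ^+ K.+1)%:c) = exprem z K.+2 by apply/funext => x; rewrite mulNr.
apply: cderivEq => /=; rewrite mulrBr mulNr; congr (_ - _).
have -> : K.+1`!%:R^-1 * K.+1%:R * t ^+ K = K`!%:R^-1 * t ^+ K :> R by rewrite factS natrM invfM (mulrAC K.+1%:R^-1) mulVf ?mul1r // pnatr_eq0.
by rewrite exprS mulrA.
Qed.

Lemma exprem_bound z K t : 0 <= t -> cabs (exprem z K t) <= Re (exprem (cabs z)%:c K t).
Proof.
set r := cabs z; have r0 : 0 <= r by sign.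
have e0 (x : R[i]) n : exprem x n.+1 0 = 0.
 elim: n => [|n IH]; first by rewrite /= mul0r cexp0 !expr0 fact0 invr1 !mulr1 subrr.
 by move: IH => /= ->; rewrite [0 ^+ n.+1]expr0n mulr0 mulr0 subrr.
elim: K t => [|K IH] t t0.
 rewrite /exprem cabs_cexp -realcM Re_realM /= cos0 mulr1 ler_expR ler_wpM2l //.
 exact: le_trans (ler_norm _) (ler_Re_cabs _).
have := @cabs_le_of_derive R (exprem z K.+1) (fun x => z * exprem z K x)
 (fun x => Re (exprem r%:c K.+1 x)) (fun x => r * Re (exprem r%:c K x)) 0 t t0.
rewrite !e0 !subr0; apply.
- by move=> x _; apply: cderiv_exprem.
- by move=> x _; have [] := cderiv_exprem r%:c K x; rewrite Re_realM.
- by move=> x /andP[x0 _]; rewrite cabsM ler_wpM2l // IH.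
Qed.

Lemma exp_taylor_c (z : R[i]) A :
 cabs (cexp z - \sum_(n < A) z ^+ n / n`!%:R) <= expR (cabs z) - \sum_(n < A) cabs z ^+ n / n`!%:R.
Proof.
have E (x : R[i]) : exprem x A 1 = cexp x - \sum_(n < A) x ^+ n / n`!%:R.
 elim: A => [|A IH]; first by rewrite big_ord0 subr0 /= mul1r.
 rewrite /= IH big_ord_recr /= opprD addrA; congr (_ - _ * _).
 by rewrite expr1n mulr1 realcV realc_nat.
have := @exprem_bound z A 1 ler01; rewrite !E ReD ReN Re_sum; congr (_ <= _ - _).
 by rewrite /= cos0 mulr1.
by apply: eq_bigr => n _; rewrite -realcX -realc_nat -realcV -realcM.
Qed.

Lemma cvg_prod_ord Y (s : nat -> nat -> R) (l : nat -> R) :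
 (forall i, s i A @[A --> \oo] --> l i)%classic ->
 ((\prod_(i < Y) s i A) @[A --> \oo] --> \prod_(i < Y) l i)%classic.
Proof.
move=> h; elim: Y => [|Y IH].
 have -> : (fun A => \prod_(i < 0) s i A) = (fun=> 1) by apply/funext => A; rewrite big_ord0.
 by rewrite big_ord0; exact: cvg_cst.
have -> : (fun A => \prod_(i < Y.+1) s i A) = (fun A => (\prod_(i < Y) s i A) * s Y A) by apply/funext => A; rewrite big_ord_recr.
by rewrite big_ord_recr; apply: cvgM.
Qed.

(** Majorants that also dominate the differences, as happens for power series with nonnegative
    coefficients, keep this property under products. *)
Lemma prod_diff Y (u v : nat -> R[i]) (U V : nat -> R) :
 (forall i, cabs (u i) <= U i) -> (forall i, cabs (v i) <= V i) -> (forall i, cabs (u i - v i) <= U i - V i) ->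
 cabs (\prod_(i < Y) u i - \prod_(i < Y) v i) <= \prod_(i < Y) U i - \prod_(i < Y) V i.
Proof.
move=> hu hv hd.
have cp n (f : nat -> R[i]) (F : nat -> R) : (forall i, cabs (f i) <= F i) -> cabs (\prod_(i < n) f i) <= \prod_(i < n) F i.
 move=> h; elim: n => [|n IH]; first by rewrite !big_ord0 cabs1.
 by rewrite !big_ord_recr cabsM ler_pM /1/.
elim: Y => [|Y IH]; first by rewrite !big_ord0 !subrr cabs0.
rewrite !big_ord_recr /=; set a := \prod_(i < Y) u i in IH *; set b := \prod_(i < Y) v i in IH *.
set a' := \prod_(i < Y) U i in IH *; set b' := \prod_(i < Y) V i in IH *.
have -> : a * u Y - b * v Y = a * (u Y - v Y) + (a - b) * v Y by ring.
have -> : a' * U Y - b' * V Y = a' * (U Y - V Y) + (a' - b') * V Y by ring.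
triD; rewrite !cabsM lerD /1/ ler_pM /1/.
exact: cp.
Qed.

Section Tail.
Variables (Y A M : nat) (x : nat -> R).
Hypothesis x0 : forall i, 0 <= x i.
Implicit Types (a : {ffun 'I_Y -> 'I_A}).

(* Rankin's trick. *)
Lemma wt_tail : \sum_(a : {ffun 'I_Y -> 'I_A} | (M <= deg a)%N) wt x a <=
 4 ^- M * expR (4 * \sum_(i < Y) x i).
Proof.
via (4 ^- M * \sum_(a : {ffun 'I_Y -> 'I_A}) wt (fun i => 4 * x i) a).
 rewrite big_mkcond mulr_sumr; apply: ler_sum => a _; have w0 := wt_ge0 a x0; rewrite wtZ.
 case: ifP => [Ma|_]; last by sign.
 rewrite ler_pdivlMl //; rewrite ler_wpM2r // ler_weXn2l //; lra.
rewrite ler_wpM2l /1/ -prod_expsum mulr_sumr expR_sum.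
apply: ler_prod => i _; rewrite exp_partial_le ?mulr_ge0 // andbT; apply: sumr_ge0 => n _.
by sign.
Qed.

(** e is the loss from cutting each factor at degree A, the other term the loss from total degree M
    on. *)
Lemma wt_exp_approx (z : nat -> R[i]) (e : R) : (forall i, cabs (z i) = x i) ->
 expR (\sum_(i < Y) x i) - \sum_(a : {ffun 'I_Y -> 'I_A}) wt x a <= e ->
 cabs (cexp (\sum_(i < Y) z i) - \sum_(a : {ffun 'I_Y -> 'I_A} | (deg a < M)%N) wt z a) <=
 e + 4 ^- M * expR (4 * \sum_(i < Y) x i).
Proof.
move=> hz he.
have -> : cexp (\sum_(i < Y) z i) - \sum_(a : {ffun 'I_Y -> 'I_A} | (deg a < M)%N) wt z a =
 (\prod_(i < Y) cexp (z i) - \prod_(i < Y) \sum_(n < A) z i ^+ n / n`!%:R) +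
 \sum_(a : {ffun 'I_Y -> 'I_A} | (M <= deg a)%N) wt z a.
 rewrite cexp_sum prod_expsum [X in _ - X + _](bigID (fun a => (deg a < M)%N)) /=.
 have -> : \sum_(a : {ffun 'I_Y -> 'I_A} | ~~ (deg a < M)%N) wt z a = \sum_(a : {ffun 'I_Y -> 'I_A} | (M <= deg a)%N) wt z a.
  by apply: eq_bigl => a; rewrite -leqNgt.
 by ring.
have wz (a : {ffun 'I_Y -> 'I_A}) : cabs (wt z a) = wt x a.
 rewrite /wt (big_morph _ (@cabsM R) (cabs1 R)); apply: eq_bigr => i _.
 by rewrite cabsM cabsX hz cabsV -realc_nat cabs_real ger0_norm.
triD; apply: lerD.
 apply: le_trans he; rewrite -prod_expsum expR_sum; apply: (@prod_diff Y (fun i => cexp (z i))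
  (fun i => \sum_(n < A) z i ^+ n / n`!%:R) (fun i => expR (x i)) (fun i => \sum_(n < A) x i ^+ n / n`!%:R)) => i.
 - by rewrite cabs_cexp ler_expR -hz; exact: le_trans (ler_norm _) (ler_Re_cabs _).
 - triS; apply: ler_sum => n _.
  by rewrite cabsM cabsX hz cabsV -realc_nat cabs_real ger0_norm.
 - by rewrite -hz; exact: exp_taylor_c.
apply: le_trans wt_tail; triS.
by apply: ler_sum => a _; rewrite wz.
Qed.
End Tail.

Section Orthogonality.
Variables (q Y A M : nat) (X : nat -> R).
Hypotheses (pq : prime q) (YMq : (Y ^ M <= q)%N) (Xp : forall i, ~~ prime i -> X i = 0).
Implicit Types (a b : {ffun 'I_Y -> 'I_A}).

Definition nprod a : nat := (\prod_(i < Y) i ^ a i)%N.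

Lemma wt_support a : wt X a != 0 -> forall i, (0 < a i)%N -> prime i.
Proof.
move=> /prodf_neq0 h i ai; apply: contraT => np; have := h i isT.
by rewrite Xp // expr0n gtn_eqF // mul0r eqxx.
Qed.

Lemma nprod_gt0 a : wt X a != 0 -> (0 < nprod a)%N.
Proof.
move=> h; apply: prodn_gt0 => i; rewrite expn_gt0; case: (posnP (a i)) => [_|ai]; first by rewrite orbT.
by rewrite prime_gt0 // (wt_support h).
Qed.

Lemma nprod_lt a : wt X a != 0 -> (deg a < M)%N -> (nprod a < q)%N.
Proof.
move=> h aM; have [Y1|Y1] := leqP Y 1.
 have -> : nprod a = 1%N.
  rewrite /nprod big1 // => i _; case: (posnP (a i)) => [->//|ai].
  have := prime_gt1 (wt_support h ai); have := leq_trans (ltn_ord i) Y1.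
  by case: (nat_of_ord i) => [|[]].
 exact: prime_gt1.
apply: leq_trans YMq; apply: leq_ltn_trans (_ : Y ^ deg a < _)%N; last by rewrite ltn_exp2l.
rewrite /nprod /deg (big_morph _ (expnD Y) (expn0 Y)); apply: leq_prod => i _.
case: (posnP (a i)) => [->//|ai]; rewrite leq_exp2r //; exact: ltnW.
Qed.

Lemma nprod_logn a (p : 'I_Y) : wt X a != 0 -> prime p -> logn p (nprod a) = a p.
Proof.
move=> h pp.
have H (r : seq 'I_Y) : (0 < \prod_(i <- r) i ^ a i)%N /\
  logn p (\prod_(i <- r) i ^ a i) = (\sum_(i <- r) a i * logn p i)%N.
 elim: r => [|i r [IH1 IH2]]; first by rewrite !big_nil logn1.
 have i0 : (0 < i ^ a i)%N.
  rewrite expn_gt0; case: (posnP (a i)) => [_|ai]; first by rewrite orbT.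
  by rewrite prime_gt0 // (wt_support h).
 by rewrite !big_cons muln_gt0 i0 IH1 lognM // lognX IH2.
have [_ ->] := H (index_enum _); rewrite (bigD1 p) //= logn_prime // eqxx muln1 big1 ?addn0 // => i ip.
case: (posnP (a i)) => [->//|ai]; rewrite logn_prime ?(wt_support h) //.
by rewrite eq_sym (negPf (_ : (i != p :> nat))) ?muln0.
Qed.

Lemma nprod_inj a b : wt X a != 0 -> wt X b != 0 -> nprod a = nprod b -> a = b.
Proof.
move=> ha hb ab; apply/ffunP => i; apply/val_inj => /=.
have [pp|np] := boolP (prime i); first by rewrite -(nprod_logn ha) // -(nprod_logn hb) // ab.
have z (c : {ffun 'I_Y -> 'I_A}) : wt X c != 0 -> c i = 0%N :> nat.
 by move=> hc; apply/eqP; rewrite -leqn0 leqNgt; apply: contra np; exact: (wt_support hc).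
by rewrite !z.
Qed.

Lemma wt_char chi a : charlike chi -> wt (fun i => (X i)%:c * chi i) a = (wt X a)%:c * chi (nprod a).
Proof.
move=> [cM c1 _].
have cX m n : chi (m ^ n)%N = chi m ^+ n by elim: n => [|n IH]; rewrite // expnS cM IH exprS.
rewrite /wt /nprod (big_morph chi cM c1) (big_morph _ (@realcM R) (erefl : (1 : R)%:c = 1)) -big_split /=.
by apply: eq_bigr => i _; rewrite exprMn cX realcM realcX realcV realc_nat; ring.
Qed.

(** Primes below Y and total degree below M keep the products under Y^M <= q; by unique
    factorization different exponent vectors give different residues, so only squares remain. *)
Lemma wt_mean_square (ch : nat -> nat -> R[i]) (om : R[i]) : char_family q ch -> cabs om = 1 ->
 \sum_(j < q.-1) cabs (\sum_(a : {ffun 'I_Y -> 'I_A} | (deg a < M)%N) wt (fun i => om * ((X i)%:c * ch j i)) a) ^+ 2 =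
 q.-1%:R * \sum_(a : {ffun 'I_Y -> 'I_A} | (deg a < M)%N) wt X a ^+ 2.
Proof.
move=> hc om1; have [_ _ _ _ [orth _]] := hc.
pose c a := om ^+ deg a * (wt X a)%:c.
have e (j : 'I_q.-1) a : wt (fun i => om * ((X i)%:c * ch j i)) a = c a * ch j (nprod a).
 by rewrite (@wtZ _ Y A om (fun i => (X i)%:c * ch j i)) wt_char ?mulrA //; exact: family_charlike hc _.
have cc a : c a * conjc (c a) = (wt X a ^+ 2)%:c by rewrite mulc_conjc /c cabsM cabsX om1 expr1n mul1r cabs_real real_normK ?num_real.
have c0 a : wt X a = 0 -> c a = 0 by rewrite /c => ->; rewrite mulr0.
suff : ((\sum_(j < q.-1) cabs (\sum_(a : {ffun 'I_Y -> 'I_A} | (deg a < M)%N) wt (fun i => om * ((X i)%:c * ch j i)) a) ^+ 2)%:C)%C =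
 (q.-1%:R * \sum_(a : {ffun 'I_Y -> 'I_A} | (deg a < M)%N) wt X a ^+ 2)%:c :> R[i] by case.
rewrite realc_sum.
transitivity (\sum_(a : {ffun 'I_Y -> 'I_A} | (deg a < M)%N) \sum_(b : {ffun 'I_Y -> 'I_A} | (deg b < M)%N)
  c a * conjc (c b) * \sum_(j < q.-1) ch j (nprod a) * conjc (ch j (nprod b))).
 under eq_bigr => j _ do rewrite -mulc_conjc conjc_sum mulr_suml.
 rewrite exchange_big /=; apply: eq_bigr => a _.
 under eq_bigr => j _ do rewrite mulr_sumr.
 rewrite exchange_big; apply: eq_bigr => b _; rewrite mulr_sumr; apply: eq_bigr => j _.
 by rewrite !e conjcM; ring.
rewrite realcM realc_sum realc_nat mulr_sumr; apply: eq_bigr => a aM.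
have [a0|a0] := eqVneq (wt X a) 0.
 by rewrite a0 expr0n mulr0 big1 // => b _; rewrite c0 // !mul0r.
have cop d : wt X d != 0 -> (deg d < M)%N -> coprime (nprod d) q.
 move=> h hM; rewrite coprime_sym prime_coprime //; apply/negP => /dvdn_leq.
 by rewrite nprod_gt0 // => /(_ isT); rewrite leqNgt nprod_lt.
rewrite (bigD1 a) //= [X in _ + X]big1 ?addr0.
 by rewrite orth !cop // eqxx muln1 cc mulrC.
move=> b /andP[bM ba]; have [b0|b0] := eqVneq (wt X b) 0.
 by rewrite (c0 b b0) -[conjc 0]/(conjc (0 : R[i])) (_ : conjc (0 : R[i]) = 0) ?mulr0 ?mul0r //; apply/eqP; rewrite eq_complex /= oppr0 !eqxx.
rewrite orth !modn_small ?nprod_lt // (_ : nprod a == nprod b = false) ?andbF ?muln0 ?mulr0 //.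
by apply/negP => /eqP /(nprod_inj a0 b0) ab; rewrite ab eqxx in ba.
Qed.
End Orthogonality.

(** exp(2 Re z) is |exp z|^2. Cutting exp z to total degree below M changes it by at most 1/4 for
    every character, since M exceeds 4 times the sum of the X i, and the cut sum has a diagonal mean
    square, nearly the product over i of the sums of (X^n/n!)^2, that is of I_0(2 X). As this
    product is at least 1, the additive error costs only constants. *)
Lemma exp_moment q (ch : nat -> nat -> R[i]) (X : nat -> R) (om : R[i]) Y M : prime q -> char_family q ch ->
 (Y ^ M <= q)%N -> (forall i, 0 <= X i) -> (forall i, ~~ (prime i && (i < Y)%N) -> X i = 0) -> cabs om = 1 ->
 4 * (\sum_(i < Y) X i) + 3 <= M%:R ->
 q.-1%:R / 16 * \prod_(i < Y) I0 (2 * X i) <=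
  \sum_(j < q.-1) expR (2 * Re (om * \sum_(i < Y) (X i)%:c * ch j i)) /\
 \sum_(j < q.-1) expR (2 * Re (om * \sum_(i < Y) (X i)%:c * ch j i)) <=
  q.-1%:R * (4 * \prod_(i < Y) I0 (2 * X i)).
Proof.
move=> pq hc YMq X0 XY om1 hM.
have Xp i : ~~ prime i -> X i = 0 by move=> np; apply: XY; rewrite (negPf np).
have S0 : 0 <= \sum_(i < Y) X i by sign.
have M3 : (1 < M)%N by rewrite -(ltr_nat R); lra.
set S := \sum_(i < Y) X i in hM *.
set P := \prod_(i < Y) I0 (2 * X i); have P1 : 1 <= P.
 by apply: (big_ind (fun t => 1 <= t)) => // [t u|i _]; [exact: mulr_ege1|exact: I0_ge1].
(* 4^-M exp(4 S) <= exp(4 S - M) <= exp(-3) <= 1/8. *)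
have dl : 4 ^- M * expR (4 * S) <= 8^-1 :> R.
 have m4 : expR M%:R <= 4 ^+ M :> R by rewrite -[M%:R]mulr1 expRM_natl lerXn2r /1/ expR1_le4.
 rewrite mulrC ler_pdivrMr //; apply: le_trans (ler_wpM2l _ m4); last by [].
 via (8^-1 * expR (4 * S + 3)); last by rewrite ler_wpM2l // ler_expR.
 rewrite expRD mulrCA ler_peMr /1/ ler_pdivlMl /1/ mulr1.
 exact: (pow2_le_exp R 3).
have [A [hA1 hA2]] : exists A, expR S - \sum_(a : {ffun 'I_Y -> 'I_A}) wt X a <= 8^-1 /\
 P - 4^-1 <= \sum_(a : {ffun 'I_Y -> 'I_A}) wt X a ^+ 2 <= P.
 have c1 : ((\prod_(i < Y) \sum_(n < A) X i ^+ n / n`!%:R) @[A --> \oo] --> \prod_(i < Y) expR (X i))%classic.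
  apply: (@cvg_prod_ord Y (fun i A => \sum_(n < A) X i ^+ n / n`!%:R) (fun i => expR (X i))) => i.
  have := is_cvg_series_exp_coeff (X i).
  have -> : (fun A => \sum_(n < A) X i ^+ n / n`!%:R) = series (exp_coeff (X i)) by apply/funext => A; rewrite /series /= big_mkord.
  by [].
 have c2 : ((\prod_(i < Y) I0p (2 * X i) A) @[A --> \oo] --> P)%classic.
  by apply: (@cvg_prod_ord Y (fun i A => I0p (2 * X i) A) (fun i => I0 (2 * X i))) => i; exact: I0p_cvg.
 have h8 : 0 < 8^-1 :> R by []; have h4 : 0 < 4^-1 :> R by [].
 move/cvgrPdist_le : c1 => /(_ _ h8) [A1 _ H1]; move/cvgrPdist_le : c2 => /(_ _ h4) [A2 _ H2].
 exists (maxn A1 A2); have := H1 (maxn A1 A2) (leq_maxl _ _); have := H2 (maxn A1 A2) (leq_maxr _ _).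
 move: (maxn _ _) => A {H1 H2} H2 H1; split.
  by rewrite -prod_expsum /S expR_sum; apply: le_trans H1; exact: ler_norm.
 have -> : \sum_(a : {ffun 'I_Y -> 'I_A}) wt X a ^+ 2 = \prod_(i < Y) I0p (2 * X i) A.
  rewrite (_ : \prod_(i < Y) I0p _ A = \prod_(i < Y) \sum_(n < A) (X i ^+ n / n`!%:R) ^+ 2).
   rewrite (bigA_distr_bigA (fun (i : 'I_Y) (n : 'I_A) => (X i ^+ n / n`!%:R) ^+ 2)).
   by apply: eq_bigr => a _; rewrite /wt prodrXl.
  apply: eq_bigr => i _; rewrite /I0p big_mkord; apply: eq_bigr => n _.
  have -> : 2 * X i / 2 = X i by field.
  by rewrite mulnC exprM [in RHS]exprMn exprVn.
 apply/andP; split; first by have := le_trans (ler_norm _) H2; clear; lra.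
 apply: ler_prod => i _; rewrite I0p_le andbT; apply: sumr_ge0 => n _; exact: I0_term_ge0.
pose D (j : 'I_q.-1) := \sum_(a : {ffun 'I_Y -> 'I_A} | (deg a < M)%N) wt (fun i => om * ((X i)%:c * ch j i)) a.
have T1 := @wt_mean_square q Y A M X pq YMq Xp ch om hc om1.
set T := \sum_(a : {ffun 'I_Y -> 'I_A} | _) _ in T1.
have /andP[TP1 TP2] : P - 4^-1 - 64^-1 <= T <= P.
 move: hA2; rewrite (bigID (fun a : {ffun 'I_Y -> 'I_A} => (deg a < M)%N)) /= -/T; set T' := \sum_(a | ~~ _) _.
 have T0 : 0 <= T' by sign.
 suff : T' <= 64^-1 by move=> h /andP[h1 h2]; apply/andP; split; lra.
 have h := le_trans (@wt_tail Y A M X X0) dl.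
 have T'E : T' = \sum_(a : {ffun 'I_Y -> 'I_A} | (M <= deg a)%N) wt X a ^+ 2 by apply: eq_bigl => a; rewrite -leqNgt.
 rewrite T'E; via (\sum_(a : {ffun 'I_Y -> 'I_A} | (M <= deg a)%N) 8^-1 * wt X a); last first.
  rewrite -mulr_sumr; apply: le_trans (ler_wpM2l _ h) _ => //; clear; lra.
 apply: ler_sum => a aM; have w0 := wt_ge0 a X0; rewrite expr2 ler_wpM2r //; apply: le_trans h.
 by rewrite (bigD1 a) //= lerDl; apply: sumr_ge0 => b _; exact: wt_ge0.
have key (j : 'I_q.-1) : exists E, [/\ 0 <= E, E <= 4^-1, E = cabs (cexp (om * \sum_(i < Y) (X i)%:c * ch j i) - D j) &
  expR (2 * Re (om * \sum_(i < Y) (X i)%:c * ch j i)) = cabs (cexp (om * \sum_(i < Y) (X i)%:c * ch j i)) ^+ 2].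
 exists (cabs (cexp (om * \sum_(i < Y) (X i)%:c * ch j i) - D j)); split=> //; first exact: cabs_ge0.
  have hz i : cabs (om * ((X i)%:c * ch j i)) = X i.
   rewrite !cabsM om1 mul1r cabs_real ger0_norm //.
   have [/andP[pi iY]|/XY ->] := boolP (prime i && (i < Y)%N); last by rewrite mul0r.
   have Y1 : (1 < Y)%N := leq_ltn_trans (prime_gt0 pi) iY.
   have [dch [_ h1] _ _ _] := hc; have [_ _ cnz] := dch j (ltn_ord j).
   rewrite h1 ?mulr1 // cnz coprime_sym prime_coprime // dvdn_prime2 // neq_ltn; apply/orP; right.
   apply: leq_trans YMq; apply: leq_trans iY _; by rewrite -[leqLHS]expn1 leq_exp2l ?(ltnW M3).
  rewrite mulr_sumr; step (wt_exp_approx M X0 hz hA1); have := dl; clear; lra.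
 by rewrite cabs_cexp -expRM_natl.
have D1 : \sum_(j < q.-1) cabs (D j) ^+ 2 = q.-1%:R * T by exact: T1.
have N0 : 0 <= q.-1%:R :> R by [].
have sq (x y e : R) : 0 <= x -> 0 <= y -> 0 <= e <= 4^-1 -> x <= y + e -> x ^+ 2 <= 2 * y ^+ 2 + 8^-1.
 by move=> h1 h2 /andP[h3 h4] h5; have := sqr_ge0 (y - e); nra.
have cst (c : R) : \sum_(j < q.-1) c = q.-1%:R * c by rewrite sumr_const card_ord mulr_natl.
split.
 have : q.-1%:R * T <= \sum_(j < q.-1) (2 * expR (2 * Re (om * \sum_(i < Y) (X i)%:c * ch j i)) + 8^-1).
  rewrite -D1; apply: ler_sum => j _; have [E [E0 E1 EE ->]] := key j.
  apply: (sq _ _ E); rewrite /1/.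
  by have := lerB_cabs (D j) (cexp (om * \sum_(i < Y) (X i)%:c * ch j i)); rewrite cabs_distC -EE; clear; lra.
 rewrite big_split /= -mulr_sumr cst; move: (\sum_(j < _) _) => Z hZ.
 have : q.-1%:R * (P - 4^-1 - 64^-1) <= q.-1%:R * T by rewrite ler_wpM2l.
 have : q.-1%:R <= q.-1%:R * P by rewrite ler_peMr.
 by clear -N0 hZ; lra.
via (\sum_(j < q.-1) (2 * cabs (D j) ^+ 2 + 8^-1)).
 apply: ler_sum => j _; have [E [E0 E1 EE ->]] := key j.
 apply: (sq _ _ E); rewrite /1/.
 by have := lerB_cabs (cexp (om * \sum_(i < Y) (X i)%:c * ch j i)) (D j); rewrite -EE; clear; lra.
rewrite big_split /= -mulr_sumr D1 cst.
have : q.-1%:R * T <= q.-1%:R * P by rewrite ler_wpM2l.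
have : q.-1%:R <= q.-1%:R * P by rewrite ler_peMr.
by clear -N0; lra.
Qed.
End ExpMoment.

(** * Large deviations of the short prime sum *)

Section LargeDeviation.
Variable (R : realType) (σ : R).
Hypothesis s12 : 2^-1 < σ < 1.

Lemma head_prime_sum : exists C : R, 0 < C /\ forall Y, (4 <= Y)%N ->
 \sum_(1 <= p < Y) (prime p)%:R * nexp p σ <= C * Y%:R `^ (1 - σ) / ln Y%:R.
Proof.
have /andP[s1 s2] := s12; have [C [C0 h]] := prime_sum_scaled s12.
have s3 : 0 < 1 - σ by lra.
exists (C + (1 - σ)^-1); split; first by sign.
move=> Y Y4; have L1 := ln_ge1_nat R Y4; have Y0 : 0 < (Y%:R : R) by rewrite ltr0n (leq_trans _ Y4).
set L := ln Y%:R in L1 *; have L0 : 0 < L by lra.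
have eL a : expR (a * L) = Y%:R `^ a by rewrite powR_expR.
(* The second factor is 1 for n <= Y and gives, beyond Y, the decay n^(-2σ) that [prime_sum_scaled]
   requires. *)
pose f n : R := Y%:R `^ σ * n%:R `^ (- σ) * Num.min 1 (Y%:R `^ σ * n%:R `^ (- σ)).
have p0 n : 0 <= Y%:R `^ σ * n%:R `^ (- σ) :> R by sign.
have m0 n : 0 <= Num.min 1 (Y%:R `^ σ * n%:R `^ (- σ)) :> R by sign.
have dec n : (0 < n)%N -> Y%:R `^ σ * n.+1%:R `^ (- σ) <= Y%:R `^ σ * n%:R `^ (- σ) :> R.
 move=> n0; rewrite ler_wpM2l /1/ !powR_expR /1/ ler_expR !mulNr lerN2 ler_wpM2l ?ler_ln /1/; clear -s1; lra.
have := h L Y f L1 _ _ _ _; have e1 : expR L = Y%:R by rewrite -[L]mul1r eL powRr1.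
rewrite !eL e1 (_ : Y%:R `^ (2 * σ) = Y%:R `^ σ * Y%:R `^ σ); last first.
 by rewrite -powRD /1/; congr (_ `^ _); ring.
move=> /(_ _ _ _ _) H.
have {}H : `|\sum_(1 <= n < Y.+1) (prime n)%:R * f n - L^-1 * \sum_(1 <= n < Y.+1) f n| <= C * Y%:R / (L * Num.sqrt L).
 apply: H => n n0.
 - by rewrite mulr_ge0.
 - rewrite ler_pM //; [exact: dec|]; rewrite le_min !ge_min lexx dec //= orbT //.
 - by rewrite ler_piMr // ge_min lexx.
 - have -> : n%:R `^ (- (2 * σ)) = n%:R `^ (- σ) * n%:R `^ (- σ) :> R.
   by rewrite -powRD ?pnatr_eq0 ?gtn_eqF ?implybT //; congr (_ `^ _); ring.
  by rewrite mulrACA ler_wpM2l // ge_min lexx orbT.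
have fle n : (0 < n < Y)%N -> f n = Y%:R `^ σ * nexp n σ.
 move=> /andP[n0 nY]; rewrite /f min_l ?mulr1 ?nexp_powR // /nexp powR_expR // -expRD -mulrBr; apply: le_trans (expR_ge1Dx _); rewrite lerDl mulr_ge0 //.
  by clear -s1; lra.
 by rewrite subr_ge0 ler_ln /1/ ler_nat ltnW.
have sf : \sum_(1 <= n < Y.+1) f n <= Y%:R / (1 - σ).
 via (Y%:R `^ σ * \sum_(1 <= n < Y.+1) n%:R `^ (- σ)).
  by rewrite mulr_sumr; apply: ler_sum => n _; rewrite ler_piMr // ge_min lexx.
 have sb : 0 < σ < 1 by rewrite s2 andbT; clear -s1; lra.
 apply: le_trans (ler_wpM2l (powR_ge0 _ _) (sum_powRN_head Y sb)) _; rewrite mulrA -powRD /1/.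
 by rewrite (_ : σ + (1 - σ) = 1) ?powRr1 /1/; ring.
have H2 : \sum_(1 <= n < Y.+1) (prime n)%:R * f n <= (C + (1 - σ)^-1) * Y%:R / L.
 have h1 : C * Y%:R / (L * Num.sqrt L) <= C * Y%:R / L.
  rewrite ler_wpM2l /1/ lef_pV2 /1/.
  by rewrite ler_peMr /1/ -[leLHS]sqrtr1 ler_wsqrtr.
 have h2 : L^-1 * \sum_(1 <= n < Y.+1) f n <= Y%:R / (1 - σ) / L by rewrite mulrC ler_wpM2r /1/.
 have := le_trans (ler_norm _) H; move: h1 h2; clear; lra.
have Ys : 0 < Y%:R `^ σ :> R by sign.
rewrite -(ler_pM2l Ys); via ((C + (1 - σ)^-1) * Y%:R / L); last first.
 rewrite powRB /1/ powRr1 /1/; apply: ler_of_eq.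
 by field; rewrite !gt_eqF.
apply: le_trans H2; rewrite [leRHS]big_nat_recr ?(leq_trans _ Y4) //= -[leLHS]addr0 lerD ?mulr_ge0 //.
rewrite mulr_sumr; apply: ler_sum_nat => n nY; rewrite fle //; clear; lra.
Qed.

(** The constant 8 of [ln_I0_shift] times a bound for the sum of p^(-2σ): it bounds the second
    differences of [MI]. *)
Definition c2 : R := 8 * (1 + (2 * σ - 1)^-1).

Lemma sum_sq Y : \sum_(1 <= p < Y) (prime p)%:R * (p%:R `^ (- σ)) ^+ 2 <= 1 + (2 * σ - 1)^-1.
Proof.
have /andP[s1 s2] := s12; have a0 : 0 < 2 * σ - 1 by lra.
have [Y1|Y1] := leqP Y 1; first by rewrite big_geq // addr_ge0 ?invr_ge0 ?(ltW a0).
rewrite big_ltn // mul0r add0r.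
have := @sum_powRN_tail R (2 * σ - 1) 1 Y.-1 a0 isT; rewrite powR1 mul1r => h.
rewrite big_add1; via (2 * σ - 1)^-1; last by rewrite lerDr.
apply: le_trans h; apply: ler_sum => n _; rewrite -[leRHS]mul1r ler_pM /1/; first by case: prime.
by rewrite -powR_mulrn /1/ -powRrM (_ : - σ * 2%:R = - (2 * σ - 1) - 1) /1/; ring.
Qed.

Lemma MI_ge0 N (k : R) : 0 <= MI σ N k.
Proof. by apply: sumr_ge0 => p _; rewrite mulr_ge0 ?ln_I0_ge0. Qed.
Lemma MI_0 N : MI σ N 0 = 0.
Proof.
rewrite /MI big1 // => p _; rewrite /unode mul0r; have := ln_I0_le_sqr (0 : R); have := ln_I0_ge0 (0 : R).
by rewrite expr0n mul0r => h1 h2; rewrite (@le_anti _ _ (ln (I0 0)) 0) ?h2 ?mulr0.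
Qed.

Lemma MI_le_sqr N (k : R) : MI σ N k <= c2 * k ^+ 2.
Proof.
via (k ^+ 2 / 4 * (1 + (2 * σ - 1)^-1)).
 apply: le_trans (ler_wpM2l _ (sum_sq N.+1)); last by sign.
 rewrite mulr_sumr; apply: ler_sum => p _; rewrite mulrCA ler_wpM2l //.
 by apply: le_trans (ln_I0_le_sqr _) _; rewrite /unode exprMn mulrAC.
have /andP[s1 s2] := s12; have a0 : 0 < (2 * σ - 1)^-1 by rewrite invr_gt0; lra.
by rewrite /c2; have := sqr_ge0 k; move: (k ^+ 2) (_^-1) a0; clear => x y; nra.
Qed.

Lemma MI_shift N (k : R) : MI σ N (k + 1) + MI σ N (k - 1) <= 2 * MI σ N k + c2.
Proof.
apply: le_trans (lerD (lexx _) (ler_wpM2l (ler0n _ 8) (sum_sq N.+1))); rewrite /MI -big_split !mulr_sumr -big_split /=.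
apply: ler_sum => p _; rewrite [8 * _]mulrCA [2 * _]mulrCA -!mulrDr ler_wpM2l // /unode mulrDl mulrBl mul1r.
exact: ln_I0_shift.
Qed.

(** Outside the window (τ, U] the tilt by k is dominated by the neighbouring tilts: by k - 1 below
    τ, by k + 1 above U. *)
Lemma tilt_pt (k : nat) (τ U x : R) : (0 < k)%N ->
 expR (k%:R * x) <= expR τ * expR (k.-1%:R * x) + expR (- U) * expR (k.+1%:R * x) + expR (k%:R * U) * ((τ < x)%R)%:R.
Proof.
move=> k0; rewrite -!expRD.
have p1 := expR_ge0 (τ + k.-1%:R * x); have p2 := expR_ge0 (- U + k.+1%:R * x); have p3 := expR_ge0 (k%:R * U).
have [t|t] := ltP τ x; rewrite ?mulr1 ?mulr0.
 have [u|u] := leP x U.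
  have : expR (k%:R * x) <= expR (k%:R * U) by rewrite ler_expR ler_wpM2l.
  by lra.
 have : expR (k%:R * x) <= expR (- U + k.+1%:R * x) by rewrite ler_expR -natr1; lra.
 by lra.
have : expR (k%:R * x) <= expR (τ + k.-1%:R * x) by rewrite ler_expR -{1}(prednK k0) -natr1; lra.
by lra.
Qed.

Lemma expRN8 : expR (- 8) <= 256^-1 :> R.
Proof. by rewrite expRN lef_pV2 /1/ (pow2_le_exp R 8). Qed.
Lemma tilt_sum (N x1 x2 x3 et eU m0 m1 m2 Z : R) : 0 <= et -> 0 <= eU -> 0 <= N -> N / 16 * m0 <= x1 ->
 x2 <= N * (4 * m1) -> x3 <= N * (4 * m2) -> x1 <= et * x2 + eU * x3 + Z ->
 et * m1 <= m0 / 256 -> eU * m2 <= m0 / 256 -> N / 32 * m0 <= Z.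
Proof.
move=> h1 h2 h3 h4 h5 h6 h7 h8 h9.
have a5 := ler_wpM2l h1 h5; have a6 := ler_wpM2l h2 h6; have a8 := ler_wpM2l h3 h8; have a9 := ler_wpM2l h3 h9.
clear -h4 h7 a5 a6 a8 a9; lra.
Qed.

(* The least k with f(k) - f(k-1) >= t: by minimality and the bound on second differences, the
  next increment exceeds t by at most 2c. *)
Lemma first_jump (f : nat -> R) (c t : R) (k0 : nat) : f 0%N = 0 -> (forall n, 0 <= f n) ->
 (forall n, f n.+2 + f n <= 2 * f n.+1 + c) -> f 1%N < t -> (0 < k0)%N -> k0%:R * t <= f k0 ->
 exists k, [/\ (0 < k <= k0)%N, t <= f k - f k.-1, t <= f k & f k.+1 - f k <= t + 2 * c].
Proof.
move=> f0 fp sh f1 k00 hM; pose P (k : nat) := (0 < k)%N && (t <= f k - f k.-1).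
have exP : exists k, P k && (k <= k0)%N.
 apply/not_existsP => H; move: hM; apply/negP; rewrite -ltNge.
 have tel (n : nat) : (0 < n <= k0)%N -> f n < n%:R * t.
  elim: n => // n IH /andP[_ nk]; have := H n.+1; rewrite /P nk /= andbT => /negP; rewrite -ltNge => h.
  case: (posnP n) => [n0|n0]; first by rewrite n0 mul1r.
  by have := IH; rewrite n0 (ltnW nk) => /(_ isT); rewrite -natr1; move: h; clear; lra.
 by apply: tel; rewrite k00 leqnn.
have exP' : exists k, P k by have [k /andP[h _]] := exP; exists k.
have [k /andP[kp hk1] kmin] := ex_minnP exP'.
have kk0 : (k <= k0)%N by have [m /andP[Pm mk]] := exP; apply: leq_trans (kmin m Pm) mk.
case: k kp hk1 kmin kk0 => [//|[|k]] _ /= hk1 kmin kk0; first by move: hk1 f1; rewrite f0; lra.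
exists k.+2; split=> //; first by have := fp k.+1; lra.
have hm : f k.+1 - f k < t by rewrite ltNge; apply/negP => h; have /kmin : P k.+1 by []; rewrite ltnn.
by have := sh k; have := sh k.+1; lra.
Qed.

Section Chernoff.
Variables (q : nat) (ch : nat -> nat -> R[i]) (om : R[i]) (Y M : nat).
Hypotheses (pq : prime q) (hc : char_family q ch) (om1 : cabs om = 1) (Y1 : (1 < Y)%N) (YM : (Y ^ M <= q)%N).

Definition Sj (j : nat) := Re (om * PB (ch j) 1 Y σ).
Let hs := \sum_(1 <= p < Y) (prime p)%:R * nexp p σ.
Let MM := MI σ Y.-1.

Lemma moment k : 0 <= k -> 2 * k * hs + 3 <= M%:R ->
 q.-1%:R / 16 * expR (MM k) <= \sum_(j < q.-1) expR (k * Sj j) /\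
 \sum_(j < q.-1) expR (k * Sj j) <= q.-1%:R * (4 * expR (MM k)).
Proof.
move=> k0 hk; pose X i : R := ((prime i && (i < Y)%N))%:R * (k / 2 * nexp i σ).
have X0 i : 0 <= X i by rewrite !mulr_ge0 ?nexp_ge0.
have X00 : X 0%N = 0 by rewrite /X mul0r.
have Y0 : (0 < Y)%N by apply: ltnW.
have sX : 2 * \sum_(i < Y) X i = k * hs.
 rewrite -(big_mkord xpredT X) big_ltn // X00 add0r mulr_sumr /hs mulr_sumr; apply: eq_big_nat => i /andP[_ iY].
 by rewrite /X iY andbT; field.
have XY i : ~~ (prime i && (i < Y)%N) -> X i = 0 by rewrite /X => /negPf ->; rewrite mul0r.
have h : 4 * (\sum_(i < Y) X i) + 3 <= M%:R by lra.
have := @exp_moment R q ch X om Y M pq hc YM X0 XY om1 h.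
have -> : \prod_(i < Y) I0 (2 * X i) = expR (MM k).
 rewrite /MM /MI prednK // expR_sum -(big_mkord xpredT (fun i => I0 (2 * X i))) big_ltn // X00 mulr0.
 have I00 : I0 0 = 1 :> R.
  apply/le_anti; rewrite I0_ge1 andbT; apply: le_trans (I0_le_expsqr _) _.
  by rewrite expr0n mul0r expR0.
 rewrite I00 mul1r; apply: eq_big_nat => i /andP[i1 iY]; rewrite /X iY andbT /unode nexp_powR //.
 case: (prime i); last by rewrite !mul0r mulr0 I00 expR0.
 by rewrite !mul1r lnK ?posrE ?I0_gt0 //; congr I0; field.
have e (j : 'I_q.-1) : 2 * Re (om * \sum_(i < Y) (X i)%:c * ch j i) = k * Sj j.
 rewrite /Sj PBE // -(big_mkord xpredT (fun i => (X i)%:c * ch j i)) big_ltn // X00 mul0r add0r.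
 rewrite -!Re_realM; congr Re; rewrite !mulrA ![_ * om]mulrC -!mulrA; congr (om * _).
 rewrite !mulr_sumr; apply: eq_big_nat => i /andP[_ iY]; rewrite /X iY andbT [LHS]mulrA -realcM [RHS]mulrCA -realcM [LHS]mulrC.
 by congr (_ * _%:c); field.
by under eq_bigr => j _ do rewrite e.
Qed.

Lemma chernoff_upper k τ : 0 <= k -> 2 * k * hs + 3 <= M%:R ->
 \sum_(j < q.-1) ((τ < Sj j)%R)%:R <= q.-1%:R * (4 * expR (MM k - k * τ)).
Proof.
move=> k0 hk; have [_ h] := moment k0 hk.
rewrite expRB !mulrA ler_pdivlMr /1/ -mulrA; apply: le_trans h; rewrite mulr_suml; apply: ler_sum => j _.
case: ltP => t; rewrite ?mul1r ?mul0r /1/ ler_expR ler_wpM2l /1/; exact: ltW.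
Qed.

(** The margins 8 make each neighbouring tilt cost at most a factor exp(-8) <= 1/256. With the
    constants 1/16 and 4 of [moment], 1/16 - 4/256 - 4/256 = 1/32 is left for the window. *)
Lemma chernoff_lower (k : nat) τ U : (0 < k)%N -> 2 * k.+1%:R * hs + 3 <= M%:R ->
 τ + 8 <= MM k%:R - MM k.-1%:R -> MM k.+1%:R - MM k%:R + 8 <= U ->
 q.-1%:R / 32 * expR (MM k%:R - k%:R * U) <= \sum_(j < q.-1) ((τ < Sj j)%R)%:R.
Proof.
move=> k0 hk h1 h2; set Z := \sum_(j < q.-1) _.
have hs0 : 0 <= hs by apply: sumr_ge0 => p _; rewrite mulr_ge0 ?nexp_ge0.
have cond m : (m <= k.+1)%N -> 2 * m%:R * hs + 3 <= M%:R by move=> mk; apply: le_trans hk; rewrite lerD2r ler_wpM2r // ler_wpM2l // ler_nat.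
have [a1 _] := moment (ler0n R k) (cond _ (leqnSn k)).
have [_ a2] := moment (ler0n R k.-1) (cond k.-1 (leq_trans (leq_pred k) (leqnSn k))).
have [_ a3] := moment (ler0n R k.+1) (cond _ (leqnn _)).
have pt : \sum_(j < q.-1) expR (k%:R * Sj j) <= expR τ * \sum_(j < q.-1) expR (k.-1%:R * Sj j) +
  expR (- U) * \sum_(j < q.-1) expR (k.+1%:R * Sj j) + expR (k%:R * U) * Z.
 by rewrite !mulr_sumr -!big_split; apply: ler_sum => j _; exact: tilt_pt.
have b2 : expR τ * expR (MM k.-1%:R) <= expR (MM k%:R) / 256.
 rewrite -expRD; via (expR (MM k%:R) * expR (- 8)); last by rewrite ler_wpM2l ?expRN8.
 by rewrite -expRD ler_expR lerBrDr addrAC -lerBrDr.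
have b3 : expR (- U) * expR (MM k.+1%:R) <= expR (MM k%:R) / 256.
 rewrite -expRD; via (expR (MM k%:R) * expR (- 8)); last by rewrite ler_wpM2l ?expRN8.
 by rewrite -expRD ler_expR lerBrDr -addrA addrC lerBlDl -lerBlDr addrAC.
rewrite expRB mulrA ler_pdivrMr /1/ [leRHS]mulrC.
exact: (tilt_sum (expR_ge0 τ) (expR_ge0 (- U)) (ler0n R q.-1) a1 a2 a3 pt b2 b3).
Qed.

(** The window ends at τ + 16 + 2 c2: the overshoot 2 c2 of [first_jump] and the two margins 8. *)
Lemma ld_lower (k0 : nat) τ : MM 1 < τ + 8 -> 2 * k0.+1%:R * hs + 3 <= M%:R -> (0 < k0)%N ->
 k0%:R * (τ + 8) <= MM k0%:R -> exists k : nat, [/\ (0 < k <= k0)%N, τ <= MM k%:R &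
 q.-1%:R / 32 * expR (MM k%:R - k%:R * (τ + (16 + 2 * c2))) <= \sum_(j < q.-1) ((τ < Sj j)%R)%:R].
Proof.
move=> M1 hk k00 hM; have M0 : MM 0 = 0 by apply: MI_0.
have sh (n : nat) : MM n.+2%:R + MM n%:R <= 2 * MM n.+1%:R + c2.
 have := MI_shift Y.-1 n.+1%:R; rewrite natr1 (_ : n.+1%:R - 1 = n%:R) //; by rewrite -natr1 addrK.
have [k [kk h1 h2 h3]] := @first_jump (fun n => MM n%:R) c2 (τ + 8) k0 M0 (fun n => MI_ge0 _ _) sh M1 k00 hM.
have /andP[kp kk0] := kk.
have hs0 : 0 <= hs by apply: sumr_ge0 => p _; rewrite mulr_ge0 ?nexp_ge0.
exists k; split=> //; first by apply: le_trans h2; rewrite lerDl.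
apply: (chernoff_lower kp _ h1).
 by apply: le_trans hk; rewrite lerD2r ler_wpM2r // ler_wpM2l // ler_nat.
step (lerD h3 (lexx 8)); apply: ler_of_eq; ring.
Qed.
End Chernoff.
End LargeDeviation.

(** * Notation for the saddle point *)

Section Definitions.
Variables (R : realType) (σ : R).
(** Locked, so that it stays an atom until [bexpE] is applied. *)
Definition bexp := locked (σ / (1 - σ)).
Lemma bexpE : bexp = σ / (1 - σ). Proof. by rewrite /bexp -lock. Qed.
(** Solving for the k where the derivative of G1 k^(1/σ)/log k is τ gives k about [kap] times [Wt],
    as log k is about b log τ; [lf] is then the order of the exponent. *)
Definition Wt (τ : R) := (τ * ln τ) `^ bexp.
Definition lf τ := τ * Wt τ.
Definition kap := (σ * bexp / G1 σ) `^ bexp.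
Definition eta T (τ : R) := (Num.sqrt (ln τ))^-1 + r_err σ T τ.
(** T stands for log q, and N is floor(T) - 1 in the application; the factor 4 absorbs the
    rounding. *)
Definition regime T τ (N : nat) :=
 [/\ 1 <= ln τ, ln τ <= ln T, 1 < T, r_err σ T τ <= 1 & T <= 4 * N%:R].
End Definitions.

(** * The Legendre transform of M *)

Section Asymptotics.
Variable (R : realType) (σ : R).
Hypothesis s12 : 2^-1 < σ < 1.
Implicit Types (τ T L k : R) (N : nat).
Local Notation b := (bexp σ).
Local Notation G := (G1 σ).
Local Notation Wt := (Wt σ).
Local Notation lf := (lf σ).
Local Notation kap := (kap σ).
Local Notation eta := (eta σ).
Local Notation regime := (regime σ).

Lemma sfacts : [/\ 0 < σ, 0 < 1 - σ, 1 <= b, 0 < G & σ^-1 = 1 + b^-1].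
Proof.
have /andP[s1 s2] := s12; have s0 : 0 < σ by lra.
have s3 : 0 < 1 - σ by lra.
split=> //; [by rewrite bexpE ler_pdivlMr; lra|exact: G1_gt0|by rewrite bexpE; field; rewrite !gt_eqF].
Qed.

Lemma b_gt0 : 0 < b. Proof. by have [_ _ h _ _] := sfacts; apply: lt_le_trans h. Qed.

Lemma kap_gt0 : 0 < kap.
Proof. by have [s0 _ _ G0 _] := sfacts; rewrite powR_gt0 // divr_gt0 // mulr_gt0 // b_gt0. Qed.
Lemma powR_sV (x : R) : 0 < x -> x `^ σ^-1 = x * x `^ b^-1.
Proof. by have [_ _ _ _ sV] := sfacts; move=> x0; rewrite sV powRD /1/ powRr1 /1/ ltW. Qed.
Lemma powR_bV (x : R) : 0 <= x -> (x `^ b) `^ b^-1 = x.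
Proof. by move=> x0; rewrite -powRrM divff ?gt_eqF ?b_gt0 // powRr1. Qed.
(** The stationarity equation: at k = kap Wt it makes the main term of M(k) equal to σ k τ. *)
Lemma kapE : G * kap `^ σ^-1 = kap * (σ * b).
Proof.
have [s0 _ _ G0 _] := sfacts; have b0 := b_gt0.
by rewrite powR_sV ?kap_gt0 /1/ powR_bV /1/ mulrCA [G * _]mulrC divfK /1/ gt_eqF.
Qed.

Lemma Wt_gt0 τ : 0 < τ -> 0 < ln τ -> 0 < Wt τ.
Proof. by move=> t0 L0; rewrite powR_gt0 // mulr_gt0. Qed.
Lemma Wt_sV τ : 0 < τ -> 0 < ln τ -> Wt τ `^ σ^-1 = ln τ * lf τ.
Proof.
move=> t0 L0; rewrite powR_sV ?Wt_gt0 // powR_bV; last by sign.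
by rewrite /lf; ring.
Qed.

(** Cutting the model at T costs a fraction (X/T)^(2σ - 1) of M, where X, the scale of the dominant
    primes, is at most of order (τ log T)^(1/(1-σ)) near the saddle point. This is one source of r,
    here even squared. *)
Lemma r_err_sq T τ : 0 < τ -> 1 < T -> ((τ * ln T) `^ (1 - σ)^-1 / T) `^ (2 * σ - 1) = r_err σ T τ ^+ 2.
Proof.
have [s0 s3 _ _ _] := sfacts; move=> t0 T1; have T0 : 0 < T by apply: lt_trans T1.
have l0 : 0 < ln T by sign.
rewrite /r_err -powR_mulrn /1/ -powRrM; set x := τ / _.
have -> : (τ * ln T) `^ (1 - σ)^-1 / T = x `^ (1 - σ)^-1.
 have -> : x = τ * ln T / T `^ (1 - σ) by rewrite /x invf_div mulrA.
 rewrite [in RHS]powRM /1/; congr (_ * _).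
 by rewrite -powRN -powRrM mulNr divff /1/ powRN powRr1 /1/ ltW.
by rewrite -powRrM; congr (_ `^ _); field; rewrite gt_eqF.
Qed.

Lemma invsqrt_le (x y : R) : 0 < x -> x <= 4 * y -> (Num.sqrt y)^-1 <= 2 * (Num.sqrt x)^-1.
Proof.
move=> x0 h; have y0 : 0 < y by lra.
rewrite -[2]invrK -invfM lef_pV2 /1/.
have -> : 2^-1 = Num.sqrt (4^-1) :> R by rewrite (_ : (4 : R)^-1 = 2^-1 ^+ 2) ?sqrtr_sqr ?ger0_norm // expr2 -invfM -natrM.
by rewrite -sqrtrM // ler_wsqrtr // ler_pdivrMl.
Qed.

Lemma MI_rel K : 0 < K -> exists C : R, 0 < C /\ forall τ T N k, regime T τ N -> 0 < τ ->
 expR 1 <= k -> k <= K * Wt τ -> ln τ <= 4 * ln k ->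
 `|MI σ N k - G * k `^ σ^-1 / ln k| <= C * eta T τ * (k `^ σ^-1 / ln k).
Proof.
have [s0 s3 _ G0 _] := sfacts; have b0 := b_gt0; have /andP[s1 _] := s12.
move=> K0; have [C [C0 h]] := MI_asymp s12; set c := (4 * K `^ σ^-1) `^ (2 * σ - 1).
exists (C * (2 + c)); split; first by sign.
move=> τ T N k [L1 LT T1 r1 TN] t0 k1 kW Lk.
have T0 : 0 < T by apply: lt_trans T1.
have N0 : 0 < (N%:R : R) by clear -T0 TN; lra.
have L0 : 0 < ln τ by sign.
have k0 : 0 < k by apply: lt_le_trans k1; exact: expR_gt0.
have lk : 1 <= ln k by rewrite -(expRK 1) ler_ln /1/.
have W0 := Wt_gt0 t0 L0.
set r := r_err _ _ _ in r1; have r0 : 0 <= r by apply: powR_ge0.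
have := h k N k1; rewrite -(ltr0n R) N0 => /(_ isT) /=; set X := k `^ σ^-1 => hh; have X0 : 0 <= X by sign.
apply: le_trans hh _; rewrite mulrC [leRHS](_ : _ = (2 + c) * eta T τ * (C * X / ln k)); last by ring.
rewrite ler_wpM2r //; first by sign.
have a1 := invsqrt_le L0 Lk.
have a2 : (X / N%:R) `^ (2 * σ - 1) <= c * r.
 via (c * r ^+ 2); last by rewrite ler_wpM2l /1/ expr2 ler_piMr.
 rewrite /r -r_err_sq /1/ -powRM /1/; apply: ge0_ler_powR.
 - by clear -s1; lra.
 - by sign.
 - by sign.
 have h1 : X <= K `^ σ^-1 * (τ * ln T) `^ (1 - σ)^-1.
  via ((K * Wt τ) `^ σ^-1).
   by rewrite ge0_ler_powR /1/.
  rewrite (powRM _ (ltW K0) (ltW W0)) ler_wpM2l /1/ -powRrM.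
  rewrite (_ : b / σ = (1 - σ)^-1); last by rewrite bexpE; field; rewrite !gt_eqF.
  rewrite ge0_ler_powR ?nnegrE ?invr_ge0 ?mulr_ge0 ?(ltW s3) /1/; first exact: le_trans (ltW L0) LT.
  by rewrite ler_wpM2l // ltW.
 rewrite ler_pdivrMr //; apply: le_trans h1 _; set q1 := K `^ _; set q2 := (τ * _) `^ _.
 have -> : 4 * q1 * (q2 / T) * N%:R = q1 * q2 * (4 * N%:R / T) by ring.
 by rewrite ler_peMr ?mulr_ge0 ?powR_ge0 // ler_pdivlMr // mul1r.
have c0 : 0 <= c by sign.
rewrite -/r mulrDr; apply: lerD; [step a1|step a2]; rewrite ler_wpM2r ?lerDl ?lerDr //.
Qed.

Lemma ln_le_sqrt (x : R) : 1 <= x -> 0 <= ln x <= 2 * Num.sqrt x.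
Proof.
move=> x1; have x0 : 0 < x by lra.
rewrite ln_ge0 //=; have := @expR_ge1Dx R (ln (Num.sqrt x)); rewrite lnK /1/.
by rewrite -{3}(sqr_sqrtr (ltW x0)) expr2 lnM /1/; lra.
Qed.

(** The difference is log K + b log log τ; a square root of log τ is all that the claimed precision
    asks for. *)
Lemma ln_Wt K : 0 < K -> exists c : R, 0 < c /\ forall τ, 0 < τ -> 1 <= ln τ ->
 `|ln (K * Wt τ) - b * ln τ| <= c * Num.sqrt (ln τ).
Proof.
have b0 := b_gt0; move=> K0; exists (`|ln K| + 2 * b); split; first by sign.
move=> τ t0 L1; have L0 : 0 < ln τ by lra.
rewrite lnM ?posrE ?powR_gt0 /1/ ln_powR lnM /1/.
have /andP[h1 h2] := ln_le_sqrt L1.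
have h3 : 1 <= Num.sqrt (ln τ) by rewrite -[leLHS]sqrtr1 ler_wsqrtr.
rewrite (_ : _ - _ = ln K + b * ln (ln τ)); last by ring.
triD; rewrite (ger0_norm (mulr_ge0 (ltW b0) h1)) mulrDl lerD //; first by rewrite ler_peMr.
by have := ler_wpM2l (ltW b0) h2; lra.
Qed.

Lemma exp_pow_le (x e : R) : 0 <= x -> 0 <= e <= 2 -> (1 + x * e) `^ b <= 1 + b * x * expR (b * x * 2) * e.
Proof.
have b0 := b_gt0; move=> x0 /andP[e0 e2]; have xe : 0 <= x * e by sign.
rewrite powR_expR; last by rewrite ltr_pwDl.
set u := b * x * e; have u0 : 0 <= u by sign.
via (expR u).
 by rewrite ler_expR /u -mulrA ler_wpM2l /1/; apply: le_ln1Dx; rewrite (lt_le_trans _ xe) /1/ ltrN10.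
have h : expR u <= 1 + u * expR u.
 have : (1 - u) * expR u <= expR (- u) * expR u by rewrite ler_wpM2r /1/ expR_ge1Dx.
 by rewrite -expRD addNr expR0; clear; move: (expR u) => E; lra.
by step h; rewrite lerD2l [leRHS]mulrAC ler_wpM2l /1/ ler_expR /u ler_wpM2l /1/ mulr_ge0.
Qed.

Lemma alg_up (MI0 C e ks kp s bb bi d si l x : R) : 0 <= C -> 0 <= ks -> 0 <= kp * s -> 0 <= bi -> 0 <= d -> 0 <= l ->
 bb * bi = 1 -> si <= 1 -> si <= e -> 0 <= e -> 0 <= bb -> x <= bi * (1 + d * si) ->
 MI0 <= (C * e * ks + kp * (s * bb)) * l * x ->
 MI0 - kp * l <= - ((1 - s) * kp * l) + (kp * s * d + C * ks * bi * (1 + d)) * e * l.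
Proof.
move=> C0 ks0 kp0 bi0 d0 l0 bbi si1 sie e0 b0 hx hM.
have P0 : 0 <= (C * e * ks + kp * (s * bb)) * l by rewrite mulr_ge0 /1/ addr_ge0 ?[kp * _]mulrA /1/ !mulr_ge0.
have h1 := le_trans hM (ler_wpM2l P0 hx).
have E : (C * e * ks + kp * (s * bb)) * l * (bi * (1 + d * si)) =
 (C * e * ks * bi * (1 + d * si)) * l + (kp * s * (1 + d * si)) * l * (bb * bi) by ring.
rewrite E bbi mulr1 in h1.
have h2 : C * e * ks * bi * (1 + d * si) * l <= C * e * ks * bi * (1 + d) * l by rewrite ler_wpM2r /1/ ler_wpM2l /1/ lerD2l ler_piMr.
have h3 : kp * s * (1 + d * si) * l <= kp * s * (1 + d * e) * l by rewrite ler_wpM2r // ler_wpM2l // lerD2l ler_wpM2l.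
clear -h1 h2 h3; lra.
Qed.

(** At the saddle point the two terms on the left are σ k τ and k τ in first order, hence the factor
    1 - σ. *)
Lemma core_upper : exists C L0 : R, 0 < C /\ forall τ T N, regime T τ N -> 0 < τ -> L0 <= ln τ ->
 MI σ N (kap * Wt τ) - kap * Wt τ * τ <= - ((1 - σ) * kap * lf τ) + C * eta T τ * lf τ.
Proof.
have [s0 s3 b1 G0 _] := sfacts; have b0 := b_gt0.
have [C [C0 hC]] := MI_rel kap_gt0; have [c [c0 hc]] := ln_Wt kap_gt0.
have k0 := kap_gt0; set ks := kap `^ σ^-1; have ks0 : 0 < ks by sign.
set d := 2 * c / b; have d0 : 0 < d by sign.
exists (kap * σ * d + C * ks / b * (1 + d)), (Num.max 2 (d ^+ 2)).
split; first by sign.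
move=> τ T N reg t0; rewrite ge_max => /andP[L2 hL2]; have [L1 LT T1 r1 TN] := reg.
set L := ln τ in L1 L2 hL2 *; set s := Num.sqrt L; have L0 : 0 < L by sign.
have sp : 0 < s by sign.
have ss : s ^+ 2 = L by rewrite sqr_sqrtr // ltW.
have sc : d <= s by rewrite -(@ler_pXn2r _ 2) /1/ ss.
have W0 : 0 < Wt τ by apply: Wt_gt0.
have := hc τ t0 L1; rewrite -/L -/s ler_norml => /andP[lk _]; set k := kap * Wt τ in lk *.
have db : d * b = 2 * c by rewrite /d divfK // gt_eqF.
have lkL : b * L / 2 <= ln k.
 have dbs : d * b * s = 2 * c * s by rewrite db.
 have := ler_wpM2l (ltW (mulr_gt0 b0 sp)) sc => h.
 have : c * s <= b * L / 2 by rewrite -ss; clear -h dbs; lra.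
 by clear -lk; lra.
have L4 : L <= 2 * ln k by clear -lkL b1 L0; nra.
have e1 : 1 <= ln k by clear -L4 L2; lra.
have kE : expR 1 <= k by rewrite -[leRHS]lnK /1/ ler_expR.
have L4' : L <= 4 * ln k by clear -L4 e1; lra.
have := hC τ T N k reg t0 kE (lexx _) L4'; set e := eta T τ.
have r0 : 0 <= r_err σ T τ by apply: powR_ge0.
have si : s^-1 <= e by rewrite /e /eta lerDl.
have s1' : s^-1 <= 1 by rewrite invf_le1 // -[leLHS]sqrtr1 ler_wsqrtr.
have XE : k `^ σ^-1 = ks * (L * lf τ) by rewrite (powRM _ (ltW k0) (ltW W0)) Wt_sV.
have l0 : 0 < lf τ by rewrite mulr_gt0.
rewrite ler_norml XE => /andP[_]; rewrite lerBlDr => hM.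
have si0 : 0 < s^-1 by sign.
have Lk : L / ln k <= b^-1 * (1 + d * s^-1).
 rewrite ler_pdivrMr; last by sign.
 rewrite -(ler_pM2l b0) !mulrA divff /1/ mul1r.
 via ((1 + d * s^-1) * (b * L - c * s)); last first.
  have q0 : 0 <= 1 + d * s^-1 by sign.
  by apply: ler_wpM2l q0 _ _ _; clear -lk; lra.
 have : s^-1 * s = 1 by rewrite mulVf // gt_eqF.
 rewrite -ss; clear -db c0 sc sp b0 si0; move: s^-1 si0 => z z0 zs.
 have -> : (1 + d * z) * (b * s ^+ 2 - c * s) = b * s ^+ 2 - c * s + d * b * (z * s) * s - d * c * (z * s) by ring.
 rewrite zs db; nra.
have -> : kap * Wt τ * τ = kap * lf τ by rewrite /lf; ring.
apply: (@alg_up _ C e ks kap σ b b^-1 d s^-1 (lf τ) (L / ln k)); rewrite ?divff /1/.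
 exact: le_trans (ltW si0) si.
step hM; rewrite -kapE -/ks; apply: ler_of_eq; ring.
Qed.

(** Young's inequality with exponents 1/σ and 1/(1-σ), after scaling by u. It holds for every k, as
    the lower bound asks: the tilt found there is known only up to its range. *)
Lemma young (k τ H : R) : 0 < k -> 0 < τ -> 0 < H ->
 k * τ - H * k `^ σ^-1 <= (1 - σ) * (τ * (τ * (σ / H)) `^ b).
Proof.
have [s0 s3 _ _ _] := sfacts; have b0 := b_gt0; move=> k0 t0 H0; set u := (H / σ) `^ σ.
have u0 : 0 < u by sign.
have := @conjugate_powR R (k * u) (τ / u) σ^-1 (1 - σ)^-1 _ _ _ _ _.
rewrite !invrK mulrACA divff /1/ mulr1 => /(_ _ _ _ _ _) h.
have {}h : k * τ <= (k * u) `^ σ^-1 * σ + (τ / u) `^ (1 - σ)^-1 * (1 - σ) by apply: h; rewrite /1/; ring.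
move: h; rewrite (powRM _ (ltW k0) (ltW u0)) -powRrM divff /1/ powRr1 /1/ -mulrA divfK /1/.
have sE : (1 - σ)^-1 = 1 + b by rewrite bexpE; field; rewrite gt_eqF.
have -> : (τ / u) `^ (1 - σ)^-1 = τ * (τ * (σ / H)) `^ b.
 rewrite (powRM _ (ltW t0)) /1/ (powRM b (ltW t0)) /1/ mulrA; congr (_ * _).
  by rewrite sE powRD /1/ powRr1 /1/ ltW.
 rewrite !powR_expR /1/ lnV /1/ /u ln_powR -(invf_div H σ) lnV /1/.
 by congr expR; rewrite bexpE; field; rewrite gt_eqF.
by rewrite [X in X <= _]mulrC lerBlDl [(1 - σ) * _]mulrC mulrC [H * _]mulrC.
Qed.

(** log k is at most its value at the top of the range, which gives M(k) >= H k^(1/σ) with one H for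
    the whole range, and [young] applies. The second claim bounds M(k)/k from below, so that a
    suitable tilt exists within the range. *)
Lemma core_lower K : 0 < K -> exists C e1 L0 : R, [/\ 0 < C, 0 < e1 & forall τ T N k, regime T τ N -> 0 < τ ->
 L0 <= ln τ -> eta T τ <= e1 -> expR 1 <= k -> k <= K * Wt τ -> ln τ <= 4 * ln k ->
 k * τ - MI σ N k <= (1 - σ) * kap * lf τ * (1 + C * eta T τ) /\
 k * (k `^ b^-1 * G / (4 * b * ln τ)) <= MI σ N k].
Proof.
have [s0 s3 b1 G0 _] := sfacts; have b0 := b_gt0.
move=> K0; have [C [C0 hC]] := MI_rel K0; have [c [c0 hc]] := ln_Wt K0.
set C3 := 2 * (c / b + C / G); have C30 : 0 < C3 by sign.
exists (b * C3 * expR (b * C3 * 2)), (Num.min 2 (G / (2 * C))), (Num.max 1 ((c / b) ^+ 2)); split.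
- by sign.
- by rewrite lt_min ltr0n divr_gt0 /1/.
move=> τ T N k reg t0; rewrite ge_max => /andP[L1 hL]; rewrite le_min => /andP[e2 eG] kE kW L4.
have [_ LT T1 r1 TN] := reg.
set L := ln τ in L1 hL L4 *; set s := Num.sqrt L; set e := eta T τ in e2 eG *.
have L0 : 0 < L by sign.
have sp : 0 < s by sign.
have ss : L = s * s by rewrite -expr2 sqr_sqrtr // ltW.
have si : s^-1 <= e by rewrite lerDl; apply: powR_ge0.
have e0 : 0 <= e by apply: le_trans si; rewrite invr_ge0 ltW.
have k0 : 0 < k by apply: lt_le_trans kE; exact: expR_gt0.
have lk : 1 <= ln k by rewrite -(expRK 1) ler_ln /1/.
have := hc τ t0 L1; rewrite -/L -/s ler_norml => /andP[_ lW].
have lkU : ln k <= b * L * (1 + c / b * s^-1).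
 via (ln (K * Wt τ)); first by rewrite ler_ln ?posrE ?mulr_gt0 ?Wt_gt0.
 have -> : b * L * (1 + c / b * s^-1) = b * L + c * s by rewrite mulrDr mulr1; congr (_ + _); rewrite [X in b * X * _]ss; field; rewrite !gt_eqF.
 by rewrite -lerBlDl.
set y := c / b * s^-1 in lkU; have y0 : 0 < y by sign.
set X := k `^ σ^-1; have X0 : 0 < X by sign.
have := hC τ T N k reg t0 kE kW L4; rewrite ler_norml -/e -/X => /andP[hM _].
have x2 : C * e <= G / 2 by move: eG; rewrite ler_pdivlMr; clear -C0; lra.
set H := (G - C * e) / (b * L * (1 + y)).
have GC : G / 2 <= G - C * e by clear -x2; lra.
have GC0 : 0 < G - C * e by apply: lt_le_trans GC; rewrite divr_gt0.
have H0 : 0 < H by sign.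
have MH : H * X <= MI σ N k.
 via ((G - C * e) * (X / ln k)); last first.
  by move: hM; rewrite -[G * X / _]mulrA; clear; move: (X / _) => z; lra.
 rewrite /H -mulrA ler_wpM2l ?(ltW GC0) /1/ mulrC ler_wpM2l /1/ lef_pV2 /1/.
have ye : y <= c / b * e by rewrite ler_wpM2l // divr_ge0 // ltW.
split.
 via (k * τ - H * X); first by rewrite lerB.
 step (young k0 t0 H0); set Ce := 1 + b * C3 * expR (b * C3 * 2) * e.
 rewrite [leRHS](_ : _ = (1 - σ) * (τ * (kap * Wt τ * Ce))); last by rewrite /lf; ring.
 rewrite ler_wpM2l ?(ltW s3) /1/ ler_wpM2l /1/.
 have sH : σ / H <= (σ * b / G) * L * (1 + C3 * e).
  rewrite /H invf_div mulrA ler_pdivrMr //.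
  have -> : σ * b / G * L * (1 + C3 * e) * (G - C * e) = σ * (b * L) * ((1 + C3 * e) * (1 - C / G * e)) by field; rewrite gt_eqF.
  rewrite [leLHS]mulrA ler_wpM2l /1/.
  have cg : C / G * e <= 2^-1 by rewrite mulrAC ler_pdivrMr //; clear -x2; lra.
  rewrite /C3; have z0 : 0 <= C / G * e by sign.
  have w0 : 0 <= c / b * e by sign.
  rewrite (_ : 2 * (c / b + C / G) * e = 2 * (c / b * e) + 2 * (C / G * e)); last by ring.
  clear -ye cg z0 w0; move: (c / b * e) (C / G * e) ye cg z0 w0 => w z; nra.
 have q1 : 0 <= τ * L by sign.
 have q2 : 0 <= σ * b / G by sign.
 have q3 : 0 <= 1 + C3 * e by sign.
 via ((τ * L * (σ * b / G) * (1 + C3 * e)) `^ b).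
  apply: ge0_ler_powR; [exact: ltW|by sign|by sign|].
  by step (ler_wpM2l (ltW t0) sH); apply: ler_of_eq; ring.
 rewrite (powRM b (mulr_ge0 q1 q2) q3) (powRM b q1 q2).
 rewrite [_ `^ b * kap]mulrC ler_wpM2l ?mulr_ge0 ?powR_ge0 //.
 by apply: exp_pow_le; rewrite ?e0 ?(ltW C30).
apply: le_trans MH; rewrite /X powR_sV /1/ [leRHS]mulrCA ler_wpM2l /1/ [leRHS]mulrC -[leLHS]mulrA ler_wpM2l /1/.
have cs : c / b <= s by rewrite -(@ler_pXn2r _ 2) /1/ [s ^+ 2]expr2 -ss.
have y1 : y <= 1 by rewrite /y ler_pdivrMr // mul1r.
via (G / 2 / (2 * b * L)); first by apply: ler_of_eq; field; rewrite !gt_eqF.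
apply: ler_pM; rewrite /1/.
rewrite lef_pV2 /1/ -[leRHS]mulrA [leRHS]mulrC ler_wpM2l /1/; clear -y1; lra.
Qed.
End Asymptotics.

(** * The large deviation estimate in the stated range *)

Section LDP.
Variable (R : realType) (σ : R).
Hypothesis s12 : 2^-1 < σ < 1.
Implicit Types (τ T : R).
Local Notation b := (bexp σ).
Local Notation Wt := (Wt σ).
Local Notation lf := (lf σ).
Local Notation eta := (eta σ).
Local Notation A := ((1 - σ) * kap σ).

Lemma small_powR (e p : R) : 0 < e -> 0 < p -> exists c : R, [/\ 0 < c, c <= 1 & forall x, 0 <= x <= c -> x `^ p <= e].
Proof.
move=> e0 p0; exists (Num.min 1 (e `^ p^-1)); split; rewrite ?lt_min /1/ => x.
rewrite le_min => /andP[x0 /andP[_ xe]]; via ((e `^ p^-1) `^ p).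
 by rewrite ge0_ler_powR /1/.
by rewrite -powRrM mulVf /1/ powRr1 /1/ ltW.
Qed.

Lemma Wt_le c τ T : 0 < τ -> 0 < ln τ -> ln τ <= ln T -> 1 < T -> 0 <= c ->
 τ * ln T <= c * T `^ (1 - σ) -> Wt τ <= c `^ b * T `^ σ.
Proof.
have [s0 s3 _ _ _] := sfacts s12; have b0 := b_gt0 s12; move=> t0 L0 LT T1 c0 h; have T0 : 0 < T by apply: lt_trans T1.
via ((c * T `^ (1 - σ)) `^ b).
 rewrite ge0_ler_powR /1/.
 by apply: le_trans h; rewrite ler_wpM2l // ltW.
rewrite powRM /1/ ler_wpM2l /1/ -powRrM bexpE.
by rewrite mulrCA divff ?mulr1 // gt_eqF.
Qed.

Lemma r_errE T τ : r_err σ T τ = (τ * ln T / T `^ (1 - σ)) `^ ((σ - 2^-1) / (1 - σ)).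
Proof. by rewrite /r_err invf_div mulrA. Qed.
Lemma ev_ln (K : R) : ev (fun T : R => K <= ln T).
Proof. by exists (expR K) => T h; rewrite -(expRK K) ler_ln ?posrE /1/ (lt_le_trans _ h) ?expR_gt0. Qed.
Lemma le_of_range c τ T : 0 < τ -> 1 <= ln T -> c <= 1 -> τ * ln T <= c * T `^ (1 - σ) -> τ <= T /\ ln τ <= ln T.
Proof.
have [s0 s3 _ _ _] := sfacts s12; move=> t0 l1 c1 h.
have T1 : 1 < T by rewrite ltNge; apply: contraTN l1 => T1; rewrite -ltNge (le_lt_trans (ln_le0 T1)).
have T0 : 0 < T by apply: lt_trans T1.
have tT : τ <= T; last by rewrite tT ler_ln.
via (τ * ln T); first by rewrite ler_peMr // ltW.
apply: le_trans h _; via (T `^ (1 - σ)); first by rewrite ler_piMl /1/.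
by rewrite -[leRHS](@powRr1 _ T) /1/ ler_powR ?(ltW T1); clear -s0; lra.
Qed.

Lemma eta_small (e0 : R) : 0 < e0 -> exists c T1 : R, [/\ 0 < c, c <= 1 & forall T τ, T1 <= τ -> 0 < τ -> 0 <= ln T ->
 τ * ln T <= c * T `^ (1 - σ) -> 0 < T -> eta T τ <= e0].
Proof.
have [s0 s3 _ _ _] := sfacts s12; have /andP[s1 _] := s12; move=> e00.
have p0 : 0 < (σ - 2^-1) / (1 - σ) by rewrite divr_gt0 // subr_gt0.
have h0 : 0 < e0 / 2 by sign.
have [c [c0 c1 hc]] := small_powR h0 p0; have [T1 hT] := ev_ln (Num.max 1 ((2 / e0) ^+ 2)).
exists c, T1; split=> // T τ /hT; rewrite ge_max => /andP[L1 L2] t0 l0 h T0.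
rewrite /eta [e0]splitr lerD //; last first.
 rewrite r_errE; apply: hc; rewrite divr_ge0 ?mulr_ge0 ?powR_ge0 ?(ltW t0) //=.
 by rewrite ler_pdivrMr // powR_gt0.
rewrite -[e0 / 2]invrK lef_pV2 /1/ invf_div.
by rewrite -(@ler_pXn2r _ 2) /1/ sqr_sqrtr /1/ (le_trans ler01).
Qed.

(** Bounded shifts of τ, and errors of the order of k in the exponent, are within the claimed
    relative error because τ eta >= 1. *)
Lemma lf_eta T τ : 0 < τ -> 1 <= ln τ -> [/\ 1 <= Wt τ, 1 <= τ * eta T τ & Wt τ <= lf τ * eta T τ].
Proof.
have b0 := b_gt0 s12; move=> t0 L1; have L0 : 0 < ln τ by sign.
have tL : ln τ <= τ by have := @expR_ge1Dx R (ln τ); rewrite lnK /1/; clear; lra.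
have W1 : 1 <= Wt τ.
 rewrite -[leLHS](powRr0 (τ * ln τ)) ler_powR /1/ -[leLHS]mulr1; apply: ler_pM => /1/.
 exact: le_trans tL.
have te : 1 <= τ * eta T τ.
 via (τ * (Num.sqrt (ln τ))^-1); last by rewrite ler_wpM2l /1/ lerDl powR_ge0.
 have s1 : 1 <= Num.sqrt (ln τ) by rewrite -[leLHS]sqrtr1 ler_wsqrtr.
 rewrite ler_pdivlMr ?mul1r /1/; apply: le_trans tL.
 by rewrite -[leRHS]sqr_sqrtr /1/ expr2 ler_peMr /1/ (le_trans ler01).
split=> //; rewrite [lf _]mulrC -mulrA ler_peMr // (le_trans ler01) //.
Qed.

Lemma LD : exists c0 C T1 Tq : R, [/\ 0 < c0, 0 < C & forall q (ch : nat -> nat -> R[i]) om T τ,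
 prime q -> char_family q ch -> cabs om = 1 -> ln q%:R = T -> Tq <= T -> T1 <= τ ->
 τ * ln T <= c0 * T `^ (1 - σ) ->
 q.-1%:R * expR (- (A * lf τ * (1 + C * eta T τ))) <=
  \sum_(j < q.-1) ((τ < Sj σ ch om (Num.truncn T) j)%R)%:R /\
 \sum_(j < q.-1) ((τ < Sj σ ch om (Num.truncn T) j)%R)%:R <=
  q.-1%:R * expR (- (A * lf τ * (1 - C * eta T τ)))].
Proof.
have [s0 s3 b1 G0 _] := sfacts s12; have b0 := b_gt0 s12; have k0 := kap_gt0 s12; have /andP[s1 _] := s12.
have A0 : 0 < A by sign.
have [Ch [Ch0 hCh]] := head_prime_sum s12.
(* The first summand makes M(k)/k >= τ + 8 for k just above K Wt, so a tilt is found below; the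
   second makes the range contain the saddle point. *)
set K := (32 * b / G1 σ) `^ b + kap σ; have K0 : 0 < K by sign.
have K2 : 0 < 2 * K by sign.
have [Cu [Lu [Cu0 hu]]] := core_upper s12.
have [Cl [e1 [Ll [Cl0 e10 hl]]]] := core_lower s12 K2.
have m0 : 0 < Num.min 1 e1 by rewrite lt_min ltr01.
have [ca [Ta [ca0 ca1 hca]]] := eta_small m0.
(* This bound for c0^b keeps 2 k times the sum of p^-σ below half of T/log y for all k <= 3 K Wt, so
   that the available degree M suffices. *)
have m1 : 0 < (12 * K * Ch)^-1 by sign.
have [cb [cb0 cb1 hcb]] := small_powR m1 b0.
set c' := 16 + 2 * c2 σ; have c20 : 0 < c2 σ.
 by rewrite mulr_gt0 // addr_gt0 // invr_gt0; clear -s1; lra.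
exists (Num.min ca cb), (Cl + (Cu + 2 * K * c' + 5) / A).
have b2 : 0 < b / 2 by sign.
have [T1 hT1] := evI (evI (ev_ln (Num.max Lu Ll)) (ev_ln 4)) (evI (evI (ev_ge (Num.max Ta (Num.max 4 (c2 σ)))) (ev_powR K^-1 b2)) (ev_ln (2 * ln (c2 σ)))).
have h16 : 0 < (16 : R)^-1 by [].
have [Tq hTq] := evI (evI (ev_trunc (ev_ge 4)) (ev_ln 1)) (evI (ev_exp 16 1 h16) (ev_ge 3)).
exists T1, Tq; split; first by rewrite lt_min ca0.
 by sign.
move=> q ch om T τ pq hc om1 qT /hTq[[y4 lT1] [E16 T3]] /hT1[[Lul L4] [[t4 tW] Lc2]] hcT.
set c0 := Num.min ca cb in hcT; set y := Num.truncn T in y4 *.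
move: Lul t4; rewrite !ge_max => /andP[Lu' Ll'] /and3P[tTa t4 tc2].
set L := ln τ in Lu' Ll' L4 Lc2 *; set e := eta T τ.
have t0 : 0 < τ by clear -t4; lra.
have L0 : 0 < L by clear -L4; lra.
have L1 : 1 <= L by clear -L4; lra.
have T0 : 0 < T by clear -T3; lra.
have T1' : 1 < T by clear -T3; lra.
have c00 : 0 <= c0 by rewrite le_min !ltW.
have [cca ccb] : c0 <= ca /\ c0 <= cb by rewrite !ge_min !lexx orbT.
have [tT LT] := le_of_range t0 lT1 (le_trans cca ca1) hcT.
have := hca T τ tTa t0 (le_trans ler01 lT1) (le_trans hcT (ler_wpM2r (powR_ge0 _ _) cca)) T0.
rewrite le_min => /andP[ee0 ee1].
have r1 : r_err σ T τ <= 1 by apply: le_trans ee0; rewrite lerDr invr_ge0 sqrtr_ge0.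
have [yT Ty] : y%:R <= T /\ T <= 2 * y%:R by apply: trunc_bounds; clear -T3; lra.
have y4' : (4 <= y)%N by rewrite -(ler_nat R).
have yN : T <= 4 * y.-1%:R by move: Ty y4; rewrite -{1 2}(@prednK y) ?(leq_trans _ y4') // -natr1; clear; lra.
have reg : regime σ T τ y.-1 by split.
have W0 : 0 < Wt τ by apply: Wt_gt0.
have tl : τ <= τ * L by rewrite ler_peMr // ltW.
have Wb : τ `^ b <= Wt τ by rewrite ge0_ler_powR /1/.
have t1 : 1 <= τ by clear -t4; lra.
have KW : τ `^ (b / 2) <= K * Wt τ.
 apply: le_trans (ler_wpM2l (ltW K0) Wb).
 have -> : τ `^ b = τ `^ (b / 2) * τ `^ (b / 2) by rewrite -powRD /1/ -splitr.
 by rewrite mulrA ler_peMl /1/ mulrC -ler_pdivrMr /1/ div1r.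
have KW1 : 1 <= K * Wt τ by apply: le_trans KW; rewrite -[leLHS](powRr0 τ) ler_powR // ltW.
have [W1 _ le1] := lf_eta T t0 L1.
have y0 : 0 < (y%:R : R) by clear -y4; lra.
have ly : 0 < ln (y%:R : R) by rewrite ln_gt0 // ltr1n (leq_trans _ y4').
have lyT : 16 * ln y%:R <= T.
 have : ln y%:R <= T / 16.
  via (ln T); first by rewrite ler_ln.
  rewrite -[leRHS]expRK ler_ln /1/ mulrC; apply: le_trans E16; rewrite expr1.
  by clear -T0; lra.
 by clear; lra.
(* The largest degree with y^M <= q. *)
set M := Num.truncn (T / ln y%:R); have Tl0 : 0 <= T / ln y%:R by sign.
have /andP[M1 M2] := truncn_itv Tl0; rewrite -/M -natr1 in M1 M2.
have yM : (y ^ M <= q)%N.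
 have qE : q%:R = expR T :> R by rewrite -qT lnK /1/.
 rewrite -(ler_nat R) natrX qE -[y%:R ^+ M]lnK /1/ ler_expR lnXn /1/ -[leLHS]mulr_natl.
 by rewrite -ler_pdivlMr.
have hk k : 0 <= k -> k <= 3 * K * Wt τ -> 2 * k * (\sum_(1 <= p < y) (prime p)%:R * nexp p σ) + 3 <= M%:R.
 move=> kp kK; have h1 := hCh y y4'; have h2 := Wt_le t0 L0 LT T1' c00 hcT.
 have h3 : c0 `^ b <= (12 * K * Ch)^-1 by apply: hcb; rewrite c00.
 have h4 : y%:R `^ (1 - σ) <= T `^ (1 - σ) by rewrite ge0_ler_powR ?nnegrE ?(ltW s3) ?(ltW T0).
 have h5 : 2 * k * (\sum_(1 <= p < y) (prime p)%:R * nexp p σ) <= T / ln y%:R / 2.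
  via (2 * (3 * K * ((12 * K * Ch)^-1 * T `^ σ)) * (Ch * T `^ (1 - σ) / ln y%:R)); last first.
   rewrite [X in X / ln _ / 2](_ : T = T `^ σ * T `^ (1 - σ)); last first.
    by rewrite -powRD (_ : σ + (1 - σ) = 1) ?powRr1 /1/; ring.
   apply: ler_of_eq; move: (T `^ σ) (T `^ (1 - σ)) => u v; field.
   by sign.
  apply: ler_pM; rewrite /1/.
  - by apply: sumr_ge0 => p _; rewrite mulr_ge0 ?nexp_ge0.
  - rewrite ler_wpM2l /1/; apply: le_trans kK _; rewrite ler_wpM2l /1/.
   by step h2; rewrite ler_wpM2r ?powR_ge0.
  - by step h1; rewrite ler_wpM2r /1/ ler_wpM2l /1/ ltW.
 have : 16 <= T / ln y%:R by rewrite ler_pdivlMr.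
 by move: M2 h5; clear; move: (T / _) (2 * k * _) => u v; lra.
have y1 : (1 < y)%N by apply: leq_trans y4'.
have l1e : 1 <= lf τ * e := le_trans W1 le1.
have AC : A * ((Cu + 2 * K * c' + 5) / A) = Cu + 2 * K * c' + 5 by rewrite mulrC divfK // gt_eqF.
have AE : A * lf τ * ((Cl + (Cu + 2 * K * c' + 5) / A) * e) = A * Cl * (lf τ * e) + (Cu + 2 * K * c' + 5) * (lf τ * e).
 by rewrite mulrACA mulrDr AC mulrDl.
have K20 : 0 <= 2 * K * c' * (lf τ * e).
 apply: mulr_ge0 (le_trans ler01 l1e); apply: mulr_ge0; first exact: ltW.
 by sign.
have N0 : 0 <= q.-1%:R :> R by [].
split; last first.
 have kk : kap σ * Wt τ <= 3 * K * Wt τ.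
  rewrite ler_wpM2r /1/; via K; first by rewrite lerDr powR_ge0.
  by rewrite ler_peMl /1/ ler1n.
 have kp : 0 <= kap σ * Wt τ by sign.
 step (chernoff_upper pq hc om1 y1 yM τ kp (hk _ kp kk)); rewrite ler_wpM2l //.
 have hx := hu τ T y.-1 reg t0 Lu'.
 via (expR 2 * expR (MI σ y.-1 (kap σ * Wt τ) - kap σ * Wt τ * τ)).
  by rewrite ler_wpM2r /1/ (pow2_le_exp R 2).
 rewrite -expRD ler_expR mulrBr mulr1 opprB AE.
 have ACl : 0 <= A * Cl * (lf τ * e) by apply: mulr_ge0 (le_trans ler01 l1e); rewrite mulr_ge0 ?ltW.
 move: hx; rewrite -/e [Cu * e * _]mulrAC -[Cu * _ * e]mulrA; move: ACl K20 l1e; clear; move: (lf τ * e) => z.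
 by move: (MI _ _ _) => m; lra.
set k1 := K * Wt τ; have k10 : 0 <= k1 by sign.
pose k0' := (Num.truncn k1).+1; have /andP[ka kb] := truncn_itv k10; rewrite -/k0' in kb.
have kc : k0'%:R <= 2 * k1 by rewrite /k0' -natr1; move: KW1 ka; rewrite -/k1; clear; lra.
have lnk k : 0 < k -> L <= 4 * ln k -> expR 1 <= k by move=> kp h; rewrite -[leRHS]lnK /1/ ler_expR; clear -h L4; lra.
have k0p : 0 < k0'%:R :> R by sign.
have Lk0 : L <= 4 * ln k0'%:R.
 have : b / 2 * L <= ln k0'%:R by rewrite -ln_powR ler_ln /1/ (le_trans KW) /1/ ltW.
 by clear -L0 b1; nra.
have k2K : k0'%:R <= 2 * K * Wt τ by rewrite -mulrA.
have [_ hM0] := hl τ T y.-1 k0'%:R reg t0 Ll' ee1 (lnk _ k0p Lk0) k2K Lk0.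
have hk0 : k0'%:R * (τ + 8) <= MI σ y.-1 k0'%:R.
 apply: le_trans hM0; rewrite ler_wpM2l /1/ -/L ler_pdivlMr /1/.
 have h1 : (32 * b / G1 σ) * (τ * L) <= k0'%:R `^ b^-1.
  have p0 : 0 <= 32 * b / G1 σ by sign.
  have q0 : 0 <= τ * L by sign.
  rewrite -(powR_bV s12 (mulr_ge0 p0 q0)) ge0_ler_powR /1/.
  rewrite (powRM _ p0 q0); apply: le_trans (ltW kb); rewrite ler_wpM2r /1/ lerDl ltW /1/.
 have h2 := ler_wpM2r (ltW G0) h1.
 have e3 : 32 * b / G1 σ * (τ * L) * G1 σ = 4 * b * L * (8 * τ) by field; rewrite gt_eqF.
 apply: le_trans h2; rewrite e3 mulrC ler_wpM2l /1/; clear -t4; lra.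
have M1' : MI σ y.-1 1 < τ + 8 by have := MI_le_sqr s12 y.-1 1; rewrite expr1n mulr1; move: tc2; clear; lra.
have hkk : 2 * k0'.+1%:R * (\sum_(1 <= p < y) (prime p)%:R * nexp p σ) + 3 <= M%:R.
 apply: hk; rewrite // -natr1 -mulrA -/k1; move: kc KW1; rewrite -/k1; clear; lra.
have [k [/andP[kp kk] tM hsum]] := ld_lower s12 pq hc om1 y1 yM M1' hkk isT hk0.
apply: le_trans hsum.
have kp' : 0 < k%:R :> R by sign.
have Lk : L <= 4 * ln k%:R.
 have : L <= ln (c2 σ * k%:R ^+ 2).
  by rewrite ler_ln /1/; step tM; apply: MI_le_sqr.
 rewrite lnM /1/ lnXn /1/ -[ln _ *+ 2]mulr_natl; move: Lc2; clear; lra.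
have kK : k%:R <= 2 * K * Wt τ by apply: le_trans k2K; rewrite ler_nat.
have [hx _] := hl τ T y.-1 k%:R reg t0 Ll' ee1 (lnk _ kp' Lk) kK Lk.
have c'0 : 0 <= c' by sign.
rewrite -[_ / 32 * _]mulrA ler_wpM2l //.
via (expR (- 5) * expR (MI σ y.-1 k%:R - k%:R * (τ + c'))); last first.
 by rewrite ler_wpM2r /1/ expRN lef_pV2 /1/ (pow2_le_exp R 5).
rewrite -expRD ler_expR lerNl [A * lf τ * _]mulrDr mulr1 AE.
have h3 : k%:R * c' <= 2 * K * c' * (lf τ * e).
 via (2 * K * Wt τ * c'); first by rewrite ler_wpM2r.
 by rewrite mulrAC ler_wpM2l // mulr_ge0 // ltW.
have Cu1 : 0 <= Cu * (lf τ * e) by apply: mulr_ge0 (le_trans ler01 l1e); rewrite ltW.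
move: hx h3 l1e Cu1; rewrite -/e [A * lf τ * _]mulrDr mulr1 [A * lf τ * (Cl * e)]mulrACA; clear.
move: (lf τ * e) (MI _ _ _) (A * lf τ) => z m w; lra.
Qed.
End LDP.

(** * From the prime sum to L *)

Section Sandwich.
Variable (R : realType) (σ : R).
Hypothesis s12 : 2^-1 < σ < 1.
Implicit Types (τ T : R).
Local Notation b := (bexp σ).
Local Notation Wt := (Wt σ).
Local Notation lf := (lf σ).
Local Notation eta := (eta σ).
Local Notation A := ((1 - σ) * kap σ).

Lemma lf_le (c : R) τ T : 0 < τ -> 1 <= ln τ -> 1 <= ln T -> 0 <= c <= 1 ->
 τ * ln T <= c * T `^ (1 - σ) -> lf τ * ln T <= c * T.
Proof.
have b0 := b_gt0 s12; move=> t0 L1 l1 /andP[c0 c1] h; have [tT LT] := le_of_range s12 t0 l1 c1 h.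
have T1 : 1 < T by rewrite ltNge; apply: contraTN l1 => T1; rewrite -ltNge (le_lt_trans (ln_le0 T1)).
have T0 : 0 < T by apply: lt_trans T1.
have L0 : 0 < ln τ by sign.
have hW := Wt_le s12 t0 L0 LT T1 c0 h.
have -> : lf τ * ln T = (τ * ln T) * Wt τ by rewrite mulrAC.
via (c * T `^ (1 - σ) * T `^ σ).
 apply: ler_pM => /1/; rewrite ?powR_ge0 /1/.
 apply: le_trans hW _; rewrite ler_piMl /1/; via (1 `^ b); last by rewrite powR1.
 by rewrite ge0_ler_powR /1/.
by rewrite -mulrA -powRD /1/ subrK powRr1 /1/ ltW.
Qed.

Lemma lf_r_err τ T : 0 < τ -> 1 <= ln τ -> ln τ <= ln T -> 1 < T ->
 lf τ * (T `^ (1 - 2 * σ) / ln T) <= (τ * r_err σ T τ) ^+ 2.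
Proof.
have [s0 s3 _ _ _] := sfacts s12; have b0 := b_gt0 s12; move=> t0 L1 LT T1.
have T0 : 0 < T by apply: lt_trans T1.
have l0 : 0 < ln T by sign.
have E : (τ * r_err σ T τ) ^+ 2 = τ * (τ * ln T) `^ b * (T `^ (1 - 2 * σ) / ln T).
 rewrite exprMn -r_err_sq /1/ (powRM _ (powR_ge0 _ _)) /1/ -powRrM -(powR_inv1 (ltW T0)) -powRrM.
 rewrite (_ : (1 - σ)^-1 * (2 * σ - 1) = b - 1); last by rewrite bexpE; field; rewrite gt_eqF.
 rewrite (_ : -1 * (2 * σ - 1) = 1 - 2 * σ); last by ring.
 by rewrite powRB /1/ powRr1 /1/; field; rewrite !gt_eqF.
rewrite E ler_wpM2r /1/ /lf ler_wpM2l /1/.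
rewrite ge0_ler_powR /1/.
by rewrite ler_wpM2l // ltW.
Qed.

(** Moments of order 2 m with m about D lf(τ), so that exp(-m) falls below the main probability. The
    threshold V has V^2 of order m times the diagonal sum, itself about T^(1-2σ)/log T; by
    [lf_r_err] the choice V = C τ r is enough. This is the second source of r. *)
Lemma block_tail (B : nat) (D : R) : 0 < D -> exists c C Tq : R, [/\ 0 < c, c <= 1, 0 < C &
 forall q (ch : nat -> nat -> R[i]) T τ, prime q -> char_family q ch -> ln q%:R = T -> Tq <= T ->
 1 <= τ -> 1 <= ln τ -> τ * ln T <= c * T `^ (1 - σ) ->
 \sum_(j < q.-1) ((C * (τ * r_err σ T τ) <
   cabs (PB (ch j) (Num.truncn T) (Num.truncn T ^ B) σ))%R)%:R <= q.-1%:R * expR (- (D * lf τ))].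
Proof.
have [s0 s3 _ _ _] := sfacts s12; have /andP[s1 _] := s12; move=> D0; have [C0 [C00 hC]] := bsum_le s12.
pose c : R := (2 * (B.+1%:R * (D + 1)))^-1; pose C := 1 + expR 1 * (4 * (D + 1) * C0).
have D1' : 1 <= D + 1 by rewrite lerDr ltW.
have B1 : 1 <= (B.+1%:R : R) by rewrite ler1n.
have BD : 1 <= B.+1%:R * (D + 1) by rewrite -[leLHS]mulr1 ler_pM.
have c0 : 0 < c by sign.
have c1 : c <= 1 by rewrite invf_le1; move: BD; clear; lra.
have C1 : 1 <= C by rewrite lerDl !mulr_ge0 /1/.
have [Tq hTq] := evI (evI (ev_trunc (ev_ge (4 : R))) (ev_ln 1)) (ev_ge 8).
exists c, C, Tq; split=> //; first by sign.
move=> q ch T τ pq hc qT /hTq[[y4 l1] T8] t1 L1 hcT.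
have t0 : 0 < τ by sign.
have T0 : 0 < T by clear -T8; lra.
have T1 : 1 < T by clear -T8; lra.
have [_ LT] := le_of_range s12 t0 l1 c1 hcT.
have cc : 0 <= c <= 1 by sign.
have hlf := lf_le t0 L1 l1 cc hcT.
have [W1 _ _] := lf_eta s12 T t0 L1.
have lf1 : 1 <= lf τ by rewrite -[leLHS]mulr1 ler_pM.
set y := Num.truncn T in y4 *; have [yT Ty] : y%:R <= T /\ T <= 2 * y%:R by apply: trunc_bounds; clear -T8; lra.
have y4' : (4 <= y)%N by rewrite -(ler_nat R).
have y0 : 0 < (y%:R : R) by clear -y4; lra.
have y1 : (1 < y)%N by apply: leq_trans y4'.
have ly0 : 0 < ln (y%:R : R) by rewrite ln_gt0 // ltr1n.
have Dl0 : 0 <= D * lf τ by sign.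
set m := (Num.truncn (D * lf τ)).+1; have /andP[m1 m2] := truncn_itv Dl0; rewrite -/m in m2.
have mD : m%:R <= (D + 1) * lf τ by rewrite -natr1; move: m1 lf1; clear; lra.
have qE : q%:R = expR T :> R by rewrite -qT lnK /1/.
have yl : ln y%:R <= ln T by rewrite ler_ln.
have l0 : 0 < ln T by sign.
have vq : ((y ^ B) ^ m < q)%N.
 rewrite -(ltr_nat R) qE !natrX -exprM -[_ ^+ _]lnK /1/ ltr_expR lnXn /1/.
 apply: (@le_lt_trans _ _ (B.+1%:R * ((D + 1) * lf τ) * ln T)).
  by rewrite -[ln _ *+ _]mulr_natl natrM; apply: ler_pM; rewrite /1/ ler_pM /1/ ler_nat.
 have h : B.+1%:R * ((D + 1) * lf τ) * ln T <= B.+1%:R * (D + 1) * (c * T) by rewrite mulrA -[leLHS]mulrA ler_wpM2l // (le_trans ler01 BD).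
 apply: le_lt_trans h _; rewrite /c mulrA (_ : _ * _^-1 = 2^-1); first by clear -T0; lra.
 by field; rewrite /1/.
set r := r_err σ T τ; have r0 : 0 < r by rewrite powR_gt0 // divr_gt0 // divr_gt0 // powR_gt0.
set V := C * (τ * r); have V0 : 0 < V by sign.
have := block_pointwise y σ pq hc vq (ltW V0).
set S := \sum_(j < q.-1) _; set bs := bsum _ _ _ => h.
have bs0 : 0 <= bs by apply: bsum_ge0.
have hbs : bs <= 4 * C0 * (T `^ (1 - 2 * σ) / ln T).
 step (hC y (y ^ B)%N y1); rewrite -mulrA [leRHS](_ : _ = C0 * ((2 * T `^ (1 - 2 * σ)) * (2 / ln T))); last by ring.
 rewrite ler_wpM2l /1/; apply: ler_pM; rewrite /1/.
  rewrite -[1 - 2 * σ]opprB !powRN; set a := 2 * σ - 1; have a0 : 0 <= a by rewrite /a; clear -s1; lra.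
  rewrite ler_pdivlMr /1/ mulrC ler_pdivrMr /1/.
  via ((2 * y%:R) `^ a); first by rewrite ge0_ler_powR /1/.
  rewrite powRM /1/ ler_wpM2r /1/ -[leRHS]powRr1 /1/ ler_powR /a; clear -s3; lra.
 rewrite ler_pdivlMr // mulrC ler_pdivrMr //.
 have -> : 2 * ln (y%:R : R) = ln (y%:R ^+ 2) by rewrite lnXn // mulr_natl.
 rewrite ler_ln /1/; apply: le_trans Ty _; rewrite expr2 ler_wpM2r /1/.
 by clear -y4; lra.
have hV : m%:R * bs <= V ^+ 2 * expR (- 1).
 have hr := lf_r_err t0 L1 LT T1; rewrite expRN ler_pdivlMr /1/.
 via ((D + 1) * lf τ * (4 * C0 * (T `^ (1 - 2 * σ) / ln T)) * expR 1).
  by rewrite ler_wpM2r /1/ ler_pM.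
 rewrite (_ : _ * expR 1 = (expR 1 * (4 * (D + 1) * C0)) * (lf τ * (T `^ (1 - 2 * σ) / ln T))); last by ring.
 rewrite /V exprMn; apply: ler_pM => /1/; rewrite /1/.
 by via C; [rewrite lerDr|rewrite expr2 ler_peMr // (le_trans ler01)].
have Vm : 0 < V ^+ (2 * m) by sign.
rewrite -(ler_pM2l Vm); apply: le_trans h _; rewrite [leRHS]mulrCA ler_wpM2l //.
via ((m%:R * bs) ^+ m).
 by rewrite exprMn ler_wpM2r /1/ -natrX ler_nat fact_le_exp.
via ((V ^+ 2 * expR (- 1)) ^+ m).
 by rewrite lerXn2r ?(mulr_ge0 (exprn_ge0 2 (ltW V0)) (expR_ge0 _)) /1/.
by rewrite exprMn -exprM ler_wpM2l /1/ -expRM_natl mulrN1 ler_expR lerN2 ltW.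
Qed.

Lemma lf_scale : exists C : R, 0 < C /\ forall τ x, 0 < τ -> 1 <= ln τ -> 0 <= x <= 1 ->
 lf (τ * (1 + x)) <= lf τ * (1 + C * x).
Proof.
have b0 := b_gt0 s12; set c := b * 3 * expR (b * 3 * 2); have c0 : 0 < c by sign.
exists (1 + 2 * c); split; first by sign.
move=> τ x t0 L1 /andP[x0 x1]; have L0 : 0 < ln τ by sign.
have x2 : 0 <= x <= 2 by rewrite x0; clear -x1; lra.
have h := exp_pow_le s12 (ler0n R 3) x2; rewrite -/c in h.
have p0 : 0 < 1 + x by clear -x0; lra.
have h1 : Wt (τ * (1 + x)) <= Wt τ * (1 + c * x).
 have q0 : 0 <= τ * ln τ by sign.
 have q1 : 0 <= 1 + 3 * x by clear -x0; lra.
 apply: le_trans (ler_wpM2l (powR_ge0 (τ * ln τ) b) h); rewrite -(powRM _ q0 q1).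
 have lx : ln (τ * (1 + x)) <= ln τ * (1 + x).
  rewrite lnM /1/ mulrDr mulr1 lerD2l; apply: le_trans (ler_peMl x0 L1).
  by have := @expR_ge1Dx R (ln (1 + x)); rewrite lnK /1/; clear; lra.
 have l0 : 0 <= ln (τ * (1 + x)) by rewrite lnM /1/ addr_ge0 /1/ ln_ge0 /1/ lerDl.
 rewrite ge0_ler_powR /1/.
 step (ler_wpM2l (mulr_ge0 (ltW t0) (ltW p0)) lx).
 rewrite mulrACA ler_wpM2l //; clear -x0 x1; nra.
have t1 : 0 <= τ * (1 + x) by sign.
step (ler_wpM2l t1 h1); rewrite mulrACA /lf ler_wpM2l ?mulr_ge0 ?powR_ge0 /1/.
have : c * x * x <= c * x by rewrite ler_piMr // mulr_ge0 // ltW.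
by move: x1; clear; move: (c) => c1; lra.
Qed.

Lemma eta_scale : exists C : R, 0 < C /\ forall T τ τ', 1 < T -> 0 < τ -> 4 <= ln τ ->
 τ / 2 <= τ' <= 2 * τ -> eta T τ' <= C * eta T τ.
Proof.
have [s0 s3 _ _ _] := sfacts s12; have /andP[s1 _] := s12.
have p0 : 0 < (σ - 2^-1) / (1 - σ) by rewrite divr_gt0 // subr_gt0.
set p := _ / _ in p0; exists (2 + 2 `^ p); split; first by sign.
move=> T τ τ' T1 t0 L4 /andP[h1 h2]; have T0 : 0 < T by apply: lt_trans T1.
have l0 : 0 < ln T by sign.
have t0' : 0 < τ' by apply: lt_le_trans h1; rewrite divr_gt0.
have r0 : 0 <= r_err σ T τ by apply: powR_ge0.
have L0 : 0 < ln τ by clear -L4; lra.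
have hL : ln τ <= 4 * ln τ'.
 have : ln (τ / 2) <= ln τ' by rewrite ler_ln /1/.
 rewrite lnM /1/ lnV /1/.
 by have := @expR_ge1Dx R (ln 2); rewrite lnK /1/; move: L4; clear; lra.
have a1 := invsqrt_le L0 hL.
have a2 : r_err σ T τ' <= 2 `^ p * r_err σ T τ.
 have y0 : 0 <= τ / (T `^ (1 - σ) / ln T) by sign.
 rewrite /r_err -/p -(powRM p (ler0n R 2) y0) ge0_ler_powR /1/.
 by rewrite mulrA ler_wpM2r /1/.
rewrite /eta mulrDr; apply: lerD; [step a1|step a2]; rewrite ler_wpM2r ?lerDl ?lerDr //.
Qed.

Lemma exp_between (M e phi : R) : 0 < M -> expR (- (M * (1 + e))) <= phi -> phi <= expR (- (M * (1 - e))) ->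
 exists E : R, `|E| <= e /\ phi = expR (- (M * (1 + E))).
Proof.
move=> M0 h1 h2; have p0 : 0 < phi by apply: lt_le_trans h1; exact: expR_gt0.
exists (- ln phi / M - 1); have -> : - (M * (1 + (- ln phi / M - 1))) = ln phi by field; rewrite gt_eqF.
rewrite lnK /1/; split=> /1/.
have l1 : - (M * (1 + e)) <= ln phi by rewrite -[leLHS]expRK ler_ln /1/.
have l2 : ln phi <= - (M * (1 - e)) by rewrite -[leRHS]expRK ler_ln /1/.
rewrite ler_norml lerBrDr lerBlDr ler_pdivlMr // ler_pdivrMr //; move: l1 l2; clear; lra.
Qed.

(** Arithmetic of moving the threshold by the relative amount C5 e: the changes of [lf] and of [eta]
    each cost O(e). The last alternative replaces a sign hypothesis on ep. *)
Lemma tilted_tail (C1 C3 C4 C5 lt lm lp e em ep : R) : 0 < C1 -> 0 < C3 -> 0 < C4 -> 0 < C5 ->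
 0 <= lt -> 0 <= lm -> 0 <= e -> em <= C3 * e -> ep <= C3 * e -> lt <= lm * (1 + C4 * (2 * (C5 * e))) ->
 lp <= lt * (1 + C4 * (C5 * e)) -> (2 * C4 * C5 + 2 * C1 * C3) * e <= 1 ->
 lt * (1 - (2 * C4 * C5 + 2 * C1 * C3) * e) <= lm * (1 - C1 * em) /\
 lp * (1 + C1 * ep) <= lt * (1 + (2 * C4 * C5 + 2 * C1 * C3) * e) \/ ep < 0.
Proof.
move=> c1 c3 c4 c5 l0 lm0 e0 hm hp h1 h2 hs; have [ep0|] := leP 0 ep; last by right.
left; set u := C4 * C5 * e; set v := C1 * C3 * e.
have u0 : 0 <= u by sign.
have v0 : 0 <= v by sign.
have E : (2 * C4 * C5 + 2 * C1 * C3) * e = 2 * u + 2 * v by rewrite /u /v; ring.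
rewrite E in hs *; have E1 : C4 * (2 * (C5 * e)) = 2 * u by rewrite /u; ring.
have E2 : C4 * (C5 * e) = u by rewrite /u; ring.
rewrite E1 in h1; rewrite E2 in h2.
have hm' : C1 * em <= v by rewrite /v -mulrA ler_wpM2l // ltW.
have hp' : C1 * ep <= v by rewrite /v -mulrA ler_wpM2l // ltW.
have hp0 : 0 <= C1 * ep by sign.
split.
 via (lm * (1 - v)); last by rewrite ler_wpM2l // lerD2l lerN2.
 have q0 : 0 <= 1 - (2 * u + 2 * v) by clear -hs; lra.
 step (ler_wpM2r q0 h1); rewrite -mulrA ler_wpM2l //; clear -u0 v0 hs; nra.
have q0 : 0 <= 1 + C1 * ep by clear -hp0; lra.
step (ler_wpM2r q0 h2); rewrite -mulrA ler_wpM2l //.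
move: hp' hp0 hs u0 v0; clear; move: (C1 * ep) => w; nra.
Qed.

(* Off an exceptional set of characters, membership in [P] is decided by the short prime sum
  [Sj] up to an error O(τ eta), which moves the threshold by a factor 1 + O(eta). *)
Lemma sandwich : exists c4 C T0 Tq : R, 0 < c4 /\ forall q (ch : nat -> nat -> R[i]) om T τ (P : nat -> bool),
 prime q -> char_family q ch -> cabs om = 1 -> ln q%:R = T -> Tq <= T -> T0 <= τ ->
 τ * ln T <= c4 * T `^ (1 - σ) ->
 (forall j w, (0 < j < q.-1)%N ->
  (forall s, σ <= s -> cabs (Defs.Lfun s (ch j) * cexp (- Pw (ch j) w s) - 1) <= 2^-1) ->
  (P j -> τ < Re (om * Pw (ch j) w σ) + 2) /\ (τ + 2 < Re (om * Pw (ch j) w σ) -> P j)) ->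
 exists E : R, `|E| <= C * eta T τ /\
  (\sum_(j < q.-1) ((0 < j)%N && P j)%:R) / q.-1%:R = expR (- (A * lf τ * (1 + E))).
Proof.
have [s0 s3 _ _ _] := sfacts s12; have k0 := kap_gt0 s12; have A0 : 0 < A by sign.
have [d [K [B [d0 K0 B0 [Tg hg]]]]] := good_set s12.
(* The prime sum gives a probability of at least exp(-2 A lf); as lf >= 1, the excess 3 makes each
   exceptional set at most 1/8 of it. *)
pose D := 2 * A + 3; have D0 : 0 < D by sign.
have [c1 [C1 [T1 [Tq1 [c10 C10 hLD]]]]] := LD s12.
have [c2 [C2 [Tq2 [c20 c21 C20 hB]]]] := block_tail B D0.
have [C4 [C40 hC4]] := lf_scale; have [C3 [C30 hC3]] := eta_scale.
(* The shift of the threshold, in units of τ eta: the block beyond y, the approximation error K, and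
   2 for the passage from L to P. *)
pose C5 := C2 + K + 2; have C50 : 0 < C5 by sign.
pose Cz := 2 * C4 * C5 + 2 * C1 * C3; have Cz0 : 0 < Cz by sign.
have m0 : 0 < Num.min (2 * C5)^-1 Cz^-1 by rewrite lt_min !invr_gt0 mulr_gt0.
have [c3 [T3 [c30 c31 he]]] := eta_small s12 m0.
have Dd0 : 0 < d / D by sign.
exists (Num.min (Num.min (c1 / 2) c2) (Num.min c3 (d / D))), (Cz + 2 / A).
have [T0 hT0] := evI (evI (ev_ge (2 * T1)) (ev_ge T3)) (evI (ev_ln 4) (ev_ge 1)).
have [Tq hTq] := evI (evI (ev_ge Tg) (ev_ge Tq1)) (evI (evI (ev_ge Tq2) (ev_ge 2)) (ev_ln 1)).
exists T0, Tq; split; first by rewrite !lt_min c20 c30 Dd0 divr_gt0.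
move=> q ch om T τ P pq hc om1 qT /hTq[[Tg' Tq1'] [[Tq2' T2] l1]] /hT0[[tT1 tT3] [L4 t1]] hcT hP.
set c4 := Num.min _ _ in hcT; have [c4a c4b] : c4 <= c1 / 2 /\ c4 <= c2 by rewrite !ge_min !lexx ?orbT.
have [c4c c4d] : c4 <= c3 /\ c4 <= d / D by rewrite !ge_min !lexx ?orbT.
have c40 : 0 <= c4 by rewrite !le_min !ltW /1/.
have T0' : 0 < T by clear -T2; lra.
have T1' : 1 < T by clear -T2; lra.
have t0 : 0 < τ by clear -t1; lra.
have L1 : 1 <= ln τ by clear -L4; lra.
have up c : c4 <= c -> τ * ln T <= c * T `^ (1 - σ) by move=> h; step hcT; rewrite ler_wpM2r ?powR_ge0.
have := he T τ tT3 t0 (le_trans ler01 l1) (up _ c4c) T0'.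
have [W1 te1 Wl] := lf_eta s12 T t0 L1; set e := eta T τ in te1 Wl *.
rewrite le_min => /andP[eC5 eCz].
have e0 : 0 < e by rewrite -(pmulr_rgt0 _ t0) (lt_le_trans ltr01 te1).
have le1 : 1 <= lf τ * e := le_trans W1 Wl.
have lf1 : 1 <= lf τ by rewrite -[leLHS]mulr1 ler_pM.
have lf0 : 0 < lf τ by sign.
pose x := C5 * e; have x0 : 0 < x by sign.
have x2 : x <= 2^-1 by move: eC5; rewrite /x -[(2 * C5)^-1]mul1r ler_pdivlMr /1/; clear; lra.
have z1 : Cz * e <= 1 by move: eCz; rewrite -[Cz^-1]mul1r ler_pdivlMr // mulrC.
pose tm := τ * (1 - x); pose tp := τ * (1 + x).
have tmb : τ / 2 <= tm <= 2 * τ by rewrite /tm; clear -t0 x0 x2; apply/andP; split; nra.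
have tpb : τ / 2 <= tp <= 2 * τ by rewrite /tp; clear -t0 x0 x2; apply/andP; split; nra.
have tmT : T1 <= tm by case/andP: tmb; move: tT1; clear; lra.
have tpT : T1 <= tp by case/andP: tpb; move: tT1; clear; lra.
have l0 : 0 <= ln T by sign.
have rng t : t <= 2 * τ -> t * ln T <= c1 * T `^ (1 - σ).
 move=> h; step (ler_wpM2r l0 h); rewrite -mulrA.
 by have := up _ c4a; clear; move: (τ * _) (T `^ _) => u v; lra.
have tmp : 0 < tm by case/andP: tmb; move: t0; clear; lra.
have Lm : 1 <= ln tm.
 have : ln (τ / 2) <= ln tm by case/andP: tmb => h _; rewrite ler_ln ?posrE ?divr_gt0.
 rewrite lnM /1/ lnV /1/.
 by have := @expR_ge1Dx R (ln 2); rewrite lnK /1/; move: L4; clear; lra.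
have lm0 : 0 <= lf tm by rewrite mulr_ge0 ?powR_ge0 // ltW.
have hm : lf τ <= lf tm * (1 + C4 * (2 * x)).
 pose x' := x / (1 - x); have p0 : 0 < 1 - x by clear -x2; lra.
 have x'0 : 0 <= x' by rewrite divr_ge0 ?ltW.
 have x'2 : x' <= 2 * x by rewrite ler_pdivrMr; clear -x0 x2; nra.
 have x'1 : 0 <= x' <= 1 by rewrite x'0; clear -x'2 x2; lra.
 have tE : τ = tm * (1 + x') by rewrite /tm /x'; field; rewrite gt_eqF.
 rewrite {1}tE; step (hC4 _ _ tmp Lm x'1).
 by rewrite ler_wpM2l // lerD2l ler_wpM2l // ltW.
have hp : lf tp <= lf τ * (1 + C4 * x) by apply: hC4 => //; rewrite (ltW x0); clear -x2; lra.
have ep0 : 0 <= eta T tp by rewrite addr_ge0 ?powR_ge0.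
have [[lm lp]|] := tilted_tail C10 C30 C40 C50 (ltW lf0) lm0 (ltW e0) (hC3 _ _ _ T1' t0 L4 tmb) (hC3 _ _ _ T1' t0 L4 tpb) hm hp z1; last by rewrite ltNge ep0.
rewrite -/Cz in lm lp.
have [_ ldu] := hLD q ch om T tm pq hc om1 qT Tq1' tmT (rng _ (andP tmb).2).
have [ldl _] := hLD q ch om T tp pq hc om1 qT Tq1' tpT (rng _ (andP tpb).2).
have [bad [badb bad0 good]] := hg T Tg' q ch pq hc qT.
have blk := hB q ch T τ pq hc qT Tq2' t1 L1 (up _ c4b).
set V := C2 * _ in blk; set y := Num.truncn T in ldu ldl good blk *.
pose b2 j := (V < cabs (PB (ch j) y (y ^ B) σ))%R; rewrite -[X in X <= _]/(\sum_(j < q.-1) (b2 j)%:R) in blk.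
have VK : V + K + 2 <= τ * x.
 have r0 : 0 <= r_err σ T τ by apply: powR_ge0.
 have re : r_err σ T τ <= e by rewrite lerDr invr_ge0 sqrtr_ge0.
 have := ler_wpM2l (ltW C20) (ler_wpM2l (ltW t0) re); have := ler_wpM2l (ltW K0) te1.
 rewrite -/V /x /C5; move: te1; clear; move: (V) => V'; lra.
have key j : (0 < j < q.-1)%N -> ~~ bad j -> ~~ b2 j -> (P j -> tm < Sj σ ch om y j) /\ (tp < Sj σ ch om y j -> P j).
 move=> hj nb nb2; have [w [hw hK]] := good j (andP hj).2 nb; have [p1 p2] := hP j w hj hw.
 have : `|Re (om * Pw (ch j) w σ) - Sj σ ch om y j| <= K + V.
  rewrite /Sj -ReN -ReD -mulrBr; apply: le_trans (ler_Re_cabs _) _; rewrite cabsM om1 mul1r.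
  rewrite (_ : _ - _ = (Pw (ch j) w σ - (PB (ch j) 1 y σ + PB (ch j) y (y ^ B) σ)) + PB (ch j) y (y ^ B) σ); last by ring.
  by triD; rewrite lerD // leNgt.
 rewrite ler_norml => /andP[h1 h2]; rewrite /tm /tp mulrBr mulrDr mulr1; split=> [/p1 h|h]; [|apply: p2]; move: h1 h2 VK h; clear; lra.
have q1 : (0 < q.-1)%N by rewrite -subn1 subn_gt0 prime_gt1.
have q0 : 0 < q.-1%:R :> R by sign.
set Sg := \sum_(j < _) ((0 < j)%N && P j)%:R.
set Sb := \sum_(j < q.-1) (bad j)%:R in badb *; set S2 := \sum_(j < q.-1) (b2 j)%:R in blk *.
have su : Sg <= Sb + S2 + \sum_(j < q.-1) ((tm < Sj σ ch om y j)%R)%:R.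
 rewrite -!big_split /=; apply: ler_sum => j _; have [j0|] := posnP j; first by rewrite j0 addr_ge0.
 move=> j0; have := key j; rewrite j0 ltn_ord => /(_ isT).
 case: (bad j) => [_|]; first by case: (P j); rewrite -addrA ?lerDl ?addr_ge0.
 case: (b2 j) => [_|/(_ isT isT)[h _]]; first by case: (P j); rewrite add0r ?lerDl ?addr_ge0.
 by rewrite !add0r; case: (P j) h => // /(_ isT) ->.
have sl : \sum_(j < q.-1) ((tp < Sj σ ch om y j)%R)%:R <= Sg + (Sb + S2).
 rewrite -!big_split /=; apply: ler_sum => j _; have [j0|] := posnP j.
  rewrite j0 bad0 /= add0r; via 1; first by case: ltP.
  by rewrite lerDl.
 move=> j0; have := key j; rewrite j0 ltn_ord => /(_ isT).
 case: (bad j) => [_|]; first by case: ltP => _; rewrite ?addr_ge0 // addrCA lerDl addr_ge0.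
 case: (b2 j) => [_|/(_ isT isT)[_ h]]; first by case: ltP => _; rewrite ?addr_ge0 // add0r lerDr.
 by rewrite !addr0; case: ltP h => // _ /(_ isT) ->.
have bad' : Sb <= q.-1%:R * expR (- (D * lf τ)).
 apply: le_trans badb _; rewrite ler_wpM2l /1/ ler_expR lerN2.
 have c41 : 0 <= c4 <= 1 by rewrite c40 (le_trans c4b).
 have h := lf_le t0 L1 l1 c41 hcT; rewrite mulrC -ler_pdivlMr // mulrAC.
 via (c4 * T); last by rewrite ler_wpM2r // ltW.
 by apply: le_trans h; rewrite ler_peMr // ltW.
have Me : A * lf τ * ((Cz + 2 / A) * e) = A * lf τ * (Cz * e) + 2 * (lf τ * e) by field; rewrite !gt_eqF.
apply: exp_between; first exact: mulr_gt0.
- rewrite ler_pdivlMr // mulrC; set X := A * lf τ * (1 + Cz * e).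
 have h1 : q.-1%:R * expR (- X) <= Sg + (Sb + S2).
  apply: le_trans sl; apply: le_trans ldl; rewrite (ler_pM2l q0) ler_expR lerN2 /X -mulrA -[leRHS]mulrA.
  by rewrite ler_wpM2l // ltW.
 have h2 : expR (- (D * lf τ)) <= expR (- X) / 8.
  via (expR (- X) * expR (- 3)).
   rewrite -expRD ler_expR /D /X; have : A * lf τ * (Cz * e) <= A * lf τ by rewrite ler_piMr // mulr_ge0 ?ltW.
   move: lf1; clear; lra.
  by rewrite ler_wpM2l /1/ expRN lef_pV2 /1/ (pow2_le_exp R 3).
 have h3 : expR (- (A * lf τ * (1 + (Cz + 2 / A) * e))) <= expR (- X) / 2.
  via (expR (- X) * expR (- 1)).
   by rewrite -expRD ler_expR /X; move: Me le1; clear; move: A (lf τ) => a l; lra.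
  by rewrite ler_wpM2l /1/ expRN lef_pV2 /1/ (pow2_le_exp R 1).
 have h4 := ler_wpM2l (ltW q0) h2; have h5 := ler_wpM2l (ltW q0) h3.
 have p0 := mulr_ge0 (ltW q0) (expR_ge0 (- X)).
 move: h1 h4 h5 bad' blk p0; clear; move: (q.-1%:R) (expR _) (expR _) (expR _) => N E1 E2 E3; lra.
rewrite ler_pdivrMr // mulrC; set X := A * lf τ * (1 - Cz * e).
have h1 : \sum_(j < q.-1) ((tm < Sj σ ch om y j)%R)%:R <= q.-1%:R * expR (- X).
 apply: le_trans ldu _; rewrite (ler_pM2l q0) ler_expR lerN2 /X -mulrA -[leRHS]mulrA.
 by rewrite ler_wpM2l // ltW.
have h2 : expR (- (D * lf τ)) <= expR (- X).
 rewrite ler_expR lerN2 /D /X; have : 0 <= A * lf τ * (Cz * e) by apply: mulr_ge0; apply: mulr_ge0; apply: ltW.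
 by have := mulr_ge0 (ltW A0) (ltW lf0); move: lf1; clear; lra.
have h3 : 4 * expR (- X) <= expR (- (A * lf τ * (1 - (Cz + 2 / A) * e))).
 via (expR 2 * expR (- X)).
  by rewrite ler_wpM2r /1/ (pow2_le_exp R 2).
 by rewrite -expRD ler_expR /X; move: Me le1; clear; move: A (lf τ) => a l; lra.
have h4 := ler_wpM2l (ltW q0) h2; have h5 := ler_wpM2l (ltW q0) h3.
have p0 := mulr_ge0 (ltW q0) (expR_ge0 (- X)).
move: su h1 h4 h5 bad' blk p0; clear; move: (q.-1%:R) (expR _) (expR _) (expR _) => N E1 E2 E3; lra.
Qed.

(** [A1] is (1 - σ) times [kap] in other notation; the two are compared by logarithms, where the
    exponents become linear. *)
Lemma A1E τ : 0 < τ -> 0 < ln τ ->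
 A1 σ * τ `^ (1 - σ)^-1 * ln τ `^ (σ / (1 - σ)) = A * lf τ.
Proof.
have [s0 s3 _ G0 _] := sfacts s12; have b0 := b_gt0 s12; move=> t0 L0.
have A0 : 0 < (1 - σ) * (σ * b / G1 σ) `^ b by sign.
have bE := bexpE σ; rewrite /A1 /kap /lf -bE; set g := G1 σ in G0 A0 *.
have -> : (1 - σ)^-1 = 1 + b by rewrite bE; field; rewrite gt_eqF.
rewrite [τ `^ _]powRD /1/ powRr1 /1/ /Wt (powRM b (ltW t0) (ltW L0)).
rewrite (_ : _ `^ (1 + b) = (1 - σ) * (σ * b / g) `^ b); first by ring.
rewrite -[RHS]lnK powR_expR /1/; congr expR.
have lb : ln b = ln σ - ln (1 - σ) by rewrite bE lnM /1/ lnV.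
rewrite !lnM /1/ !lnV /1/ !lnM /1/ !ln_powR !lnM /1/ lb lnV /1/.
by rewrite bE; field; rewrite gt_eqF.
Qed.
End Sandwich.

Theorem theorem4p5 (R : realType) (sigma : R) :
  2^-1 < sigma < 1 ->
  exists c4 : R, 0 < c4 /\
  exists (T0 C : R) (Q0 : nat),
    forall q : nat, prime q -> (Q0 <= q)%N ->
    forall tau : R, T0 <= tau ->
      tau <= c4 * (ln (q%:R : R)) `^ (1 - sigma) / ln (ln (q%:R : R)) ->
      (exists E : R,
          `|E| <= C * ((Num.sqrt (ln tau))^-1 + r_err sigma (ln (q%:R : R)) tau)
          /\ Phi_char q sigma tau
             = expR (- (A1 sigma * tau `^ ((1 - sigma)^-1)
                        * (ln tau) `^ (sigma / (1 - sigma)) * (1 + E))))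
      /\
      (exists E : R,
          `|E| <= C * ((Num.sqrt (ln tau))^-1 + r_err sigma (ln (q%:R : R)) tau)
          /\ Phi_arg q sigma tau
             = expR (- (A1 sigma * tau `^ ((1 - sigma)^-1)
                        * (ln tau) `^ (sigma / (1 - sigma)) * (1 + E)))).
Proof.
move=> s12; have [c4 [C [T0 [Tq [c40 h]]]]] := sandwich s12; exists c4; split=> //.
have [T1 hT1] := evI (ev_ge T0) (ev_ge 2); have [Tr hTr] := evI (ev_ge Tq) (ev_ge 4).
exists T1, C, (Num.truncn (expR Tr)).+1 => q pq hq tau /hT1[tT t2] htau.
have /hTr[qT T4] : Tr <= ln q%:R.
 rewrite -[leLHS]expRK ler_ln /1/.
 have /andP[_ h1] := truncn_itv (expR_ge0 Tr).
 by step (ltW h1); rewrite ler_nat.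
have l0 : 0 < ln (ln q%:R) :> R by rewrite ln_gt0; move: T4; clear; lra.
have {}htau : tau * ln (ln q%:R) <= c4 * ln q%:R `^ (1 - sigma) by rewrite -ler_pdivlMr.
have t0 : 0 < tau by clear -t2; lra.
have L0 : 0 < ln tau by rewrite ln_gt0; clear -t2; lra.
have [ch hc] := chars_exist R pq; have qp := prime_gt0 pq.
have hj j : (0 < j < q.-1)%N -> npchar q (ch j) /\ charlike (ch j).
 by move=> h0; split; [exact: family_npchar|apply: family_charlike hc _; case/andP: h0].
rewrite (A1E s12 t0 L0) /Phi_char /Phi_arg !(char_proportionE pq _ hc); split.
- apply: (h q ch 1 _ tau (fun j => `[< logabsL_gt sigma tau (ch j) >]) pq hc (cabs1 R) erefl qT tT htau).
 move=> j w /hj[np cl] hw; rewrite mul1r; have [p0 p1] := logabs_approx hw.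
 move: p1; rewrite ler_norml => /andP[p1 p2].
 split; first by move/asboolP => [_ hh]; move: p1 p2 hh; clear; lra.
 by move=> hh; apply/asboolP; split=> //; move: p1 p2 hh; clear; lra.
(* Rotation by -i turns Im P into Re (om P), so the argument is another instance of [sandwich]. *)
have om1 : cabs (Complex 0 (- 1) : R[i]) = 1 by rewrite /cabs expr0n add0r sqrrN expr1n sqrtr1.
apply: (h q ch _ _ tau (fun j => `[< argL_gt sigma tau (ch j) >]) pq hc om1 erefl qT tT htau).
move=> j w /hj[np cl] hw.
rewrite (_ : Re _ = Im (Pw (ch j) w sigma)); last by rewrite ReM /=; ring.
split; first by move/asboolP; exact: (arg_upper cl hw).
by move=> hh; apply/asboolP; exact: (arg_lower s12 qp np cl hw hh).
Qed.
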